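(* Let $X=\mathbb{R}^{2n}/\mathbb{Z}^{2n}$ with symplectic form $\omega=\sum_{i=1}^n dy^i\wedge dx^i$, let $Q^\hbar$ be the Toeplitz operator for the pair of polarizations $(\mathcal{P}^{\check T},\mathcal{P}^T)$ acting on the quantum Hilbert space $\mathcal{H}^\hbar$, and for $N\in\mathbb{N}\cup\{0\}$ let $f\star_N g=\sum_{i=0}^N\hbar^iC_i(f,g)$ be the $N$th order truncation of the star product $\star$. For all $f,g\in\mathcal{C}^\infty(X,\mathbb{C})$ and $N\in\mathbb{N}\cup\{0\}$, there exists $K_N(f,g)>0$ such that $$\left\lVert Q_f^\hbar\circ Q_g^\hbar-Q_{f\star_N g}^\hbar\right\rVert\le K_N(f,g)\,\hbar^{N+1}$$ for all $k\in\mathbb{N}$, where $\hbar=\tfrac1k$ and $\lVert\cdot\rVert$ is the operator norm with respect to the inner product of $\mathcal{H}^\hbar$.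
   Context: Setting. Let $n\ge 1$, $\mathbb{N}=\{1,2,\dots\}$, $T=\check T=\mathbb{R}^n/\mathbb{Z}^n$, $X=T\times\check T=\mathbb{R}^{2n}/\mathbb{Z}^{2n}$ with periodic coordinates $(x,y)$, $x,y\in\mathbb{R}^n$, and $\omega=\sum_{i=1}^n dy^i\wedge dx^i$. $\mathcal{C}^\infty(X,\mathbb{C})$ is identified with the smooth $\mathbb{Z}^{2n}$-periodic functions on $\mathbb{R}^{2n}$. $\mathcal{P}^T$ is the complex span of the $\partial_{x^i}$ and $\mathcal{P}^{\check T}$ the complex span of the $\partial_{y^i}$. For $k\in\mathbb{N}$ put $\hbar=1/k$ and $\mathbb{Z}_k^n=\mathbb{Z}^n/k\mathbb{Z}^n$; $[m]$ is the class of $m\in\mathbb{Z}^n$. Star product. For $f,g\in\mathcal{C}^\infty(X,\mathbb{C})$, $f\star g=\sum_{j\ge0}\hbar^jC_j(f,g)$ with $C_j(f,g)=\frac{1}{(2\pi\sqrt{-1})^j}\sum_{|I|=j}\frac{1}{I!}\frac{\partial^jf}{\partial y^I}\frac{\partial^jg}{\partial x^I}$ (sum over multi-indices $I\in(\mathbb{N}\cup\{0\})^n$). Line bundle. Smooth sections of the prequantum bundle $L^{\otimes k}$ are identified with smooth $s:\mathbb{R}^{2n}\to\mathbb{C}$ satisfying $s(u+\lambda)=\alpha(\lambda)^ke^{-k\pi\sqrt{-1}\,\omega(u,\lambda)}s(u)$ for $\lambda\in\mathbb{Z}^{2n}$, where $\alpha(\lambda)=(-1)^{\sum_i\lambda_i\lambda_{n+i}}$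 and $\omega(u,v)=\sum_i(u_{n+i}v_i-u_iv_{n+i})$. The connection is $\nabla^\hbar=d-k\pi\sqrt{-1}\sum_i(y^idx^i-x^idy^i)$, and $\langle s,t\rangle_{L^2}=\int_{[0,1]^{2n}}s\bar t\,d^nx\,d^ny$. A distributional section $s\in\Gamma^{-\infty}(X,L^{\otimes k})$ is a continuous linear functional $t\mapsto s(\bar t)=:\langle s,t\rangle$ of $\bar t$, $t$ smooth, with smooth sections embedded via $\langle\cdot,\cdot\rangle_{L^2}$; products with functions and $\nabla^\hbar$ extend by duality. Weil-Brezin transform. For smooth $s$ and $[m]\in\mathbb{Z}_k^n$ let $(s)_{[m]}(y)=\int_{[0,1]^n}\tilde s(x,y+\hbar m)e^{-2\pi\sqrt{-1}m\cdot x}d^nx$, where $\tilde s(x,y)=e^{k\pi\sqrt{-1}x\cdot y}s(x,y)$. This gives isomorphisms $\Gamma^\infty(X,L^{\otimes k})\cong\prod_{\mathbb{Z}_k^n}\mathcal{S}(\mathbb{R}^n)$ and, by extension, $\Gamma^{-\infty}(X,L^{\otimes k})\cong\prod_{\mathbb{Z}_k^n}\mathcal{S}'(\mathbb{R}^n)$, with $\langle a,b\rangle_{L^2}=\sum_{[m]}\int_{\mathbb{R}^n}(a)_{[m]}\overline{(b)_{[m]}}\,d^ny$. Quantum Hilbert spaces. $\mathcal{H}^\hbar=\{s\in\Gamma^{-\infty}(X,L^{\otimes k}):\nabla^\hbar_{\bar\xi}s=0\ \forall\xi\in\Gamma^\infty(X,\mathcal{P}^T)\}\otimes\mathbb{C}\rho$,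 and $\check{\mathcal{H}}^\hbar$ is defined likewise with $\mathcal{P}^{\check T}$ and $\check\rho$ in place of $\mathcal{P}^T$ and $\rho$. Here $\rho,\check\rho$ are the chosen half-form generators (square roots of $\bigwedge^n(-2\sqrt{-1}dy)$ and $\bigwedge^n(2dx)$), paired by $\langle\rho,\check\rho\rangle=2^{n/2}k^{-n/2}$. Bases indexed by $m\in\mathbb{Z}_k^n$ are $\sigma_\hbar^m=2^{n/4}k^{n/2}\vartheta_\hbar^m\otimes\rho$ of $\mathcal{H}^\hbar$ and $\check\sigma_\hbar^m=2^{n/4}k^{n/2}\check\vartheta_\hbar^m\otimes\check\rho$ of $\check{\mathcal{H}}^\hbar$, where the Weil-Brezin coefficients are $(\vartheta_\hbar^m)_{m'}(\varphi)=\delta_{m,m'}(2k)^{-n/2}\varphi(0)$ for $\varphi\in\mathcal{S}(\mathbb{R}^n)$, and $(\check\vartheta_\hbar^m)_{m'}$ is the constant function $\delta_{m,m'}2^{-n/2}$. The inner product on $\mathcal{H}^\hbar$ (the boundary limit of the Blattner-Kostant-Sternberg pairing) is the one for which $\{\sigma_\hbar^m\}$ is orthonormal. Pairing and Toeplitz operator. Let $\mathrm{WF}^\hbar$, $\check{\mathrm{WF}}^\hbar$ be the unions of wavefront sets of (the section parts of) elements of $\mathcal{H}^\hbar$, $\check{\mathcal{H}}^\hbar$. They are disjoint, so by Hörmander's criterion $\langle\cdot,\cdot\rangle_{L^2}$ extends to a sesquilinear pairing (linear in the first slot) of distributional sections with wavefront set in $\mathrm{WF}^\hbar$ against those with wavefront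 set in $\check{\mathrm{WF}}^\hbar$; it is tensored with $\langle\rho,\check\rho\rangle$. Concretely, for smooth $f$, $\langle f\vartheta_\hbar^a,\check\vartheta_\hbar^b\rangle=\langle\vartheta_\hbar^a,\bar f\check\vartheta_\hbar^b\rangle=\sum_{c\in\mathbb{Z}_k^n}(\vartheta_\hbar^a)_c\big(\overline{(\bar f\check\vartheta_\hbar^b)_c}\big)$, the pairing of compactly supported distributions with smooth functions on $\mathbb{R}^n$. Then $\langle\sigma_\hbar^m,\check\sigma_\hbar^{m'}\rangle=\delta_{m,m'}$. The projection is $\Pi^\hbar s=\sum_{m\in\mathbb{Z}_k^n}\langle s,\check\sigma_\hbar^m\rangle\sigma_\hbar^m$ and the Toeplitz operator for $(\mathcal{P}^{\check T},\mathcal{P}^T)$ is $Q_f^\hbar s=\Pi^\hbar(fs)$, $f\in\mathcal{C}^\infty(X,\mathbb{C})$, $s\in\mathcal{H}^\hbar$. *)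

(* Defs.v *)
(* The real numbers are an arbitrary R : realType, the complex numbers R[i]. *)
From HB Require Import structures.
From mathcomp Require Import all_boot all_order all_algebra.
From mathcomp Require Import all_classical all_reals all_analysis.
From mathcomp Require Export complex.

Set Implicit Arguments.
Unset Strict Implicit.
Unset Printing Implicit Defensive.

Import Order.TTheory GRing.Theory Num.Theory.
Import numFieldNormedType.Exports.

Local Open Scope classical_set_scope.
Local Open Scope ring_scope.
Local Open Scope complex_scope.

(* Calculus for complex-valued functions on R^d = 'rV[R]_d; derivatives,
   continuity and integrals are taken on real and imaginary parts. *)

Definition cabs (R : realType) (z : R[i]) : R := ComplexField.Normc.normc z.

Definition imag (R : realType) : R[i] := 0 +i* 1.

Definition expi (R : realType) (t : R) : R[i] := cos t +i* sin t.

Definition partial (R : realType) (d : nat) (j : 'I_d) (f : 'rV[R]_d -> R[i]) :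
    'rV[R]_d -> R[i] := fun u =>
  ('D_(delta_mx 0 j) (fun v => complex.Re (f v)) u)
    +i* ('D_(delta_mx 0 j) (fun v => complex.Im (f v)) u).

Fixpoint partials (R : realType) (d : nat) (l : seq 'I_d)
    (f : 'rV[R]_d -> R[i]) : 'rV[R]_d -> R[i] :=
  if l is j :: l' then partial j (partials l' f) else f.

Definition smooth (R : realType) (d : nat) (f : 'rV[R]_d -> R[i]) : Prop :=
  forall l : seq 'I_d,
    let h := partials l f in
    [/\ continuous (fun v => complex.Re (h v)),
        continuous (fun v => complex.Im (h v)) &
        forall (j : 'I_d) (u : 'rV[R]_d),
          derivable (fun v => complex.Re (h v)) u (delta_mx 0 j) /\
          derivable (fun v => complex.Im (h v)) u (delta_mx 0 j)].

(* The integral over D^d as an iterated Lebesgue integral. *)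
Fixpoint rint (R : realType) (D : set R) (d : nat) : ('rV[R]_d -> R) -> R :=
  match d with
  | 0%N => fun f => f 0
  | d'.+1 => fun f =>
      \int[lebesgue_measure]_(t in D)
        @rint R D d' (fun v => f (row_mx (t%:M : 'rV[R]_1) v))
  end.

Definition cint (R : realType) (D : set R) (d : nat) (f : 'rV[R]_d -> R[i]) :
    R[i] :=
  (rint D (fun v => complex.Re (f v))) +i* (rint D (fun v => complex.Im (f v))).

Definition dot (R : realType) (n : nat) (x y : 'rV[R]_n) : R :=
  \sum_(i < n) x 0 i * y 0 i.

(* A point u = (x, y) of R^(2n) is row_mx x y : 'rV_(n + n).  The family
   j : 'I_n -> 'I_(n + n) of coordinate directions is lshift n for the x^i and
   rshift n for the y^i. *)

Definition hbar (R : realType) (k : nat) : R := k%:R^-1.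

Definition torus_smooth (R : realType) (n : nat) (f : 'rV[R]_(n + n) -> R[i]) :
    Prop :=
  smooth f /\
  forall (l : 'rV[int]_(n + n)) (u : 'rV[R]_(n + n)),
    f (u + map_mx intr l) = f u.

(* Star product. *)

Definition mpartial (R : realType) (n d : nat) (j : 'I_n -> 'I_d)
    (I : 'I_n -> nat) (f : 'rV[R]_d -> R[i]) : 'rV[R]_d -> R[i] :=
  partials (flatten [seq nseq (I i) (j i) | i <- enum 'I_n]) f.

Definition star_coef (R : realType) (n j : nat) (f g : 'rV[R]_(n + n) -> R[i]) :
    'rV[R]_(n + n) -> R[i] := fun u =>
  ((2 * pi)%:C * imag R) ^- j *
  \sum_(I : {ffun 'I_n -> 'I_j.+1} | (\sum_(i < n) I i == j)%N)
     ((\prod_(i < n) (I i)`!)%N%:R)^-1 *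
     mpartial (@rshift n n) (fun i => I i) f u *
     mpartial (@lshift n n) (fun i => I i) g u.

Definition star_trunc (R : realType) (n k N : nat)
    (f g : 'rV[R]_(n + n) -> R[i]) : 'rV[R]_(n + n) -> R[i] := fun u =>
  \sum_(j < N.+1) (hbar R k ^+ j)%:C * star_coef j f g u.

(* Prequantum line bundle. *)

Definition symp (R : realType) (n : nat) (u v : 'rV[R]_(n + n)) : R :=
  \sum_(i < n) (u 0 (rshift n i) * v 0 (lshift n i)
                - u 0 (lshift n i) * v 0 (rshift n i)).

Definition alpha (R : realType) (n : nat) (l : 'rV[int]_(n + n)) : R[i] :=
  ((-1 : R[i]) ^ (\sum_(i < n) l 0 (lshift n i) * l 0 (rshift n i)))%R.

Definition smooth_section (R : realType) (n k : nat)
    (s : 'rV[R]_(n + n) -> R[i]) : Prop :=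
  smooth s /\
  forall (l : 'rV[int]_(n + n)) (u : 'rV[R]_(n + n)),
    s (u + map_mx intr l) =
      alpha R l ^+ k * expi (- (k%:R * pi * symp u (map_mx intr l))) * s u.

(* The covariant derivative along the j-th coordinate direction. *)
Definition nabla (R : realType) (n k : nat) (j : 'I_(n + n))
    (s : 'rV[R]_(n + n) -> R[i]) : 'rV[R]_(n + n) -> R[i] := fun u =>
  partial j s u -
  (k%:R * pi * match fintype.split j with
               | inl i => u 0 (rshift n i)
               | inr i => - u 0 (lshift n i)
               end)%:C * imag R * s u.

(* A distributional section s is encoded by t |-> <s, t>, which is conjugate
   linear in the smooth section t.  Its values on functions that are not smooth
   sections are irrelevant, hence the equality deq. *)

Definition functional (R : realType) (n : nat) : Type :=
  ('rV[R]_(n + n) -> R[i]) -> R[i].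

(* Continuity is with respect to the C^infty seminorms on the fundamental
   domain. *)
Definition dist_section (R : realType) (n k : nat) (S : functional R n) : Prop :=
  (forall (a : R[i]) (t1 t2 : 'rV[R]_(n + n) -> R[i]),
     smooth_section k t1 -> smooth_section k t2 ->
     S (fun u => a * t1 u + t2 u) = conjc a * S t1 + S t2) /\
  (exists (A : R) (M : nat), forall (t : 'rV[R]_(n + n) -> R[i]) (B : R),
     smooth_section k t ->
     (forall (l : seq 'I_(n + n)) (u : 'rV[R]_(n + n)),
        (size l <= M)%N -> (forall j, 0 <= u 0 j <= 1) ->
        cabs (partials l t u) <= B) ->
     cabs (S t) <= A * B).

Definition deq (R : realType) (n k : nat) (S T : functional R n) : Prop :=
  forall t, smooth_section k t -> S t = T t.

Definition dscale (R : realType) (n : nat) (a : R[i]) (S : functional R n) :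
    functional R n := fun t => a * S t.

Definition dmul (R : realType) (n : nat) (f : 'rV[R]_(n + n) -> R[i])
    (S : functional R n) : functional R n :=
  fun t => S (fun u => conjc (f u) * t u).

(* The minus sign: nabla is unitary and coordinate fields are divergence free
   and real. *)
Definition dnabla (R : realType) (n k : nat) (j : 'I_(n + n))
    (S : functional R n) : functional R n := fun t => - S (nabla k j t).

(* The quantum Hilbert space of the polarization spanned by the d/dx^i.  An
   element s (x) rho is represented by its section part s.  A section of the
   polarization is xi = \sum_i xi_i d/dx^i, with conjugate
   \sum_i (xi_i)^* d/dx^i. *)
Definition quantum_space (R : realType) (n k : nat) : set (functional R n) :=
  [set S | dist_section k S /\
     forall xi : 'I_n -> 'rV[R]_(n + n) -> R[i],
       (forall i, torus_smooth (xi i)) ->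
       deq k (fun t => \sum_(i < n)
                dmul (fun u => conjc (xi i u)) (dnabla k (lshift n i) S) t)
             (fun=> 0)].

(* Schwartz functions and tempered distributions on R^n. *)

Definition schwartz (R : realType) (n : nat) (phi : 'rV[R]_n -> R[i]) : Prop :=
  smooth phi /\
  forall (l : seq 'I_n) (p : nat), exists B : R, forall y : 'rV[R]_n,
    (1 + `|y|) ^+ p * cabs (partials l phi y) <= B.

Definition tempered (R : realType) (n : nat)
    (T : ('rV[R]_n -> R[i]) -> R[i]) : Prop :=
  (forall (a : R[i]) (phi psi : 'rV[R]_n -> R[i]),
     schwartz phi -> schwartz psi ->
     T (fun y => a * phi y + psi y) = a * T phi + T psi) /\
  (exists (A : R) (M : nat), forall (phi : 'rV[R]_n -> R[i]) (B : R),
     schwartz phi ->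
     (forall (l : seq 'I_n) (y : 'rV[R]_n), (size l <= M)%N ->
        (1 + `|y|) ^+ M * cabs (partials l phi y) <= B) ->
     cabs (T phi) <= A * B).

Definition regular_dist (R : realType) (n : nat) (v : 'rV[R]_n -> R[i]) :
    ('rV[R]_n -> R[i]) -> R[i] :=
  fun phi => cint setT (fun y => v y * phi y).

Definition delta0 (R : realType) (n : nat) : ('rV[R]_n -> R[i]) -> R[i] :=
  fun phi => phi 0.

(* Weil-Brezin transform.  Classes in Z^n / k Z^n are represented by vectors
   with entries in {0, ..., k - 1}. *)

Definition Zk_vec (R : realType) (n k : nat) (m : 'rV['I_k]_n) : 'rV[R]_n :=
  \row_i (m 0 i : nat)%:R.

Definition tilde (R : realType) (n k : nat) (s : 'rV[R]_(n + n) -> R[i])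
    (x y : 'rV[R]_n) : R[i] :=
  expi (k%:R * pi * dot x y) * s (row_mx x y).

Definition weil_brezin (R : realType) (n k : nat)
    (s : 'rV[R]_(n + n) -> R[i]) (m : 'rV['I_k]_n) (y : 'rV[R]_n) : R[i] :=
  cint `[0, 1]%classic (fun x : 'rV[R]_n =>
    tilde k s x (y + hbar R k *: Zk_vec R m) *
    expi (- (2 * pi * dot (Zk_vec R m) x))).

(* The distributional section with Weil-Brezin coefficients T, obtained by
   extending <a, b> = \sum_[m] \int (a)_[m] ((b)_[m])^*. *)
Definition of_weil_brezin (R : realType) (n k : nat)
    (T : 'rV['I_k]_n -> ('rV[R]_n -> R[i]) -> R[i]) : functional R n :=
  fun t => \sum_(m : 'rV['I_k]_n) T m (fun y => conjc (weil_brezin t m y)).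

Definition has_weil_brezin (R : realType) (n k : nat) (S : functional R n)
    (T : 'rV['I_k]_n -> ('rV[R]_n -> R[i]) -> R[i]) : Prop :=
  (forall m, tempered (T m)) /\ deq k S (of_weil_brezin T).

(* Bases of the two quantum Hilbert spaces (section parts). *)

Definition theta (R : realType) (n k : nat) (m : 'rV['I_k]_n) :
    functional R n :=
  of_weil_brezin (fun m' phi =>
    (m == m')%:R * ((2 * k%:R) `^ (- n%:R / 2))%:C * delta0 phi).

Definition theta_check (R : realType) (n k : nat) (m : 'rV['I_k]_n) :
    functional R n :=
  of_weil_brezin (fun m' =>
    regular_dist (fun=> (m == m')%:R * (2 `^ (- n%:R / 2))%:C)).

Definition sigma (R : realType) (n k : nat) (m : 'rV['I_k]_n) :
    functional R n :=
  dscale (2 `^ (n%:R / 4) * k%:R `^ (n%:R / 2))%:C (theta m).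

Definition sigma_check (R : realType) (n k : nat) (m : 'rV['I_k]_n) :
    functional R n :=
  dscale (2 `^ (n%:R / 4) * k%:R `^ (n%:R / 2))%:C (theta_check m).

(* The extension of the L^2 pairing to distributional sections with disjoint
   wavefront sets (Hormander), computed on Weil-Brezin coefficients as
   \sum_c (S)_c (((S')_c)^* ). *)

Definition cutoff (R : realType) (n : nat) (chi : 'rV[R]_n -> R[i]) : Prop :=
  [/\ smooth chi,
      exists r : R, forall y : 'rV[R]_n, r <= `|y| -> chi y = 0 &
      \forall y \near (0 : 'rV[R]_n), chi y = 1].

(* The value w of the tempered distribution T on a smooth function psi which
   need not be Schwartz.  If T has compact support, then T (chi_j * psi) is
   eventually constant and w is the usual pairing of a compactly supported
   distribution with a smooth function; the limit is needed because the
   coefficients of f * theta are rapidly decreasing distributions of noncompact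
   support. *)
Definition dist_value (R : realType) (n : nat)
    (T : ('rV[R]_n -> R[i]) -> R[i]) (psi : 'rV[R]_n -> R[i]) (w : R[i]) :
    Prop :=
  forall chi : 'rV[R]_n -> R[i], cutoff chi ->
    (fun j : nat =>
       cabs (T (fun y => chi (j.+1%:R^-1 *: y) * psi y) - w)) @ \oo --> (0 : R).

(* Sections of the first kind (wavefront set in the dy directions) have rapidly
   decreasing Weil-Brezin coefficients T c, those of the second kind (wavefront
   set in the dx directions) have smooth ones v c. *)
Definition is_pairing (R : realType) (n k : nat) (S S' : functional R n)
    (z : R[i]) : Prop :=
  exists (T : 'rV['I_k]_n -> ('rV[R]_n -> R[i]) -> R[i])
         (v : 'rV['I_k]_n -> 'rV[R]_n -> R[i]) (w : 'rV['I_k]_n -> R[i]),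
    [/\ has_weil_brezin S T,
        (forall c, smooth (v c)) /\
        has_weil_brezin S' (fun c => regular_dist (v c)),
        forall c, dist_value (T c) (fun y => conjc (v c y)) (w c) &
        z = \sum_c w c].

(* The pairing of S (x) rho with S' (x) rho_check; the scalar factor is
   <rho, rho_check>. *)
Definition pairing (R : realType) (n k : nat) (S S' : functional R n) : R[i] :=
  (2 `^ (n%:R / 2) * k%:R `^ (- n%:R / 2))%:C *
  xget 0 [set z | is_pairing k S S' z].

(* Toeplitz operators. *)

Definition projection (R : realType) (n k : nat) (S : functional R n) :
    functional R n := fun t =>
  \sum_(m : 'rV['I_k]_n) pairing k S (sigma_check m) * sigma m t.

Definition toeplitz (R : realType) (n k : nat) (f : 'rV[R]_(n + n) -> R[i])
    (S : functional R n) : functional R n := projection k (dmul f S).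

(* The inner product of the quantum Hilbert space for which the basis sigma is
   orthonormal, and the associated norm and operator norm. *)

Definition coords (R : realType) (n k : nat) (S : functional R n) :
    {ffun 'rV['I_k]_n -> R[i]} :=
  xget [ffun=> 0] [set c : {ffun 'rV['I_k]_n -> R[i]} |
    deq k S (fun t => \sum_(m : 'rV['I_k]_n) c m * sigma m t)].

Definition inner (R : realType) (n k : nat) (S S' : functional R n) : R[i] :=
  \sum_(m : 'rV['I_k]_n) coords k S m * conjc (coords k S' m).

Definition hnorm (R : realType) (n k : nat) (S : functional R n) : R :=
  Num.sqrt (complex.Re (inner k S S)).

Definition op_norm (R : realType) (n k : nat)
    (A : functional R n -> functional R n) : \bar R :=
  ereal_sup [set (hnorm k (A S))%:E |
    S in [set S | quantum_space k S /\ hnorm k S <= 1]].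

(* Main.v *)
Require Import Defs.
From mathcomp Require Import all_boot all_order all_algebra.
From mathcomp Require Import all_classical all_reals all_analysis.
From mathcomp Require Import measurable_realfun ring lra zify.

(** The theorem is an operator statement about matrices of size k^n, with
    bounds that must not depend on k.

    Sections.  Multiplying a section by e^(k pi i x.y) turns it into a function
    h that is Z^n-periodic in x and satisfies
    h(x, y + b) = e^(2 pi i k x.b) h(x, y) for integral b ([quasi_periodic]);
    its Weil-Brezin coefficients are the Fourier coefficients in x,
    [fhat h m (y + m/k)].

    States.  An element S of the quantum space annihilates every covariant
    derivative in the x directions.  Averaging h along x against
    e^(-2 pi i k y_j a) changes h by such a derivative, and multiplication by
    e^(-2 pi i k y_j) - 1 produces another one.  The first fact makes S(h) depend
    on the averages of h only, the second localises S at the points whose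
    coordinates y_j lie in (1/k)Z.  There an averaged h is determined by its
    Fourier coefficient of index k y, so that S is a combination of the k^n
    functionals sending h to the conjugate of [fhat h m (m/k)]
    ([quantum_value]).  These are the sigma^m up to a factor, which identifies
    the quantum space with C^(k^n) and its norm with the Euclidean one
    ([quantum_expansion], [coordsE], [hnormE]).

    Toeplitz operators.  The product of a function g with a combination of the
    sigma^m has as coefficients the measures [wbdist] carried by (1/k)Z^n with
    rapidly decreasing weights.  A section determines its coefficients on test
    functions, and the pairing depends on nothing else ([pairing_unique]); so it
    can be computed with these measures, and Q_g acts as the matrix
      [toeplitz_mx g b m] = k^(-n) sum_j g(j/k, m/k) e^(-2 pi i (b - m).j/k),
    which by Fourier inversion in x is the sum of [fhat g p (m/k)] over the p
    congruent to b - m modulo k ([pairingE], [mat_fourier]).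

    The estimate.  With q + p congruent to b - m,
      (Q_f Q_g) b m is the sum of [fhat f q (m/k + p/k) * fhat g p (m/k)],
    because passing the first factor through the intermediate index moves its
    base point by p/k.  In the entry of the star product the operator
    hbar^|I| / (2 pi i)^|I| d/dx^I acts on e^(2 pi i p.x) as multiplication by
    (p/k)^I, so that f *_N g gives the same sum with [fhat f q (m/k + p/k)]
    replaced by its Taylor polynomial of degree N at m/k ([mat_comp_fourier],
    [star_fourier]).  The difference is a Taylor remainder of size
    (|p|/k)^(N+1); the rapid decay of [fhat f] and [fhat g] makes the sums of the
    absolute values along rows and columns O(hbar^(N+1)) uniformly in k
    ([matrix_estimate]), and Schur's test turns these sums into a bound for the
    operator norm. *)

Set Implicit Arguments.
Unset Strict Implicit.
Unset Printing Implicit Defensive.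

Import Order.TTheory GRing.Theory Num.Theory.
Import numFieldNormedType.Exports.

Local Open Scope classical_set_scope.
Local Open Scope ring_scope.
Local Open Scope complex_scope.

(** * Smooth real functions *)

Lemma near_continuous_at (V W : topologicalType) (f g : V -> W) u :
  (\forall v \near u, f v = g v) -> {for u, continuous g} -> {for u, continuous f}.
Proof.
move=> E; rewrite /prop_for /continuous_at (nbhs_singleton E); apply: cvg_trans.
by apply: near_eq_cvg; apply: filterS E => v ->.
Qed.

Section RealSmooth.
Variable R : realType.

Definition edir (d : nat) (j : 'I_d) : 'rV[R]_d := delta_mx 0 j.

(** Restricting to a line reduces directional derivatives to derivatives of
    functions of one real variable, for which the chain rule is available. *)
Lemma is_derive_line (d : nat) (h : 'rV[R]_d -> R) (u v : 'rV[R]_d) (s df : R) :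
  is_derive (u + s *: v) v h df <-> is_derive s (1 : R) (fun r : R => h (u + r *: v)) df.
Proof.
have E : (fun r : R => r^-1 *: ((h \o shift (u + s *: v)) (r *: v) - h (u + s *: v)))
  = (fun r : R => r^-1 *: (((fun r : R => h (u + r *: v)) \o shift s) (r *: (1:R)) - h (u + s *: v))).
  apply/funext => r; congr (_ *: (_ - _)) => /=; congr h.
  by rewrite [r *: (1:R)]mulr1 scalerDl addrCA.
split=> -[cd dd]; apply: DeriveDef.
- by move: cd; rewrite /derivable E.
- by move: dd; rewrite /derive E.
- by move: cd; rewrite /derivable E.
- by move: dd; rewrite /derive E.
Qed.

Lemma is_derive_line0 (d : nat) (h : 'rV[R]_d -> R) (u v : 'rV[R]_d) (df : R) :
  is_derive u v h df <-> is_derive 0 (1 : R) (fun r : R => h (u + r *: v)) df.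
Proof. by rewrite -is_derive_line scale0r addr0. Qed.

(** Smoothness of order m by recursion on m rather than over lists of directions:
    products and compositions then follow by induction on m. *)
Fixpoint rsm (m d : nat) (h : 'rV[R]_d -> R) : Prop :=
  continuous h /\
  if m is m'.+1 then
    forall j : 'I_d, (forall u, derivable h u (edir j)) /\
      rsm m' (fun u => 'D_(edir j) h u)
  else True.

Definition rsmooth (d : nat) (h : 'rV[R]_d -> R) := forall m, rsm m h.

Lemma rsm_cont m d (h : 'rV[R]_d -> R) : rsm m h -> continuous h.
Proof. by case: m => [|m] []. Qed.
Arguments rsm_cont {m d h} _ _.

Lemma rsmS m d (h : 'rV[R]_d -> R) : rsm m.+1 h -> rsm m h.
Proof.
elim: m h => [|m IH] h; first by case=> c _; split.
case=> c H; split=> // j; have [dj hj] := H j.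
by split=> //; exact: IH.
Qed.

Lemma rsmooth_cont d (h : 'rV[R]_d -> R) : rsmooth h -> continuous h.
Proof. by move/(_ 0%N)/rsm_cont. Qed.
Arguments rsmooth_cont {d h} _ _.

Lemma rsmooth_derivable d (h : 'rV[R]_d -> R) j u :
  rsmooth h -> derivable h u (edir j).
Proof. by move=> /(_ 1%N)[_ /(_ j)[]]. Qed.

Lemma rsmooth_is_derive d (h : 'rV[R]_d -> R) j u :
  rsmooth h -> is_derive u (edir j) h ('D_(edir j) h u).
Proof. by move=> H; apply/derivableP/rsmooth_derivable. Qed.

Lemma rsmooth_D d (h : 'rV[R]_d -> R) j :
  rsmooth h -> rsmooth (fun u => 'D_(edir j) h u).
Proof. by move=> H m; have [_ /(_ j)[]] := H m.+1. Qed.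

Lemma rsmS_is_derive m d (h : 'rV[R]_d -> R) (g : 'I_d -> 'rV[R]_d -> R) :
  continuous h -> (forall j u, is_derive u (edir j) h (g j u)) ->
  (forall j, rsm m (g j)) -> rsm m.+1 h.
Proof.
move=> c H G; split=> // j; split=> [u|]; first by have [] := H j u.
have -> : (fun u => 'D_(edir j) h u) = g j by apply/funext=> u; have [] := H j u.
exact: G.
Qed.

Lemma rsm_D m d (h : 'rV[R]_d -> R) j :
  rsm m.+1 h -> rsm m (fun u => 'D_(edir j) h u).
Proof. by case=> _ /(_ j)[]. Qed.

Lemma rsm_is_derive m d (h : 'rV[R]_d -> R) j u :
  rsm m.+1 h -> is_derive u (edir j) h ('D_(edir j) h u).
Proof. by case=> _ /(_ j)[] H _; apply/derivableP. Qed.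

Lemma rsm_cst m d (c : R) : @rsm m d (fun=> c).
Proof.
elim: m c => [|m IH] c; first by split => //; exact: cst_continuous.
apply: (@rsmS_is_derive _ _ _ (fun=> fun=> 0)) => //.
- exact: cst_continuous.
Qed.

Lemma rsm_add m d (f g : 'rV[R]_d -> R) :
  rsm m f -> rsm m g -> rsm m (fun u => f u + g u).
Proof.
elim: m f g => [|m IH] f g Hf Hg.
  by split => // u; exact: (cvgD (rsm_cont Hf u) (rsm_cont Hg u)).
apply: (@rsmS_is_derive _ _ _ (fun j u => 'D_(edir j) f u + 'D_(edir j) g u)).
- by move=> u; exact: (cvgD (rsm_cont Hf u) (rsm_cont Hg u)).
- by move=> j u; exact: (is_deriveD (rsm_is_derive j u Hf) (rsm_is_derive j u Hg)).
- by move=> j; apply: IH; apply: rsm_D.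
Qed.

Lemma rsm_mul m d (f g : 'rV[R]_d -> R) :
  rsm m f -> rsm m g -> rsm m (fun u => f u * g u).
Proof.
elim: m f g => [|m IH] f g Hf Hg.
  by split => // u; exact: (cvgM (rsm_cont Hf u) (rsm_cont Hg u)).
apply: (@rsmS_is_derive _ _ _ (fun j u => f u * 'D_(edir j) g u + g u * 'D_(edir j) f u)).
- by move=> u; exact: (cvgM (rsm_cont Hf u) (rsm_cont Hg u)).
- by move=> j u; exact: (is_deriveM (rsm_is_derive j u Hf) (rsm_is_derive j u Hg)).
- by move=> j; apply: rsm_add; apply: IH; try exact: rsm_D; exact: rsmS.
Qed.

Lemma rsmooth_cst d (c : R) : @rsmooth d (fun=> c).
Proof. by move=> m; exact: rsm_cst. Qed.

Lemma rsmooth_add d (f g : 'rV[R]_d -> R) :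
  rsmooth f -> rsmooth g -> rsmooth (fun u => f u + g u).
Proof. by move=> Hf Hg m; exact: rsm_add. Qed.

Lemma rsmooth_mul d (f g : 'rV[R]_d -> R) :
  rsmooth f -> rsmooth g -> rsmooth (fun u => f u * g u).
Proof. by move=> Hf Hg m; exact: rsm_mul. Qed.

Lemma rsmooth_opp d (f : 'rV[R]_d -> R) :
  rsmooth f -> rsmooth (fun u => - f u).
Proof.
move=> Hf; have -> : (fun u => - f u) = (fun u => (-1) * f u).
  by apply/funext => u; rewrite mulN1r.
by apply: rsmooth_mul => //; exact: rsmooth_cst.
Qed.

Lemma rsmooth_sub d (f g : 'rV[R]_d -> R) :
  rsmooth f -> rsmooth g -> rsmooth (fun u => f u - g u).
Proof. by move=> Hf Hg; apply: rsmooth_add => //; exact: rsmooth_opp. Qed.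

Lemma rsmooth_sum d (I : Type) (r : seq I) (F : I -> 'rV[R]_d -> R) :
  (forall i, rsmooth (F i)) -> rsmooth (fun u => \sum_(i <- r) F i u).
Proof.
move=> H; elim: r => [|i r IH].
  by under eq_fun do rewrite big_nil; exact: rsmooth_cst.
by under eq_fun do rewrite big_cons; exact: rsmooth_add.
Qed.

Lemma rsmooth_prod d (I : Type) (r : seq I) (F : I -> 'rV[R]_d -> R) :
  (forall i, rsmooth (F i)) -> rsmooth (fun u => \prod_(i <- r) F i u).
Proof.
move=> H; elim: r => [|i r IH].
  by under eq_fun do rewrite big_nil; exact: rsmooth_cst.
by under eq_fun do rewrite big_cons; exact: rsmooth_mul.
Qed.

Lemma cont_coord d (i : 'I_d) : continuous (fun u : 'rV[R]_d => u 0 i).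
Proof. by move=> u; exact: coord_continuous. Qed.
Arguments cont_coord {d} i _.

Lemma rsmooth_coord d (i : 'I_d) : rsmooth (fun u : 'rV[R]_d => u 0 i).
Proof.
case=> [|m]; first by split => //; exact: cont_coord.
apply: (@rsmS_is_derive _ _ _ (fun j => fun=> (i == j)%:R)).
- exact: cont_coord.
- move=> j u; rewrite is_derive_line0.
  have -> : (fun r : R => (u + r *: edir j) 0 i) = (fun r : R => u 0 i + r * (i == j)%:R).
    by apply/funext => r; rewrite !mxE eqxx.
  have := is_deriveD (is_derive_cst (u 0 i) (0:R) (1:R))
    (is_deriveM (is_derive_id (0:R) (1:R)) (is_derive_cst ((i == j)%:R : R) (0:R) (1:R))).
  by move=> /is_derive_eq; apply; rewrite scaler0 !add0r /GRing.scale /= mulr1.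
- by move=> j; exact: rsm_cst.
Qed.

(** By the chain rule the derivatives of G i (q u) are again combinations of
    functions of the same kind, times derivatives of q.  This covers sine and
    cosine, and the flat functions exp(-1/x) / x^j below. *)
Lemma rsm_comp1 (I : Type) (G : I -> R -> R) m d (q : 'rV[R]_d -> R) :
  (forall i, exists r : seq (R * I), forall x,
     is_derive x (1:R) (G i) (\sum_(p <- r) p.1 * G p.2 x)) ->
  rsm m q -> forall i, rsm m (fun u => G i (q u)).
Proof.
move=> HG.
have cG i : continuous (G i).
  move=> x; apply: differentiable_continuous; apply/derivable1_diffP.
  by have [r Hr] := HG i; have [] := Hr x.
have cGq i (f : 'rV[R]_d -> R) : continuous f -> continuous (fun u => G i (f u)).
  by move=> cf u; apply: continuous_comp; [exact: cf|exact: cG].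
elim: m q => [|m IH] q Hq i.
  by split=> //; apply: cGq; exact: rsm_cont Hq.
have [r Hr] := HG i.
apply: (@rsmS_is_derive _ _ _ (fun j u => (\sum_(p <- r) p.1 * G p.2 (q u)) * 'D_(edir j) q u)).
- by apply: cGq; exact: rsm_cont Hq.
- move=> j u; rewrite is_derive_line0.
  have : is_derive (0:R) (1:R) (fun s : R => q (u + s *: edir j)) ('D_(edir j) q u).
    by rewrite -is_derive_line0; apply: rsm_is_derive; exact: Hq.
  apply: (@is_derive1_comp _ (G i)).
  by rewrite scale0r addr0; exact: Hr.
- move=> j; apply: rsm_mul; last exact: rsm_D.
  elim: r {Hr} => [|p r IHr].
    by under eq_fun do rewrite big_nil; exact: rsm_cst.
  under eq_fun do rewrite big_cons.
  apply: rsm_add => //; apply: rsm_mul; first exact: rsm_cst.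
  by apply: IH; exact: rsmS.
Qed.

Lemma rsmooth_sincos d (q : 'rV[R]_d -> R) : rsmooth q ->
  rsmooth (fun u => sin (q u)) /\ rsmooth (fun u => cos (q u)).
Proof.
move=> Hq.
pose G (b : bool) := if b then @sin R else @cos R.
have HG : forall i, exists r : seq (R * bool), forall x,
     is_derive x (1:R) (G i) (\sum_(p <- r) p.1 * G p.2 x).
  case.
    exists [:: (1, false)] => x; rewrite big_seq1 mul1r /=; exact: is_derive_sin.
  by exists [:: (-1, true)] => x; rewrite big_seq1 mulN1r /=; exact: is_derive_cos.
by split=> m; [exact: (rsm_comp1 HG (Hq m) true)|exact: (rsm_comp1 HG (Hq m) false)].
Qed.

Lemma rsm_inv m d (q : 'rV[R]_d -> R) : (forall u, q u != 0) ->
  rsm m q -> rsm m (fun u => (q u)^-1).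
Proof.
move=> q0; elim: m => [|m IH] Hq.
  by split=> // u; exact: (cvgV (q0 u) (rsm_cont Hq u)).
apply: (@rsmS_is_derive _ _ _ (fun j u => (-1) * ((q u)^-1 * ((q u)^-1 * 'D_(edir j) q u)))).
- by move=> u; exact: (cvgV (q0 u) (rsm_cont Hq u)).
- move=> j u; rewrite is_derive_line0.
  have H : is_derive (0:R) (1:R) (fun s : R => q (u + s *: edir j)) ('D_(edir j) q u).
    by apply/is_derive_line0; exact: (rsm_is_derive j u Hq).
  have q0' : q (u + 0 *: edir j) != 0 by exact: q0.
  have := is_deriveV q0' H; move/is_derive_eq; apply.
  by rewrite scale0r addr0 /GRing.scale /= mulN1r mulrA -invfM -expr2 mulNr.
- move=> j; apply: rsm_mul; first exact: rsm_cst.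
  by do 2! (apply: rsm_mul; first by apply: IH; exact: rsmS); exact: rsm_D.
Qed.

Lemma rsmooth_inv d (q : 'rV[R]_d -> R) : (forall u, q u != 0) ->
  rsmooth q -> rsmooth (fun u => (q u)^-1).
Proof. by move=> q0 H m; exact: rsm_inv. Qed.

(** A map sending each coordinate line to a point or into a coordinate line keeps
    partial derivatives partial derivatives; every substitution used below is of
    this kind, which avoids total derivatives. *)
Lemma rsmooth_map d d' (h : 'rV[R]_d' -> R) (L : 'rV[R]_d -> 'rV[R]_d') :
  rsmooth h -> continuous L ->
  (forall j, (forall u (s : R), L (u + s *: edir j) = L u) \/
     exists (a : 'rV[R]_d -> R) i, rsmooth a /\
       forall u s, L (u + s *: edir j) = L u + (s * a u) *: edir i) ->
  rsmooth (fun u => h (L u)).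
Proof.
move=> Hh cL HL m; elim: m h Hh => [|m IH] h Hh.
  split=> // u; apply: continuous_comp; first exact: cL.
  exact: (rsmooth_cont Hh).
split=> [u|j].
  by apply: continuous_comp; [exact: cL|exact: (rsmooth_cont Hh)].
have [H|[a [i [Ha H]]]] := HL j.
  have D u : is_derive u (edir j) (fun u => h (L u)) 0.
    rewrite is_derive_line0; under eq_fun do rewrite H; exact: is_derive_cst.
  split=> [u|]; first by have [] := D u.
  have -> : (fun u => 'D_(edir j) (fun u => h (L u)) u) = fun=> 0.
    by apply/funext => u; have [] := D u.
  exact: rsm_cst.
have D u : is_derive u (edir j) (fun u => h (L u)) ('D_(edir i) h (L u) * a u).
  rewrite is_derive_line0; under eq_fun do rewrite H.
  apply: (@is_derive1_comp _ (fun r : R => h (L u + r *: edir i)) (fun s : R => s * a u)).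
    rewrite mul0r -is_derive_line scale0r addr0; exact: rsmooth_is_derive.
  have := is_deriveM (is_derive_id (0:R) (1:R)) (is_derive_cst (a u) (0:R) (1:R)).
  by move=> /is_derive_eq; apply; rewrite scaler0 !add0r /GRing.scale /= mulr1.
split=> [u|]; first by have [] := D u.
have -> : (fun u => 'D_(edir j) (fun u => h (L u)) u) = fun u => 'D_(edir i) h (L u) * a u.
  by apply/funext => u; have [] := D u.
by apply: rsm_mul; [exact: (IH _ (rsmooth_D i Hh))|exact: Ha].
Qed.

(** Smoothness is local.  This is what allows locally finite sums and functions
    defined piecewise on overlapping open sets. *)
Lemma rsm_local m d (h : 'rV[R]_d -> R) :
  (forall u : 'rV[R]_d, exists g, rsm m g /\ \forall v \near u, h v = g v) -> rsm m h.
Proof.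
elim: m h => [|m IH] h H.
  split=> // u; have [g [Hg E]] := H u; exact: near_continuous_at E (rsm_cont Hg u).
split=> [u|j].
  have [g [Hg E]] := H u; exact: near_continuous_at E (rsm_cont Hg u).
have D u : exists g, [/\ rsm m.+1 g, \forall v \near u, h v = g v &
    is_derive u (edir j) h ('D_(edir j) g u)].
  have [g [Hg E]] := H u; exists g; split=> //.
  by apply: near_eq_is_derive (rsm_is_derive j u Hg); apply: filterS E => v ->.
split=> [u|]; first by have [g [_ _ []]] := D u.
apply: IH => u; have [g [Hg E _]] := D u.
exists (fun v => 'D_(edir j) g v); split; first exact: rsm_D.
by apply: filterS (near_join E) => v; exact: near_eq_derive.
Qed.
End RealSmooth.

(** * Iterated integrals of dominated functions *)

Section Seq.
Variable R : realType.

(** Dominated convergence is a statement on sequences, so continuity of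
    integrals in a parameter is obtained sequentially. *)
Lemma seq_continuous_at (V : normedModType R) (f : V -> R) (p : V) :
  (forall u : nat -> V, u n @[n --> \oo] --> p -> f (u n) @[n --> \oo] --> f p) ->
  {for p, continuous f}.
Proof.
move=> H; apply/cvgrPdist_lt => e e0; apply: contrapT => nE.
have Hn n : exists v : V, `|p - v| < n.+1%:R^-1 /\ e <= `|f p - f v|.
  apply: contrapT => nv; apply: nE.
  apply/nbhs_ballP; exists n.+1%:R^-1 => /=; first by rewrite invr_gt0.
  move=> v /=; rewrite -ball_normE /= => pv; rewrite ltNge; apply/negP => ev.
  by apply: nv; exists v.
have [u Hu] := choice Hn.
have cu : u n @[n --> \oo] --> p.
  apply/cvgrPdist_lt => d d0.
  near=> n.
  have [+ _] := Hu n; move=> /lt_trans; apply.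
  by near: n; exact: near_infty_natSinv_lt (PosNum d0).
have /cvgrPdist_lt/(_ e e0) := H u cu.
move=> [N _ /(_ N (leqnn N))] /=.
by have [_] := Hu N; rewrite leNgt => /negP.
Unshelve. all: by end_near.
Qed.

End Seq.

Lemma cvg_comp_cont (T : Type) (F : set_system T) (V W : topologicalType)
    (g : T -> V) (h : V -> W) (p : V) :
  g x @[x --> F] --> p -> {for p, continuous h} -> h (g x) @[x --> F] --> h p.
Proof. by move=> cg ch; exact: (cvg_comp g h cg ch). Qed.

Section ContinuousOps.
Variables (R : realType) (V : topologicalType).
Implicit Types f g : V -> R.

Lemma cont_cst (c : R) : continuous (fun _ : V => c).
Proof. exact: cst_continuous. Qed.

Lemma cont_add f g : continuous f -> continuous g -> continuous (fun u => f u + g u).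
Proof. by move=> cf cg u; apply: cvgD; [exact: cf|exact: cg]. Qed.

Lemma cont_mul f g : continuous f -> continuous g -> continuous (fun u => f u * g u).
Proof. by move=> cf cg u; apply: cvgM; [exact: cf|exact: cg]. Qed.

Lemma cont_opp f : continuous f -> continuous (fun u => - f u).
Proof. by move=> cf u; apply: cvgN; exact: cf. Qed.

Lemma cont_sub f g : continuous f -> continuous g -> continuous (fun u => f u - g u).
Proof. by move=> cf cg; apply: cont_add => //; exact: cont_opp. Qed.

Lemma cont_comp (W Z : topologicalType) (h : W -> Z) (L : V -> W) :
  continuous L -> continuous h -> continuous (fun u => h (L u)).
Proof. by move=> cL ch u; apply: continuous_comp; [exact: cL|exact: ch]. Qed.

End ContinuousOps.

Section CvgRow.
Variable R : realType.

Lemma cvg_rV (T : Type) (F : set_system T) (FF : Filter F) d (L : T -> 'rV[R]_d) (p : 'rV[R]_d) :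
  (forall j, L x 0 j @[x --> F] --> p 0 j) -> L x @[x --> F] --> p.
Proof.
move=> H P [A HA AP].
suff : F [set x | forall j, A 0 j (L x 0 j)].
  by move=> FA; rewrite nbhs_filterE /=; move: FA; apply: filterS => x Hx;
    apply: AP => i j; rewrite ord1; exact: Hx.
by apply: filter_forall => j; apply: (H j); have := HA 0 j.
Qed.

Lemma ler_mx_norm d (v : 'rV[R]_d) i : `|v 0 i| <= `|v|.
Proof. by rewrite [leRHS]mx_normrE (le_bigmax _ (fun ij => `|v ij.1 ij.2|) (0, i)). Qed.

Lemma mx_norm_ler d (v : 'rV[R]_d) (r : R) : 0 <= r ->
  (forall i, `|v 0 i| <= r) -> `|v| <= r.
Proof.
move=> r0 H; rewrite [leLHS]mx_normrE; apply: bigmax_le => // -[a b] _.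
by rewrite /= ord1.
Qed.

Definition rcons0 d (t : R) (v : 'rV[R]_d) : 'rV[R]_d.+1 := row_mx (t%:M : 'rV_1) v.

Lemma rcons00 d t (v : 'rV[R]_d) : rcons0 t v 0 ord0 = t.
Proof.
have -> : ord0 = lshift d (ord0 : 'I_1) by apply/val_inj.
by apply: etrans (row_mxEl (t%:M : 'rV_1) v 0 ord0) _; rewrite mxE.
Qed.

Lemma rcons0S d t (v : 'rV[R]_d) i : rcons0 t v 0 (lift ord0 i) = v 0 i.
Proof.
have -> : lift ord0 i = rshift 1 i by apply/val_inj.
exact: (row_mxEr (t%:M : 'rV_1) v 0 i).
Qed.

Lemma rcons0_eta d (v : 'rV[R]_d.+1) :
  v = rcons0 (v 0 ord0) (\row_i v 0 (lift ord0 i)).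
Proof.
apply/rowP => i; case: (unliftP ord0 i) => [j ->|->].
  by rewrite rcons0S mxE.
by rewrite rcons00.
Qed.

Lemma cvg_rcons0 (T : Type) (F : set_system T) (FF : Filter F) d
    (f : T -> R) (g : T -> 'rV[R]_d) (t : R) (v : 'rV[R]_d) :
  f x @[x --> F] --> t -> g x @[x --> F] --> v ->
  rcons0 (f x) (g x) @[x --> F] --> rcons0 t v.
Proof.
move=> cf cg; apply: cvg_rV => j; case: (unliftP ord0 j) => [i ->|->].
  rewrite rcons0S; under eq_fun do rewrite rcons0S.
  exact: (cvg_comp_cont cg (@cont_coord R d i v)).
by rewrite rcons00; under eq_fun do rewrite rcons00.
Qed.

Lemma cont_rcons0 d t : continuous (@rcons0 d t).
Proof.
move=> v; apply: (@cvg_rcons0 _ (nbhs v) _ d (fun=> t) id t v); last exact: cvg_id.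
exact: cvg_cst.
Qed.

End CvgRow.

Section BoundedOnBalls.
Variable R : realType.

(** Closed balls of R^d are products of segments, hence compact. *)
Lemma bounded_on_ball d (h : 'rV[R]_d -> R) (r : R) : continuous h ->
  exists2 B, 0 <= B & forall v, `|v| <= r -> `|h v| <= B.
Proof.
move=> ch.
have cA : compact [set v : 'rV[R]_d | forall i, `[- r, r]%classic (v ord0 i)].
  exact: (@rV_compact R d (fun=> `[- r, r]%classic) (fun=> @segment_compact R _ _)).
have cI : compact (h @` [set v : 'rV[R]_d | forall i, `[- r, r]%classic (v ord0 i)]).
  apply: continuous_compact => //; exact: continuous_subspaceT.
have [M [_ HM]] := compact_bounded cI.
exists (`|M| + 1) => [|v vr]; first by rewrite addr_ge0.
apply: (HM (`|M| + 1)); first by rewrite ltr_pwDr// ler_norm.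
exists v => // i; rewrite /= in_itv /= -ler_norml.
exact: le_trans (ler_mx_norm _ _) vr.
Qed.
End BoundedOnBalls.

Section Rint.
Variable R : realType.
Local Notation mu := (@lebesgue_measure R).
Variables (D : set R) (w : R -> R).

Definition weight := [/\ measurable (D : set (measurableTypeR R)),
  (forall t, 0 <= w t <= 1) & mu.-integrable D (EFin \o w)].

(** The bound is a product over the coordinates, so that integrating one variable
    out leaves a function of the other variables of the same form. *)
Definition dominated d (B : R) (f : 'rV[R]_d -> R) :=
  [/\ continuous f, 0 <= B & forall v, `|f v| <= B * \prod_(i < d) w (v 0 i)].

Hypothesis Hw : weight.

Let w0 t : 0 <= w t. Proof. by have [_ /(_ t)/andP[]] := Hw. Qed.
Let w1 t : w t <= 1. Proof. by have [_ /(_ t)/andP[]] := Hw. Qed.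

Lemma rintS d (f : 'rV[R]_d.+1 -> R) :
  rint D f = \int[mu]_(t in D) rint D (fun v => f (rcons0 t v)).
Proof. by []. Qed.

Lemma dominated_slice d (B : R) (f : 'rV[R]_d.+1 -> R) t :
  dominated B f -> dominated (B * w t) (fun v => f (rcons0 t v)).
Proof.
case=> cf B0 H; split.
- by apply: (cont_comp _ cf); exact: cont_rcons0.
- exact: mulr_ge0.
- move=> v; apply: le_trans (H _) _; rewrite big_ord_recl rcons00 -mulrA.
  by under eq_bigr do rewrite rcons0S.
Qed.

Lemma dominated_le d (B B' : R) (f : 'rV[R]_d -> R) :
  B <= B' -> dominated B f -> dominated B' f.
Proof.
move=> BB [cf B0 H]; split=> //; first exact: le_trans BB.
by move=> v; apply: le_trans (H v) _; apply: ler_wpM2r => //; apply: prodr_ge0.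
Qed.

Lemma dominated_add d (B1 B2 a : R) (f g : 'rV[R]_d -> R) :
  dominated B1 f -> dominated B2 g ->
  dominated (`|a| * B1 + B2) (fun v => a * f v + g v).
Proof.
move=> [cf B10 H1] [cg B20 H2]; split.
- by apply: cont_add => //; apply: cont_mul => //; exact: cont_cst.
- by rewrite addr_ge0// mulr_ge0.
- move=> v; apply: le_trans (ler_normD _ _) _; rewrite mulrDl lerD//.
  by rewrite normrM -mulrA ler_wpM2l.
Qed.

Lemma dominated_integrable (phi : R -> R) (B : R) :
  continuous phi -> (forall t, D t -> `|phi t| <= B * w t) ->
  mu.-integrable D (EFin \o phi).
Proof.
move=> cphi H; have [mD _ iw] := Hw.
have iBw : mu.-integrable D (fun t => (B%:E * (w t)%:E)%E).
  exact: integrableZl iw.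
apply: le_integrable iBw => //.
  by apply/measurable_EFinP; apply: measurable_funTS; exact: continuous_measurable_fun.
move=> t Dt; rewrite /= lee_fin; apply: le_trans (H t Dt) _; exact: ler_norm.
Qed.

Let W := \int[mu]_(t in D) w t.

Lemma dominated_bound1 (phi : R -> R) (B : R) :
  continuous phi -> (forall t, D t -> `|phi t| <= B * w t) ->
  `|\int[mu]_(t in D) phi t| <= B * W.
Proof.
move=> cphi H; have [mD _ iw] := Hw.
have ip := dominated_integrable cphi H.
apply: le_trans (le_normr_Rintegral mD ip) _.
rewrite /W -RintegralZl//; apply: le_Rintegral => //.
- exact: (integrable_norm ip).
- by have := integrableZl mD B iw; apply: eq_integrable.
Qed.

Lemma dominated_cvg1 (phis : nat -> R -> R) (phi : R -> R) (B : R) :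
  (forall n, continuous (phis n)) -> continuous phi ->
  (forall n t, D t -> `|phis n t| <= B * w t) ->
  (forall t, phis n t @[n --> \oo] --> phi t) ->
  (\int[mu]_(t in D) phis n t) @[n --> \oo] --> (\int[mu]_(t in D) phi t).
Proof.
move=> cphis cphi H Hc; have [mD _ iw] := Hw.
have Hphi t : D t -> `|phi t| <= B * w t.
  move=> Dt.
  have cn : `|phis n t| @[n --> \oo] --> `|phi t| by apply: cvg_norm; exact: Hc.
  rewrite -(cvg_lim _ cn)//; apply: limr_le; first exact: cvgP cn.
  by apply: nearW => n; exact: H.
apply: fine_cvg; rewrite /Rintegral fineK; last first.
  apply: integrable_fin_num => //; exact: dominated_integrable Hphi.
apply: (@dominated_cvg _ _ _ mu _ mD (fun n t => (phis n t)%:E) _ (fun t => (B%:E * (w t)%:E)%E)).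
- by move=> n; apply/measurable_EFinP; apply: measurable_funTS; exact: continuous_measurable_fun.
- by move=> t _; apply: cvg_EFin; [exact: nearW|exact: Hc].
- by [].
- exact: integrableZl iw.
- by move=> n t Dt; rewrite /= lee_fin; exact: H.
Qed.

(** The three assertions are proved together.  In the inductive step the inner
    integral must be continuous in the outer variable to be integrable, and this is
    dominated convergence in one dimension less; the bound on the inner integral
    dominates the outer one. *)
Lemma rint_main d :
  [/\ forall (f : 'rV[R]_d -> R) B, dominated B f -> `|rint D f| <= B * W ^+ d,
      forall (fs : nat -> 'rV[R]_d -> R) f B,
        (forall n, dominated B (fs n)) -> dominated B f ->
        (forall v, fs n v @[n --> \oo] --> f v) ->
        rint D (fs n) @[n --> \oo] --> rint D f &
      forall (f g : 'rV[R]_d -> R) B1 B2 a, dominated B1 f -> dominated B2 g ->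
        rint D (fun v => a * f v + g v) = a * rint D f + rint D g].
Proof.
elim: d => [|d [IH1 IH2 IH3]].
  split=> //=.
  - by move=> f B [_ _ /(_ 0)]; rewrite big_ord0 expr0.
have cslice (f : 'rV[R]_d.+1 -> R) B : dominated B f ->
    continuous (fun t => rint D (fun v => f (rcons0 t v))).
  move=> Hf t; apply: seq_continuous_at => u cu.
  have HB s : dominated B (fun v => f (rcons0 s v)).
    apply: dominated_le (dominated_slice s Hf).
    by case: Hf => _ B0 _; rewrite -[leRHS]mulr1 ler_wpM2l.
  apply: (IH2 _ _ B) => // v.
  have [cf _ _] := Hf.
  apply: (@cvg_comp _ _ _ (fun n => rcons0 (u n) v) f) (cf _).
  by apply: cvg_rcons0 => //; exact: cvg_cst.
have bslice (f : 'rV[R]_d.+1 -> R) B : dominated B f ->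
    forall t, D t -> `|rint D (fun v => f (rcons0 t v))| <= B * W ^+ d * w t.
  move=> Hf t _; apply: le_trans (IH1 _ _ (dominated_slice t Hf)) _.
  by rewrite mulrAC.
split.
- move=> f B Hf; rewrite rintS exprSr mulrA; exact: (dominated_bound1 (cslice _ _ Hf) (bslice _ _ Hf)).
- move=> fs f B Hfs Hf Hc; rewrite rintS.
  apply: (@dominated_cvg1 (fun n t => rint D (fun v => fs n (rcons0 t v))) _ (B * W ^+ d)).
  + by move=> n; exact: (cslice _ _ (Hfs n)).
  + exact: (cslice _ _ Hf).
  + by move=> n; exact: (bslice _ _ (Hfs n)).
  + move=> t; apply: (IH2 _ _ (B * w t)).
    * by move=> n; apply: dominated_slice.
    * exact: dominated_slice.
    * by move=> v; exact: Hc.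
- move=> f g B1 B2 a Hf Hg; rewrite !rintS; have [mD _ _] := Hw.
  have i1 := dominated_integrable (cslice _ _ Hf) (bslice _ _ Hf).
  have i2 := dominated_integrable (cslice _ _ Hg) (bslice _ _ Hg).
  under eq_Rintegral do rewrite (IH3 _ _ _ _ _ (dominated_slice _ Hf) (dominated_slice _ Hg)).
  rewrite RintegralD// ?RintegralZl//.
  by have := integrableZl mD a i1; apply: eq_integrable.
Qed.

End Rint.

Section Weights.
Variable R : realType.
Local Notation mu := (@lebesgue_measure R).

Lemma weight01 : weight `[0, 1]%classic (fun _ : R => 1).
Proof.
split; first exact: measurable_itv.
- by move=> t; rewrite ler01 lexx.
- apply: continuous_compact_integrable; first exact: segment_compact.
  by apply: continuous_subspaceT => x; exact: cvg_cst.
Qed.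

Lemma weight01_mass : \int[mu]_(t in `[0, 1]%classic) (1 : R) = 1.
Proof.
rewrite Rintegral_cst; last exact: measurable_itv.
have E := @lebesgue_measure_itv R `[0, 1].
by rewrite [X in fine X]E /= lte_fin ltr01 -EFinB subr0 mulr1.
Qed.

(** An explicit integrable weight on the line; its values at the integers are also
    summable and dominate the Fourier coefficients. *)
Definition decay (t : R) : R := (1 + t ^+ 2)^-1.

Lemma decay_gt0 t : 0 < decay t.
Proof. by rewrite invr_gt0 ltr_wpDr// sqr_ge0. Qed.

Lemma decay_le1 t : decay t <= 1.
Proof. by rewrite invf_le1 ?lerDl ?sqr_ge0// ltr_wpDr// sqr_ge0. Qed.

Lemma cont_decay : continuous decay.
Proof.
move=> t; apply: cvgV; first by rewrite gt_eqF// ltr_wpDr// sqr_ge0.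
by apply: cvgD; [exact: cvg_cst|apply: exprn_continuous].
Qed.

Lemma weightT : weight setT decay.
Proof.
split; first exact: measurableT.
- by move=> t; rewrite ltW ?decay_gt0// decay_le1.
apply/integrableP; split.
  by apply/measurable_EFinP; apply: continuous_measurable_fun; exact: cont_decay.
have -> : (\int[mu]_x `|(EFin \o decay) x| = \int[mu]_x (decay x)%:E)%E.
  by apply: eq_integral => x _; rewrite /= ger0_norm// ltW// decay_gt0.
rewrite ge0_symfun_integralT.
- have -> : [set x : R | 0 <= x] = `[0, +oo[%classic.
    by apply/seteqP; split => x /=; rewrite in_itv /= andbT.
  have := integral0y_oneDsqr R; rewrite /oneDsqr /decay => ->.
  by rewrite -EFinM ltry.
- by move=> x; rewrite ltW// decay_gt0.
- exact: cont_decay.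
- by move=> x; rewrite /= /decay sqrrN.
Qed.

End Weights.

Section ParamIntegral.
Variable R : realType.
Local Notation mu := (@lebesgue_measure R).

Lemma norm_rcons0 d t (v : 'rV[R]_d) (r : R) : `|t| <= r -> `|v| <= r -> `|rcons0 t v| <= r.
Proof.
move=> tr vr; apply: mx_norm_ler => [|i]; first exact: le_trans tr.
case: (unliftP ord0 i) => [j ->|->]; last by rewrite rcons00.
by rewrite rcons0S; apply: le_trans (ler_mx_norm _ _) vr.
Qed.

Lemma cont_rcons0l d (v : 'rV[R]_d) : continuous (fun t : R => rcons0 t v).
Proof.
move=> t; apply: (@cvg_rcons0 _ _ (nbhs t) _ d id (fun=> v) t v); first exact: cvg_id.
exact: cvg_cst.
Qed.

Lemma cont_int01 d (H : 'rV[R]_d.+1 -> R) : continuous H ->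
  continuous (fun u : 'rV[R]_d => \int[mu]_(s in `[0, 1]) H (rcons0 s u)).
Proof.
move=> cH u; apply: seq_continuous_at => us cus.
have [N _ HN] : \forall n \near \oo, `|us n| <= `|u| + 1.
  have /cvgrPdist_lt/(_ 1 ltr01) := cus; apply: filterS => n Hn.
  rewrite -[us n](subrK u); apply: le_trans (ler_normD _ _) _.
  by rewrite addrC lerD2l distrC ltW.
have [B B0 HB] := bounded_on_ball (`|u| + 1) cH.
rewrite -(cvg_shiftn N) /=.
apply: (dominated_cvg1 (weight01 R) (phis := fun n s => H (rcons0 s (us (n + N)%N))) (B := B)).
- by move=> n; apply: (cont_comp (@cont_rcons0l d _) cH).
- by apply: (cont_comp (@cont_rcons0l d _) cH).
- move=> n t; rewrite /= in_itv /= mulr1 => /andP[t0 t1]; apply: HB.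
  apply: norm_rcons0; last by apply: HN; exact: leq_addl.
  by rewrite ger0_norm// (le_trans t1)// lerDr.
- move=> t.
  apply: (@cvg_comp_cont _ _ _ _ (fun n => rcons0 t (us (n + N)%N)) H (rcons0 t u)); last exact: cH.
  apply: cvg_rcons0; first exact: cvg_cst.
  by rewrite (cvg_shiftn N us).
Qed.

Lemma rcons0_line d (t : R) (u : 'rV[R]_d) s j :
  rcons0 t (u + s *: edir R j) = rcons0 t u + s *: edir R (lift ord0 j).
Proof.
apply/rowP => i; case: (unliftP ord0 i) => [l ->|->].
  rewrite rcons0S [RHS]mxE rcons0S !mxE !eqxx /=.
  by rewrite (inj_eq (@lift_inj _ ord0)).
by rewrite rcons00 [RHS]mxE rcons00 !mxE /= mulr0 addr0.
Qed.

Lemma is_derive_int01 d (H : 'rV[R]_d.+1 -> R) j u : rsmooth H ->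
  is_derive u (edir R j) (fun u : 'rV[R]_d => \int[mu]_(s in `[0, 1]) H (rcons0 s u))
    (\int[mu]_(s in `[0, 1]) 'D_(edir R (lift ord0 j)) H (rcons0 s u)).
Proof.
move=> sH; apply/is_derive_line0.
pose f (x : R) (s : R) := H (rcons0 s (u + x *: edir R j)).
have df x s : is_derive x (1:R) (f ^~ s) ('D_(edir R (lift ord0 j)) H (rcons0 s (u + x *: edir R j))).
  rewrite /f rcons0_line; under eq_fun do rewrite rcons0_line.
  apply/is_derive_line; exact: rsmooth_is_derive.
have [B B0 HB] := bounded_on_ball (`|u| + 1) (rsmooth_cont (rsmooth_D (lift ord0 j) sH)).
have mI : measurable (`[0%R, 1%R] : set (measurableTypeR R)) by exact: measurable_itv.
have I0 : `](-1 : R), 1[%classic 0 by rewrite /= in_itv /= ltrN10 ltr01.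
have intf x : `](-1 : R), 1[%classic x -> mu.-integrable `[0, 1] (EFin \o f x).
  move=> _; apply: continuous_compact_integrable; first exact: segment_compact.
  apply: continuous_subspaceT; exact: (cont_comp (@cont_rcons0l d _) (rsmooth_cont sH)).
have df1 x s : `](-1 : R), 1[%classic x -> `[0, 1]%classic s -> derivable (f ^~ s) x 1.
  by move=> _ _; have [] := df x s.
have iG : mu.-integrable `[0, 1] (EFin \o (fun=> B)).
  apply: continuous_compact_integrable; first exact: segment_compact.
  by apply: continuous_subspaceT => x; exact: cvg_cst.
have nedir : `|edir R j| <= 1.
  by apply: mx_norm_ler => // i; rewrite !mxE eqxx; case: (_ == _); rewrite ?normr1 ?normr0.
have G_ub x s : `](-1 : R), 1[%classic x -> `[0, 1]%classic s -> `|partial1of2 f x s| <= B.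
  rewrite /= !in_itv /= => /andP[x1 x2] /andP[s0 s1].
  rewrite partial1of2E; have [_ ->] := df x s; apply: HB; apply: norm_rcons0.
    by rewrite ger0_norm// (le_trans s1)// lerDr.
  apply: le_trans (ler_normD _ _) _; rewrite lerD2l normrZ.
  rewrite -[leRHS]mulr1; apply: ler_pM => //.
  by rewrite ler_norml ltW//= ltW.
have D1 := derivable_under_integral mI I0 intf df1 (fun=> B0) iG G_ub.
have D2 := differentiation_under_integral mI I0 intf df1 (fun=> B0) iG G_ub.
apply: DeriveDef; first exact: D1.
rewrite -derive1E D2; apply: eq_Rintegral => s _.
by rewrite partial1of2E; have [_ ->] := df 0 s; rewrite scale0r addr0.
Qed.

Lemma rsmooth_int01 d (H : 'rV[R]_d.+1 -> R) : rsmooth H ->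
  rsmooth (fun u : 'rV[R]_d => \int[mu]_(s in `[0, 1]) H (rcons0 s u)).
Proof.
move=> sH m; elim: m H sH => [|m IH] H sH.
  by split => //; exact: cont_int01 (rsmooth_cont sH).
apply: (rsmS_is_derive (g := fun j u => \int[mu]_(s in `[0, 1]) 'D_(edir R (lift ord0 j)) H (rcons0 s u))).
- exact: cont_int01 (rsmooth_cont sH).
- by move=> j u; exact: is_derive_int01.
- by move=> j; apply: (IH (fun v => 'D_(edir R (lift ord0 j)) H v)); exact: rsmooth_D.
Qed.

End ParamIntegral.

(** * Complex numbers and smooth complex functions *)

Section ComplexBasics.
Variable R : realType.
Implicit Types z w : R[i].
Local Notation Re := (@complex.Re R).
Local Notation Im := (@complex.Im R).

Lemma Re_mul z w : Re (z * w) = Re z * Re w - Im z * Im w. Proof. by case: z; case: w. Qed.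
Lemma Im_mul z w : Im (z * w) = Re z * Im w + Im z * Re w. Proof. by case: z; case: w. Qed.
Lemma Re_add z w : Re (z + w) = Re z + Re w. Proof. by case: z; case: w. Qed.
Lemma Im_add z w : Im (z + w) = Im z + Im w. Proof. by case: z; case: w. Qed.
Lemma Re_opp z : Re (- z) = - Re z. Proof. by case: z. Qed.
Lemma Im_opp z : Im (- z) = - Im z. Proof. by case: z. Qed.
Lemma Re_sub z w : Re (z - w) = Re z - Re w. Proof. by rewrite Re_add Re_opp. Qed.
Lemma Im_sub z w : Im (z - w) = Im z - Im w. Proof. by rewrite Im_add Im_opp. Qed.
Lemma Re_conjc z : Re (conjc z) = Re z. Proof. by case: z. Qed.
Lemma Im_conjc z : Im (conjc z) = - Im z. Proof. by case: z. Qed.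

Lemma complex_eqP z w : Re z = Re w -> Im z = Im w -> z = w.
Proof. by case: z => a b; case: w => c d /= -> ->. Qed.

Lemma cabs_sqr z : cabs z ^+ 2 = Re z ^+ 2 + Im z ^+ 2.
Proof. by case: z => a b; rewrite /cabs /= sqr_sqrtr// addr_ge0// sqr_ge0. Qed.

Lemma cabs_ge0 z : 0 <= cabs z.
Proof. by case: z => a b; exact: sqrtr_ge0. Qed.

Lemma cabs0 : cabs (0 : R[i]) = 0. Proof. exact: ComplexField.Normc.normc0. Qed.
Lemma cabs1 : cabs (1 : R[i]) = 1. Proof. exact: ComplexField.Normc.normc1. Qed.
Lemma cabsM z w : cabs (z * w) = cabs z * cabs w.
Proof. exact: ComplexField.Normc.normcM. Qed.
Lemma cabsD z w : cabs (z + w) <= cabs z + cabs w.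
Proof. exact: le_normcD. Qed.
Lemma cabsN z : cabs (- z) = cabs z. Proof. exact: normcN. Qed.
Lemma cabsB z w : cabs (z - w) <= cabs z + cabs w.
Proof. by rewrite -(cabsN w) cabsD. Qed.
Lemma cabsJ z : cabs (conjc z) = cabs z.
Proof. by case: z => a b; rewrite /cabs /= sqrrN. Qed.
Lemma cabsC z w : cabs (z - w) = cabs (w - z).
Proof. by rewrite -cabsN opprB. Qed.
Lemma cabs_real (r : R) : cabs r%:C = `|r|.
Proof. by rewrite /cabs /= expr0n addr0 sqrtr_sqr. Qed.

Lemma Re_le_cabs z : `|Re z| <= cabs z.
Proof.
rewrite -(ler_pXn2r (ltn0Sn 1)) ?nnegrE ?cabs_ge0//.
by rewrite cabs_sqr real_normK ?num_real// lerDl sqr_ge0.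
Qed.

Lemma Im_le_cabs z : `|Im z| <= cabs z.
Proof.
rewrite -(ler_pXn2r (ltn0Sn 1)) ?nnegrE ?cabs_ge0//.
by rewrite cabs_sqr real_normK ?num_real// lerDr sqr_ge0.
Qed.

Lemma cabs_le z : cabs z <= `|Re z| + `|Im z|.
Proof.
rewrite -(ler_pXn2r (ltn0Sn 1)) ?nnegrE ?cabs_ge0 ?addr_ge0//.
rewrite cabs_sqr sqrrD !real_normK ?num_real//.
by rewrite addrAC lerDl mulrn_wge0// mulr_ge0.
Qed.

Lemma cabs_eq0 z : cabs z = 0 -> z = 0.
Proof. exact: ComplexField.Normc.eq0_normc. Qed.

Lemma cabs_sum (I : Type) (r : seq I) (P : pred I) (F : I -> R[i]) :
  cabs (\sum_(i <- r | P i) F i) <= \sum_(i <- r | P i) cabs (F i).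
Proof.
elim/big_rec2 : _ => [|i y x _ H]; first by rewrite cabs0.
by apply: le_trans (cabsD _ _) _; rewrite lerD2l.
Qed.

Lemma cabs_sqrE z : z * conjc z = (cabs z ^+ 2)%:C.
Proof.
rewrite cabs_sqr; case: z => a b /=; apply: complex_eqP => /=.
  by rewrite mulrN opprK -!expr2.
by rewrite mulrN mulrC addNr.
Qed.

Lemma expiD (a b : R) : expi (a + b) = expi a * expi b.
Proof. by apply: complex_eqP; rewrite ?Re_mul ?Im_mul /= ?sinD ?cosD// addrC [cos a * _]mulrC [sin a * _]mulrC. Qed.

Lemma expi0 : expi (0 : R) = 1.
Proof. by rewrite /expi cos0 sin0. Qed.

Lemma conj_expi (a : R) : conjc (expi a) = expi (- a).
Proof. by rewrite /expi /= cosN sinN. Qed.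

Lemma cabs_expi (a : R) : cabs (expi a) = 1.
Proof. by rewrite /cabs /= cos2Dsin2 sqrtr1. Qed.

Lemma expi2pi : expi (2 * pi : R) = 1.
Proof. by rewrite /expi mulr_natl cos2pi sin2pi. Qed.

Lemma expi2pin (n : nat) : expi (2 * pi * n%:R : R) = 1.
Proof.
elim: n => [|n IH]; first by rewrite mulr0 expi0.
have -> : n.+1%:R = n%:R + 1 :> R by rewrite natr1.
by rewrite mulrDr mulr1 expiD IH expi2pi mulr1.
Qed.

Lemma expi2piz (n : int) : expi (2 * pi * n%:~R : R) = 1.
Proof.
case: n => n; first exact: expi2pin.
by rewrite NegzE rmorphN /= mulrN -conj_expi expi2pin conjc1.
Qed.

Lemma expiV (a : R) : expi a * expi (- a) = 1.
Proof. by rewrite -expiD subrr expi0. Qed.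

Lemma expi_sum (I : Type) (r : seq I) (F : I -> R) :
  expi (\sum_(i <- r) F i) = \prod_(i <- r) expi (F i).
Proof. by elim/big_rec2 : _ => [|i y x _ <-]; [exact: expi0|exact: expiD]. Qed.

End ComplexBasics.

Section Ccvg.
Variable R : realType.
Implicit Types (u v : nat -> R[i]).
Local Notation Re := (@complex.Re R).
Local Notation Im := (@complex.Im R).

Definition ccvg u (l : R[i]) :=
  (Re (u n) @[n --> \oo] --> Re l) /\ (Im (u n) @[n --> \oo] --> Im l).

Lemma ccvg_cst l : ccvg (fun=> l) l.
Proof. by split; exact: cvg_cst. Qed.

Lemma ccvgD u v l m : ccvg u l -> ccvg v m -> ccvg (fun n => u n + v n) (l + m).
Proof.
move=> [u1 u2] [v1 v2]; split.
- by rewrite Re_add; under eq_fun do rewrite Re_add; exact: cvgD.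
- by rewrite Im_add; under eq_fun do rewrite Im_add; exact: cvgD.
Qed.

Lemma ccvgM u v l m : ccvg u l -> ccvg v m -> ccvg (fun n => u n * v n) (l * m).
Proof.
move=> [u1 u2] [v1 v2]; split.
- by rewrite Re_mul; under eq_fun do rewrite Re_mul; apply: cvgB; exact: cvgM.
- by rewrite Im_mul; under eq_fun do rewrite Im_mul; apply: cvgD; exact: cvgM.
Qed.

Lemma ccvgN u l : ccvg u l -> ccvg (fun n => - u n) (- l).
Proof.
move=> [u1 u2]; split.
- by rewrite Re_opp; under eq_fun do rewrite Re_opp; exact: cvgN.
- by rewrite Im_opp; under eq_fun do rewrite Im_opp; exact: cvgN.
Qed.

Lemma ccvgB u v l m : ccvg u l -> ccvg v m -> ccvg (fun n => u n - v n) (l - m).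
Proof. by move=> Hu Hv; apply: ccvgD => //; exact: ccvgN. Qed.

Lemma ccvgJ u l : ccvg u l -> ccvg (fun n => conjc (u n)) (conjc l).
Proof.
move=> [u1 u2]; split.
- by rewrite Re_conjc; under eq_fun do rewrite Re_conjc.
- by rewrite Im_conjc; under eq_fun do rewrite Im_conjc; exact: cvgN.
Qed.

Lemma ccvg_sum (I : Type) (r : seq I) (F : I -> nat -> R[i]) (L : I -> R[i]) :
  (forall i, ccvg (F i) (L i)) ->
  ccvg (fun n => \sum_(i <- r) F i n) (\sum_(i <- r) L i).
Proof.
move=> H; elim: r => [|i r IH].
  by rewrite big_nil; under eq_fun do rewrite big_nil; exact: ccvg_cst.
by rewrite big_cons; under eq_fun do rewrite big_cons; exact: ccvgD.
Qed.

Lemma ccvg_unique u l m : ccvg u l -> ccvg u m -> l = m.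
Proof.
move=> [u1 u2] [v1 v2]; apply: complex_eqP.
  exact: cvg_unique u1 v1.
exact: cvg_unique u2 v2.
Qed.

Lemma ccvgP u l : ccvg u l <-> (cabs (u n - l) @[n --> \oo] --> (0 : R)).
Proof.
split=> [[u1 u2]|H].
  have H : `|Re (u n) - Re l| + `|Im (u n) - Im l| @[n --> \oo] --> (0 : R).
    rewrite -[0]addr0; apply: cvgD; apply/norm_cvg0P => /=.
      by rewrite -(subrr (Re l)); apply: cvgB => //; exact: cvg_cst.
    by rewrite -(subrr (Im l)); apply: cvgB => //; exact: cvg_cst.
  apply: squeeze_cvgr (cvg_cst 0) H; apply: nearW => n; rewrite cabs_ge0 /=.
  by apply: le_trans (cabs_le _) _; rewrite Re_sub Im_sub.
split; apply/cvgrPdist_le => e e0.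
  have /cvgrPdist_le/(_ e e0) := H; apply: filterS => n; rewrite sub0r normrN.
  rewrite ger0_norm ?cabs_ge0//; apply: le_trans; rewrite distrC -Re_sub; exact: Re_le_cabs.
have /cvgrPdist_le/(_ e e0) := H; apply: filterS => n; rewrite sub0r normrN.
rewrite ger0_norm ?cabs_ge0//; apply: le_trans; rewrite distrC -Im_sub; exact: Im_le_cabs.
Qed.

Lemma ccvg_squeeze u l (b : nat -> R) : (forall n, cabs (u n - l) <= b n) ->
  b n @[n --> \oo] --> (0 : R) -> ccvg u l.
Proof.
move=> H Hb; apply/ccvgP; apply: squeeze_cvgr (cvg_cst 0) Hb.
by apply: nearW => n; rewrite cabs_ge0 H.
Qed.

Lemma ccvg_le u l (B : R) : ccvg u l -> (forall n, cabs (u n) <= B) -> cabs l <= B.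
Proof.
move=> /ccvgP H HB; rewrite -subr_le0 -(cvg_lim _ H)//.
apply: limr_ge; first exact: cvgP H.
apply: nearW => n; rewrite lerBlDr; apply: (@le_trans _ _ (cabs (u n - l) + cabs (u n))).
  by rewrite cabsC -{1}(subrK (u n) l) cabsD.
by rewrite lerD2l.
Qed.

End Ccvg.

Section ComplexSmooth.
Variable R : realType.
Local Notation Re := (@complex.Re R).
Local Notation Im := (@complex.Im R).

Definition rparts d (l : seq 'I_d) (h : 'rV[R]_d -> R) : 'rV[R]_d -> R :=
  foldr (fun j h u => 'D_(edir R j) h u) h l.

Lemma partialsE d (l : seq 'I_d) (f : 'rV[R]_d -> R[i]) u :
  partials l f u = rparts l (fun v => Re (f v)) u +i* rparts l (fun v => Im (f v)) u.
Proof.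
elim: l u => [|j l IH] u /=; first by case: (f u).
rewrite /partial; congr (_ +i* _); congr ('D_ _ _ u).
  by apply/funext => v; rewrite IH.
by apply/funext => v; rewrite IH.
Qed.

Lemma rsmooth_rparts d (l : seq 'I_d) (h : 'rV[R]_d -> R) : rsmooth h -> rsmooth (rparts l h).
Proof. by move=> H; elim: l => //= j l IH; exact: rsmooth_D. Qed.

Lemma rsmoothP d (h : 'rV[R]_d -> R) :
  rsmooth h <-> forall l, continuous (rparts l h) /\
     forall j u, derivable (rparts l h) u (edir R j).
Proof.
split=> [H l|H m].
  have Hl := rsmooth_rparts l H; split; first exact: rsmooth_cont Hl.
  by move=> j u; exact: rsmooth_derivable.
suff : forall l, rsm m (rparts l h) by move=> /(_ [::]).
elim: m => [|m IH] l; first by split=> //; have [] := H l.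
have [c D] := H l.
by split=> // j; split => //; exact: (IH (j :: l)).
Qed.

(** The partial derivatives of a complex function are those of its real and
    imaginary part, so smoothness reduces to the real case. *)
Lemma smoothP d (f : 'rV[R]_d -> R[i]) :
  smooth f <-> rsmooth (fun v => Re (f v)) /\ rsmooth (fun v => Im (f v)).
Proof.
have E l : (fun v => Re (partials l f v)) = rparts l (fun v => Re (f v)) /\
           (fun v => Im (partials l f v)) = rparts l (fun v => Im (f v)).
  by split; apply/funext => v; rewrite partialsE.
split=> [H|[/rsmoothP H1 /rsmoothP H2] l /=].
  split; apply/rsmoothP => l; have [E1 E2] := E l; have [] := H l.
    by rewrite E1 => c _ D; split=> // j u; have [] := D j u.
  by rewrite E2 => _ c D; split=> // j u; have [] := D j u.
have [-> ->] := E l; have [c1 D1] := H1 l; have [c2 D2] := H2 l.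
by split=> // j u; split; [exact: D1|exact: D2].
Qed.

Local Opaque smooth.

Lemma smooth_real d (h : 'rV[R]_d -> R) : rsmooth h -> smooth (fun u => (h u)%:C).
Proof. by move=> H; apply/smoothP; split=> //=; exact: rsmooth_cst. Qed.

Lemma smooth_cst d (c : R[i]) : smooth (fun _ : 'rV[R]_d => c).
Proof. by apply/smoothP; split; exact: rsmooth_cst. Qed.

Lemma smooth_add d (f g : 'rV[R]_d -> R[i]) : smooth f -> smooth g ->
  smooth (fun u => f u + g u).
Proof.
move=> /smoothP[f1 f2] /smoothP[g1 g2]; apply/smoothP; split.
- by under eq_fun do rewrite Re_add; exact: rsmooth_add.
- by under eq_fun do rewrite Im_add; exact: rsmooth_add.
Qed.

Lemma smooth_mul d (f g : 'rV[R]_d -> R[i]) : smooth f -> smooth g ->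
  smooth (fun u => f u * g u).
Proof.
move=> /smoothP[f1 f2] /smoothP[g1 g2]; apply/smoothP; split.
- by under eq_fun do rewrite Re_mul; apply: rsmooth_sub; exact: rsmooth_mul.
- by under eq_fun do rewrite Im_mul; apply: rsmooth_add; exact: rsmooth_mul.
Qed.

Lemma smooth_opp d (f : 'rV[R]_d -> R[i]) : smooth f -> smooth (fun u => - f u).
Proof.
move=> /smoothP[f1 f2]; apply/smoothP; split.
- by under eq_fun do rewrite Re_opp; exact: rsmooth_opp.
- by under eq_fun do rewrite Im_opp; exact: rsmooth_opp.
Qed.

Lemma smooth_sub d (f g : 'rV[R]_d -> R[i]) : smooth f -> smooth g ->
  smooth (fun u => f u - g u).
Proof. by move=> Hf Hg; exact: (smooth_add Hf (smooth_opp Hg)). Qed.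

Lemma smooth_conj d (f : 'rV[R]_d -> R[i]) : smooth f -> smooth (fun u => conjc (f u)).
Proof.
move=> /smoothP[f1 f2]; apply/smoothP; split.
- by under eq_fun do rewrite Re_conjc.
- by under eq_fun do rewrite Im_conjc; exact: rsmooth_opp.
Qed.

Lemma smooth_sum d (I : Type) (r : seq I) (P : pred I) (F : I -> 'rV[R]_d -> R[i]) :
  (forall i, smooth (F i)) -> smooth (fun u => \sum_(i <- r | P i) F i u).
Proof.
move=> H; elim: r => [|i r IH].
  have -> : (fun u => \sum_(i <- [::] | P i) F i u) = fun=> 0.
    by apply/funext => u; rewrite big_nil.
  exact: smooth_cst.
have -> : (fun u => \sum_(i <- i :: r | P i) F i u) =
    fun u => (if P i then F i u + \sum_(i <- r | P i) F i u else \sum_(i <- r | P i) F i u).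
  by apply/funext => u; rewrite big_cons.
by case: (P i); [exact: (smooth_add (H i) IH)|exact: IH].
Qed.

Lemma smooth_expi d (q : 'rV[R]_d -> R) : rsmooth q -> smooth (fun u => expi (q u)).
Proof. by move=> /rsmooth_sincos[H1 H2]; apply/smoothP; split. Qed.

Lemma smooth_partial d j (f : 'rV[R]_d -> R[i]) : smooth f -> smooth (partial j f).
Proof.
by move=> /smoothP[f1 f2]; apply/smoothP; split; exact: rsmooth_D.
Qed.

Lemma smooth_map d d' (h : 'rV[R]_d' -> R[i]) (L : 'rV[R]_d -> 'rV[R]_d') :
  smooth h -> continuous L ->
  (forall j, (forall u (s : R), L (u + s *: edir R j) = L u) \/
     exists (a : 'rV[R]_d -> R) i, rsmooth a /\
       forall u s, L (u + s *: edir R j) = L u + (s * a u) *: edir R i) ->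
  smooth (fun u => h (L u)).
Proof.
move=> /smoothP[h1 h2] cL HL; apply/smoothP; split.
  exact: (rsmooth_map h1).
exact: (rsmooth_map h2).
Qed.

Lemma smooth_contRe d (f : 'rV[R]_d -> R[i]) : smooth f -> continuous (fun u => Re (f u)).
Proof. by move=> /smoothP[/rsmooth_cont]. Qed.

Lemma smooth_contIm d (f : 'rV[R]_d -> R[i]) : smooth f -> continuous (fun u => Im (f u)).
Proof. by move=> /smoothP[_ /rsmooth_cont]. Qed.

Definition is_cderive (V : normedModType R) (u v : V) (f : V -> R[i]) (a : R[i]) :=
  is_derive u v (fun x => Re (f x)) (Re a) /\ is_derive u v (fun x => Im (f x)) (Im a).

Lemma is_cderive_cst (V : normedModType R) (u v : V) c : is_cderive u v (fun=> c) 0.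
Proof. by split; exact: is_derive_cst. Qed.

Lemma is_cderiveM (V : normedModType R) (u v : V) f g a b :
  is_cderive u v f a -> is_cderive u v g b ->
  is_cderive u v (fun x => f x * g x) (a * g u + f u * b).
Proof.
move=> [f1 f2] [g1 g2]; split.
- under eq_fun do rewrite Re_mul.
  apply: is_derive_eq.
  by rewrite Re_add !Re_mul /GRing.scale /=; ring.
- under eq_fun do rewrite Im_mul.
  apply: is_derive_eq.
  by rewrite Im_add !Im_mul /GRing.scale /=; ring.
Qed.

Lemma is_cderiveZ (V : normedModType R) (u v : V) c f a :
  is_cderive u v f a -> is_cderive u v (fun x => c * f x) (c * a).
Proof. by move=> H; have := is_cderiveM (is_cderive_cst u v c) H; rewrite mul0r add0r. Qed.

Lemma is_cderive_line d (f : 'rV[R]_d -> R[i]) u v (s : R) a :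
  is_cderive (u + s *: v) v f a <-> is_cderive s (1 : R) (fun r => f (u + r *: v)) a.
Proof.
have HR := @is_derive_line R d (fun x => Re (f x)) u v s (Re a).
have HI := @is_derive_line R d (fun x => Im (f x)) u v s (Im a).
by split=> -[d1 d2]; split; [exact/HR|exact/HI|exact/HR|exact/HI].
Qed.

Lemma is_cderive_line0 d (f : 'rV[R]_d -> R[i]) u v a :
  is_cderive u v f a <-> is_cderive (0 : R) (1 : R) (fun r => f (u + r *: v)) a.
Proof. by rewrite -is_cderive_line scale0r addr0. Qed.

Lemma is_cderive_comp (f : R -> R[i]) (q : R -> R) t a b :
  is_cderive (q t) (1 : R) f a -> is_derive t (1 : R) q b ->
  is_cderive t (1 : R) (fun s => f (q s)) (b%:C * a).
Proof.
move=> [d1 d2] dq; split.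
  rewrite Re_mul /= mul0r subr0 mulrC; exact: (is_derive1_comp d1 dq).
rewrite Im_mul /= mul0r addr0 mulrC; exact: (is_derive1_comp d2 dq).
Qed.

Lemma is_cderive_expi (q : R -> R) t b :
  is_derive t (1 : R) q b -> is_cderive t (1 : R) (fun s => expi (q s)) (b%:C * imag R * expi (q t)).
Proof. by move=> H; split => /=; apply: is_derive_eq; ring. Qed.

Definition cderiv d (j : 'I_d) (u : 'rV[R]_d) (f : 'rV[R]_d -> R[i]) (a : R[i]) :=
  is_cderive u (edir R j) f a.

Lemma cderiv_partial d j (u : 'rV[R]_d) f a : cderiv j u f a -> partial j f u = a.
Proof. by case=> -[_ d1] [_ d2]; apply: complex_eqP. Qed.

Lemma smooth_cderiv d j (u : 'rV[R]_d) f : smooth f -> cderiv j u f (partial j f u).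
Proof. by move=> /smoothP[f1 f2]; split; exact: rsmooth_is_derive. Qed.

Lemma cderiv_expi d j (u : 'rV[R]_d) (q : 'rV[R]_d -> R) (a : R) :
  is_derive u (edir R j) q a -> cderiv j u (fun v => expi (q v)) (a%:C * imag R * expi (q u)).
Proof.
move=> /is_derive_line0 H; apply/is_cderive_line0.
by have := is_cderive_expi H; rewrite scale0r addr0.
Qed.

Lemma partialM d j (f g : 'rV[R]_d -> R[i]) : smooth f -> smooth g ->
  partial j (fun v => f v * g v) = fun u => partial j f u * g u + f u * partial j g u.
Proof.
move=> sf sg; apply/funext => u; apply: cderiv_partial.
by apply: is_cderiveM; exact: smooth_cderiv.
Qed.

Lemma smooth_local d (f : 'rV[R]_d -> R[i]) :
  (forall u : 'rV[R]_d, exists g, smooth g /\ \forall v \near u, f v = g v) -> smooth f.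
Proof.
move=> H; apply/smoothP; split=> m; apply: rsm_local => u; have [g [/smoothP[g1 g2] E]] := H u.
  by exists (fun v => Re (g v)); split=> //; apply: filterS E => v ->.
by exists (fun v => Im (g v)); split=> //; apply: filterS E => v ->.
Qed.

End ComplexSmooth.

(* Simplification would otherwise unfold the quantification over lists of directions. *)
Local Opaque smooth.

(** * Complex integrals and periodic functions *)

Section Cint.
Variable R : realType.
Local Notation Re := (@complex.Re R).
Local Notation Im := (@complex.Im R).
Local Notation mu := (@lebesgue_measure R).
Variables (D : set R) (w : R -> R).
Hypothesis Hw : weight D w.

Definition cdominated d (B : R) (f : 'rV[R]_d -> R[i]) :=
  dominated w B (fun v => Re (f v)) /\ dominated w B (fun v => Im (f v)).

Lemma cdominated_lin d (a : R[i]) (f g : 'rV[R]_d -> R[i]) B1 B2 :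
  cdominated B1 f -> cdominated B2 g ->
  cdominated (2 * cabs a * B1 + B2) (fun v => a * f v + g v).
Proof.
move=> [f1 f2] [g1 g2].
have B10 : 0 <= B1 by case: f1.
split.
- have -> : (fun v => Re (a * f v + g v)) =
     (fun v => Re a * Re (f v) + (- Im a * Im (f v) + Re (g v))).
    by apply/funext => v; rewrite Re_add Re_mul; ring.
  apply: (dominated_le Hw _ (dominated_add (Re a) f1 (dominated_add (- Im a) f2 g1))).
  rewrite addrA lerD2r normrN -mulrDl ler_wpM2r// mulr2n mulrDl mul1r lerD//.
    exact: Re_le_cabs.
  exact: Im_le_cabs.
- have -> : (fun v => Im (a * f v + g v)) =
     (fun v => Re a * Im (f v) + (Im a * Re (f v) + Im (g v))).
    by apply/funext => v; rewrite Im_add Im_mul; ring.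
  apply: (dominated_le Hw _ (dominated_add (Re a) f2 (dominated_add (Im a) f1 g2))).
  rewrite addrA lerD2r -mulrDl ler_wpM2r// mulr2n mulrDl mul1r lerD//.
    exact: Re_le_cabs.
  exact: Im_le_cabs.
Qed.

Lemma cint_lin d (a : R[i]) (f g : 'rV[R]_d -> R[i]) B1 B2 :
  cdominated B1 f -> cdominated B2 g ->
  cint D (fun v => a * f v + g v) = a * cint D f + cint D g.
Proof.
move=> [f1 f2] [g1 g2].
have [_ _ L] := rint_main Hw d.
apply: complex_eqP; rewrite /cint.
- rewrite Re_add Re_mul /=.
  have -> : (fun v => Re (a * f v + g v)) =
     (fun v => Re a * Re (f v) + (- Im a * Im (f v) + Re (g v))).
    by apply/funext => v; rewrite Re_add Re_mul; ring.
  rewrite (L _ _ _ _ _ f1 (dominated_add (- Im a) f2 g1)) (L _ _ _ _ _ f2 g1); ring.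
- rewrite Im_add Im_mul /=.
  have -> : (fun v => Im (a * f v + g v)) =
     (fun v => Re a * Im (f v) + (Im a * Re (f v) + Im (g v))).
    by apply/funext => v; rewrite Im_add Im_mul; ring.
  rewrite (L _ _ _ _ _ f2 (dominated_add (Im a) f1 g2)) (L _ _ _ _ _ f1 g2); ring.
Qed.

Lemma cdominated0 d : @cdominated d 0 (fun=> 0).
Proof.
by split; split=> //=; try exact: cst_continuous; move=> v; rewrite normr0 mul0r.
Qed.

Lemma cint0 d : cint D (fun _ : 'rV[R]_d => 0) = 0.
Proof.
have := cint_lin 1 (cdominated0 d) (cdominated0 d).
have -> : (fun v : 'rV[R]_d => 1 * 0 + 0 : R[i]) = fun=> 0.
  by apply/funext => v; rewrite mulr0 addr0.
by rewrite mul1r => E; apply: (addIr (cint D (fun _ : 'rV[R]_d => 0))); rewrite add0r -E.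
Qed.

Lemma cintZ d (a : R[i]) (f : 'rV[R]_d -> R[i]) B : cdominated B f ->
  cint D (fun v => a * f v) = a * cint D f.
Proof.
move=> Hf; have := cint_lin a Hf (cdominated0 d).
rewrite cint0 addr0 => <-; congr cint; apply/funext => v; by rewrite addr0.
Qed.

Lemma cintD d (f g : 'rV[R]_d -> R[i]) B1 B2 : cdominated B1 f -> cdominated B2 g ->
  cint D (fun v => f v + g v) = cint D f + cint D g.
Proof.
move=> Hf Hg; have := cint_lin 1 Hf Hg; rewrite mul1r => <-.
by congr cint; apply/funext => v; rewrite mul1r.
Qed.

Lemma cdominated_sum d (I : Type) (r : seq I) (F : I -> 'rV[R]_d -> R[i]) :
  (forall i, exists B, cdominated B (F i)) ->
  exists B, cdominated B (fun v => \sum_(i <- r) F i v).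
Proof.
move=> H; elim: r => [|i r [B HB]].
  by exists 0; under eq_fun do rewrite big_nil; exact: cdominated0.
have [Bi Hi] := H i; eexists.
have -> : (fun v => \sum_(j <- i :: r) F j v) = (fun v => 1 * F i v + \sum_(j <- r) F j v).
  by apply/funext => v; rewrite big_cons mul1r.
exact: (cdominated_lin 1 Hi HB).
Qed.

Lemma cint_sum d (I : Type) (r : seq I) (F : I -> 'rV[R]_d -> R[i]) :
  (forall i, exists B, cdominated B (F i)) ->
  cint D (fun v => \sum_(i <- r) F i v) = \sum_(i <- r) cint D (F i).
Proof.
move=> H; elim: r => [|i r IH].
  by rewrite big_nil; under eq_fun do rewrite big_nil; exact: cint0.
have [Bi Hi] := H i; have [B HB] := cdominated_sum r H.
rewrite big_cons -IH -(cintD Hi HB).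
by congr cint; apply/funext => v; rewrite big_cons.
Qed.

Lemma cint_bound d (f : 'rV[R]_d -> R[i]) B : cdominated B f ->
  cabs (cint D f) <= 2 * (B * (\int[mu]_(t in D) w t) ^+ d).
Proof.
move=> [f1 f2]; have [L _ _] := rint_main Hw d.
apply: le_trans (cabs_le _) _; rewrite mulr2n mulrDl mul1r lerD//.
  exact: L.
exact: L.
Qed.

Lemma cint_cvg d (fs : nat -> 'rV[R]_d -> R[i]) f B :
  (forall n, cdominated B (fs n)) -> cdominated B f ->
  (forall v, ccvg (fs^~ v) (f v)) -> ccvg (fun n => cint D (fs n)) (cint D f).
Proof.
move=> Hfs [f1 f2] Hc; have [_ L _] := rint_main Hw d.
split; rewrite /cint /=.
- by apply: (L (fun n v => Re (fs n v)) _ B) => // [n|v]; [have [] := Hfs n|have [] := Hc v].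
- by apply: (L (fun n v => Im (fs n v)) _ B) => // [n|v]; [have [] := Hfs n|have [] := Hc v].
Qed.

Lemma cintS d (f : 'rV[R]_d.+1 -> R[i]) :
  cint D f = (\int[mu]_(t in D) Re (cint D (fun v => f (rcons0 t v)))) +i*
             (\int[mu]_(t in D) Im (cint D (fun v => f (rcons0 t v)))).
Proof. by []. Qed.

End Cint.

Section Unit.
Variable R : realType.
Local Notation Re := (@complex.Re R).
Local Notation Im := (@complex.Im R).
Local Notation mu := (@lebesgue_measure R).
Local Notation I01 := (`[0, 1]%classic : set R).
Local Notation w1 := (fun _ : R => (1:R)).

Definition cbounded d B (f : 'rV[R]_d -> R[i]) :=
  [/\ continuous (fun v => Re (f v)), continuous (fun v => Im (f v)) & forall v, cabs (f v) <= B].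

Lemma dominated1 d B (h : 'rV[R]_d -> R) : continuous h -> 0 <= B ->
  (forall v, `|h v| <= B) -> dominated w1 B h.
Proof. by move=> c B0 H; split=> // v; rewrite big1 ?mulr1. Qed.

Lemma cboundedP d B (f : 'rV[R]_d -> R[i]) : cbounded B f -> cdominated w1 B f.
Proof.
move=> [c1 c2 H].
have B0 : 0 <= B by apply: le_trans (H 0); exact: cabs_ge0.
split; apply: dominated1 => // v; apply: le_trans (H v).
  exact: Re_le_cabs.
exact: Im_le_cabs.
Qed.

Lemma cbounded_cst d (c : R[i]) : cbounded (cabs c) (fun _ : 'rV[R]_d => c).
Proof. by split=> //; exact: cst_continuous. Qed.

Lemma cboundedM d B1 B2 (f g : 'rV[R]_d -> R[i]) : cbounded B1 f -> cbounded B2 g ->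
  cbounded (B1 * B2) (fun v => f v * g v).
Proof.
move=> [f1 f2 Hf] [g1 g2 Hg]; split.
- by under eq_fun do rewrite Re_mul; apply: cont_sub; exact: cont_mul.
- by under eq_fun do rewrite Im_mul; apply: cont_add; exact: cont_mul.
- by move=> v; rewrite cabsM ler_pM ?cabs_ge0.
Qed.

Lemma cint1_bound d B (f : 'rV[R]_d -> R[i]) : cbounded B f -> cabs (cint I01 f) <= 2 * B.
Proof.
move=> /cboundedP/(cint_bound (weight01 R)).
by rewrite weight01_mass expr1n mulr1.
Qed.

(** Differentiation under the integral: by the mean value theorem the difference
    quotients are bounded by B', so they converge to H' inside the integral. *)
Lemma is_derive_rint01 d (H H' : R -> 'rV[R]_d -> R) B B' t :
  (forall s, continuous (H s)) -> (forall s, continuous (H' s)) ->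
  (forall s v, is_derive s (1:R) (H^~ v) (H' s v)) ->
  (forall s v, `|H s v| <= B) -> (forall s v, `|H' s v| <= B') ->
  is_derive t (1:R) (fun s => rint I01 (H s)) (rint I01 (H' t)).
Proof.
move=> cH cH' dH bH bH'.
have B0 : 0 <= B by apply: le_trans (bH t 0).
have B'0 : 0 <= B' by apply: le_trans (bH' t 0).
have [L0 L1 L2] := rint_main (weight01 R) d.
(* the difference quotient, continued by the derivative at h = 0 *)
pose Q (h : R) v := if h == 0 then H' t v else h^-1 * (H (h + t) v - H t v).
have QH h : dominated w1 B' (Q h).
  apply: dominated1 => //; rewrite /Q; case: eqP => [_|/eqP h0]; first exact: cH'.
  - by apply: cont_mul; [exact: cont_cst|apply: cont_sub; exact: cH].
  - by move=> v; exact: bH'.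
  - move=> v; have cl : continuous (H^~ v).
      by move=> s; apply/differentiable_continuous/derivable1_diffP; have [] := dH s v.
    have [c _ E] : exists2 c, true & H (h + t) v - H t v = H' c v * h.
      case: (ltgtP h 0) => [hn|hp|h00]; last by rewrite h00 eqxx in h0.
        have ht : h + t < t by rewrite gtrDr.
        have [c _ E] := MVT ht (fun x _ => dH x v) (continuous_subspaceT cl).
        by exists c => //; rewrite -opprB E opprD addrCA subrr addr0 mulrN opprK.
      have ht : t < h + t by rewrite ltrDr.
      have [c _ E] := MVT ht (fun x _ => dH x v) (continuous_subspaceT cl).
      by exists c => //; rewrite E addrK.
    by rewrite E mulrCA mulVf// mulr1.
have cQ : {for 0, continuous (fun h => rint I01 (Q h))}.
  apply: seq_continuous_at => u cu; apply: (L1 _ _ B') => // v.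
  have : {for 0, continuous (Q^~ v)}.
    apply/continuous_withinNx; rewrite {2}/Q eqxx.
    have := dH t v; case=> dd <-; rewrite /derive.
    have E : {near 0^', (fun h => h^-1 *: ((H^~ v \o shift t) (h *: 1) - H t v)) =1 Q^~ v}.
      near=> h; rewrite /Q ifN; last by near: h; exact: nbhs_dnbhs_neq.
      by rewrite /= [h *: _]mulr1.
    apply: cvg_trans (near_eq_cvg E) _; exact: dd.
  by move/(cvg_comp_cont cu).
have Qd h : h != 0 -> rint I01 (Q h) = h^-1 *: ((fun s => rint I01 (H s)) (h + t) - rint I01 (H t)).
  move=> h0.
  have dHs s : dominated w1 B (H s) by exact: dominated1.
  have -> : Q h = (fun v => h^-1 * H (h + t) v + (- h^-1 * H t v + 0)).
    by apply/funext => v; rewrite /Q (negbTE h0); ring.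
  have d0 : dominated w1 0 (fun _ : 'rV[R]_d => 0 : R).
    by apply: dominated1 => //; [exact: cst_continuous|move=> v; rewrite normr0].
  rewrite (L2 _ _ _ _ _ (dHs _) (dominated_add _ (dHs _) d0)) (L2 _ _ _ _ _ (dHs _) d0).
  have -> : rint I01 (fun _ : 'rV[R]_d => 0 : R) = 0.
    by have := L0 _ _ d0; rewrite mul0r normr_le0 => /eqP.
  by rewrite /GRing.scale /=; ring.
have E : {near 0^', (fun h => rint I01 (Q h)) =1
    (fun h => h^-1 *: (((fun s => rint I01 (H s)) \o shift t) (h *: (1:R)) - rint I01 (H t)))}.
  near=> h; rewrite /= [h *: 1]mulr1; apply: Qd.
  by near: h; exact: nbhs_dnbhs_neq.
have lim0 : rint I01 (Q h) @[h --> 0^'] --> rint I01 (H' t).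
  have := cQ; move/continuous_withinNx; rewrite (_ : Q 0 = H' t) //.
  by apply/funext => v; rewrite /Q eqxx.
have lim1 : h^-1 *: (((fun s => rint I01 (H s)) \o shift t) (h *: (1:R)) - rint I01 (H t)) @[h --> 0^']
    --> rint I01 (H' t).
  by apply: cvg_trans lim0; apply: near_eq_cvg; apply: filterS E => h.
apply: DeriveDef; first by apply: cvgP lim1.
exact: cvg_lim lim1.
Unshelve. all: by end_near.
Qed.

Definition periodic_fun (T : Type) d (f : 'rV[R]_d -> T) :=
  forall (l : 'rV[int]_d) u, f (u + map_mx intr l) = f u.

Lemma int_shift_unit d (u : 'rV[R]_d) : exists l : 'rV[int]_d, `|u + map_mx intr l| <= 1.
Proof.
exists (\row_i - Num.floor (u 0 i)); apply: mx_norm_ler => // i.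
rewrite !mxE rmorphN /= ger0_norm ?subr_ge0 ?floor_le_tmp ?ge_floor//.
by rewrite lerBlDr addrC -[1]/(1%:~R : R) -intrD ltW// lt_succ_floor.
Qed.

Lemma periodic_bounded d (h : 'rV[R]_d -> R) : continuous h -> periodic_fun h ->
  exists2 B, 0 <= B & forall v, `|h v| <= B.
Proof.
move=> ch ph; have [B B0 HB] := bounded_on_ball 1 ch.
exists B => // v; have [l Hl] := int_shift_unit v.
by rewrite -(ph l); exact: HB.
Qed.

Lemma periodic_fun_D d (h : 'rV[R]_d -> R) j : periodic_fun h ->
  periodic_fun (fun u => 'D_(edir R j) h u).
Proof.
move=> ph l u; rewrite /derive.
have -> : (fun r : R => r^-1 *: ((h \o shift (u + map_mx intr l)) (r *: edir R j) - h (u + map_mx intr l)))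
   = (fun r : R => r^-1 *: ((h \o shift u) (r *: edir R j) - h u)).
  by apply/funext => r /=; rewrite addrA !ph.
by [].
Qed.

Lemma rcons0_shift d t (v : 'rV[R]_d) (l : 'rV[int]_d) :
  rcons0 t (v + map_mx intr l) = rcons0 t v + map_mx intr (row_mx (0 : 'rV[int]_1) l : 'rV_d.+1).
Proof.
rewrite /rcons0.
have -> : map_mx intr (row_mx (0 : 'rV[int]_1) l : 'rV[int]_d.+1) =
   (row_mx (0 : 'rV[R]_1) (map_mx intr l) : 'rV_d.+1).
  by have := @map_row_mx _ _ (intr : int -> R) 1 1 d 0 l; rewrite map_mx0.
by have := @add_row_mx _ 1 1 d (t%:M) v 0 (map_mx intr l); rewrite addr0 => <-.
Qed.

Lemma periodic_fun_slice (T : Type) d (h : 'rV[R]_d.+1 -> T) t : periodic_fun h ->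
  periodic_fun (fun v => h (rcons0 t v)).
Proof. by move=> ph l v; rewrite rcons0_shift ph. Qed.

Lemma rsmooth_slice d (h : 'rV[R]_d.+1 -> R) t : rsmooth h ->
  rsmooth (fun v => h (rcons0 t v)).
Proof.
move=> sh; apply: (rsmooth_map sh); first exact: cont_rcons0.
move=> j; right; exists (fun=> 1), (lift ord0 j); split; first exact: rsmooth_cst.
by move=> u s; rewrite rcons0_line mulr1.
Qed.

Lemma rcons0_line0 d (t s : R) (v : 'rV[R]_d) : rcons0 (t + s) v = rcons0 t v + s *: edir R ord0.
Proof.
apply/rowP => i; case: (unliftP ord0 i) => [l ->|->].
  by rewrite rcons0S [RHS]mxE rcons0S !mxE /= mulr0 addr0.
by rewrite rcons00 [RHS]mxE rcons00 !mxE /= mulr1.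
Qed.

Lemma is_derive_slice0 d (h : 'rV[R]_d.+1 -> R) t v : rsmooth h ->
  is_derive t (1:R) (fun s => h (rcons0 s v)) ('D_(edir R ord0) h (rcons0 t v)).
Proof.
move=> sh.
have E : (fun s => h (rcons0 s v)) = (fun s => h (rcons0 0 v + s *: edir R ord0)).
  by apply/funext => s; rewrite -rcons0_line0 add0r.
have H : is_derive (rcons0 0 v + t *: edir R ord0) (edir R ord0) h ('D_(edir R ord0) h (rcons0 t v)).
  by rewrite -rcons0_line0 add0r; exact: rsmooth_is_derive.
by rewrite E; apply/is_derive_line.
Qed.

Lemma int01_derive (F f : R -> R) : continuous f -> (forall t, is_derive t (1:R) F (f t)) ->
  \int[mu]_(t in I01) f t = F 1 - F 0.
Proof.
move=> cf dF.
have cF : continuous F.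
  by move=> t; apply/differentiable_continuous/derivable1_diffP; have [] := dF t.
rewrite /Rintegral (@continuous_FTC2 _ f F 0 1)//.
- exact: continuous_subspaceT.
- split=> [t _||].
  + by have [] := dF t.
  + exact: cvg_at_right_filter (cF 0).
  + exact: cvg_at_left_filter (cF 1).
- by move=> t _; rewrite derive1E; have [] := dF t.
Qed.

(** For the first variable this is the fundamental theorem of calculus together
    with h(1, v) = h(0, v); the other variables are reached by induction. *)
Lemma rint01_D_periodic d (h : 'rV[R]_d -> R) j : rsmooth h -> periodic_fun h ->
  rint I01 (fun u => 'D_(edir R j) h u) = 0.
Proof.
elim: d h j => [|d IH] h j sh ph; first by case: j.
rewrite rintS; case: (unliftP ord0 j) => [i ->|->].
  have E t : rint I01 (fun v => 'D_(edir R (lift ord0 i)) h (rcons0 t v)) = 0.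
    rewrite -[RHS](IH (fun v => h (rcons0 t v)) i).
    - congr rint; apply/funext => v.
      have : is_derive v (edir R i) (fun v => h (rcons0 t v)) ('D_(edir R (lift ord0 i)) h (rcons0 t v)).
        apply/is_derive_line0; under eq_fun do rewrite rcons0_line.
        by apply/is_derive_line0; exact: rsmooth_is_derive.
      by case.
    - exact: rsmooth_slice.
    - exact: periodic_fun_slice.
  under eq_Rintegral do rewrite E.
  by rewrite Rintegral_cst ?mul0r//; exact: measurable_itv.
have [B _ bh] := periodic_bounded (rsmooth_cont sh) ph.
have [B' B'0 bh'] := periodic_bounded (rsmooth_cont (rsmooth_D ord0 sh)) (periodic_fun_D ord0 ph).
have dG t : is_derive t (1:R) (fun t => rint I01 (fun v => h (rcons0 t v)))
    (rint I01 (fun v => 'D_(edir R ord0) h (rcons0 t v))).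
  apply: (@is_derive_rint01 d (fun t v => h (rcons0 t v)) (fun t v => 'D_(edir R ord0) h (rcons0 t v)) B B').
  - by move=> s; exact: rsmooth_cont (rsmooth_slice s sh).
  - by move=> s; exact: rsmooth_cont (rsmooth_slice s (rsmooth_D ord0 sh)).
  - by move=> s v; exact: is_derive_slice0.
  - by move=> s v; exact: bh.
  - by move=> s v; exact: bh'.
rewrite (int01_derive _ dG).
  apply/eqP; rewrite subr_eq0; apply/eqP; congr rint; apply/funext => v.
  have -> : rcons0 1 v = rcons0 0 v + map_mx intr (row_mx (1%:M : 'rV[int]_1) 0 : 'rV_d.+1).
    apply/rowP => i; case: (unliftP ord0 i) => [l ->|->].
      rewrite rcons0S [RHS]mxE rcons0S mxE.
      have -> : lift ord0 l = rshift 1 l by apply/val_inj.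
      by rewrite (row_mxEr (1%:M : 'rV[int]_1) 0) mxE addr0.
    rewrite rcons00 [RHS]mxE rcons00 mxE.
    have -> : ord0 = lshift d (ord0 : 'I_1) by apply/val_inj.
    by rewrite (row_mxEl (1%:M : 'rV[int]_1) 0) mxE /= add0r.
  exact: ph.
move=> t; apply: seq_continuous_at => u cu.
have [_ L _] := rint_main (weight01 R) d.
apply: (L (fun n v => 'D_(edir R ord0) h (rcons0 (u n) v)) _ B').
- move=> n; apply: dominated1 => //.
  exact: rsmooth_cont (rsmooth_slice (u n) (rsmooth_D ord0 sh)).
- apply: dominated1 => //; exact: rsmooth_cont (rsmooth_slice t (rsmooth_D ord0 sh)).
- move=> v; apply: (@cvg_comp_cont _ _ _ _ (fun n => rcons0 (u n) v) (fun u => 'D_(edir R ord0) h u) (rcons0 t v)).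
    by apply: cvg_rcons0 => //; exact: cvg_cst.
  exact: (rsmooth_cont (rsmooth_D ord0 sh)).
Qed.

End Unit.

(** * Fourier series in one variable *)

Section IntBox.

Definition zseg (M : nat) : seq int := [seq (i%:Z - M%:Z)%R | i <- iota 0 M.*2.+1].

Lemma zsegS M : zseg M.+1 = - M.+1%:Z :: rcons (zseg M) M.+1%:Z.
Proof.
have E k : iota 0 k.+2 = 0%N :: rcons (map S (iota 0 k)) k.+1.
  have -> : map S (iota 0 k) = iota 1 k by rewrite (iotaDl 1 0 k).
  have F : iota 1 k.+1 = iota 1 k ++ [:: k.+1] by have := iotaD 1 k 1; rewrite addn1.
  by rewrite -cats1 -F.
rewrite /zseg doubleS E map_cons map_rcons -map_comp sub0r; congr (_ :: rcons _ _); last by lia.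
by apply: eq_map => i /=; lia.
Qed.

Lemma zseg_sum (V : nmodType) (M : nat) (F : int -> V) :
  \sum_(p <- zseg M) F p = F 0 + \sum_(m < M) (F m.+1%:Z + F (- m.+1%:Z)).
Proof.
elim: M => [|M IH]; first by rewrite big_ord0 addr0 /zseg /= big_seq1.
by rewrite zsegS big_cons -cats1 big_cat big_seq1 IH big_ord_recr /= addrC -!addrA.
Qed.

Lemma mem_zseg M (p : int) : (p \in zseg M) = (`|p|%N <= M)%N.
Proof.
apply/mapP/idP => [ [j] | H].
  by rewrite mem_iota => /andP[_ Hj] ->; lia.
by exists (absz (p + M%:Z)); rewrite ?mem_iota; lia.
Qed.

Lemma uniq_zseg M : uniq (zseg M).
Proof. by rewrite map_inj_uniq ?iota_uniq// => i j; lia. Qed.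

End IntBox.

Section Dirichlet.
Variable R : realType.
Local Notation mu := (@lebesgue_measure R).
Local Notation I01 := (`[0, 1]%classic : set R).

(** The slope of the chord is at least 1/2 near 0 and the sine increases up to
    pi / 2; the constant 1/8 is not sharp. *)
Lemma sin_lower (x : R) : 0 <= x <= pi / 2 -> x / 8 <= sin x.
Proof.
move=> /andP[x0 x1].
have cosl (t : R) : 0 <= t -> 1 - t <= cos t.
  rewrite le_eqVlt => /orP[/eqP <-|t0]; first by rewrite cos0 subr0.
  have [c _ E] := MVT t0 (fun y _ => is_derive_cos y) (continuous_subspaceT (@continuous_cos R)).
  move: E; rewrite cos0 subr0 => E; rewrite lerBlDr -lerBlDl -opprB E mulNr opprK.
  by rewrite -[leRHS]mul1r ler_pM2r// sin_le1.
have small (t : R) : 0 <= t <= 1 / 2 -> t / 2 <= sin t.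
  move=> /andP[]; rewrite le_eqVlt => /orP[/eqP <- _|t0 t1]; first by rewrite sin0 mul0r.
  have [c + E] := MVT t0 (fun y _ => is_derive_sin y) (continuous_subspaceT (@continuous_sin R)).
  rewrite in_itv /= => /andP[c0 ct].
  move: E; rewrite sin0 !subr0 => ->; rewrite mulrC ler_pM2r//.
  by apply: le_trans (cosl c (ltW c0)); lra.
have [xs|xl] := leP x (1/2).
  by apply: le_trans (small x _); [lra|rewrite x0].
have [c + E] := MVT xl (fun y _ => is_derive_sin y) (continuous_subspaceT (@continuous_sin R)).
rewrite in_itv /= => /andP[c0 cx].
have cc : 0 <= cos c by apply: cos_ge0_pihalf; rewrite (le_trans (ltW cx) x1) andbT; lra.
have s1 := small (1/2) _.
have : 0 <= cos c * (x - 1/2) by rewrite mulr_ge0// subr_ge0 ltW.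
have pi4 := pihalf_lt2 R.
rewrite -E; have := s1 _; lra.
Qed.

Lemma is_derive_chain (h g : R -> R) (t a b c : R) :
  is_derive (g t) 1 h a -> is_derive t 1 g b -> c = a * b ->
  is_derive t 1 (fun s => h (g s)) c.
Proof. by move=> H1 H2 ->; exact: (is_derive1_comp H1 H2). Qed.

Lemma is_derive_scale (a t : R) : is_derive t (1:R) (fun s => a * s) a.
Proof.
have := is_deriveM (is_derive_cst a t (1:R)) (is_derive_id t (1:R)).
by move/is_derive_eq; apply; rewrite scaler0 addr0 /GRing.scale /= mulr1.
Qed.

Lemma is_derive_addl (a t : R) : is_derive t (1:R) (fun s => a + s) 1.
Proof.
have := is_deriveD (is_derive_cst a t (1:R)) (is_derive_id t (1:R)).
by move/is_derive_eq; apply; rewrite add0r.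
Qed.

(** Measurability rather than continuity, because the quotient used in
    [dirichlet_cvg0] may jump at the endpoints. *)
Definition bounded_meas (g : R -> R) := measurable_fun I01 g /\ exists C, forall t, I01 t -> `|g t| <= C.

Lemma bmeas_integrable g : bounded_meas g -> mu.-integrable I01 (EFin \o g).
Proof.
move=> [mg [C HC]].
have mI : measurable (I01 : set (measurableTypeR R)) by exact: measurable_itv.
have iC : mu.-integrable I01 (EFin \o (fun=> C)).
  apply: continuous_compact_integrable; first exact: segment_compact.
  by apply: continuous_subspaceT => x; exact: cvg_cst.
apply: le_integrable iC => //; first exact/measurable_EFinP.
by move=> t It; rewrite /= lee_fin; apply: le_trans (HC t It) (ler_norm _).
Qed.

Lemma bmeas_cont g : continuous g -> bounded_meas g.
Proof.
move=> cg; split; first by apply: measurable_funTS; exact: continuous_measurable_fun.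
have cI : compact (g @` I01).
  by apply: continuous_compact; [exact: continuous_subspaceT|exact: segment_compact].
have [M [_ HM]] := compact_bounded cI.
exists (`|M| + 1) => t It; apply: (HM (`|M| + 1)); last by exists t.
by rewrite ltr_pwDr// ler_norm.
Qed.

Lemma bmeas_cosM (a : R) : bounded_meas (fun t => cos (a * t)).
Proof.
apply: bmeas_cont => t; apply: continuous_comp; last exact: continuous_cos.
by apply: cvgM; [exact: cvg_cst|exact: cvg_id].
Qed.

Lemma bmeasM f g : bounded_meas f -> bounded_meas g -> bounded_meas (fun t => f t * g t).
Proof.
move=> [mf [C HC]] [mg [C' HC']]; split; first exact: measurable_funM.
by exists (C * C') => t It; rewrite normrM ler_pM// ?HC ?HC'.
Qed.

Lemma bmeasD f g : bounded_meas f -> bounded_meas g -> bounded_meas (fun t => f t + g t).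
Proof.
move=> [mf [C HC]] [mg [C' HC']]; split; first exact: measurable_funD.
by exists (C + C') => t It; apply: le_trans (ler_normD _ _) _; rewrite lerD ?HC ?HC'.
Qed.

Lemma bmeas_cst (c : R) : bounded_meas (fun=> c).
Proof. by apply: bmeas_cont; exact: cst_continuous. Qed.

Lemma bmeas_sum (I : Type) (r : seq I) (F : I -> R -> R) :
  (forall i, bounded_meas (F i)) -> bounded_meas (fun t => \sum_(i <- r) F i t).
Proof.
move=> H; elim: r => [|i r IH].
  have -> : (fun t => \sum_(i <- [::]) F i t) = fun=> 0 by apply/funext => t; rewrite big_nil.
  exact: bmeas_cst.
have -> : (fun t => \sum_(j <- i :: r) F j t) = fun t => F i t + \sum_(j <- r) F j t.
  by apply/funext => t; rewrite big_cons.
exact: bmeasD.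
Qed.

Let mI : measurable (I01 : set (measurableTypeR R)). Proof. exact: measurable_itv. Qed.

Lemma int_bD f g : bounded_meas f -> bounded_meas g ->
  \int[mu]_(t in I01) (f t + g t) = \int[mu]_(t in I01) f t + \int[mu]_(t in I01) g t.
Proof. by move=> bf bg; apply: RintegralD => //; exact: bmeas_integrable. Qed.

Lemma int_bZ c f : bounded_meas f ->
  \int[mu]_(t in I01) (c * f t) = c * \int[mu]_(t in I01) f t.
Proof. by move=> bf; apply: RintegralZl => //; exact: bmeas_integrable. Qed.

Lemma int_b_sum (I : Type) (r : seq I) (F : I -> R -> R) : (forall i, bounded_meas (F i)) ->
  \int[mu]_(t in I01) (\sum_(i <- r) F i t) = \sum_(i <- r) \int[mu]_(t in I01) F i t.
Proof.
move=> H; elim: r => [|i r IH].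
  rewrite big_nil; under eq_Rintegral do rewrite big_nil.
  by rewrite Rintegral_cst// mul0r.
rewrite big_cons -IH -int_bD//; last exact: bmeas_sum.
by apply: eq_Rintegral => t _; rewrite big_cons.
Qed.

(** Bessel's inequality makes the squares of the coefficients summable. *)
Lemma bessel_cvg0 (g : R -> R) (s : nat -> R -> R) (c : R) : 0 < c ->
  bounded_meas g -> (forall m, bounded_meas (s m)) ->
  (forall m p, \int[mu]_(t in I01) (s m t * s p t) = if m == p then c else 0) ->
  \int[mu]_(t in I01) (g t * s m t) @[m --> \oo] --> (0 : R).
Proof.
move=> c0 bg bs orth.
pose b m := \int[mu]_(t in I01) (g t * s m t).
have H m : \sum_(i < m) b i ^+ 2 <= c * \int[mu]_(t in I01) (g t * g t).
  pose S t := \sum_(i < m) (b i / c) * s i t.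
  have bS : bounded_meas S by apply: bmeas_sum => i; apply: bmeasM => //; exact: bmeas_cst.
  have : 0 <= \int[mu]_(t in I01) ((g t - S t) ^+ 2) by apply: Rintegral_ge0 => t _; exact: sqr_ge0.
  have bgg := bmeasM bg bg; have bgS := bmeasM bg bS; have bSS := bmeasM bS bS.
  have -> : \int[mu]_(t in I01) ((g t - S t) ^+ 2) =
     \int[mu]_(t in I01) (g t * g t) + ((-2) * \int[mu]_(t in I01) (g t * S t)
      + \int[mu]_(t in I01) (S t * S t)).
    rewrite -int_bZ// -int_bD//; last by apply: bmeasM => //; exact: bmeas_cst.
    rewrite -int_bD//; last by apply: bmeasD => //; apply: bmeasM => //; exact: bmeas_cst.
    by apply: eq_Rintegral => t _; ring.
  have E1 f : bounded_meas f -> \int[mu]_(t in I01) (f t * S t) =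
      \sum_(i < m) (b i / c) * \int[mu]_(t in I01) (f t * s i t).
    move=> bf.
    transitivity (\int[mu]_(t in I01) (\sum_(i < m) (b i / c) * (f t * s i t))).
      by apply: eq_Rintegral => t _; rewrite /S mulr_sumr; apply: eq_bigr => i _; rewrite mulrCA.
    rewrite int_b_sum; first by apply: eq_bigr => i _; rewrite int_bZ//; exact: bmeasM.
    by move=> i; apply: bmeasM; [exact: bmeas_cst|exact: bmeasM].
  have E2 (i : 'I_m) : \int[mu]_(t in I01) (S t * s i t) = b i.
    transitivity (\int[mu]_(t in I01) (s i t * S t)).
      by apply: eq_Rintegral => t _; rewrite mulrC.
    rewrite E1// (bigD1 i)//= orth eqxx divfK ?gt_eqF// big1 ?addr0// => j ji.
    by rewrite orth (_ : (i == j :> nat) = false) ?mulr0// eq_sym; apply/negbTE.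
  rewrite !E1// => Hpos.
  have E3 : \sum_(i < m) b i / c * \int[mu]_(t in I01) (S t * s i t) = (\sum_(i < m) b i ^+ 2) / c.
    by rewrite mulr_suml; apply: eq_bigr => i _; rewrite E2 mulrAC -expr2.
  have E4 : \sum_(i < m) b i / c * \int[mu]_(t in I01) (g t * s i t) = (\sum_(i < m) b i ^+ 2) / c.
    by rewrite mulr_suml; apply: eq_bigr => i _; rewrite -/(b i) mulrAC -expr2.
  move: Hpos; rewrite E3 E4 => Hpos.
  rewrite -ler_pdivrMl// mulrC; lra.
have ndS : nondecreasing_seq (fun m => \sum_(i < m) b i ^+ 2).
  by apply/nondecreasing_seqP => m; rewrite big_ord_recr /= lerDl sqr_ge0.
have cS : cvgn (series (fun i => b i ^+ 2)).
  rewrite /series /=.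
  have -> : (fun n => \sum_(0 <= k < n) b k ^+ 2) = (fun m => \sum_(i < m) b i ^+ 2).
    by apply/funext => m; rewrite big_mkord.
  apply: nondecreasing_is_cvgn => //.
  by exists (c * \int[mu]_(t in I01) (g t * g t)) => _ [m _ <-].
have := cvg_series_cvg_0 cS.
move=> /cvgrPdist_lt H2; apply/cvgrPdist_lt => e e0.
have := H2 (e ^+ 2) (exprn_gt0 2 e0); apply: filterS => m.
rewrite !sub0r !normrN normrX ltr_pXn2r// ?nnegrE ?ltW//.
Qed.

Definition C1_periodic (h h' : R -> R) := [/\ forall t, is_derive t (1:R) h (h' t),
  continuous h' & forall t, h (t + 1) = h t].

Lemma C1per_cont h h' : C1_periodic h h' -> continuous h.
Proof. by case=> H _ _ t; apply/differentiable_continuous/derivable1_diffP; have [] := H t. Qed.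

Lemma C1per_int h : (forall t, h (t + 1) = h t) -> forall (t : R) (m : int), h (t + m%:~R) = h t :> R.
Proof.
move=> p.
have N (m : nat) t : h (t + m%:R) = h t.
  by elim: m => [|m IH]; rewrite ?addr0// -natr1 addrA p.
move=> t [m|m]; first exact: N.
by rewrite NegzE rmorphN /= -(N m.+1) subrK.
Qed.

Lemma C1per_bounded (h : R -> R) : continuous h -> (forall t, h (t + 1) = h t) ->
  exists2 B, 0 <= B & forall t, `|h t : R| <= B.
Proof.
move=> ch p; have [_ [C HC]] := bmeas_cont ch.
have C0 : 0 <= C by apply: le_trans (HC 0 _) => //; rewrite /= in_itv /= lexx ler01.
exists C => // t; rewrite -(C1per_int p t (- Num.floor t)); apply: HC.
rewrite /= in_itv /= rmorphN /= subr_ge0 ge_floor//=.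
by rewrite lerBlDr addrC -[1]/(1%:~R : R) -intrD ltW// lt_succ_floor.
Qed.

Lemma C1per_deriv h h' : C1_periodic h h' -> forall t, h' (t + 1) = h' t.
Proof.
move=> [H c p] t.
have := H (t + 1); have := H t; case=> _ <- [] _ <-.
rewrite /derive.
have -> : (fun r : R => r^-1 *: ((h \o shift (t + 1)) (r *: 1) - h (t + 1)))
   = (fun r : R => r^-1 *: ((h \o shift t) (r *: (1:R)) - h t)).
  by apply/funext => r /=; rewrite addrA !p.
by [].
Qed.

(** The derivative in x of the left-hand side is the integral of h' over a period,
    which is 0. *)
Lemma int01_shift h h' x : C1_periodic h h' ->
  \int[mu]_(s in I01) h (x + s) = \int[mu]_(s in I01) h s.
Proof.
move=> Hh; have [dh ch' p] := Hh.
have [B _ HB] := C1per_bounded (C1per_cont Hh) p.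
have [B' _ HB'] := C1per_bounded ch' (C1per_deriv Hh).
pose G x := \int[mu]_(s in I01) h (x + s).
have cG y : continuous (fun s : R => y + s) by apply: cont_add; [exact: cont_cst|move=> s; exact: cvg_id].
have dG y : is_derive y (1:R) G (\int[mu]_(s in I01) h' (y + s)).
  have E f z : rint I01 (fun v : 'rV[R]_1 => f (z + v 0 0)) = \int[mu]_(s in I01) f (z + s).
    by rewrite rintS /=; apply: eq_Rintegral => s _; rewrite rcons00.
  rewrite -E; rewrite (_ : G = fun z => rint I01 (fun v : 'rV[R]_1 => h (z + v 0 0))); last first.
    by apply/funext => z; rewrite E.
  apply: (@is_derive_rint01 R 1 (fun y (v : 'rV[R]_1) => h (y + v 0 0)) (fun y (v : 'rV[R]_1) => h' (y + v 0 0)) B B').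
  - move=> s; apply: (cont_comp _ (C1per_cont Hh)); apply: cont_add; [exact: cont_cst|exact: cont_coord].
  - move=> s; apply: (cont_comp _ ch'); apply: cont_add; [exact: cont_cst|exact: cont_coord].
  - move=> s v.
    apply: (@is_derive_chain h (fun y => y + v 0 0) s _ _ _ (dh _)
      (is_deriveD (is_derive_id s (1:R)) (is_derive_cst (v 0 0) s (1:R)))).
    by rewrite addr0 mulr1.
  - by move=> s v.
  - by move=> s v.
have dG0 y : is_derive y (1:R) G 0.
  have c := cont_comp (cG y) ch'.
  have d t : is_derive t (1:R) (fun s => h (y + s)) (h' (y + t)).
    by apply: (is_derive_chain (dh _) (is_derive_addl y t)); rewrite mulr1.
  by have := dG y; rewrite (int01_derive c d) addr0 p subrr.
have -> : \int[mu]_(s in I01) h s = G 0 by rewrite /G; apply: eq_Rintegral => s _; rewrite add0r.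
exact: (@is_derive_0_is_cst R G x 0 dG0).
Qed.

Definition dirichlet (M : nat) (t : R) : R := \sum_(p <- zseg M) cos (2 * pi * p%:~R * t).

Lemma dirichletE M t : dirichlet M t = 1 + \sum_(m < M) 2 * cos (2 * pi * m.+1%:R * t).
Proof.
rewrite /dirichlet zseg_sum mulr0 mul0r cos0; congr (_ + _); apply: eq_bigr => m _.
rewrite rmorphN /= mulrN mulNr cosN (_ : m.+1%:~R = m.+1%:R :> R)//; ring.
Qed.

(** Multiplying by sin (pi t) makes the sum telescope. *)
Lemma dirichlet_sin M t : dirichlet M t * sin (pi * t) = sin ((2 * M%:R + 1) * pi * t).
Proof.
rewrite dirichletE; elim: M => [|M IH].
  by rewrite big_ord0 addr0 mul1r mulr0 add0r mul1r.
rewrite big_ord_recr /= addrA mulrDl IH.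
set a := (2 * M%:R + 1) * pi * t.
have -> : 2 * pi * M.+1%:R * t = a + pi * t by rewrite /a -natr1; ring.
have -> : (2 * M.+1%:R + 1) * pi * t = a + pi * t + pi * t by rewrite /a -natr1; ring.
rewrite [in RHS]sinD !sinD !cosD.
have := cos2Dsin2 (pi * t); set c := cos (pi * t); set d := sin (pi * t) => E.
have : sin a * (c ^+ 2 + d ^+ 2) = sin a by rewrite E mulr1.
by move=> Ea; rewrite -[X in X + _ = _]Ea; ring.
Qed.

Lemma int01_sincos (k : int) : k != 0 ->
  \int[mu]_(t in I01) cos (2 * pi * k%:~R * t) = 0.
Proof.
move=> k0; set a := 2 * pi * k%:~R.
have a0 : a != 0 by rewrite /a !mulf_neq0// ?intr_eq0// ?gt_eqF// pi_gt0.
have ca : continuous (fun t : R => cos (a * t)).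
  move=> t; apply: continuous_comp; last exact: continuous_cos.
  by apply: cvgM; [exact: cvg_cst|exact: cvg_id].
have d t : is_derive t (1:R) (fun t => a^-1 * sin (a * t)) (cos (a * t)).
  have ds := is_derive_chain (is_derive_sin _) (is_derive_scale a t) erefl.
  apply: (is_derive_chain (is_derive_scale a^-1 _) ds).
  by rewrite mulrCA mulVf// mulr1.
rewrite (int01_derive ca d).
have S : sin (a * 1) = 0.
  by have := congr1 (@complex.Im R) (expi2piz R k); rewrite /expi /= mulr1.
by rewrite S mulr0 mulr0 sin0 mulr0 subrr.
Qed.

Lemma sin_odd_orth (m p : nat) :
  \int[mu]_(t in I01) (sin ((2 * m%:R + 1) * pi * t) * sin ((2 * p%:R + 1) * pi * t)) =
  if m == p then 1 / 2 else 0.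
Proof.
have E (t : R) : sin ((2 * m%:R + 1) * pi * t) * sin ((2 * p%:R + 1) * pi * t) =
   2^-1 * cos (2 * pi * (m%:Z - p%:Z)%:~R * t) + (- 2^-1) * cos (2 * pi * (m%:Z + p%:Z + 1)%:~R * t).
  set A := (2 * m%:R + 1) * pi * t; set B := (2 * p%:R + 1) * pi * t.
  have -> : 2 * pi * (m%:Z - p%:Z)%:~R * t = A - B.
    by rewrite /A /B rmorphB /= !pmulrn; ring.
  have -> : 2 * pi * (m%:Z + p%:Z + 1)%:~R * t = A + B.
    by rewrite /A /B !rmorphD /= !pmulrn; ring.
  by rewrite !cosD sinN cosN; field.
have bc := bmeas_cosM.
under eq_Rintegral do rewrite E.
rewrite int_bD; [|by apply: bmeasM => //; exact: bmeas_cst..].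
rewrite !int_bZ//.
rewrite (@int01_sincos (m%:Z + p%:Z + 1)); last by lia.
rewrite mulr0 addr0; case: eqP => [->|/eqP mp].
  rewrite subrr; under eq_Rintegral do rewrite mulr0 mul0r cos0.
  by rewrite weight01_mass mulr1 div1r.
by rewrite int01_sincos ?mulr0//; lia.
Qed.

Lemma bmeas_dirichlet M : bounded_meas (dirichlet M).
Proof. by apply: bmeas_sum => p; exact: bmeas_cosM. Qed.

Lemma int_dirichlet M : \int[mu]_(t in I01) dirichlet M t = 1.
Proof.
have bc := bmeas_cosM.
rewrite /dirichlet int_b_sum// zseg_sum big1 ?addr0.
  by under eq_Rintegral do rewrite mulr0 mul0r cos0; rewrite weight01_mass.
by move=> m _; rewrite !int01_sincos ?addr0//; lia.
Qed.

(** With g(t) = (psi(t) - psi(0)) / sin (pi t), which is bounded because psi is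
    Lipschitz and periodic, the error is the integral of g(t) sin ((2M+1) pi t): a
    coefficient of g for an orthogonal family, so Bessel's inequality applies. *)
Lemma dirichlet_cvg0 (psi psi' : R -> R) : C1_periodic psi psi' ->
  \int[mu]_(t in I01) (psi t * dirichlet M t) @[M --> \oo] --> psi 0.
Proof.
move=> Hp; have [dp cp' pp] := Hp; have cp := C1per_cont Hp.
have [L L0 HL] := C1per_bounded cp' (C1per_deriv Hp).
pose g t := (psi t - psi 0) / sin (pi * t).
have p1 : psi 1 = psi 0 by rewrite -(pp 0) add0r.
have sgt (t : R) : 0 < t < 1 -> 0 < sin (pi * t).
  move=> /andP[t0 t1]; apply: sin_gt0_pi; rewrite mulr_gt0 ?pi_gt0//=.
  by rewrite -[ltRHS]mulr1 ltr_pM2l ?pi_gt0.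
have lip (a b : R) : a < b -> `|psi b - psi a| <= L * (b - a).
  move=> ab; have [c _ ->] := MVT ab (fun y _ => dp y) (continuous_subspaceT cp).
  have ab0 : 0 <= b - a by rewrite subr_ge0 ltW.
  by rewrite normrM (ger0_norm ab0) ler_wpM2r.
have pi1 : 1 <= (pi : R) by have := @pi_ge2 R; lra.
have bg : bounded_meas g.
  split.
    apply: measurable_funM.
      apply: measurable_funB; last exact: measurable_cst.
      by apply: measurable_funTS; exact: continuous_measurable_fun.
    apply: (@measurable_fun_itv_cc _ 0 1 false true).
    apply: open_continuous_measurable_fun; first exact: interval_open.
    move=> t; rewrite inE /= in_itv /= => /sgt st; apply: cvgV; first by rewrite gt_eqF.
    apply: continuous_comp; last exact: continuous_sin.
    by apply: cvgM; [exact: cvg_cst|exact: cvg_id].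
  exists (8 * L) => t; rewrite /= in_itv /= => /andP[].
  rewrite le_eqVlt => /orP[/eqP <- _|t0]; first by rewrite /g subrr mul0r normr0 mulr_ge0.
  rewrite le_eqVlt => /orP[/eqP ->|t1]; first by rewrite /g p1 subrr mul0r normr0 mulr_ge0.
  have st : 0 < sin (pi * t) by apply: sgt; rewrite t0.
  rewrite /g normrM normfV [`|sin _|]gtr0_norm// ler_pdivrMr//.
  have [th|th] := leP t (1/2).
    apply: le_trans (lip 0 t t0) _; rewrite subr0 [8 * L]mulrC -mulrA ler_wpM2l//.
    have := @sin_lower (pi * t); rewrite mulr_ge0 ?pi_ge0 ?(ltW t0)//= => /(_ _)H.
    have {}H : pi * t / 8 <= sin (pi * t) by apply: H; rewrite ler_pM2l ?pi_gt0//; lra.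
    have : t <= pi * t by rewrite -[leLHS]mul1r ler_pM2r.
    lra.
  have e1 : sin (pi * t) = sin (pi * (1 - t)).
    by rewrite mulrBr mulr1 sinB sinpi cospi mul0r sub0r mulN1r opprK.
  rewrite e1 -p1 distrC; apply: le_trans (lip t 1 t1) _; rewrite [8 * L]mulrC -mulrA ler_wpM2l//.
  have t1' : 0 < 1 - t by rewrite subr_gt0.
  have := @sin_lower (pi * (1 - t)); rewrite mulr_ge0 ?pi_ge0 ?(ltW t1')//= => /(_ _)H.
  have {}H : pi * (1 - t) / 8 <= sin (pi * (1 - t)) by apply: H; rewrite ler_pM2l ?pi_gt0//; lra.
  have : 1 - t <= pi * (1 - t) by rewrite -[leLHS]mul1r ler_pM2r.
  lra.
pose s (m : nat) (t : R) := sin ((2 * m%:R + 1) * pi * t).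
have bs m : bounded_meas (s m).
  apply: bmeas_cont => t; apply: continuous_comp; last exact: continuous_sin.
  by apply: cvgM; [exact: cvg_cst|exact: cvg_id].
have c0 : 0 < 1 / 2 :> R by lra.
have K := bessel_cvg0 c0 bg bs (@sin_odd_orth).
have E M : \int[mu]_(t in I01) (psi t * dirichlet M t) =
    psi 0 + \int[mu]_(t in I01) (g t * s M t).
  have bd := bmeas_dirichlet M; have bp := bmeas_cont cp.
  have -> : \int[mu]_(t in I01) (g t * s M t) =
     \int[mu]_(t in I01) (psi t * dirichlet M t + (- psi 0) * dirichlet M t).
    apply: eq_Rintegral => t; rewrite inE /= in_itv /= => /andP[].
    rewrite -mulrDl /s -dirichlet_sin /g.
    rewrite le_eqVlt => /orP[/eqP <- _|t0]; first by rewrite subrr !mul0r.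
    rewrite le_eqVlt => /orP[/eqP ->|t1]; first by rewrite p1 subrr !mul0r.
    have st : sin (pi * t) != 0 by rewrite gt_eqF// sgt// t0.
    by field.
  rewrite int_bD; [|by apply: bmeasM|by apply: bmeasM => //; exact: bmeas_cst].
  by rewrite int_bZ// int_dirichlet mulr1 addrC subrK.
under eq_fun do rewrite E.
have H := cvgD (cvg_cst (psi 0)) K; rewrite addr0 in H; exact: H.
Qed.

Lemma dirichlet_cvg (phi phi' : R -> R) x : C1_periodic phi phi' ->
  \int[mu]_(t in I01) (phi t * dirichlet M (x - t)) @[M --> \oo] --> phi x.
Proof.
move=> Hp; have [dp cp' pp] := Hp.
have HpS : C1_periodic (fun t => phi (x + t)) (fun t => phi' (x + t)).
  have cx : continuous (fun s : R => x + s) by apply: cont_add; [exact: cont_cst|move=> s; exact: cvg_id].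
  split.
  - by move=> t; apply: (is_derive_chain (dp _) (is_derive_addl x t)); rewrite mulr1.
  - exact: (cont_comp cx cp').
  - by move=> t; rewrite addrA pp.
have E M : \int[mu]_(t in I01) (phi t * dirichlet M (x - t)) =
   \int[mu]_(t in I01) (phi (x + t) * dirichlet M t).
  pose F t := phi t * dirichlet M (x - t).
  have dcos (a t : R) : is_derive t (1:R) (fun t => cos (a * (x - t))) (a * sin (a * (x - t))).
    have dl : is_derive t (1:R) (fun s : R => x - s) (-1).
      have := is_deriveB (is_derive_cst x t (1:R)) (is_derive_id t (1:R)).
      by move/is_derive_eq; apply; rewrite sub0r.
    have dl2 := is_derive_chain (is_derive_scale a _) dl erefl.
    by apply: (is_derive_chain (is_derive_cos _) dl2); ring.
  pose D' t := \sum_(p <- zseg M) (2 * pi * p%:~R) * sin ((2 * pi * p%:~R) * (x - t)).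
  have dD t : is_derive t (1:R) (fun t => dirichlet M (x - t)) (D' t).
    rewrite /dirichlet /D'; elim: (zseg M) => [|p r IH].
      by rewrite big_nil; under eq_fun do rewrite big_nil; exact: is_derive_cst.
    by rewrite big_cons; under eq_fun do rewrite big_cons; exact: (is_deriveD (dcos _ t) IH).
  have cD' : continuous D'.
    rewrite /D'; elim: (zseg M) => [|p r IH].
      by under eq_fun do rewrite big_nil; exact: cst_continuous.
    under eq_fun do rewrite big_cons; apply: cont_add => //.
    apply: cont_mul; first exact: cont_cst.
    apply: (cont_comp _ (@continuous_sin R)).
    apply: cont_mul; first exact: cont_cst.
    by apply: cont_sub; [exact: cont_cst|move=> s; exact: cvg_id].
  have HF : C1_periodic F (fun t => phi t * D' t + dirichlet M (x - t) * phi' t).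
    split.
    - by move=> t; exact: (is_deriveM (dp t) (dD t)).
    - apply: cont_add; apply: cont_mul => //; first exact: C1per_cont Hp.
      by move=> t; apply/differentiable_continuous/derivable1_diffP; have [] := dD t.
    - move=> t; rewrite /F pp; congr (_ * _); apply: eq_bigr => p _.
      have -> : 2 * pi * p%:~R * (x - (t + 1)) = 2 * pi * p%:~R * (x - t) + 2 * pi * (- p)%:~R.
        by rewrite rmorphN /=; ring.
      rewrite cosD.
      have := expi2piz R (- p); rewrite /expi => -[-> ->].
      by rewrite mulr1 mulr0 subr0.
  rewrite -[LHS](int01_shift x HF); apply: eq_Rintegral => t _; rewrite /F; congr (_ * _).
  apply: eq_bigr => p _; have -> : x - (x + t) = - t by ring.
  by rewrite mulrN cosN.
under eq_fun do rewrite E.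
have := dirichlet_cvg0 HpS; by rewrite addr0.
Qed.

End Dirichlet.

(** * Fourier series in several variables *)

Section Fourier.
Variable R : realType.
Local Notation Re := (@complex.Re R).
Local Notation Im := (@complex.Im R).
Local Notation mu := (@lebesgue_measure R).
Local Notation I01 := (`[0, 1]%classic : set R).
Local Notation w1 := (fun _ : R => (1:R)).

Definition icons d (a : int) (v : 'rV[int]_d) : 'rV[int]_d.+1 := row_mx (a%:M : 'rV_1) v.

Lemma icons0 d a (v : 'rV[int]_d) : icons a v 0 ord0 = a.
Proof.
have -> : ord0 = lshift d (ord0 : 'I_1) by apply/val_inj.
by apply: etrans (row_mxEl (a%:M : 'rV_1) v 0 ord0) _; rewrite mxE.
Qed.

Lemma iconsS d a (v : 'rV[int]_d) i : icons a v 0 (lift ord0 i) = v 0 i.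
Proof.
have -> : lift ord0 i = rshift 1 i by apply/val_inj.
exact: (row_mxEr (a%:M : 'rV_1) v 0 i).
Qed.

Lemma map_icons d a (v : 'rV[int]_d) :
  map_mx intr (icons a v) = rcons0 (a%:~R : R) (map_mx intr v).
Proof.
apply/rowP => i; rewrite mxE; case: (unliftP ord0 i) => [j ->|->].
  by rewrite rcons0S iconsS mxE.
by rewrite rcons00 icons0.
Qed.

Lemma icons_eta d (v : 'rV[int]_d.+1) : v = icons (v 0 ord0) (\row_i v 0 (lift ord0 i)).
Proof.
apply/rowP => i; case: (unliftP ord0 i) => [j ->|->].
  by rewrite iconsS mxE.
by rewrite icons0.
Qed.

(** Cubes of side 2M + 1: summing over them is iterated summation, which is what
    the induction on the dimension in [fourier_inversion] needs. *)
Fixpoint zbox (M d : nat) : seq 'rV[int]_d :=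
  if d is d'.+1 then [seq icons a v | a <- zseg M, v <- zbox M d'] else [:: 0].

Lemma zbox_sumS (V : nmodType) M d (F : 'rV[int]_d.+1 -> V) :
  \sum_(p <- zbox M d.+1) F p = \sum_(a <- zseg M) \sum_(v <- zbox M d) F (icons a v).
Proof. exact: big_allpairs_dep. Qed.

Lemma mem_zbox M d (p : 'rV[int]_d) : (p \in zbox M d) = [forall i : 'I_d, leq (absz (p 0 i)) M].
Proof.
elim: d p => [|d IH] p.
  by rewrite /= inE; apply/eqP/forallP => [_ []//|_]; apply/rowP => -[].
apply/allpairsP/forallP => [[[a v] /= [Ha Hv ->]] i|H].
  case: (unliftP ord0 i) => [j ->|->]; rewrite ?iconsS ?icons0; last by rewrite -mem_zseg.
  by move: Hv; rewrite IH => /forallP.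
exists (p 0 ord0, \row_i p 0 (lift ord0 i)); split => /=; last exact: icons_eta.
  by rewrite mem_zseg.
by rewrite IH; apply/forallP => i; rewrite mxE.
Qed.

Lemma icons_inj d a b (v w : 'rV[int]_d) : icons a v = icons b w -> a = b /\ v = w.
Proof.
move=> /rowP H; split; first by have := H ord0; rewrite !icons0.
by apply/rowP => i; have := H (lift ord0 i); rewrite !iconsS.
Qed.

Lemma uniq_zbox M d : uniq (zbox M d).
Proof.
elim: d => // d IH; apply: (@allpairs_uniq _ _ _ (@icons d) (zseg M) (zbox M d)) => //; first exact: uniq_zseg.
by move=> [a v] [b w] _ _ /= /icons_inj[-> ->].
Qed.

Lemma zbox_prod M d (F : int -> R) :
  \sum_(p <- zbox M d) \prod_(i < d) F (p 0 i) = (\sum_(a <- zseg M) F a) ^+ d.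
Proof.
elim: d => [|d IH]; first by rewrite /= big_seq1 big_ord0 expr0.
rewrite zbox_sumS exprS mulr_suml; apply: eq_bigr => a _; rewrite -IH mulr_sumr.
apply: eq_bigr => v _; rewrite big_ord_recl icons0; congr (_ * _).
by apply: eq_bigr => i _; rewrite iconsS.
Qed.

Definition zdecay (a : int) : R := decay (a%:~R : R).
Definition pdecay d (p : 'rV[int]_d) : R := \prod_(i < d) zdecay (p 0 i).
Definition zmass (M : nat) : R := \sum_(a <- zseg M) zdecay a.

Lemma zdecay_ge0 a : 0 <= zdecay a. Proof. exact: ltW (decay_gt0 _). Qed.

Lemma pdecay_ge0 d (p : 'rV[int]_d) : 0 <= pdecay p.
Proof. by apply: prodr_ge0 => i _; exact: zdecay_ge0. Qed.

Lemma pdecay_icons d a (p : 'rV[int]_d) : pdecay (icons a p) = zdecay a * pdecay p.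
Proof.
rewrite /pdecay big_ord_recl icons0; congr (_ * _).
by apply: eq_bigr => i _; rewrite iconsS.
Qed.

Lemma zmassS M : zmass M.+1 = zmass M + 2 * zdecay M.+1%:Z.
Proof.
rewrite /zmass zsegS big_cons -cats1 big_cat big_seq1 /=.
have -> : zdecay (- M.+1%:Z) = zdecay M.+1%:Z by rewrite /zdecay /decay rmorphN sqrrN.
ring.
Qed.

(** Each term (1 + m^2)^-1 is at most 2/m - 2/(m+1), and the latter telescope. *)
Lemma zmass_le M : zmass M <= 5 - 4 / M.+1%:R.
Proof.
elim: M => [|M IH].
  by rewrite /zmass zseg_sum big_ord0 addr0 /zdecay /decay expr0n addr0 invr1; lra.
rewrite zmassS; apply: le_trans (lerD IH (lexx _)) _.
rewrite /zdecay /decay -pmulrn.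
have -> : (M.+2%:R : R) = M.+1%:R + 1 by rewrite natr1.
have : 1 <= (M.+1%:R : R) by rewrite ler1n.
set m := (M.+1%:R : R) => m1.
have m0 : 0 < m by apply: lt_le_trans m1.
have H : (1 + m ^+ 2)^-1 <= 2 * (m^-1 - (m + 1)^-1).
  have -> : 2 * (m^-1 - (m + 1)^-1) = 2 / (m * (m + 1)).
    by field; rewrite !gt_eqF//; lra.
  rewrite -[leLHS]mul1r ler_pdivrMr ?ltr_wpDr ?sqr_ge0//.
  rewrite mulrAC ler_pdivlMr ?mulr_gt0//; last by lra.
  nra.
move: H; set A := (1 + m ^+ 2)^-1; set B := m^-1; set C := (m + 1)^-1; lra.
Qed.

Lemma zmass_nd : nondecreasing_seq zmass.
Proof. by apply/nondecreasing_seqP => M; rewrite zmassS lerDl mulr_ge0// zdecay_ge0. Qed.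

Definition Zmass : R := limn zmass.

Lemma zmass_is_cvg : cvgn zmass.
Proof.
apply: nondecreasing_is_cvgn; first exact: zmass_nd.
exists 5 => _ [M _ <-]; apply: le_trans (zmass_le M) _.
by rewrite gerBl divr_ge0.
Qed.

Lemma zmass_cvg : zmass M @[M --> \oo] --> Zmass.
Proof. exact: zmass_is_cvg. Qed.

Lemma zmass_leZ M : zmass M <= Zmass.
Proof. exact: nondecreasing_cvgn_le zmass_nd zmass_is_cvg M. Qed.

Lemma zmass_ge0 M : 0 <= zmass M.
Proof. by apply: sumr_ge0 => i _; exact: zdecay_ge0. Qed.

Lemma Zmass_ge0 : 0 <= Zmass. Proof. exact: le_trans (zmass_ge0 0) (zmass_leZ 0). Qed.

Lemma pdecay_sum M d : \sum_(p <- zbox M d) pdecay p <= Zmass ^+ d.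
Proof.
rewrite zbox_prod; apply: lerXn2r; rewrite ?nnegrE; [exact: zmass_ge0|exact: Zmass_ge0|exact: zmass_leZ].
Qed.

Lemma pdecay_sumE M d : \sum_(p <- zbox M d) pdecay p = zmass M ^+ d.
Proof. exact: zbox_prod. Qed.

Lemma zseg_sub (V : nmodType) M n (F : int -> V) : exists r : seq int,
  \sum_(a <- zseg (M + n)) F a = \sum_(a <- zseg M) F a + \sum_(a <- r) F a /\
  \sum_(a <- zseg (M + n)) zdecay a = \sum_(a <- zseg M) zdecay a + \sum_(a <- r) zdecay a.
Proof.
exists (flatten [seq [:: k.+1%:Z; - k.+1%:Z] | k <- iota M n]).
have Z (W : nmodType) n' (G : int -> W) : \sum_(a <- zseg (M + n'.+1)) G a =
    \sum_(a <- zseg (M + n')) G a + (G (M + n').+1%:Z + G (- (M + n').+1%:Z)).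
  by rewrite addnS !zseg_sum big_ord_recr addrA.
have Fl (W : nmodType) n' (G : int -> W) :
    \sum_(a <- flatten [seq [:: k.+1%:Z; - k.+1%:Z] | k <- iota M n'.+1]) G a =
    \sum_(a <- flatten [seq [:: k.+1%:Z; - k.+1%:Z] | k <- iota M n']) G a +
      (G (M + n').+1%:Z + G (- (M + n').+1%:Z)).
  by rewrite -addn1 iotaD map_cat flatten_cat big_cat /= !big_cons big_nil addr0.
elim: n => [|n [IH1 IH2]]; first by rewrite addn0 /= !big_nil !addr0.
by rewrite !Z !Fl IH1 IH2 !addrA.
Qed.

Lemma zseg_tail (c : int -> R[i]) C l M : (forall a, cabs (c a) <= C * zdecay a) ->
  ccvg (fun M => \sum_(a <- zseg M) c a) l ->
  cabs (l - \sum_(a <- zseg M) c a) <= C * (Zmass - zmass M).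
Proof.
move=> Hc Hl.
have C0 : 0 <= C.
  have := Hc 0; rewrite /zdecay /decay expr0n addr0 invr1 mulr1.
  by apply: le_trans; exact: cabs_ge0.
have H : ccvg (fun n => \sum_(a <- zseg (n + M)) c a - \sum_(a <- zseg M) c a) (l - \sum_(a <- zseg M) c a).
  apply: ccvgB; last exact: ccvg_cst.
  case: Hl => h1 h2; split.
    by rewrite -(cvg_shiftn M) in h1.
  by rewrite -(cvg_shiftn M) in h2.
apply: ccvg_le H _ => n.
have [r [E1 E2]] := zseg_sub M n c; rewrite [(n + M)%N]addnC E1 addrAC subrr add0r.
apply: le_trans (cabs_sum _ _ _) _; apply: (@le_trans _ _ (\sum_(a <- r) C * zdecay a)).
  by apply: ler_sum => a _; exact: Hc.
rewrite -mulr_sumr ler_wpM2l// lerBrDl; apply: le_trans (zmass_leZ (M + n)).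
by rewrite /zmass E2.
Qed.

Definition cint01 (phi : R -> R[i]) : R[i] :=
  (\int[mu]_(t in I01) Re (phi t)) +i* (\int[mu]_(t in I01) Im (phi t)).

Definition ccont (f : R -> R[i]) := continuous (fun t => Re (f t)) /\ continuous (fun t => Im (f t)).

Lemma cint01_lin (a : R[i]) f g : ccont f -> ccont g -> cint01 (fun t => a * f t + g t) = a * cint01 f + cint01 g.
Proof.
move=> [/bmeas_cont f1 /bmeas_cont f2] [/bmeas_cont g1 /bmeas_cont g2].
have bZ (c : R) h : bounded_meas h -> bounded_meas (fun t => c * h t) by apply: bmeasM; exact: bmeas_cst.
apply: complex_eqP; rewrite /cint01.
  rewrite Re_add Re_mul /=.
  have -> : (fun t => Re (a * f t + g t)) = (fun t => (Re a * Re (f t) + (- Im a) * Im (f t)) + Re (g t)).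
    by apply/funext => t; rewrite Re_add Re_mul mulNr.
  rewrite int_bD; [|exact: bmeasD (bZ _ _ f1) (bZ _ _ f2)|exact: g1].
  by rewrite int_bD; [rewrite !int_bZ// mulNr|exact: bZ|exact: bZ].
rewrite Im_add Im_mul /=.
have -> : (fun t => Im (a * f t + g t)) = (fun t => (Re a * Im (f t) + Im a * Re (f t)) + Im (g t)).
  by apply/funext => t; rewrite Im_add Im_mul.
rewrite int_bD; [|exact: bmeasD (bZ _ _ f2) (bZ _ _ f1)|exact: g2].
by rewrite int_bD; [rewrite !int_bZ|exact: bZ|exact: bZ].
Qed.

Lemma cint01_derive (F f : R -> R[i]) : ccont f -> (forall t, is_cderive t (1 : R) F (f t)) ->
  cint01 f = F 1 - F 0.
Proof.
move=> [f1 f2] H; apply: complex_eqP; rewrite /cint01 ?Re_sub ?Im_sub /=.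
  by rewrite (int01_derive f1 (fun t => (H t).1)).
by rewrite (int01_derive f2 (fun t => (H t).2)).
Qed.

Lemma ccont_cst (c : R[i]) : ccont (fun=> c).
Proof. by split; exact: cst_continuous. Qed.

Lemma ccontM f g : ccont f -> ccont g -> ccont (fun t => f t * g t).
Proof.
move=> [f1 f2] [g1 g2]; split.
  by under eq_fun do rewrite Re_mul; apply: cont_sub; exact: cont_mul.
by under eq_fun do rewrite Im_mul; apply: cont_add; exact: cont_mul.
Qed.

Lemma ccont_lin a f g : ccont f -> ccont g -> ccont (fun t => a * f t + g t).
Proof.
move=> cf [g1 g2]; have [f1 f2] := ccontM (ccont_cst a) cf; split.
  by under eq_fun do rewrite Re_add; exact: cont_add.
by under eq_fun do rewrite Im_add; exact: cont_add.
Qed.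

Lemma ccont_expi (q : R -> R) : continuous q -> ccont (fun t => expi (q t)).
Proof.
by move=> cq; split; [exact: (cont_comp cq (@continuous_cos R))|exact: (cont_comp cq (@continuous_sin R))].
Qed.

Lemma cint01_0 : cint01 (fun=> 0) = 0.
Proof. by apply: complex_eqP; rewrite /cint01 /= Rintegral_cst ?mul0r//=; exact: measurable_itv. Qed.

Lemma cint01Z a f : ccont f -> cint01 (fun t => a * f t) = a * cint01 f.
Proof.
move=> cf; have := cint01_lin a cf (ccont_cst 0); rewrite cint01_0 addr0 => <-.
by congr cint01; apply/funext => t; rewrite addr0.
Qed.

Lemma cint01_sum (I : Type) (r : seq I) (F : I -> R -> R[i]) : (forall i, ccont (F i)) ->
  ccont (fun t => \sum_(i <- r) F i t) /\ cint01 (fun t => \sum_(i <- r) F i t) = \sum_(i <- r) cint01 (F i).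
Proof.
move=> H; elim: r => [|i r [IH1 IH2]].
  rewrite big_nil; have -> : (fun t => \sum_(i <- [::]) F i t) = fun=> 0 by apply/funext => t; rewrite big_nil.
  by split; [exact: ccont_cst|exact: cint01_0].
have -> : (fun t => \sum_(j <- i :: r) F j t) = fun t => 1 * F i t + \sum_(j <- r) F j t.
  by apply/funext => t; rewrite big_cons mul1r.
by rewrite big_cons -IH2 (cint01_lin 1 (H i) IH1) mul1r; split=> //; exact: ccont_lin.
Qed.

Lemma sum_expi_zseg M (s : R) : \sum_(a <- zseg M) expi (2 * pi * (a%:~R * s)) = (dirichlet M s)%:C.
Proof.
apply: complex_eqP.
  rewrite (big_morph Re (@Re_add R) (erefl _)) /dirichlet; apply: eq_bigr => a _.
  by rewrite /expi /= mulrA.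
rewrite (big_morph Im (@Im_add R) (erefl _)) zseg_sum /expi /= mul0r mulr0 sin0 add0r big1// => m _.
by rewrite rmorphN /= mulNr mulrN sinN subrr.
Qed.

Definition cC1_periodic (phi phi' : R -> R[i]) :=
  C1_periodic (fun t => Re (phi t)) (fun t => Re (phi' t)) /\
  C1_periodic (fun t => Im (phi t)) (fun t => Im (phi' t)).

(** The partial sum is the convolution with the Dirichlet kernel. *)
Lemma fourier1 (phi phi' : R -> R[i]) x : cC1_periodic phi phi' ->
  ccvg (fun M => \sum_(a <- zseg M) cint01 (fun t => phi t * expi (- (2 * pi * (a%:~R * t)))) *
                 expi (2 * pi * (a%:~R * x))) (phi x).
Proof.
move=> [H1 H2]; have cphi : ccont phi by split; [exact: C1per_cont H1|exact: C1per_cont H2].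
have cid (b : R) : continuous (fun t : R => b * t).
  by apply: cont_mul; [exact: cont_cst|move=> t; exact: cvg_id].
have E M : \sum_(a <- zseg M) cint01 (fun t => phi t * expi (- (2 * pi * (a%:~R * t)))) * expi (2 * pi * (a%:~R * x)) =
    cint01 (fun t => phi t * (dirichlet M (x - t))%:C).
  transitivity (\sum_(a <- zseg M) cint01 (fun t => expi (2 * pi * (a%:~R * x)) * (phi t * expi (- (2 * pi * (a%:~R * t)))))).
    apply: eq_bigr => a _; rewrite mulrC cint01Z//; apply: ccontM => //; apply: ccont_expi.
    by apply: cont_opp; apply: cont_mul; [exact: cont_cst|exact: cid].
  rewrite -(cint01_sum _ _).2 => [|a]; last first.
    apply: ccontM; first exact: ccont_cst.
    apply: ccontM => //; apply: ccont_expi; apply: cont_opp; apply: cont_mul; [exact: cont_cst|exact: cid].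
  congr cint01; apply/funext => t; rewrite -sum_expi_zseg mulr_sumr; apply: eq_bigr => a _.
  by rewrite mulrCA -expiD; congr (_ * expi _); ring.
under eq_fun do rewrite E.
have E2 M : cint01 (fun t => phi t * (dirichlet M (x - t))%:C) =
   (\int[mu]_(t in I01) (Re (phi t) * dirichlet M (x - t))) +i*
   (\int[mu]_(t in I01) (Im (phi t) * dirichlet M (x - t))).
  rewrite /cint01; congr (_ +i* _); apply: eq_Rintegral => t _.
    by rewrite Re_mul /= mulr0 subr0.
  by rewrite Im_mul /= mulr0 add0r.
under eq_fun do rewrite E2.
by split=> /=; [exact: (@dirichlet_cvg R _ _ x H1)|exact: (@dirichlet_cvg R _ _ x H2)].
Qed.

Definition chr d (p : 'rV[int]_d) (x : 'rV[R]_d) : R[i] :=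
  expi (2 * pi * dot (map_mx intr p) x).

Definition fourier_coef d (f : 'rV[R]_d -> R[i]) (p : 'rV[int]_d) : R[i] :=
  cint I01 (fun x => f x * expi (- (2 * pi * dot (map_mx intr p) x))).

Definition periodic_smooth d (f : 'rV[R]_d -> R[i]) := smooth f /\ periodic_fun f.

Lemma dot_rcons0 d a b (v w : 'rV[R]_d) : dot (rcons0 a v) (rcons0 b w) = a * b + dot v w.
Proof.
rewrite /dot big_ord_recl !rcons00; congr (_ + _).
by apply: eq_bigr => i _; rewrite !rcons0S.
Qed.

Lemma dotDr d (p v w : 'rV[R]_d) : dot p (v + w) = dot p v + dot p w.
Proof. by rewrite -big_split; apply: eq_bigr => i _; rewrite mxE mulrDr. Qed.

Lemma dotDl d (p q v : 'rV[R]_d) : dot (p + q) v = dot p v + dot q v.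
Proof. by rewrite -big_split; apply: eq_bigr => i _; rewrite mxE mulrDl. Qed.

Lemma dotZr d a (p v : 'rV[R]_d) : dot p (a *: v) = a * dot p v.
Proof. by rewrite mulr_sumr; apply: eq_bigr => i _; rewrite mxE mulrCA. Qed.

Lemma dotC d (p v : 'rV[R]_d) : dot p v = dot v p.
Proof. by apply: eq_bigr => i _; rewrite mulrC. Qed.

Lemma dot_edir d (p : 'rV[R]_d) j : dot p (edir R j) = p 0 j.
Proof.
rewrite /dot (bigD1 j)//= big1 => [|i ij]; rewrite !mxE eqxx /=; first by rewrite eqxx mulr1 addr0.
by rewrite (negbTE ij) mulr0.
Qed.

Lemma dot_int d (p l : 'rV[int]_d) :
  dot (map_mx intr p) (map_mx intr l) = (\sum_(i < d) p 0 i * l 0 i)%:~R :> R.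
Proof.
rewrite /dot (big_morph (intr : int -> R) (@rmorphD _ _ _) (erefl _)).
by apply: eq_bigr => i _; rewrite !mxE rmorphM.
Qed.

Lemma dot0l d (v : 'rV[R]_d) : dot 0 v = 0.
Proof. by rewrite /dot big1 // => i _; rewrite mxE mul0r. Qed.

Lemma rsmooth_dot d (p : 'rV[R]_d) : rsmooth (dot p).
Proof.
apply: rsmooth_sum => i; apply: rsmooth_mul; first exact: rsmooth_cst.
exact: rsmooth_coord.
Qed.

Lemma is_derive_dot d (p : 'rV[R]_d) u j : is_derive u (edir R j) (dot p) (p 0 j).
Proof.
apply/is_derive_line0.
have -> : (fun r : R => dot p (u + r *: edir R j)) = fun r => dot p u + p 0 j * r.
  by apply/funext => r; rewrite dotDr dotZr dot_edir mulrC.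
by apply: (is_derive_chain (is_derive_addl _ _) (is_derive_scale _ _)); rewrite mul1r.
Qed.

Lemma is_derive_scaled d (q : 'rV[R]_d -> R) u j (c a : R) :
  is_derive u (edir R j) q a -> is_derive u (edir R j) (fun v => c * q v) (c * a).
Proof.
by move=> /is_derive_line0 H; apply/is_derive_line0; exact: (is_derive_chain (is_derive_scale c _) H erefl).
Qed.

Lemma smooth_chr d (c : R) (p : 'rV[R]_d) : smooth (fun x => expi (c * dot p x)).
Proof. by apply/smooth_expi/rsmooth_mul; [exact: rsmooth_cst|exact: rsmooth_dot]. Qed.

Lemma chrN d (p : 'rV[int]_d) (x : 'rV[R]_d) : expi (- (2 * pi * dot (map_mx intr p) x)) =
  expi ((- (2 * pi)) * dot (map_mx intr p) x).
Proof. by rewrite mulNr. Qed.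

Lemma periodic_chrN d (p : 'rV[int]_d) : periodic_fun (fun x : 'rV[R]_d => expi (- (2 * pi * dot (map_mx intr p) x))).
Proof.
move=> l u; rewrite dotDr mulrDr opprD expiD dot_int -[X in _ * X]conj_expi expi2piz.
by rewrite conjc1 mulr1.
Qed.

Lemma psm_mul d (f g : 'rV[R]_d -> R[i]) : periodic_smooth f -> periodic_smooth g -> periodic_smooth (fun u => f u * g u).
Proof.
move=> [sf pf] [sg pg]; split; first exact: smooth_mul.
by move=> l u; rewrite pf pg.
Qed.

Lemma psm_chrN d (p : 'rV[int]_d) : periodic_smooth (fun x : 'rV[R]_d => expi (- (2 * pi * dot (map_mx intr p) x))).
Proof.
split; last exact: periodic_chrN.
have -> : (fun x : 'rV[R]_d => expi (- (2 * pi * dot (map_mx intr p) x))) =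
  fun x => expi (- (2 * pi) * dot (map_mx intr p) x) by apply/funext => x; rewrite chrN.
exact: (smooth_chr (- (2 * pi)) (map_mx intr p)).
Qed.

Lemma periodic_Re d (f : 'rV[R]_d -> R[i]) : periodic_fun f -> periodic_fun (fun u => Re (f u)).
Proof. by move=> p l u; rewrite p. Qed.
Lemma periodic_Im d (f : 'rV[R]_d -> R[i]) : periodic_fun f -> periodic_fun (fun u => Im (f u)).
Proof. by move=> p l u; rewrite p. Qed.

Lemma psm_partial d j (f : 'rV[R]_d -> R[i]) : periodic_smooth f -> periodic_smooth (partial j f).
Proof.
move=> [sf pf]; split; first exact: smooth_partial.
move=> l u; rewrite /partial; congr (_ +i* _).
  exact: (periodic_fun_D j (periodic_Re pf) l u).
exact: (periodic_fun_D j (periodic_Im pf) l u).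
Qed.

Lemma psm_slice d t (f : 'rV[R]_d.+1 -> R[i]) : periodic_smooth f -> periodic_smooth (fun v => f (rcons0 t v)).
Proof.
move=> [/smoothP[f1 f2] pf]; split; last exact: periodic_fun_slice.
by apply/smoothP; split; [exact: (rsmooth_slice t f1)|exact: (rsmooth_slice t f2)].
Qed.

Lemma psm_bounded d (f : 'rV[R]_d -> R[i]) : periodic_smooth f -> exists B, cbounded B f.
Proof.
move=> [sf pf].
have [B1 _ H1] := periodic_bounded (smooth_contRe sf) (periodic_Re pf).
have [B2 _ H2] := periodic_bounded (smooth_contIm sf) (periodic_Im pf).
exists (B1 + B2); split; [exact: smooth_contRe|exact: smooth_contIm|].
by move=> v; apply: le_trans (cabs_le _) _; rewrite lerD.
Qed.

Lemma cbounded_expi d (q : 'rV[R]_d -> R) : rsmooth q -> cbounded 1 (fun x => expi (q x)).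
Proof.
move=> sq; have s := smooth_expi sq; split; [exact: (smooth_contRe s)|exact: (smooth_contIm s)|].
by move=> v; rewrite cabs_expi.
Qed.

Lemma cbounded_chrN d (p : 'rV[int]_d) :
  cbounded 1 (fun x : 'rV[R]_d => expi (- (2 * pi * dot (map_mx intr p) x))).
Proof.
under eq_fun do rewrite chrN; apply: cbounded_expi.
by apply: rsmooth_mul; [exact: rsmooth_cst|exact: rsmooth_dot].
Qed.

Lemma cint_partial0 d j (f : 'rV[R]_d -> R[i]) : periodic_smooth f -> cint I01 (partial j f) = 0.
Proof.
move=> [/smoothP[f1 f2] pf]; apply: complex_eqP => /=.
  exact: (rint01_D_periodic j f1 (periodic_Re pf)).
exact: (rint01_D_periodic j f2 (periodic_Im pf)).
Qed.

Lemma cderiv_chrN d (p : 'rV[int]_d) j u :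
  cderiv j u (fun x : 'rV[R]_d => expi (- (2 * pi * dot (map_mx intr p) x)))
    (- ((2 * pi * (p 0 j)%:~R)%:C * imag R) * expi (- (2 * pi * dot (map_mx intr p) u))).
Proof.
under eq_fun do rewrite chrN; rewrite chrN.
have := cderiv_expi (is_derive_scaled (- (2 * pi)) (is_derive_dot (map_mx intr p) u j)).
by rewrite mxE mulNr rmorphN /= mulNr.
Qed.

(** Integration by parts: the integral of a derivative of a periodic function
    vanishes. *)
Lemma fc_partial d (f : 'rV[R]_d -> R[i]) j p : periodic_smooth f ->
  fourier_coef (partial j f) p = (2 * pi * (p 0 j)%:~R)%:C * imag R * fourier_coef f p.
Proof.
move=> pf; have pe := psm_chrN p.
have H := cint_partial0 j (psm_mul pf pe).
have sf := pf.1; have se := pe.1.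
move: H; rewrite partialM//.
set c := (2 * pi * (p 0 j)%:~R)%:C * imag R.
have -> : (fun u => partial j f u * expi (- (2 * pi * dot (map_mx intr p) u)) +
      f u * partial j (fun v : 'rV[R]_d => expi (- (2 * pi * dot (map_mx intr p) v))) u) =
   fun u => (- c) * (f u * expi (- (2 * pi * dot (map_mx intr p) u))) +
     partial j f u * expi (- (2 * pi * dot (map_mx intr p) u)).
  apply/funext => u; rewrite (cderiv_partial (cderiv_chrN p j u)) -/c; ring.
have [B1 HB1] := psm_bounded pf; have [B2 HB2] := psm_bounded (psm_partial j pf).
rewrite (cint_lin (weight01 R) _ (cboundedP (cboundedM HB1 (cbounded_chrN p)))
  (cboundedP (cboundedM HB2 (cbounded_chrN p)))).
by rewrite -/(fourier_coef f p) -/(fourier_coef (partial j f) p) mulNr addrC => /eqP; rewrite subr_eq0 => /eqP.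
Qed.

Lemma imag_sqr : imag R * imag R = -1.
Proof. by apply: complex_eqP; rewrite /imag /=; ring. Qed.

(** Its symbol 1 + (2 pi p_j)^2 is at least the inverse of the weight [zdecay], so
    that each application of it to all variables gains a factor [pdecay]. *)
Definition laplD d (j : 'I_d) (f : 'rV[R]_d -> R[i]) := fun u => f u - partial j (partial j f) u.
Definition laplDs d (l : seq 'I_d) (f : 'rV[R]_d -> R[i]) := foldr (@laplD d) f l.

Lemma psm_sub d (f g : 'rV[R]_d -> R[i]) : periodic_smooth f -> periodic_smooth g -> periodic_smooth (fun u => f u - g u).
Proof.
move=> [sf pf] [sg pg]; split; first exact: smooth_sub.
by move=> l u; rewrite pf pg.
Qed.

Lemma psm_add d (f g : 'rV[R]_d -> R[i]) : periodic_smooth f -> periodic_smooth g -> periodic_smooth (fun u => f u + g u).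
Proof.
move=> [sf pf] [sg pg]; split; first exact: smooth_add.
by move=> l u; rewrite pf pg.
Qed.

Lemma psm_cst d c : periodic_smooth (fun _ : 'rV[R]_d => c).
Proof. by split; [exact: smooth_cst|]. Qed.

Lemma psm_laplD d j (f : 'rV[R]_d -> R[i]) : periodic_smooth f -> periodic_smooth (laplD j f).
Proof. by move=> pf; exact: (psm_sub pf (psm_partial j (psm_partial j pf))). Qed.

Lemma psm_laplDs d l (f : 'rV[R]_d -> R[i]) : periodic_smooth f -> periodic_smooth (laplDs l f).
Proof. by move=> pf; elim: l => [|j l IH]; [exact: pf|exact: (psm_laplD j IH)]. Qed.

Lemma fcB d (f g : 'rV[R]_d -> R[i]) p : periodic_smooth f -> periodic_smooth g ->
  fourier_coef (fun u => f u - g u) p = fourier_coef f p - fourier_coef g p.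
Proof.
move=> /psm_bounded[B1 H1] /psm_bounded[B2 H2].
have := cint_lin (weight01 R) (-1) (cboundedP (cboundedM H2 (cbounded_chrN p)))
  (cboundedP (cboundedM H1 (cbounded_chrN p))).
rewrite -/(fourier_coef f p) -/(fourier_coef g p) mulN1r addrC => <-.
by congr cint; apply/funext => u; ring.
Qed.

Lemma fc_laplD d (f : 'rV[R]_d -> R[i]) j p : periodic_smooth f ->
  fourier_coef (laplD j f) p = (1 + (2 * pi * (p 0 j)%:~R) ^+ 2)%:C * fourier_coef f p.
Proof.
move=> pf; have pf1 := psm_partial j pf.
rewrite (fcB p pf (psm_partial j pf1)) (fc_partial j p pf1) (fc_partial j p pf); set a := 2 * pi * (p 0 j)%:~R.
have -> : a%:C * imag R * (a%:C * imag R * fourier_coef f p) = - (a ^+ 2)%:C * fourier_coef f p.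
  by rewrite mulrA; congr (_ * _); rewrite mulrACA imag_sqr mulrN1 -rmorphM.
by rewrite rmorphD rmorph1 /=; ring.
Qed.

Lemma fc_bound d (f : 'rV[R]_d -> R[i]) p B : periodic_smooth f -> (forall x, cabs (f x) <= B) ->
  cabs (fourier_coef f p) <= 2 * B.
Proof.
move=> [sf _] H.
have cb : cbounded B f by split; [exact: smooth_contRe|exact: smooth_contIm|].
by have := cint1_bound (cboundedM cb (cbounded_chrN p)); rewrite mulr1.
Qed.

Lemma pdecay_gt0 d (p : 'rV[int]_d) : 0 < pdecay p.
Proof. by apply: prodr_gt0 => i _; exact: decay_gt0. Qed.

(** The coefficients of f are those of its image divided by the symbol, so a bound on
    the image gives decay. *)
Lemma fc_laplDs d (f : 'rV[R]_d -> R[i]) p : periodic_smooth f ->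
  cabs (fourier_coef f p) <= pdecay p * cabs (fourier_coef (laplDs (enum 'I_d) f) p).
Proof.
move=> pf.
have -> : fourier_coef (laplDs (enum 'I_d) f) p = (\prod_(i < d) (1 + (2 * pi * (p 0 i)%:~R) ^+ 2))%:C * fourier_coef f p.
  rewrite -big_enum /=; elim: (enum 'I_d) => [|j l IH]; first by rewrite big_nil mul1r.
  rewrite big_cons [laplDs _ _]/= (fc_laplD j p (psm_laplDs l pf)) IH.
  by rewrite mulrA -rmorphM.
rewrite cabsM cabs_real mulrA ler_peMl ?cabs_ge0//.
rewrite -ler_pdivrMl ?pdecay_gt0// mulr1; apply: le_trans (ler_norm _).
rewrite /pdecay -prodfV; apply: ler_prod => i _; rewrite /zdecay /decay invrK.
rewrite addr_ge0 ?sqr_ge0//= lerD2l exprMn -[leLHS]mul1r ler_wpM2r ?sqr_ge0//.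
have := @pi_ge2 R; nra.
Qed.

Lemma expiM_slice d a (p : 'rV[int]_d) t (v : 'rV[R]_d) :
  expi (- (2 * pi * dot (map_mx intr (icons a p)) (rcons0 t v))) =
  expi (- (2 * pi * (a%:~R * t))) * expi (- (2 * pi * dot (map_mx intr p) v)) :> R[i].
Proof. by rewrite map_icons dot_rcons0 mulrDr opprD expiD. Qed.

(** The integral is iterated by definition and the character splits. *)
Lemma fcS d (f : 'rV[R]_d.+1 -> R[i]) a p : periodic_smooth f ->
  fourier_coef f (icons a p) = cint01 (fun t => fourier_coef (fun v => f (rcons0 t v)) p * expi (- (2 * pi * (a%:~R * t)))).
Proof.
move=> pf; rewrite /fourier_coef cintS /cint01.
have E t : cint I01 (fun v => f (rcons0 t v) * expi (- (2 * pi * dot (map_mx intr (icons a p)) (rcons0 t v)))) =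
    cint I01 (fun v => f (rcons0 t v) * expi (- (2 * pi * dot (map_mx intr p) v))) * expi (- (2 * pi * (a%:~R * t))).
  have [B HB] := psm_bounded (psm_slice t pf).
  rewrite [RHS]mulrC -(cintZ (weight01 R) _ (cboundedP (cboundedM HB (cbounded_chrN p)))).
  by congr cint; apply/funext => v; rewrite expiM_slice; ring.
by congr (_ +i* _); apply: eq_Rintegral => t _; rewrite E.
Qed.

Lemma is_cderive_fc d (F F' : R -> 'rV[R]_d -> R[i]) B B' p t :
  (forall s, cbounded B (F s)) -> (forall s, cbounded B' (F' s)) ->
  (forall s v, is_cderive s (1 : R) (F^~ v) (F' s v)) ->
  is_cderive t (1 : R) (fun s => fourier_coef (F s) p) (fourier_coef (F' t) p).
Proof.
move=> cF cF' dF; set e := fun v : 'rV[R]_d => expi (- (2 * pi * dot (map_mx intr p) v)).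
have cbe s := cboundedM (cF s) (cbounded_chrN p).
have cbe' s := cboundedM (cF' s) (cbounded_chrN p).
have dFe s v : is_cderive s (1 : R) (fun s => F s v * e v) (F' s v * e v).
  by have := is_cderiveM (dF s v) (is_cderive_cst s (1:R) (e v)); rewrite mulr0 addr0.
split.
  apply: (@is_derive_rint01 R d (fun t v => Re (F t v * e v)) (fun t v => Re (F' t v * e v)) (B * 1) (B' * 1)).
  - by move=> s; have [] := cbe s.
  - by move=> s; have [] := cbe' s.
  - by move=> s v; have [] := dFe s v.
  - by move=> s v; apply: le_trans (Re_le_cabs _) _; have [_ _] := cbe s; exact.
  - by move=> s v; apply: le_trans (Re_le_cabs _) _; have [_ _] := cbe' s; exact.
apply: (@is_derive_rint01 R d (fun t v => Im (F t v * e v)) (fun t v => Im (F' t v * e v)) (B * 1) (B' * 1)).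
- by move=> s; have [] := cbe s.
- by move=> s; have [] := cbe' s.
- by move=> s v; have [] := dFe s v.
- by move=> s v; apply: le_trans (Im_le_cabs _) _; have [_ _] := cbe s; exact.
- by move=> s v; apply: le_trans (Im_le_cabs _) _; have [_ _] := cbe' s; exact.
Qed.

Lemma cbounded_comp d d' B (f : 'rV[R]_d -> R[i]) (L : 'rV[R]_d' -> 'rV[R]_d) :
  continuous L -> cbounded B f -> cbounded B (fun v => f (L v)).
Proof.
by move=> cL [c1 c2 H]; split; [exact: (cont_comp cL c1)|exact: (cont_comp cL c2)|move=> v; exact: H].
Qed.

Lemma cC1_periodic_fc d (f : 'rV[R]_d.+1 -> R[i]) p : periodic_smooth f ->
  cC1_periodic (fun t => fourier_coef (fun v => f (rcons0 t v)) p)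
         (fun t => fourier_coef (fun v => partial ord0 f (rcons0 t v)) p).
Proof.
have D (g : 'rV[R]_d.+1 -> R[i]) t : periodic_smooth g ->
    is_cderive t (1 : R) (fun t => fourier_coef (fun v => g (rcons0 t v)) p) (fourier_coef (fun v => partial ord0 g (rcons0 t v)) p).
  move=> pg; have [B HB] := psm_bounded pg; have [B' HB'] := psm_bounded (psm_partial ord0 pg).
  have cr (s : R) : continuous (rcons0 s : 'rV[R]_d -> _) by exact: cont_rcons0.
  apply: (@is_cderive_fc d (fun s v => g (rcons0 s v)) (fun s v => partial ord0 g (rcons0 s v)) B B').
  - by move=> s; exact: cbounded_comp HB.
  - by move=> s; exact: cbounded_comp HB'.
  - move=> s v; have /smoothP[g1 g2] := pg.1.
    by split; [exact: is_derive_slice0 s v g1|exact: is_derive_slice0 s v g2].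
move=> pf; have D1 t := D f t pf; have D2 t := D _ t (psm_partial ord0 pf).
have per t : fourier_coef (fun v => f (rcons0 (t + 1) v)) p = fourier_coef (fun v => f (rcons0 t v)) p.
  congr fourier_coef; apply/funext => v.
  have -> : rcons0 (t + 1) v = rcons0 t v + map_mx intr (icons 1 0 : 'rV[int]_d.+1).
    rewrite map_icons; apply/rowP => i; case: (unliftP ord0 i) => [l ->|->].
      by rewrite rcons0S [RHS]mxE !rcons0S !mxE addr0.
    by rewrite rcons00 [RHS]mxE !rcons00.
  exact: pf.2.
split; split=> [t|t|t].
- by have [] := D1 t.
- by apply/differentiable_continuous/derivable1_diffP; have [[]] := D2 t.
- by rewrite per.
- by have [] := D1 t.
- by apply/differentiable_continuous/derivable1_diffP; have [_ []] := D2 t.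
- by rewrite per.
Qed.

Lemma fc_decayE d (f : 'rV[R]_d -> R[i]) : periodic_smooth f ->
  exists2 C, 0 <= C & forall p, cabs (fourier_coef f p) <= C * pdecay p.
Proof.
move=> pf; have pL := psm_laplDs (enum 'I_d) pf; have [B [_ _ HB]] := psm_bounded pL.
have B0 : 0 <= B by apply: le_trans (HB 0); exact: cabs_ge0.
exists (2 * B) => [|p]; first exact: mulr_ge0.
apply: le_trans (fc_laplDs p pf) _; rewrite mulrC ler_wpM2r ?(ltW (pdecay_gt0 _))//.
exact: fc_bound pL HB.
Qed.

Definition fsum d (f : 'rV[R]_d -> R[i]) (M : nat) (x : 'rV[R]_d) : R[i] :=
  \sum_(p <- zbox M d) fourier_coef f p * chr p x.

Lemma cabs_chr d (p : 'rV[int]_d) x : cabs (chr p x) = 1.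
Proof. exact: cabs_expi. Qed.

(** Induction on the dimension.  For fixed p the sum over the first index converges
    to the coefficient of the slice at the first coordinate, with an error
    C pdecay(p) (Zmass - zmass M) that is summable over p and tends to 0; the sum
    over p of the coefficients of the slice converges by induction. *)
Lemma fourier_inversion d (f : 'rV[R]_d -> R[i]) x : periodic_smooth f -> ccvg (fsum f ^~ x) (f x).
Proof.
elim: d f x => [|d IH] f x pf.
  have E M : fsum f M x = f x.
    rewrite /fsum /= big_seq1 /fourier_coef /chr /cint /=.
    have d0 (p v : 'rV[R]_0) : dot p v = 0 by rewrite /dot big_ord0.
    rewrite !d0 mulr0 oppr0 expi0 !mulr1 (_ : x = 0); first by case: (f 0).
    by apply/rowP => -[].
  by under eq_fun do rewrite E; exact: ccvg_cst.
rewrite (rcons0_eta x); set a := x 0 ord0; set x' := \row__ _.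
have [C C0 HC] := fc_decayE pf.
pose S M (p : 'rV[int]_d) := \sum_(b <- zseg M) fourier_coef f (icons b p) * expi (2 * pi * (b%:~R * a)).
pose phi (p : 'rV[int]_d) t := fourier_coef (fun v => f (rcons0 t v)) p.
have HS p M : cabs (S M p - phi p a) <= C * pdecay p * (Zmass - zmass M).
  rewrite cabsC; apply: zseg_tail.
    move=> b; rewrite cabsM cabs_expi mulr1; apply: le_trans (HC _) _.
    by rewrite pdecay_icons [zdecay b * _]mulrC mulrA.
  have := fourier1 a (cC1_periodic_fc p pf); rewrite -/(phi p a).
  by under eq_fun do under eq_bigr do rewrite -fcS//.
have E M : fsum f M (rcons0 a x') = \sum_(p <- zbox M d) S M p * chr p x'.
  rewrite /fsum zbox_sumS exchange_big /=; apply: eq_bigr => p _.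
  rewrite mulr_suml; apply: eq_bigr => b _; rewrite -mulrA; congr (_ * _).
  by rewrite /chr map_icons dot_rcons0 mulrDr expiD.
have IHa := IH _ x' (psm_slice a pf).
apply: (@ccvg_squeeze _ _ _ (fun M => C * Zmass ^+ d * (Zmass - zmass M) +
   cabs (fsum (fun v => f (rcons0 a v)) M x' - f (rcons0 a x')))).
  move=> M; rewrite E.
  set A := \sum_(p <- zbox M d) _; set F := fsum _ M x'.
  have -> : A - f (rcons0 a x') = (A - F) + (F - f (rcons0 a x')) by ring.
  apply: le_trans (cabsD _ _) _; rewrite lerD2r.
  rewrite /A /F /fsum -sumrB; apply: le_trans (cabs_sum _ _ _) _.
  apply: (@le_trans _ _ (\sum_(p <- zbox M d) C * pdecay p * (Zmass - zmass M))).
    by apply: ler_sum => p _; rewrite -mulrBl cabsM cabs_chr mulr1; exact: HS.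
  rewrite -mulr_suml -mulr_sumr ler_wpM2r ?subr_ge0 ?zmass_leZ// ler_wpM2l//.
  exact: pdecay_sum.
have T1 : C * Zmass ^+ d * (Zmass - zmass M) @[M --> \oo] --> (0 : R).
  have := cvgM (cvg_cst (C * Zmass ^+ d)) (cvgB (cvg_cst Zmass) zmass_cvg).
  by rewrite subrr mulr0; apply.
have T2 := (ccvgP _ _).1 IHa.
by have := cvgD T1 T2; rewrite addr0; apply.
Qed.

End Fourier.

(** * Taylor expansion with multi-indices *)

Section Taylor.
Variable R : realType.
Local Notation Re := (@complex.Re R).
Local Notation Im := (@complex.Im R).

Lemma is_derive_pow M (t : R) : is_derive t (1:R) (fun s : R => s ^+ M.+1) (M.+1%:R * t ^+ M).
Proof.
elim: M => [|M IH].
  by under eq_fun do rewrite expr1; rewrite expr0 mulr1; exact: is_derive_id.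
under eq_fun do rewrite exprS.
have := is_deriveM (is_derive_id t (1:R)) IH; move/is_derive_eq; apply.
by rewrite /GRing.scale /= -[in RHS]natr1 mulr1 mulrDl mul1r exprS mulrCA.
Qed.

Lemma taylor1 N (phi : nat -> R -> R) B v : 0 <= B ->
  (forall a t, is_derive t (1:R) (phi a) (phi a.+1 t)) ->
  (forall t, `|phi N.+1 t| <= B) ->
  `|phi 0%N v - \sum_(a < N.+1) v ^+ a / a`!%:R * phi a 0| <= B * `|v| ^+ N.+1.
Proof.
move=> B0; elim: N phi v => [|N IH] phi v dphi HB.
  rewrite big_ord1 expr0 fact0 divr1 mul1r expr1.
  have cphi : continuous (phi 0%N).
    by move=> t; apply/differentiable_continuous/derivable1_diffP; have [] := dphi 0%N t.
  case: (ltgtP v 0) => [vn|vp|->]; last by rewrite subrr normr0 mulr0.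
    have [c _ E] := MVT vn (fun x _ => dphi 0%N x) (continuous_subspaceT cphi).
    by rewrite distrC E sub0r normrM normrN ler_wpM2r.
  have [c _ E] := MVT vp (fun x _ => dphi 0%N x) (continuous_subspaceT cphi).
  by rewrite E subr0 normrM ler_wpM2r.
pose psi t := phi 0%N t - \sum_(a < N.+2) t ^+ a / a`!%:R * phi a 0.
pose psi' t := phi 1%N t - \sum_(a < N.+1) t ^+ a / a`!%:R * phi a.+1 0.
have dpsi t : is_derive t (1:R) psi (psi' t).
  suff H2 : is_derive t (1:R) (fun t : R => \sum_(a < N.+2) t ^+ a / a`!%:R * phi a 0)
      (\sum_(a < N.+1) t ^+ a / a`!%:R * phi a.+1 0).
    exact: (is_deriveB (dphi 0%N t) H2).
  have -> : (fun t : R => \sum_(a < N.+2) t ^+ a / a`!%:R * phi a 0) =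
     (fun t => phi 0%N 0 + \sum_(a < N.+1) t ^+ a.+1 / (a.+1)`!%:R * phi a.+1 0).
    by apply/funext => s; rewrite big_ord_recl expr0 fact0 divr1 mul1r.
  rewrite -[X in is_derive _ _ _ X]add0r; apply: is_deriveD.
  elim: N.+1 => [|M IHM].
    by rewrite big_ord0; under eq_fun do rewrite big_ord0; exact: is_derive_cst.
  rewrite big_ord_recr /=; under eq_fun do rewrite big_ord_recr /=.
  apply: is_deriveD => //.
  have dX : is_derive t (1:R) (fun s : R => s ^+ M.+1) (M.+1%:R * t ^+ M).
    exact: is_derive_pow.
  have -> : (fun x : R => x ^+ M.+1 / (M.+1)`!%:R * phi M.+1 0) =
      (fun x => ((M.+1)`!%:R^-1 * phi M.+1 0) * x ^+ M.+1).
    by apply/funext => x; ring.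
  apply: (is_derive_chain (is_derive_scale _ _) dX).
  rewrite factS natrM invfM; have : (M.+1%:R : R) != 0 by rewrite pnatr_eq0.
  move=> h; rewrite [RHS](_ : _ = (M.+1%:R^-1 * M.+1%:R) * (t ^+ M / M`!%:R * phi M.+1 0)); last by ring.
  by rewrite mulVf// mul1r.
have Hpsi' t : `|psi' t| <= B * `|t| ^+ N.+1.
  exact: (IH (fun a => phi a.+1) t (fun a t => dphi a.+1 t) HB).
have psi0 : psi 0 = 0.
  rewrite /psi big_ord_recl expr0 fact0 divr1 mul1r big1 ?addr0 ?subrr// => i _.
  by rewrite /= expr0n /= mul0r mul0r.
have cpsi : continuous psi.
  by move=> t; apply/differentiable_continuous/derivable1_diffP; have [] := dpsi t.
rewrite -/(psi v).
have fin c : `|c| <= `|v| -> `|psi' c * v| <= B * `|v| ^+ N.+2.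
  move=> cv; rewrite normrM exprSr mulrA ler_wpM2r//.
  by apply: le_trans (Hpsi' c) _; rewrite ler_wpM2l// lerXn2r// nnegrE.
case: (ltgtP v 0) => [vn|vp|->]; last by rewrite psi0 normr0 mulr_ge0// exprn_ge0.
  have [c + E] := MVT vn (fun x _ => dpsi x) (continuous_subspaceT cpsi).
  rewrite in_itv /= => /andP[c1 c2].
  have -> : psi v = psi' c * v by move: E; rewrite psi0 !sub0r mulrN => /oppr_inj.
  by apply: fin; rewrite !ltr0_norm// lerN2 ltW.
have [c + E] := MVT vp (fun x _ => dpsi x) (continuous_subspaceT cpsi).
rewrite in_itv /= => /andP[c1 c2].
have -> : psi v = psi' c * v by move: E; rewrite psi0 !subr0.
by apply: fin; rewrite !gtr0_norm// ltW.
Qed.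

Lemma ctaylor1 N (phi : nat -> R -> R[i]) B v : 0 <= B ->
  (forall a t, is_derive t (1:R) (fun s => Re (phi a s)) (Re (phi a.+1 t))) ->
  (forall a t, is_derive t (1:R) (fun s => Im (phi a s)) (Im (phi a.+1 t))) ->
  (forall t, cabs (phi N.+1 t) <= B) ->
  cabs (phi 0%N v - \sum_(a < N.+1) (v ^+ a / a`!%:R)%:C * phi a 0) <= 2 * B * `|v| ^+ N.+1.
Proof.
move=> B0 d1 d2 HB; apply: le_trans (cabs_le _) _.
rewrite Re_sub Im_sub (big_morph Re (@Re_add R) (erefl _)) (big_morph Im (@Im_add R) (erefl _)).
rewrite -mulrA mulr2n mulrDl mul1r lerD//.
  have := @taylor1 N (fun a t => Re (phi a t)) B v B0 d1 (fun t => le_trans (Re_le_cabs _) (HB t)).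
  apply: le_trans; rewrite le_eqVlt; apply/orP; left; apply/eqP.
  by congr `|_ - _|; apply: eq_bigr => a _; rewrite Re_mul /= mul0r subr0.
have := @taylor1 N (fun a t => Im (phi a t)) B v B0 d2 (fun t => le_trans (Im_le_cabs _) (HB t)).
apply: le_trans; rewrite le_eqVlt; apply/orP; left; apply/eqP.
by congr `|_ - _|; apply: eq_bigr => a _; rewrite Im_mul /= mul0r addr0.
Qed.

Variable n : nat.
Implicit Types (s : seq 'I_n) (J : 'I_n -> nat).

Definition upd J (i : 'I_n) (a : nat) : 'I_n -> nat := fun j => if j == i then a else J j.

Definition mlist J : seq 'I_n := flatten [seq nseq (J i) i | i <- enum 'I_n].

Definition multi_coef (v : 'rV[R]_n) J : R := \prod_(i < n) (v 0 i ^+ J i / (J i)`!%:R).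

(** The sum of G over the multi-indices that have degree at most N on s and agree
    with J elsewhere, as the iterated sum that a coordinatewise expansion produces. *)
Fixpoint nest (V : nmodType) (G : ('I_n -> nat) -> V) s (N : nat) J : V :=
  if s is i :: s' then \sum_(a < N.+1) nest G s' (N - a)%N (upd J i a) else G J.

Lemma mlist_upd J i a s1 s2 : enum 'I_n = s1 ++ i :: s2 ->
  (forall j, j \in s1 -> J j = 0%N) -> J i = 0%N ->
  mlist (upd J i a) = nseq a i ++ mlist J.
Proof.
move=> E H1 H2; have U : uniq (s1 ++ i :: s2) by rewrite -E enum_uniq.
move: U; rewrite cat_uniq /= negb_or => /and3P[_ /andP[is1 _] /andP[is2 _]].
have F J' s : (forall j, j \in s -> J' j = 0%N) -> flatten [seq nseq (J' j) j | j <- s] = [::].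
  elim: s => //= j s IH H; rewrite H ?mem_head//= IH// => l ls.
  by apply: H; rewrite inE ls orbT.
rewrite /mlist E !map_cat !flatten_cat /= {2}/upd eqxx H2 (F J)//.
rewrite (F (upd J i a)) => [|j js]; last first.
  by rewrite /upd; case: eqP => [ji|_]; [move: js; rewrite ji (negbTE is1)|exact: H1].
rewrite /=; congr (_ ++ flatten _); apply/eq_in_map => j js; rewrite /upd.
by case: eqP js => [->|//]; rewrite (negbTE is2).
Qed.

Lemma mcoef_upd v J i a : J i = 0%N -> multi_coef v (upd J i a) = v 0 i ^+ a / a`!%:R * multi_coef v J.
Proof.
move=> Ji; rewrite /multi_coef (bigD1 i)//= [in RHS](bigD1 i)//= {1 2}/upd eqxx Ji expr0 fact0 divr1 mul1r.
by congr (_ * _); apply: eq_bigr => j ji; rewrite /upd (negbTE ji).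
Qed.

Definition vpart (v : 'rV[R]_n) s : 'rV[R]_n := \sum_(i <- s) v 0 i *: edir R i.

(** The function is expanded successively in the coordinates listed in s.  J
    records the orders already taken in the other coordinates, Phi l stands for
    the derivative along l, and K does not depend on Phi. *)
Definition taylor_bound s N (K : R) :=
  forall (Phi : seq 'I_n -> 'rV[R]_n -> R[i]) (y v : 'rV[R]_n) (delta B : R) J,
    0 <= delta -> 0 <= B ->
    (forall l j u, cderiv j u (Phi l) (Phi (j :: l) u)) ->
    (forall l u, (size l <= size (mlist J) + N.+1)%N -> cabs (Phi l u) <= B) ->
    (forall i, `|v 0 i| <= delta) ->
    (exists s2, enum 'I_n = rev s ++ s2) -> (forall j, j \in s -> J j = 0%N) ->
    cabs ((multi_coef v J)%:C * Phi (mlist J) (y + vpart v s) -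
          nest (fun J => (multi_coef v J)%:C * Phi (mlist J) y) s N J)
      <= K * B * `|multi_coef v J| * delta ^+ N.+1.

(** Expanding in the coordinate i to order N leaves a remainder of order N + 1;
    the term of degree a in v_i then only needs an expansion to order N - a in the
    remaining coordinates, as it carries the factor delta^a. *)
Lemma taylor_nest s : forall N, exists2 K, 0 <= K & taylor_bound s N K.
Proof.
elim: s => [|i s IH] N.
  exists 0 => // Phi y v delta B J d0 B0 _ _ _ _ _ /=.
  by rewrite /vpart big_nil addr0 subrr cabs0 !mul0r.
have /choice[Ks HKs'] : forall a : nat, exists K : R, 0 <= K /\ taylor_bound s (N - a) K.
  by move=> a; have [K K0 HK] := IH (N - a)%N; exists K.
have Ks0 a : 0 <= Ks a by have [] := HKs' a.
have HKs a : taylor_bound s (N - a) (Ks a) by have [] := HKs' a.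
exists (2 + \sum_(a < N.+1) Ks a); first by rewrite addr_ge0// sumr_ge0.
move=> Phi y v delta B J d0 B0 dPhi bPhi vd [s2 E] Js.
have E' : enum 'I_n = rev s ++ i :: s2 by rewrite E rev_cons cat_rcons.
have Ji : J i = 0%N by apply: Js; rewrite mem_head.
have Js' j : j \in s -> J j = 0%N by move=> js; apply: Js; rewrite inE js orbT.
have is' : i \notin s.
  have := enum_uniq 'I_n; rewrite E' cat_uniq /= negb_or mem_rev.
  by move=> /and3P[_ /andP[] ].
have ML a : mlist (upd J i a) = nseq a i ++ mlist J.
  apply: (mlist_upd a E') => // j; rewrite mem_rev; exact: Js'.
pose z := y + vpart v s.
pose phi a t := Phi (nseq a i ++ mlist J) (z + t *: edir R i).
have T : cabs (phi 0%N (v 0 i) - \sum_(a < N.+1) (v 0 i ^+ a / a`!%:R)%:C * phi a 0)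
    <= 2 * B * `|v 0 i| ^+ N.+1.
  apply: ctaylor1 => // [a t|a t|t].
  - by have [/is_derive_line d1 /is_derive_line d2] := dPhi (nseq a i ++ mlist J) i (z + t *: edir R i).
  - by have [/is_derive_line d1 /is_derive_line d2] := dPhi (nseq a i ++ mlist J) i (z + t *: edir R i).
  - by apply: bPhi; rewrite size_cat size_nseq addnC.
have phi0 : phi 0%N (v 0 i) = Phi (mlist J) (y + vpart v (i :: s)).
  by rewrite /phi /z /vpart /= big_cons -addrA [X in _ + X]addrC.
set c := multi_coef v J.
have step : cabs (c%:C * Phi (mlist J) (y + vpart v (i :: s)) -
    \sum_(a < N.+1) (multi_coef v (upd J i a))%:C * Phi (mlist (upd J i a)) z) <= 2 * B * `|c| * delta ^+ N.+1.
  rewrite -phi0.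
  have -> : \sum_(a < N.+1) (multi_coef v (upd J i a))%:C * Phi (mlist (upd J i a)) z =
     c%:C * \sum_(a < N.+1) (v 0 i ^+ a / a`!%:R)%:C * phi a 0.
    rewrite mulr_sumr; apply: eq_bigr => a _; rewrite ML mcoef_upd// /phi scale0r addr0.
    by rewrite rmorphM /= mulrA; congr (_ * _); rewrite mulrC.
  rewrite -mulrBr cabsM cabs_real mulrC mulrAC ler_wpM2r//.
  apply: le_trans T _; rewrite ler_wpM2l ?mulr_ge0// lerXn2r// nnegrE//.
set A := c%:C * _ in step *.
set S := \sum_(a < N.+1) _ in step.
rewrite /= -[A](subrK S) -addrA; apply: le_trans (cabsD _ _) _.
rewrite [leRHS](_ : _ = 2 * B * `|c| * delta ^+ N.+1 +
  (\sum_(a < N.+1) Ks a) * B * `|c| * delta ^+ N.+1); last by ring.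
apply: lerD; first exact: step.
rewrite /S -sumrB; apply: le_trans (cabs_sum _ _ _) _.
rewrite !mulr_suml; apply: ler_sum => a _.
have aN : (a <= N)%N by have := ltn_ord a; rewrite ltnS.
have Hc : `|multi_coef v (upd J i a)| <= delta ^+ a * `|c|.
  rewrite mcoef_upd// normrM ler_wpM2r// normrM normrX normfV normr_nat.
  rewrite ler_pdivrMr ?ltr0n ?fact_gt0//; apply: (@le_trans _ _ (delta ^+ a)).
    by rewrite lerXn2r// nnegrE.
  by rewrite ler_peMr ?exprn_ge0// ler1n fact_gt0.
apply: le_trans (HKs a Phi y v delta B (upd J i a) d0 B0 dPhi _ vd _ _) _.
- move=> l u sl; apply: bPhi; apply: leq_trans sl _; rewrite ML size_cat size_nseq.
  by rewrite addnAC addnC leq_add2l -subSn// subnKC// ltnW.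
- by exists (i :: s2).
- move=> j js; rewrite /upd; case: eqP => [ji|_]; last exact: Js'.
  by move: js; rewrite ji (negbTE is').
rewrite -!mulrA ler_wpM2l// ler_wpM2l//.
apply: (@le_trans _ _ (delta ^+ a * `|c| * delta ^+ (N - a).+1)).
  by rewrite ler_wpM2r// exprn_ge0.
by rewrite mulrAC -exprD mulrC -subSn// subnKC// ltnW.
Qed.

Lemma nest_sum (V : nmodType) (G : ('I_n -> nat) -> V) N0 s N (I0 : {ffun 'I_n -> 'I_N0.+1}) :
  uniq s -> (N <= N0)%N ->
  nest G s N (fun i => I0 i) = \sum_(I : {ffun 'I_n -> 'I_N0.+1} |
     [forall j, (j \notin s) ==> (I j == I0 j)] && (\sum_(j <- s) I j <= N)%N) G (fun i => I i).
Proof.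
move=> Us; elim: s N I0 Us => [|i s IH] N I0 /=.
  move=> _ _; rewrite (bigD1 I0) /=; last first.
    by rewrite big_nil leq0n andbT; apply/forallP => j.
  rewrite big1 ?addr0// => I /andP[/andP[/forallP H _] /eqP II0]; case: II0.
  by apply/ffunP => j; apply/eqP; exact: H.
move=> /andP[is' Us] NN0.
transitivity (\sum_(a < N.+1) \sum_(I : {ffun 'I_n -> 'I_N0.+1} |
   [forall j, (j \notin s) ==> (I j == (if j == i then inord a else I0 j))] &&
   (\sum_(j <- s) I j <= N - a)%N) G (fun i => I i)).
  apply: eq_bigr => a _.
  have aN0 : (a < N0.+1)%N by rewrite ltnS (leq_trans _ NN0)// -ltnS.
  pose I1 : {ffun 'I_n -> 'I_N0.+1} := [ffun j => if j == i then inord a else I0 j].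
  have -> : upd (fun i => I0 i) i a = fun j => I1 j.
    by apply/funext => j; rewrite /upd ffunE; case: eqP => // _; rewrite inordK.
  rewrite (IH _ _ Us); last by rewrite (leq_trans (leq_subr _ _)).
  by apply: eq_bigl => I; congr (_ && _); apply: eq_forallb => j; rewrite ffunE.
rewrite (partition_big (fun I : {ffun 'I_n -> 'I_N0.+1} => inord (I i) : 'I_N.+1) predT) //=.
apply: eq_bigr => a _; apply: eq_bigl => I.
have aN0 : (a < N0.+1)%N by rewrite ltnS (leq_trans _ NN0)// -ltnS.
apply/andP/andP => [[/forallP H1 H2]|[/andP[/forallP H1]]].
  have Ii : I i = inord a :> 'I_N0.+1.
    by have := H1 i; rewrite is' eqxx => /eqP.
  have Iia : (I i : nat) = a by rewrite Ii inordK.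
  split; last by apply/eqP/val_inj; rewrite /= Iia inordK.
  apply/andP; split.
    apply/forallP => j; apply/implyP; rewrite inE negb_or => /andP[ji js].
    by have := H1 j; rewrite js (negbTE ji).
  by rewrite big_cons Iia -leq_subRL// -ltnS.
rewrite big_cons => H2 /eqP Ha.
have IiN : (I i <= N)%N by apply: leq_trans H2; exact: leq_addr.
have Iia : (I i : nat) = a by rewrite -Ha inordK.
split; last by rewrite leq_subRL -?Iia.
apply/forallP => j; apply/implyP => js; case: (j =P i) => [->|/eqP ji].
  by apply/eqP/val_inj; rewrite /= inordK.
by have := H1 j; rewrite inE negb_or ji js.
Qed.

Lemma sum_by_degree (V : nmodType) (G : ('I_n -> nat) -> V) N :
  \sum_(j < N.+1) \sum_(I : {ffun 'I_n -> 'I_j.+1} | (\sum_(i < n) I i == j)%N) G (fun i => I i) =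
  \sum_(I : {ffun 'I_n -> 'I_N.+1} | (\sum_(i < n) I i <= N)%N) G (fun i => I i).
Proof.
rewrite (partition_big (fun I : {ffun 'I_n -> 'I_N.+1} => inord (\sum_(i < n) I i) : 'I_N.+1) predT) //=.
apply: eq_bigr => j _; have jN : (j <= N)%N by rewrite -ltnS.
pose h (I : {ffun 'I_n -> 'I_j.+1}) : {ffun 'I_n -> 'I_N.+1} := [ffun i => inord (I i)].
have hE I i : (h I i : nat) = I i.
  by rewrite ffunE inordK// ltnS (leq_trans _ jN)// -ltnS.
pose h' (I : {ffun 'I_n -> 'I_N.+1}) : {ffun 'I_n -> 'I_j.+1} := [ffun i => inord (I i)].
rewrite (reindex h) /=; last first.
  exists h' => [I _|I]; first by apply/ffunP => i; apply/val_inj; rewrite ffunE /= hE inord_val.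
  rewrite inE => /andP[H1 /eqP H2]; apply/ffunP => i; apply/val_inj.
  rewrite /= hE ffunE inordK// ltnS -H2 inordK ?ltnS// (bigD1 i)//=; exact: leq_addr.
apply: eq_big => [I|I _]; last by congr G; apply/funext => i; rewrite hE.
have -> : (\sum_(i < n) h I i = \sum_(i < n) I i)%N by apply: eq_bigr => i _; rewrite hE.
apply/eqP/andP => [E|[H /eqP Hj]]; last by have := congr1 val Hj; rewrite /= inordK.
by rewrite E; split=> //; apply/eqP/val_inj; rewrite /= inordK.
Qed.

(** The sum has the shape of the truncated star product: by degree j and, for each
    j, over functions with values at most j. *)
Lemma taylor_multi N : exists2 K, 0 <= K &
  forall (Phi : seq 'I_n -> 'rV[R]_n -> R[i]) (y v : 'rV[R]_n) (delta B : R),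
    0 <= delta -> 0 <= B ->
    (forall l j u, cderiv j u (Phi l) (Phi (j :: l) u)) ->
    (forall l u, (size l <= N.+1)%N -> cabs (Phi l u) <= B) ->
    (forall i, `|v 0 i| <= delta) ->
    cabs (Phi [::] (y + v) - \sum_(j < N.+1)
       \sum_(I : {ffun 'I_n -> 'I_j.+1} | (\sum_(i < n) I i == j)%N)
         (multi_coef v (fun i => I i))%:C * Phi (mlist (fun i => I i)) y) <= K * B * delta ^+ N.+1.
Proof.
have [K K0 HK] := taylor_nest (rev (enum 'I_n)) N.
exists K => // Phi y v delta B d0 B0 dPhi bPhi vd.
pose J0 : 'I_n -> nat := fun=> 0%N.
have ml0 : mlist J0 = [::] by rewrite /mlist; elim: (enum 'I_n).
have mc0 : multi_coef v J0 = 1.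
  by rewrite /multi_coef big1// => i _; rewrite expr0 fact0 divr1.
have := HK Phi y v delta B J0 d0 B0 dPhi; rewrite ml0 add0n mc0 normr1 mulr1 mul1r.
move=> /(_ bPhi vd) H.
have := H (ex_intro _ [::] _) (fun _ _ => erefl); rewrite revK cats0 => /(_ erefl).
have -> : vpart v (rev (enum 'I_n)) = v.
  rewrite /vpart; apply/rowP => j; rewrite summxE (bigD1_seq j) ?rev_uniq ?enum_uniq ?mem_rev ?mem_enum//=.
  rewrite !mxE !eqxx mulr1 big1 ?addr0// => i ij.
  by rewrite !mxE eqxx eq_sym (negbTE ij) mulr0.
have -> : J0 = (fun i => ([ffun=> ord0] : {ffun 'I_n -> 'I_N.+1}) i) :> ('I_n -> nat).
  by apply/funext => i; rewrite ffunE.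
rewrite nest_sum ?rev_uniq ?enum_uniq//.
rewrite (sum_by_degree (fun J => (multi_coef v J)%:C * Phi (mlist J) y)).
set S1 := bigop _ _ _; set S2 := bigop _ _ _; suff -> : S1 = S2 by [].
apply: eq_bigl => I.
rewrite (perm_big (enum 'I_n)) ?perm_rev// big_enum /=.
by case: forallP => // H'; case: H' => j; rewrite mem_rev mem_enum.
Qed.

End Taylor.

(** * The matrix of a Toeplitz operator *)

Section FiniteGrid.
Variable R : realType.
Variables (n k' : nat).
Local Notation k := k'.+1.
Local Notation V := 'rV['I_k]_n.

Definition zvec (m : V) : 'rV[int]_n := \row_i (m 0 i : nat)%:Z.

Lemma Zk_vecE m : Zk_vec R m = map_mx intr (zvec m).
Proof. by apply/rowP => i; rewrite !mxE. Qed.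

(** Congruence to 0 modulo k, coordinatewise. *)
Definition kdvd (p : 'rV[int]_n) : bool := [forall i : 'I_n, (k%:Z %| p 0%R i)%Z].

(** The representative in [0, k)^n of a class modulo k. *)
Definition zred (p : 'rV[int]_n) : V := \row_i inord (absz (modz (p 0 i) k%:Z)).

Lemma zred_val p i : (zred p 0 i : nat)%:Z = modz (p 0 i) k%:Z.
Proof.
rewrite mxE inordK; last by lia.
by lia.
Qed.

Lemma kdvdP p : reflect (exists l : 'rV[int]_n, p = k%:Z *: l) (kdvd p).
Proof.
apply: (iffP forallP) => [H|[l ->] i]; last by rewrite mxE dvdz_mulr.
exists (\row_i divz (p 0 i) k%:Z); apply/rowP => i; rewrite !mxE mulrC divzK//.
Qed.

Lemma kdvd_zred p (c : V) : kdvd (p - zvec c) = (c == zred p).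
Proof.
apply/forallP/eqP => [H|-> i].
  apply/rowP => i; apply/val_inj; apply/eqP; rewrite -eqz_nat /= zred_val.
  have := H i; rewrite !mxE; have := ltn_ord (c 0 i) => l1 /dvdzP[q]; move: (p 0 i) => a Ha.
  have -> : a = q * k%:Z + (c 0 i : nat)%:Z by lia.
  by rewrite modzMDl modz_small//; lia.
rewrite !mxE; have := zred_val p i; rewrite mxE => ->.
by rewrite {1}(divz_eq (p 0 i) k%:Z) addrK dvdz_mull.
Qed.

Lemma kdvdD p q : kdvd p -> kdvd (p + q) = kdvd q.
Proof.
move=> /kdvdP[l ->]; apply/eq_forallb => i; rewrite !mxE.
by rewrite rpredDl// dvdz_mulr.
Qed.

Lemma kdvdN p : kdvd (- p) = kdvd p.
Proof. by apply/eq_forallb => i; rewrite !mxE rpredN. Qed.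

Definition grid_pt (m : V) : 'rV[R]_n := hbar R k *: Zk_vec R m.

Lemma k_neq0 : (k%:R : R) != 0. Proof. by rewrite pnatr_eq0. Qed.

Lemma sum_rV (F : 'I_n -> 'I_k -> R[i]) :
  \sum_(j : V) \prod_(i < n) F i (j 0 i) = \prod_(i < n) \sum_(a < k) F i a.
Proof.
rewrite bigA_distr_bigA /=.
rewrite (reindex (fun f : {ffun 'I_n -> 'I_k} => \row_i f i)) /=; last first.
  exists (fun j : V => [ffun i => j 0 i]) => [f _|j _].
    by apply/ffunP => i; rewrite ffunE mxE.
  by apply/rowP => i; rewrite mxE ffunE.
by apply: eq_bigr => f _; apply: eq_bigr => i _; rewrite mxE.
Qed.

Lemma expi_neq1 (t : R) : 0 < t < 2 * pi -> expi t != 1.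
Proof.
move=> /andP[t0 t1]; apply/eqP => /(congr1 (@complex.Re R)) /= H.
have : 0 < sin (t / 2) by apply: sin_gt0_pi; lra.
have : cos t = cos (t / 2) ^+ 2 - sin (t / 2) ^+ 2.
  have -> : cos t = cos (t / 2 + t / 2) by congr cos; lra.
  by rewrite cosD -!expr2.
have := cos2Dsin2 (t / 2); rewrite H => E1 E2 s0.
have : sin (t / 2) ^+ 2 = 0 by lra.
by move/eqP; rewrite sqrf_eq0 gt_eqF.
Qed.

Lemma geometric_unity (p : int) :
  \sum_(a < k) expi (2 * pi * (p%:~R * (a%:R / k%:R))) = (if (k%:Z %| p)%Z then k%:R else 0) :> R[i].
Proof.
pose z : R[i] := expi (2 * pi * (p%:~R / k%:R)).
have E (a : nat) : expi (2 * pi * (p%:~R * (a%:R / k%:R))) = z ^+ a :> R[i].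
  elim: a => [|a IH]; first by rewrite mul0r !mulr0 expi0.
  by rewrite exprS -IH /z -expiD; congr expi; rewrite -natr1; ring.
under eq_bigr do rewrite E.
case: ifP => [/dvdzP[q pq]|ndiv].
  have -> : z = 1.
    rewrite /z pq -[RHS](expi2piz R q); congr expi.
    by rewrite rmorphM /= -pmulrn mulfK// pnatr_eq0.
  by under eq_bigr do rewrite expr1n; rewrite sumr_const card_ord.
have zk : z ^+ k = 1.
  by rewrite -E mulrA divff ?k_neq0// mulr1 expi2piz.
have z1 : z != 1.
  have -> : z = expi (2 * pi * ((p %% k%:Z)%Z%:~R / k%:R)).
    rewrite /z {1}(divz_eq p k%:Z) rmorphD rmorphM /= -pmulrn [_ / k%:R]mulrDl.
    rewrite mulfK ?pnatr_eq0// mulrDr expiD expi2piz mul1r//.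
  apply: expi_neq1; have H1 : (0 < (p %% k%:Z)%Z) by lia.
  have H2 : ((p %% k%:Z)%Z < k%:Z) by lia.
  have p2 : 0 < 2 * pi :> R by rewrite mulr_gt0// pi_gt0.
  rewrite mulr_gt0 ?divr_gt0 ?ltr0z//= -[ltRHS]mulr1 ltr_pM2l//.
  by rewrite ltr_pdivrMr ?ltr0n// mul1r pmulrn ltr_int.
have := subrX1 z k; rewrite zk subrr => /esym/eqP; rewrite mulf_eq0 subr_eq0 (negbTE z1) /=.
by move/eqP.
Qed.

(** Orthogonality of the characters of (Z/k)^n: the geometric sum over a
    nontrivial k-th root of unity vanishes. *)
Lemma dft_orth (p : 'rV[int]_n) :
  (k%:R ^- n)%:C * \sum_(j : V) expi (2 * pi * dot (map_mx intr p) (grid_pt j)) = (kdvd p)%:R :> R[i].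
Proof.
have E (j : V) : expi (2 * pi * dot (map_mx intr p) (grid_pt j)) =
   \prod_(i < n) expi (2 * pi * ((p 0 i)%:~R * ((j 0 i : nat)%:R / k%:R))) :> R[i].
  rewrite -expi_sum; congr expi; rewrite /dot mulr_sumr; apply: eq_bigr => i _.
  by rewrite !mxE /hbar [k%:R^-1 * _]mulrC.
under eq_bigr do rewrite E.
rewrite (sum_rV (fun i a => expi (2 * pi * ((p 0 i)%:~R * ((a : nat)%:R / k%:R))))).
under eq_bigr do rewrite geometric_unity.
case: (boolP (kdvd p)) => [/forallP H|].
  under eq_bigr do rewrite H; rewrite prodr_const card_ord.
  rewrite rmorphV ?unitfE ?expf_neq0 ?pnatr_eq0// rmorphXn /= rmorph_nat mulVf//.
rewrite negb_forall => /existsP[i Hi].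
by rewrite (bigD1 i)//= (negbTE Hi) mul0r mulr0.
Qed.

Definition xslice (f : 'rV[R]_(n + n) -> R[i]) (y : 'rV[R]_n) := fun x => f (row_mx x y).
(** The Fourier coefficient in the variable x, as a function of y. *)
Definition fhat (f : 'rV[R]_(n + n) -> R[i]) (p : 'rV[int]_n) (y : 'rV[R]_n) := fourier_coef (xslice f y) p.

(** The matrix of the Toeplitz operator of f in the basis sigma, see [pairingE]:
    the coefficients of index b - m of f( . , m/k) for the discrete Fourier
    transform on ((1/k)Z/Z)^n. *)
Definition toeplitz_mx (f : 'rV[R]_(n + n) -> R[i]) (b m : V) : R[i] :=
  (k%:R ^- n)%:C * \sum_(j : V) f (row_mx (grid_pt j) (grid_pt m)) *
     expi (- (2 * pi * dot (map_mx intr (zvec b - zvec m)) (grid_pt j))).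

End FiniteGrid.

Section Slices.
Variable R : realType.
Variable n : nat.
Local Notation Re := (@complex.Re R).
Local Notation Im := (@complex.Im R).
Implicit Types f g : 'rV[R]_(n + n) -> R[i].

Lemma cont_row_mxl (y : 'rV[R]_n) : continuous (fun x : 'rV[R]_n => row_mx x y).
Proof.
move=> x; apply: (@cvg_rV R _ (nbhs x) _ _ (fun x => row_mx x y)) => j; case: (split_ordP j) => i ->.
  rewrite row_mxEl; under eq_fun do rewrite row_mxEl; exact: cont_coord.
by rewrite row_mxEr; under eq_fun do rewrite row_mxEr; exact: cvg_cst.
Qed.

Lemma cont_row_mxr (x : 'rV[R]_n) : continuous (fun y : 'rV[R]_n => row_mx x y).
Proof.
move=> y; apply: (@cvg_rV R _ (nbhs y) _ _ (fun y => row_mx x y)) => j; case: (split_ordP j) => i ->.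
  by rewrite row_mxEl; under eq_fun do rewrite row_mxEl; exact: cvg_cst.
rewrite row_mxEr; under eq_fun do rewrite row_mxEr; exact: cont_coord.
Qed.

Lemma edir_lshift (i : 'I_n) : edir R (lshift n i) = row_mx (edir R i) 0.
Proof. exact: delta_mx_lshift. Qed.

Lemma edir_rshift (i : 'I_n) : edir R (rshift n i) = row_mx 0 (edir R i).
Proof. exact: delta_mx_rshift. Qed.

Lemma row_mx_linel (x y : 'rV[R]_n) (s : R) i :
  row_mx (x + s *: edir R i) y = row_mx x y + s *: edir R (lshift n i).
Proof. by rewrite edir_lshift scale_row_mx add_row_mx scaler0 addr0. Qed.

Lemma row_mx_liner (x y : 'rV[R]_n) (s : R) i :
  row_mx x (y + s *: edir R i) = row_mx x y + s *: edir R (rshift n i).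
Proof. by rewrite edir_rshift scale_row_mx add_row_mx scaler0 addr0. Qed.

Lemma smooth_xslice f y : smooth f -> smooth (xslice f y).
Proof.
move=> sf; apply: (smooth_map sf (@cont_row_mxl y)) => j; right.
exists (fun=> 1), (lshift n j); split; first exact: rsmooth_cst.
by move=> u s; rewrite row_mx_linel mulr1.
Qed.

Lemma psm_xslice f y : periodic_smooth f -> periodic_smooth (xslice f y).
Proof.
move=> [sf pf]; split; first exact: smooth_xslice.
move=> l u; rewrite /xslice.
have -> : row_mx (u + map_mx intr l) y = row_mx u y + map_mx intr (row_mx l 0).
  by rewrite map_row_mx map_mx0 add_row_mx addr0.
exact: pf.
Qed.

Lemma partial_xslice f y j : smooth f -> partial j (xslice f y) = xslice (partial (lshift n j) f) y.
Proof.
move=> sf; apply/funext => x; apply: cderiv_partial.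
have := smooth_cderiv (lshift n j) (row_mx x y) sf => /is_cderive_line0 H.
by apply/is_cderive_line0; under eq_fun do rewrite /xslice row_mx_linel.
Qed.

Lemma fhat_periodic f p y (l : 'rV[int]_n) : periodic_smooth f ->
  fhat f p (y + map_mx intr l) = fhat f p y.
Proof.
move=> [_ pf]; rewrite /fhat; congr fourier_coef; apply/funext => x; rewrite /xslice.
have -> : row_mx x (y + map_mx intr l) = row_mx x y + map_mx intr (row_mx 0 l).
  by rewrite map_row_mx map_mx0 add_row_mx addr0.
exact: pf.
Qed.

(** Both functions on the torus and the quasi-periodic functions of [quasi_periodic]
    have this property, which is all that Fourier series in x require. *)
Definition xperiodic_smooth f := smooth f /\ forall y, periodic_fun (xslice f y).

Lemma psm_xpsm f : periodic_smooth f -> xperiodic_smooth f.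
Proof. by move=> pf; split=> [|y]; [case: pf|case: (psm_xslice y pf)]. Qed.

Lemma xpsm_xslice f y : xperiodic_smooth f -> periodic_smooth (xslice f y).
Proof. by move=> [sf pf]; split; [exact: smooth_xslice|exact: pf]. Qed.

Lemma fhat_partialx f p y j : xperiodic_smooth f ->
  fhat (partial (lshift n j) f) p y = (2 * pi * (p 0 j)%:~R)%:C * imag R * fhat f p y.
Proof.
move=> pf; rewrite /fhat -partial_xslice; last by case: pf.
exact: (fc_partial j p (xpsm_xslice y pf)).
Qed.

Lemma psm_partials l f : periodic_smooth f -> periodic_smooth (partials l f).
Proof. by move=> pf; elim: l => [|j l IH]; [exact: pf|exact: (psm_partial j IH)]. Qed.

Lemma fhat_partialsx f p y l : periodic_smooth f ->
  fhat (partials (map (@lshift n n) l) f) p y =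
    (\prod_(i <- l) ((2 * pi * (p 0 i)%:~R)%:C * imag R)) * fhat f p y.
Proof.
move=> pf; elim: l => [|j l IH]; first by rewrite big_nil mul1r.
rewrite big_cons -mulrA -IH /=.
exact: (fhat_partialx p y j (psm_xpsm (psm_partials _ pf))).
Qed.

Lemma fhat_bounded f B p y : periodic_smooth f -> (forall u, cabs (f u) <= B) -> cabs (fhat f p y) <= 2 * B.
Proof. by move=> pf HB; apply: fc_bound; [exact: psm_xslice|move=> x; exact: HB]. Qed.

Lemma fhat_decay r f : periodic_smooth f ->
  exists2 C, 0 <= C & forall p y, cabs (fhat f p y) <= C * pdecay R p ^+ r.
Proof.
elim: r f => [|r IH] f pf.
  have [B [_ _ HB]] := psm_bounded pf.
  have B0 : 0 <= B by apply: le_trans (HB 0); exact: cabs_ge0.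
  exists (2 * B); first exact: mulr_ge0.
  by move=> p y; rewrite expr0 mulr1; exact: fhat_bounded.
have pL := psm_laplDs (map (@lshift n n) (enum 'I_n)) pf.
have [C C0 HC] := IH _ pL.
exists C => // p y.
have E : xslice (laplDs (map (@lshift n n) (enum 'I_n)) f) y = laplDs (enum 'I_n) (xslice f y).
  elim: (enum 'I_n) => [|j l IHl]; first by [].
  rewrite [RHS]/(laplD j (laplDs l (xslice f y))) -IHl.
  have pg := psm_laplDs [seq lshift n i | i <- l] pf; set g := laplDs _ f in pg *.
  transitivity (xslice (laplD (lshift n j) g) y); first by [].
  apply/funext => x; rewrite /laplD (partial_xslice y j pg.1).
  by rewrite (partial_xslice y j (psm_partial (lshift n j) pg).1).
apply: le_trans (fc_laplDs p (psm_xslice y pf)) _; rewrite exprS mulrCA ler_wpM2l ?(ltW (pdecay_gt0 _ _))//.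
by rewrite -E; exact: HC.
Qed.

Lemma cderiv_fhat f p j y : periodic_smooth f ->
  cderiv j y (fhat f p) (fhat (partial (rshift n j) f) p y).
Proof.
move=> pf; have pf' := psm_partial (rshift n j) pf.
have [B HB] := psm_bounded pf; have [B' HB'] := psm_bounded pf'.
apply/is_cderive_line0.
have -> : fhat (partial (rshift n j) f) p y =
    fourier_coef (fun x => partial (rshift n j) f (row_mx x (y + (0 : R) *: edir R j))) p.
  by rewrite scale0r addr0.
apply: (@is_cderive_fc R n (fun s x => f (row_mx x (y + s *: edir R j)))
   (fun s x => partial (rshift n j) f (row_mx x (y + s *: edir R j))) B B').
- by move=> s; exact: (cbounded_comp (@cont_row_mxl _) HB).
- by move=> s; exact: (cbounded_comp (@cont_row_mxl _) HB').
move=> s x; rewrite row_mx_liner; under eq_fun do rewrite row_mx_liner.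
by apply/is_cderive_line; exact: smooth_cderiv pf.1.
Qed.

(** One constant for all derivatives of order at most L, as the Taylor remainder
    involves all derivatives of a given order. *)
Lemma fhat_decay_all r L f : periodic_smooth f -> exists2 C, 0 <= C &
  forall l p y, (size l <= L)%N ->
    cabs (fhat (partials (map (@rshift n n) l) f) p y) <= C * pdecay R p ^+ r.
Proof.
elim: L f => [|L IH] f pf.
  by have [C C0 HC] := fhat_decay r pf; exists C => // -[|//] p y _; exact: HC.
have [C C0 HC] := fhat_decay r pf.
have /choice[Cs HCs] : forall j : 'I_n, exists C, 0 <= C /\ forall l p y, (size l <= L)%N ->
    cabs (fhat (partials (map (@rshift n n) l) (partial (rshift n j) f)) p y) <= C * pdecay R p ^+ r.
  by move=> j; have [C1 C10 H1] := IH _ (psm_partial (rshift n j) pf); exists C1.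
have Cs0 j : 0 <= Cs j by have [] := HCs j.
exists (C + \sum_j Cs j); first by rewrite addr_ge0// sumr_ge0.
have pp p : 0 <= pdecay R p ^+ r by rewrite exprn_ge0// pdecay_ge0.
move=> l p y; case: (lastP l) => [_|l' j].
  by apply: le_trans (HC p y) _; rewrite ler_wpM2r// lerDl sumr_ge0.
rewrite size_rcons ltnS => sl.
have [_ /(_ l' p y sl) H] := HCs j.
have -> : partials [seq rshift n i | i <- rcons l' j] f =
   partials [seq rshift n i | i <- l'] (partial (rshift n j) f).
  by rewrite map_rcons; elim: l' {sl H} => //= i l' ->.
apply: le_trans H _; rewrite ler_wpM2r// (bigD1 j)//= addrCA lerDl addr_ge0// sumr_ge0//.
Qed.

End Slices.

(** * Composition and star product of the matrices *)

Section CcvgMore.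
Variable R : realType.

Lemma ccvg_sum_cond (I : Type) (r : seq I) (P : pred I) (F : I -> nat -> R[i]) (L : I -> R[i]) :
  (forall i, P i -> ccvg (F i) (L i)) ->
  ccvg (fun n => \sum_(i <- r | P i) F i n) (\sum_(i <- r | P i) L i).
Proof.
move=> H; elim: r => [|i r IH].
  by rewrite big_nil; under eq_fun do rewrite big_nil; exact: ccvg_cst.
rewrite big_cons; under eq_fun do rewrite big_cons.
by case: ifP => // Pi; apply: ccvgD => //; exact: H.
Qed.

Lemma cabs_phase (z : R[i]) : exists2 w : R[i], cabs w = 1 & w * z = (cabs z)%:C.
Proof.
have [->|z0] := eqVneq z 0; first by exists 1; rewrite ?cabs1// mulr0 cabs0.
have c0 : cabs z != 0 by apply: contra_neq z0; exact: cabs_eq0.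
exists (conjc z * ((cabs z)^-1)%:C).
  by rewrite cabsM cabsJ cabs_real normfV ger0_norm ?cabs_ge0// divff.
by rewrite mulrAC [conjc z * z]mulrC cabs_sqrE -rmorphM expr2 -mulrA divff// mulr1.
Qed.

(** Fatou's lemma for finite sums of moduli, through the phases of the limits. *)
Lemma ccvg_cabs_sum_le (I : Type) (r : seq I) (F : I -> nat -> R[i]) (L : I -> R[i]) (B : R) :
  (forall i, ccvg (F i) (L i)) -> (forall M, \sum_(i <- r) cabs (F i M) <= B) ->
  \sum_(i <- r) cabs (L i) <= B.
Proof.
move=> H HB; have /choice[w Hw] : forall i, exists w : R[i], cabs w = 1 /\ w * L i = (cabs (L i))%:C.
  by move=> i; have [w w1 w2] := cabs_phase (L i); exists w.
have : cabs (\sum_(i <- r) w i * L i) <= B.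
  apply: (@ccvg_le R (fun M => \sum_(i <- r) w i * F i M)).
    by apply: ccvg_sum => i; apply: ccvgM => //; exact: ccvg_cst.
  move=> M; apply: le_trans (cabs_sum _ _ _) _; apply: le_trans (HB M).
  by apply: ler_sum => i _; rewrite cabsM (Hw i).1 mul1r.
under eq_bigr do rewrite (Hw _).2.
rewrite -rmorph_sum cabs_real; apply: le_trans; exact: ler_norm.
Qed.

(** Cauchy-Schwarz with the weights |E b m|: the square of a row of E u is at most
    B times the sum of |E b m| |u m|^2, and summing over b uses the columns. *)
Lemma schur_test (I : finType) (E : I -> I -> R[i]) (B : R) :
  (forall m, \sum_b cabs (E b m) <= B) -> (forall b, \sum_m cabs (E b m) <= B) ->
  forall u : I -> R[i],
  \sum_b cabs (\sum_m E b m * u m) ^+ 2 <= B ^+ 2 * \sum_m cabs (u m) ^+ 2.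
Proof.
move=> H1 H2 u.
have cs (b : I) : cabs (\sum_m E b m * u m) ^+ 2 <= B * \sum_m cabs (E b m) * cabs (u m) ^+ 2.
  set S := \sum_m cabs (E b m) * cabs (u m) ^+ 2.
  set t := cabs (\sum_m E b m * u m).
  have t0 : 0 <= t by exact: cabs_ge0.
  have S0 : 0 <= S by apply: sumr_ge0 => m _; rewrite mulr_ge0 ?cabs_ge0 ?exprn_ge0 ?cabs_ge0.
  have A0 : 0 <= \sum_m cabs (E b m) by apply: sumr_ge0 => m _; exact: cabs_ge0.
  have tle : t <= \sum_m cabs (E b m) * cabs (u m).
    by apply: le_trans (cabs_sum _ _ _) _; apply: ler_sum => m _; rewrite cabsM.
  (* from 2 s |u m| <= s^2 + |u m|^2, to be used with s = t / B *)
  have key (s : R) : 2 * s * t <= s ^+ 2 * B + S \/ s < 0.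
    have [s0|] := leP 0 s; last by right.
    left; apply: (@le_trans _ _ (s ^+ 2 * (\sum_m cabs (E b m)) + S)); last first.
      by rewrite lerD2r ler_wpM2l ?sqr_ge0.
    apply: (@le_trans _ _ (2 * s * \sum_m cabs (E b m) * cabs (u m))).
      by rewrite ler_wpM2l// mulr_ge0.
    rewrite !mulr_sumr -big_split; apply: ler_sum => m _ /=.
    rewrite -subr_ge0; have -> : s ^+ 2 * cabs (E b m) + cabs (E b m) * cabs (u m) ^+ 2 -
      2 * s * (cabs (E b m) * cabs (u m)) = cabs (E b m) * (s - cabs (u m)) ^+ 2 by ring.
    by rewrite mulr_ge0 ?cabs_ge0 ?sqr_ge0.
  have B0 : 0 <= B by exact: le_trans A0 (H2 b).
  have [B1|B1] := eqVneq B 0.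
    have Z m : cabs (E b m) = 0.
      apply/eqP; rewrite eq_le cabs_ge0 andbT -B1; apply: le_trans (H2 b).
      by rewrite (bigD1 m)//= lerDl sumr_ge0// => j _; exact: cabs_ge0.
    have t00 : t = 0.
      by apply/eqP; rewrite eq_le t0 andbT; apply: le_trans tle _; rewrite big1// => m _; rewrite Z mul0r.
    by rewrite t00 expr0n /= B1 mul0r.
  have Bp : 0 < B by rewrite lt_def B1.
  have [H|H] := key (t / B); last by move: H; rewrite ltNge divr_ge0.
  have E1 : 2 * (t / B) * t = 2 * (t ^+ 2 / B) by field.
  have E2 : (t / B) ^+ 2 * B = t ^+ 2 / B by field.
  move: H; rewrite E1 E2 => H; rewrite mulrC -ler_pdivrMr//; lra.
apply: le_trans (ler_sum _ (fun b _ => cs b)) _.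
rewrite -mulr_sumr expr2 -mulrA; case: (pickP (fun _ : I => true)) => [i0 _|I0]; last first.
  by rewrite big_pred0// [in X in _ <= X]big_pred0// !mulr0.
have B0 : 0 <= B by apply: le_trans (H2 i0); apply: sumr_ge0 => m _; exact: cabs_ge0.
rewrite ler_wpM2l// exchange_big /= mulr_sumr; apply: ler_sum => m _.
by rewrite -mulr_suml ler_wpM2r// exprn_ge0// cabs_ge0.
Qed.

End CcvgMore.

Section MatrixEstimate.
Variable R : realType.
Variables (n k' : nat).
Local Notation k := k'.+1.
Local Notation V := 'rV['I_k]_n.
Local Notation grid_pt := (@grid_pt R n k').
Local Notation toeplitz_mx := (@toeplitz_mx R n k').
Implicit Types f g : 'rV[R]_(n + n) -> R[i].

Lemma chrD (p q : 'rV[int]_n) (x : 'rV[R]_n) : chr (p + q) x = chr p x * chr q x.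
Proof. by rewrite /chr map_mxD dotDl mulrDr expiD. Qed.

Lemma dft_chr (p q : 'rV[int]_n) :
  (k%:R ^- n)%:C * \sum_(j : V) chr p (grid_pt j) * expi (- (2 * pi * dot (map_mx intr q) (grid_pt j)))
  = (kdvd k' (p - q))%:R.
Proof.
rewrite -(@dft_orth R); congr (_ * _); apply: eq_bigr => j _.
rewrite /chr -expiD -mulrN -mulrDr map_mxB dotDl; congr (expi (_ * (_ + _))).
by rewrite /dot -sumrN; apply: eq_bigr => i _; rewrite !mxE mulNr.
Qed.

(** Inserting the Fourier series of f( . , m/k), the discrete Fourier transform
    selects the indices congruent to b - m (aliasing). *)
Lemma mat_fourier f b m : periodic_smooth f -> ccvg (fun M => \sum_(p <- zbox M n)
   (kdvd k' (p - (zvec b - zvec m)))%:R * fhat f p (grid_pt m)) (toeplitz_mx f b m).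
Proof.
move=> pf; have H (j : V) : ccvg (fun M => fsum (xslice f (grid_pt m)) M (grid_pt j)) (f (row_mx (grid_pt j) (grid_pt m))).
  exact: (fourier_inversion (grid_pt j) (psm_xslice (grid_pt m) pf)).
have := ccvgM (ccvg_cst (k%:R ^- n)%:C) (ccvg_sum (index_enum V) (fun j => ccvgM (H j) (ccvg_cst
  (expi (- (2 * pi * dot (map_mx intr (zvec b - zvec m)) (grid_pt j))))))).
congr ccvg; apply/funext => M; rewrite /fsum.
under eq_bigr do rewrite mulr_suml.
rewrite exchange_big /= mulr_sumr; apply: eq_bigr => p _.
rewrite -dft_chr -mulrA; congr (_ * _); rewrite mulr_suml; apply: eq_bigr => j _.
by rewrite /fhat; ring.
Qed.

Lemma mat_mul_fourier f g b m : periodic_smooth f -> periodic_smooth g ->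
  ccvg (fun M => \sum_(q <- zbox M n) \sum_(p <- zbox M n)
   (kdvd k' (q + p - (zvec b - zvec m)))%:R * (fhat f q (grid_pt m) * fhat g p (grid_pt m)))
   (toeplitz_mx (fun u => f u * g u) b m).
Proof.
move=> pf pg.
have Hf (j : V) := fourier_inversion (grid_pt j) (psm_xslice (grid_pt m) pf).
have Hg (j : V) := fourier_inversion (grid_pt j) (psm_xslice (grid_pt m) pg).
have := ccvgM (ccvg_cst (k%:R ^- n)%:C) (ccvg_sum (index_enum V) (fun j => ccvgM (ccvgM (Hf j) (Hg j)) (ccvg_cst
  (expi (- (2 * pi * dot (map_mx intr (zvec b - zvec m)) (grid_pt j))))))).
congr ccvg; apply/funext => M; rewrite /fsum.
under eq_bigr do rewrite !mulr_suml.
rewrite exchange_big /= mulr_sumr; apply: eq_bigr => q _.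
under eq_bigr do rewrite mulr_sumr mulr_suml.
rewrite exchange_big /= mulr_sumr; apply: eq_bigr => p _.
rewrite -dft_chr -mulrA; congr (_ * _); rewrite mulr_suml; apply: eq_bigr => j _.
by rewrite chrD /fhat; ring.
Qed.

(** Reducing the index m + p modulo k changes the point m/k + p/k by an integral
    vector only. *)
Lemma grid_pt_zred (m : V) (p : 'rV[int]_n) : exists l : 'rV[int]_n,
  grid_pt m + hbar R k *: map_mx intr p = grid_pt (zred k' (zvec m + p)) + map_mx intr l.
Proof.
have : kdvd k' (zvec m + p - zvec (zred k' (zvec m + p))) by rewrite kdvd_zred eqxx.
move=> /kdvdP[l Hl]; exists l.
rewrite /grid_pt !Zk_vecE -scalerDr -map_mxD -[zvec m + p](subrK (zvec (zred k' (zvec m + p)))) Hl.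
rewrite addrC map_mxD scalerDr; congr (_ + _).
  by congr (_ *: map_mx _ (zvec (zred _ _))); rewrite -Hl addrC subrK.
apply/rowP => i; rewrite !mxE /= intrM -pmulrn mulrA /hbar mulVf ?mul1r//.
Qed.

(** In the series of toeplitz_mx g c m only p with c = m + p modulo k contribute;
    for such p the first factor is evaluated at c/k, which is m/k + p/k modulo
    Z^n. *)
Lemma mat_comp_fourier f g b m : periodic_smooth f -> periodic_smooth g ->
  ccvg (fun M => \sum_(q <- zbox M n) \sum_(p <- zbox M n)
   (kdvd k' (q + p - (zvec b - zvec m)))%:R *
     (fhat f q (grid_pt m + hbar R k *: map_mx intr p) * fhat g p (grid_pt m)))
   (\sum_(c : V) toeplitz_mx f b c * toeplitz_mx g c m).
Proof.
move=> pf pg.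
have := ccvg_sum (index_enum V) (fun c => ccvgM (mat_fourier b c pf) (mat_fourier c m pg)).
congr ccvg; apply/funext => M.
under eq_bigr do rewrite mulr_suml.
rewrite exchange_big /=; apply: eq_bigr => q _.
under eq_bigr do rewrite mulr_sumr.
rewrite exchange_big /=; apply: eq_bigr => p _.
have E (c : V) : kdvd k' (p - (zvec c - zvec m)) = (c == zred k' (zvec m + p)).
  by rewrite -kdvd_zred; congr kdvd; rewrite opprB addrCA addrA.
under eq_bigr do rewrite E.
rewrite (bigD1 (zred k' (zvec m + p)))//= eqxx mul1r big1 ?addr0; last first.
  by move=> c /negbTE ->; rewrite mul0r mulr0.
have [l ->] := grid_pt_zred m p; rewrite (fhat_periodic _ _ _ pf) mulrA; congr (_ * _ * _).
set c := zred _ _; have kc : kdvd k' (zvec m + p - zvec c) by rewrite kdvd_zred eqxx.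
have kc' : kdvd k' (- (zvec m + p - zvec c)) by rewrite kdvdN.
rewrite -(kdvdD (q + p - (zvec b - zvec m)) kc').
congr ((nat_of_bool (kdvd _ _))%:R); apply/rowP => i; rewrite !mxE; ring.
Qed.

Lemma mat_sum (I : Type) (r : seq I) (P : pred I) (F : I -> 'rV[R]_(n + n) -> R[i]) b m :
  toeplitz_mx (fun u => \sum_(i <- r | P i) F i u) b m = \sum_(i <- r | P i) toeplitz_mx (F i) b m.
Proof.
rewrite /toeplitz_mx; under eq_bigr do rewrite mulr_suml.
by rewrite exchange_big mulr_sumr.
Qed.

Lemma mat_scale a f b m : toeplitz_mx (fun u => a * f u) b m = a * toeplitz_mx f b m.
Proof. by rewrite /toeplitz_mx [RHS]mulrCA; congr (_ * _); rewrite mulr_sumr; apply: eq_bigr => j _; rewrite mulrA. Qed.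

Lemma prod_mlist (W : comPzSemiRingType) (J : 'I_n -> nat) (F : 'I_n -> W) :
  \prod_(i <- mlist J) F i = \prod_(i < n) F i ^+ J i.
Proof.
rewrite /mlist -[in RHS]big_enum /=; elim: (enum 'I_n) => [|i l IH]; first by rewrite !big_nil.
rewrite /= big_cat big_cons IH; congr (_ * _).
by elim: (J i) => [|j IHj]; [rewrite big_nil|rewrite /= big_cons IHj exprS].
Qed.

Lemma mpartialE d (j : 'I_n -> 'I_d) (J : 'I_n -> nat) (f : 'rV[R]_d -> R[i]) :
  mpartial j J f = partials (map j (mlist J)) f.
Proof.
rewrite /mpartial /mlist map_flatten -map_comp; congr (partials (flatten _) _).
by apply: eq_map => i /=; rewrite map_nseq.
Qed.

Lemma imag_neq0 : imag R != 0.
Proof. by apply/eqP => -[/eqP]; rewrite oner_eq0. Qed.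

(** The x-derivatives of the star product contribute (2 pi i p)^I, which cancels
    the powers of 2 pi i in its coefficients and leaves the coefficient
    (p/k)^I / I! of a Taylor polynomial in the increment p/k. *)
Lemma star_symbol g p y (j : nat) (I : 'I_n -> nat) : periodic_smooth g -> (\sum_(i < n) I i)%N = j ->
  (hbar R k ^+ j)%:C * (((2 * pi)%:C * imag R) ^- j *
    ((\prod_(i < n) (I i)`!)%N%:R)^-1) * fhat (mpartial (@lshift n n) I g) p y =
  (multi_coef (hbar R k *: map_mx intr p) I)%:C * fhat g p y.
Proof.
move=> pg Ij; rewrite mpartialE (fhat_partialsx p y _ pg) mulrA; congr (_ * _).
rewrite prod_mlist.
have -> : \prod_(i < n) ((2 * pi * (p 0 i)%:~R)%:C * imag R) ^+ I i =
   ((2 * pi)%:C * imag R) ^+ j * (\prod_(i < n) (p 0 i)%:~R ^+ I i)%:C.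
  rewrite -Ij -prodrXr rmorph_prod -big_split; apply: eq_bigr => i _ /=.
  by rewrite rmorphM rmorphXn -exprMn; congr (_ ^+ _); rewrite mulrAC.
have z0 : ((2 * pi)%:C * imag R) ^+ j != 0 :> R[i].
  rewrite expf_neq0// mulf_neq0 ?imag_neq0//; apply/eqP => -[/eqP].
  by rewrite mulf_eq0 pnatr_eq0 /= gt_eqF// pi_gt0.
have -> : multi_coef (hbar R k *: map_mx intr p) I =
    hbar R k ^+ j * (\prod_(i < n) (I i)`!)%N%:R^-1 * \prod_(i < n) (p 0 i)%:~R ^+ I i.
  rewrite /multi_coef -Ij -prodrXr natr_prod -prodfV -!big_split; apply: eq_bigr => i _ /=.
  by rewrite !mxE exprMn mulrAC.
set z := _ ^+ j in z0 *; move: z0; clearbody z => z0.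
rewrite !rmorphM /= fmorphV rmorph_nat.
set d := (\prod_(i < n) (I i)`!)%N%:R; set a := (hbar R k ^+ j)%:C; set w := (\prod_(i < n) _)%:C.
by transitivity ((z^-1 * z) * (a / d * w)); [ring|rewrite mulVf// mul1r].
Qed.

Lemma star_fourier N f g b m : periodic_smooth f -> periodic_smooth g ->
  ccvg (fun M => \sum_(q <- zbox M n) \sum_(p <- zbox M n)
   (kdvd k' (q + p - (zvec b - zvec m)))%:R *
     ((\sum_(j < N.+1) \sum_(I : {ffun 'I_n -> 'I_j.+1} | (\sum_(i < n) I i == j)%N)
        (multi_coef (hbar R k *: map_mx intr p) (fun i => I i))%:C *
        fhat (partials (map (@rshift n n) (mlist (fun i => I i))) f) q (grid_pt m)) * fhat g p (grid_pt m)))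
   (toeplitz_mx (star_trunc k N f g) b m).
Proof.
move=> pf pg.
pose cf (j : nat) (I : {ffun 'I_n -> 'I_j.+1}) : R[i] := (hbar R k ^+ j)%:C *
  (((2 * pi)%:C * imag R) ^- j * ((\prod_(i < n) (I i)`!)%N%:R)^-1).
have -> : toeplitz_mx (star_trunc k N f g) b m = \sum_(j < N.+1)
   \sum_(I : {ffun 'I_n -> 'I_j.+1} | (\sum_(i < n) I i == j)%N)
    cf j I * toeplitz_mx (fun u => mpartial (@rshift n n) (fun i => I i) f u *
      mpartial (@lshift n n) (fun i => I i) g u) b m.
  rewrite /star_trunc mat_sum; apply: eq_bigr => j _; rewrite mat_scale /star_coef mat_scale.
  rewrite mat_sum !mulr_sumr; apply: eq_bigr => I _; rewrite /cf -!mulrA; congr (_ * (_ * _)).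
  by rewrite -mat_scale; congr toeplitz_mx; apply/funext => u; rewrite !mulrA.
have pa (d : 'I_n -> 'I_(n + n)) I (h : 'rV[R]_(n + n) -> R[i]) : periodic_smooth h -> periodic_smooth (mpartial d I h) by exact: psm_partials.
have := ccvg_sum_cond (index_enum 'I_N.+1) (fun (j : 'I_N.+1) (_ : true) => ccvg_sum_cond
  (index_enum {ffun 'I_n -> 'I_j.+1}) (fun (I : {ffun 'I_n -> 'I_j.+1}) (_ : (\sum_(i < n) I i == j)%N) =>
    ccvgM (ccvg_cst (cf j I)) (mat_mul_fourier b m (pa (@rshift n n) (fun i => I i) f pf)
       (pa (@lshift n n) (fun i => I i) g pg)))).
congr ccvg; apply/funext => M.
under [RHS]eq_bigr do under eq_bigr do rewrite mulr_suml mulr_sumr.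
under [RHS]eq_bigr do rewrite exchange_big /=.
rewrite [RHS]exchange_big /=; apply: eq_bigr => j _.
under [RHS]eq_bigr do under eq_bigr do rewrite mulr_suml mulr_sumr.
under [RHS]eq_bigr do rewrite exchange_big /=.
rewrite [RHS]exchange_big /=; apply: eq_bigr => I /eqP Ij.
rewrite mulr_sumr; apply: eq_bigr => q _; rewrite mulr_sumr; apply: eq_bigr => p _.
have := star_symbol p (grid_pt m) pg Ij; rewrite -/(cf j I) => H.
rewrite -mpartialE [X in _ = _ * X]mulrAC -H; ring.
Qed.

End MatrixEstimate.

Section Estimate.
Variable R : realType.
Variable n : nat.
Implicit Types f g : 'rV[R]_(n + n) -> R[i].

Lemma cabs_bool (b : bool) : cabs (b%:R : R[i]) = b%:R.
Proof. by case: b; rewrite ?cabs1 ?cabs0. Qed.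

Lemma sum_kdvd_l k' (p : 'rV[int]_n) (m : 'rV['I_k'.+1]_n) :
  \sum_(b : 'rV['I_k'.+1]_n) (kdvd k' (p - (zvec b - zvec m)))%:R = 1 :> R.
Proof.
have E (b : 'rV['I_k'.+1]_n) : kdvd k' (p - (zvec b - zvec m)) = (b == zred k' (p + zvec m)).
  by rewrite -kdvd_zred; congr kdvd; rewrite opprB addrA.
under eq_bigr do rewrite E.
by rewrite (bigD1 (zred k' (p + zvec m)))//= eqxx big1 ?addr0// => b /negbTE ->.
Qed.

Lemma sum_kdvd_r k' (p : 'rV[int]_n) (b : 'rV['I_k'.+1]_n) :
  \sum_(m : 'rV['I_k'.+1]_n) (kdvd k' (p - (zvec b - zvec m)))%:R = 1 :> R.
Proof.
have E (m : 'rV['I_k'.+1]_n) : kdvd k' (p - (zvec b - zvec m)) = (m == zred k' (zvec b - p)).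
  by rewrite -kdvd_zred -kdvdN; congr kdvd; rewrite !opprB addrAC.
under eq_bigr do rewrite E.
by rewrite (bigD1 (zred k' (zvec b - p)))//= eqxx big1 ?addr0// => m /negbTE ->.
Qed.

Lemma pdecay_coord (p : 'rV[int]_n) i : pdecay R p * `|(p 0 i)%:~R| <= 1.
Proof.
rewrite /pdecay (bigD1 i)//= mulrAC.
have H : \prod_(j < n | j != i) zdecay R (p 0 j) <= 1.
  apply: prodr_ile1 => j _; rewrite zdecay_ge0 /=; exact: decay_le1.
have H0 : 0 <= \prod_(j < n | j != i) zdecay R (p 0 j) by apply: prodr_ge0 => j _; exact: zdecay_ge0.
have : zdecay R (p 0 i) * `|(p 0 i)%:~R| <= 1.
  rewrite /zdecay /decay; set a := (p 0 i)%:~R; rewrite mulrC ler_pdivrMr ?mul1r.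
    by rewrite -[a ^+ 2]real_normK ?num_real//; set c := `|a|; nra.
  by rewrite ltr_pwDl// sqr_ge0.
have : 0 <= zdecay R (p 0 i) * `|(p 0 i)%:~R| by rewrite mulr_ge0// zdecay_ge0.
by move=> h0 h1; rewrite mulr_ile1.
Qed.

(** The two series of [mat_comp_fourier] and [star_fourier] differ, term by term,
    by the Taylor remainder of [fhat f q] at m/k with increment p/k.  The terms
    are dominated by a summable family times hbar^(N+1), and for given q, p and m
    exactly one b occurs, so that sums over b (or m) cost nothing. *)
Lemma matrix_estimate N f g : periodic_smooth f -> periodic_smooth g -> exists2 K : R, 0 <= K & forall k',
  let E (b m : 'rV['I_k'.+1]_n) := \sum_c toeplitz_mx f b c * toeplitz_mx g c m - toeplitz_mx (star_trunc k'.+1 N f g) b m in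
  (forall m, \sum_b cabs (E b m) <= K * hbar R k'.+1 ^+ N.+1) /\
  (forall b, \sum_m cabs (E b m) <= K * hbar R k'.+1 ^+ N.+1).
Proof.
move=> pf pg.
have [KT KT0 HT] := @taylor_multi R n N.
have [C C0 HC] := fhat_decay_all 1 N.+1 pf.
have [C' C'0 HC'] := fhat_decay N.+2 pg.
pose Z := Zmass R; have Z0 : 0 <= Z by exact: Zmass_ge0.
exists (KT * C * C' * (Z ^+ n * Z ^+ n)); first by rewrite !mulr_ge0// exprn_ge0.
move=> k' E; set h := hbar R k'.+1.
have h0 : 0 <= h by rewrite /h /hbar invr_ge0.
pose kd (q p : 'rV[int]_n) (b m : 'rV['I_k'.+1]_n) := kdvd k' (q + p - (zvec b - zvec m)).
pose X q p (m : 'rV['I_k'.+1]_n) : R[i] :=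
 (fhat f q (grid_pt R m + h *: map_mx intr p) - \sum_(j < N.+1)
     \sum_(I : {ffun 'I_n -> 'I_j.+1} | (\sum_(i < n) I i == j)%N)
        (multi_coef (h *: map_mx intr p) (fun i => I i))%:C *
        fhat (partials (map (@rshift n n) (mlist (fun i => I i))) f) q (grid_pt R m)) * fhat g p (grid_pt R m).
(* |p_i| is at most 1 / pdecay(p), and the power N + 1 of this factor in the Taylor
   remainder is absorbed by the decay of order N + 2 of fhat g *)
pose W (q p : 'rV[int]_n) := KT * C * C' * h ^+ N.+1 * (pdecay R q * pdecay R p).
have XW q p m : cabs (X q p m) <= W q p.
  have dp := pdecay_gt0 R p.
  have H : cabs (fhat f q (grid_pt R m + h *: map_mx intr p) - \sum_(j < N.+1)
     \sum_(I : {ffun 'I_n -> 'I_j.+1} | (\sum_(i < n) I i == j)%N)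
        (multi_coef (h *: map_mx intr p) (fun i => I i))%:C *
        fhat (partials (map (@rshift n n) (mlist (fun i => I i))) f) q (grid_pt R m)) <=
        KT * (C * pdecay R q) * (h / pdecay R p) ^+ N.+1.
    apply: (HT (fun l => fhat (partials (map (@rshift n n) l) f) q)).
    - by rewrite divr_ge0// ltW.
    - by rewrite mulr_ge0// pdecay_ge0.
    - by move=> l j u; apply: cderiv_fhat; exact: psm_partials.
    - by move=> l u sl; rewrite -[pdecay R q]expr1; exact: HC.
    - move=> i; rewrite !mxE normrM (ger0_norm h0) ler_wpM2l//.
      by rewrite -[leRHS]mulr1 ler_pdivlMl// pdecay_coord.
  rewrite /X cabsM; apply: le_trans (ler_pM _ _ H (HC' p _)) _; rewrite ?cabs_ge0//.
  rewrite /W expr_div_n le_eqVlt; apply/orP; left; apply/eqP.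
  by rewrite [pdecay R p ^+ N.+2]exprS; field; rewrite expf_neq0// gt_eqF.
have EX b m : ccvg (fun M => \sum_(q <- zbox M n) \sum_(p <- zbox M n) (kd q p b m)%:R * X q p m) (E b m).
  have := ccvgB (mat_comp_fourier b m pf pg) (star_fourier N b m pf pg).
  congr ccvg; apply/funext => M; rewrite -sumrB; apply: eq_bigr => q _.
  by rewrite -sumrB; apply: eq_bigr => p _; rewrite -mulrBr -mulrBl.
have WZ M : \sum_(q <- zbox M n) \sum_(p <- zbox M n) W q p <=
   KT * C * C' * (Z ^+ n * Z ^+ n) * h ^+ N.+1.
  have -> : \sum_(q <- zbox M n) \sum_(p <- zbox M n) W q p = KT * C * C' * h ^+ N.+1 *
      ((\sum_(q <- zbox M n) pdecay R q) * (\sum_(p <- zbox M n) pdecay R p)).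
    by rewrite mulr_suml mulr_sumr; apply: eq_bigr => q _; rewrite !mulr_sumr.
  have s0 : 0 <= \sum_(q <- zbox M n) pdecay R q by apply: sumr_ge0 => p _; exact: pdecay_ge0.
  rewrite [leRHS]mulrAC ler_wpM2l ?mulr_ge0 ?exprn_ge0//.
  by apply: ler_pM => //; exact: pdecay_sum.
have EB b m M : cabs (\sum_(q <- zbox M n) \sum_(p <- zbox M n) (kd q p b m)%:R * X q p m) <=
    \sum_(q <- zbox M n) \sum_(p <- zbox M n) (kd q p b m)%:R * W q p.
  apply: le_trans (cabs_sum _ _ _) _; apply: ler_sum => q _.
  apply: le_trans (cabs_sum _ _ _) _; apply: ler_sum => p _.
  by rewrite cabsM cabs_bool ler_wpM2l// XW.
split=> [m|b].
  apply: (ccvg_cabs_sum_le (fun b => EX b m)) => M; apply: le_trans (WZ M).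
  apply: le_trans (ler_sum _ (fun b _ => EB b m M)) _.
  rewrite exchange_big /=; apply: ler_sum => q _.
  rewrite exchange_big /=; apply: ler_sum => p _.
  by rewrite -mulr_suml sum_kdvd_l mul1r.
apply: (ccvg_cabs_sum_le (fun m => EX b m)) => M; apply: le_trans (WZ M).
apply: le_trans (ler_sum _ (fun m _ => EB b m M)) _.
rewrite exchange_big /=; apply: ler_sum => q _.
rewrite exchange_big /=; apply: ler_sum => p _.
by rewrite -mulr_suml sum_kdvd_r mul1r.
Qed.

End Estimate.

(** * Sections as quasi-periodic functions *)

Section C1.
Variable R : realType.
Local Notation Re := (@complex.Re R).
Local Notation Im := (@complex.Im R).
Local Notation mu := (@lebesgue_measure R).
Local Notation I01 := (`[0, 1]%classic : set R).

Lemma smooth_cint01 d (H : 'rV[R]_d.+1 -> R[i]) : smooth H ->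
  smooth (fun u : 'rV[R]_d => cint01 (fun s => H (rcons0 s u))).
Proof.
move=> /smoothP[H1 H2]; apply/smoothP; split; first exact: rsmooth_int01 H1.
exact: rsmooth_int01 H2.
Qed.

Lemma cderiv_cint01 d (H : 'rV[R]_d.+1 -> R[i]) j u : smooth H ->
  cderiv j u (fun u : 'rV[R]_d => cint01 (fun s => H (rcons0 s u)))
    (cint01 (fun s => partial (lift ord0 j) H (rcons0 s u))).
Proof.
move=> /smoothP[H1 H2]; split; first exact: is_derive_int01 j u H1.
exact: is_derive_int01 j u H2.
Qed.

Lemma ccont_rcons0 d (H : 'rV[R]_d.+1 -> R[i]) u : smooth H -> ccont (fun s => H (rcons0 s u)).
Proof.
move=> sH; split.
  exact: (cont_comp (@cont_rcons0l R d u) (smooth_contRe sH)).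
exact: (cont_comp (@cont_rcons0l R d u) (smooth_contIm sH)).
Qed.

End C1.

Section Quasi.
Variable R : realType.
Variables (n k : nat).
Local Notation Re := (@complex.Re R).
Local Notation Im := (@complex.Im R).
Implicit Types (h : 'rV[R]_(n + n) -> R[i]) (u : 'rV[R]_(n + n)) (l : 'rV[int]_(n + n)).

(** The functions e^(k pi i x.y) s(x, y) for s a smooth section. *)
Definition quasi_periodic h := smooth h /\ forall l u,
  h (u + map_mx intr l) = expi (2 * pi * (k%:R * dot (lsubmx u) (map_mx intr (rsubmx l)))) * h u.

Definition dotxy u : R := dot (lsubmx u) (rsubmx u).
Definition untilded h u := expi (- (k%:R * pi * dotxy u)) * h u.
Definition tilded h u := expi (k%:R * pi * dotxy u) * h u.

Lemma untildedK h : tilded (untilded h) = h.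
Proof. by apply/funext => u; rewrite /tilded /untilded mulrA expiV mul1r. Qed.

Lemma tildedK h : untilded (tilded h) = h.
Proof. by apply/funext => u; rewrite /tilded /untilded mulrA [expi _ * _]mulrC expiV mul1r. Qed.

Lemma expi_piz (z : int) : expi (pi * z%:~R : R) = ((-1 : R[i]) ^ z)%R.
Proof.
have H (m : nat) : expi (pi * m%:R : R) = (-1) ^+ m.
  elim: m => [|m IH]; first by rewrite mulr0 expi0 expr0.
  rewrite -natr1 mulrDr expiD IH exprSr; congr (_ * _).
  by apply: complex_eqP; rewrite /= mulr1 ?cospi ?sinpi// oppr0.
case: z => m; first exact: H.
rewrite NegzE rmorphN /= mulrN -exprnN.
have := expiV (pi * m.+1%:R : R); rewrite H -pmulrn => E.
have e0 : (-1 : R[i]) ^+ m.+1 != 0 by rewrite signr_eq0.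
by apply: (mulfI e0); rewrite E divff.
Qed.

Lemma alphaE l : alpha R l ^+ k =
  expi (k%:R * pi * dot (map_mx intr (lsubmx l)) (map_mx intr (rsubmx l)) : R).
Proof.
rewrite dot_int -[LHS]/(((-1 : R[i]) ^ _)%R ^+ k).
have -> : \sum_i lsubmx l 0 i * rsubmx l 0 i = \sum_i l 0 (lshift n i) * l 0 (rshift n i).
  by apply: eq_bigr => i _; rewrite !mxE.
rewrite -expi_piz; elim: k => [|m IH]; first by rewrite expr0 !mul0r expi0.
by rewrite exprS IH -expiD; congr expi; rewrite -natr1; ring.
Qed.

Lemma dotxyD u l : dotxy (u + map_mx intr l) = dotxy u + dot (lsubmx u) (map_mx intr (rsubmx l))
   + dot (map_mx intr (lsubmx l)) (rsubmx u) + dot (map_mx intr (lsubmx l)) (map_mx intr (rsubmx l)).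
Proof. by rewrite /dotxy !raddfD /= dotDl !dotDr -map_lsubmx -map_rsubmx !addrA. Qed.

Lemma sympE u l : symp u (map_mx intr l) =
  dot (map_mx intr (lsubmx l)) (rsubmx u) - dot (lsubmx u) (map_mx intr (rsubmx l)).
Proof.
rewrite /symp /dot -sumrB; apply: eq_bigr => i _; rewrite !mxE; congr (_ - _); exact: mulrC.
Qed.

Lemma rsmooth_dotxy : rsmooth dotxy.
Proof.
apply: rsmooth_sum => i; apply: rsmooth_mul.
  by under eq_fun do rewrite mxE; exact: rsmooth_coord.
by under eq_fun do rewrite mxE; exact: rsmooth_coord.
Qed.

Lemma smooth_untilded h : smooth h -> smooth (untilded h).
Proof.
move=> sh; refine (smooth_mul (smooth_expi (rsmooth_opp _)) sh).
exact: rsmooth_mul (@rsmooth_cst R _ _) rsmooth_dotxy.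
Qed.

Lemma smooth_tilded h : smooth h -> smooth (tilded h).
Proof.
move=> sh; refine (smooth_mul (smooth_expi _) sh).
exact: rsmooth_mul (@rsmooth_cst R _ _) rsmooth_dotxy.
Qed.

Lemma quasi_section h : quasi_periodic h -> smooth_section k (untilded h).
Proof.
move=> [sh qh]; split=> [|l u]; first exact: smooth_untilded.
rewrite /untilded qh alphaE dotxyD sympE.
set a := dot (lsubmx u) _; set b := dot _ (rsubmx u).
rewrite dot_int; set z := \sum_i _.
rewrite !mulrA; congr (_ * _); rewrite -!expiD.
have -> : k%:R * pi * z%:~R + - (k%:R * pi * (b - a)) + - (k%:R * pi * dotxy u) =
  (- (k%:R * pi * (dotxy u + a + b + z%:~R)) + 2 * pi * (k%:R * a)) + 2 * pi * (k%:Z * z)%:~R :> R.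
  by rewrite intrM -pmulrn; ring.
by rewrite [X in _ = X]expiD expi2piz mulr1 -?mulrA.
Qed.

Lemma section_quasi h : smooth_section k h -> quasi_periodic (tilded h).
Proof.
move=> [sh qh]; split=> [|l u]; first exact: smooth_tilded.
rewrite /tilded qh alphaE dotxyD sympE.
set a := dot (lsubmx u) _; set b := dot _ (rsubmx u).
rewrite dot_int; set z := \sum_i _.
rewrite !mulrA; congr (_ * _); rewrite -!expiD.
have -> : k%:R * pi * (dotxy u + a + b + z%:~R) + k%:R * pi * z%:~R + - (k%:R * pi * (b - a)) =
  (2 * pi * (k%:R * a) + k%:R * pi * dotxy u) + 2 * pi * (k%:Z * z)%:~R :> R.
  by rewrite intrM -pmulrn; ring.
by rewrite [X in X = _]expiD expi2piz mulr1 -?mulrA.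
Qed.

Lemma quasi_lin (a : R[i]) h1 h2 : quasi_periodic h1 -> quasi_periodic h2 -> quasi_periodic (fun u => a * h1 u + h2 u).
Proof.
move=> [s1 q1] [s2 q2]; split=> [|l u]; last by rewrite q1 q2; ring.
exact: smooth_add (smooth_mul (smooth_cst a) s1) s2.
Qed.

Lemma quasi0 : quasi_periodic (fun=> 0).
Proof. by split=> [|l u]; [exact: smooth_cst|rewrite mulr0]. Qed.

Lemma quasi_scale (a : R[i]) h : quasi_periodic h -> quasi_periodic (fun u => a * h u).
Proof.
move=> [s1 q1]; split=> [|l u]; last by rewrite q1 mulrCA.
exact: smooth_mul (smooth_cst a) s1.
Qed.

Lemma quasi_sum (I : Type) (r : seq I) (F : I -> 'rV[R]_(n + n) -> R[i]) :
  (forall i, quasi_periodic (F i)) -> quasi_periodic (fun u => \sum_(i <- r) F i u).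
Proof.
move=> H; elim: r => [|i r IH]; first by under eq_fun do rewrite big_nil; exact: quasi0.
have -> : (fun u => \sum_(j <- i :: r) F j u) = (fun u => 1 * F i u + \sum_(j <- r) F j u).
  by apply/funext => u; rewrite big_cons mul1r.
exact: quasi_lin.
Qed.

Lemma quasi_mul f h : periodic_smooth f -> quasi_periodic h -> quasi_periodic (fun u => f u * h u).
Proof.
move=> [sf pf] [sh qh]; split=> [|l u]; first exact: smooth_mul.
by rewrite pf qh mulrCA.
Qed.

Lemma psm_conj (d : nat) (f : 'rV[R]_d -> R[i]) : periodic_smooth f -> periodic_smooth (fun v : 'rV[R]_d => conjc (f v)).
Proof. by move=> [sf pf]; split=> [|l u]; [exact: smooth_conj|rewrite pf]. Qed.

Lemma section_mul f t : periodic_smooth f -> smooth_section k t -> smooth_section k (fun u => f u * t u).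
Proof.
move=> [sf pf] [st qt]; split=> [|l u]; first exact: smooth_mul.
by rewrite pf qt mulrCA.
Qed.

(** The modulus is periodic. *)
Lemma quasi_bounded h : quasi_periodic h -> exists2 B, 0 <= B & forall u, cabs (h u) <= B.
Proof.
move=> [sh qh]; have : periodic_smooth (fun u => h u * conjc (h u)).
  split=> [|l u]; first exact: smooth_mul (smooth_conj sh).
  by rewrite !cabs_sqrE qh cabsM cabs_expi mul1r.
move=> /psm_bounded[B [_ _ HB]].
have B0 : 0 <= B by apply: le_trans (HB 0); exact: cabs_ge0.
exists (1 + B) => [|u]; first by rewrite addr_ge0.
have := HB u; rewrite cabsM cabsJ; have := cabs_ge0 (h u); nra.
Qed.

Lemma quasi_xpsm h : quasi_periodic h -> xperiodic_smooth h.
Proof.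
move=> [sh qh]; split=> // y a x; rewrite /xslice.
have -> : row_mx (x + map_mx intr a) y = row_mx x y + map_mx intr (row_mx a 0).
  by rewrite map_row_mx map_mx0 add_row_mx addr0.
by rewrite qh row_mxKr map_mx0 dotC dot0l !mulr0 expi0 mul1r.
Qed.

(** The covariant derivative in the direction x^j, transported by the
    multiplication with e^(k pi i x.y); it no longer involves x. *)
Definition Dx (j : 'I_n) h u : R[i] := partial (lshift n j) h u -
  (2 * pi * (k%:R * u 0 (rshift n j)))%:C * imag R * h u.

Lemma nabla_untilded j h : smooth h -> nabla k (lshift n j) (untilded h) = untilded (Dx j h).
Proof.
move=> sh; apply/funext => u; rewrite /nabla.
rewrite -[X in fintype.split X]/(unsplit (inl j)) unsplitK.
have dq : is_derive u (edir R (lshift n j)) (fun v => - (k%:R * pi * dotxy v)) (- (k%:R * pi * u 0 (rshift n j))).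
  apply: is_deriveN; apply/is_derive_line0.
  have -> : (fun r : R => k%:R * pi * dotxy (u + r *: edir R (lshift n j))) =
     (fun r : R => k%:R * pi * dotxy u + (k%:R * pi * u 0 (rshift n j)) * r).
    apply/funext => r; rewrite /dotxy !raddfD /= edir_lshift scale_row_mx row_mxKl row_mxKr scaler0 addr0.
    rewrite dotDl [dot (_ *: _) _]dotC dotZr dot_edir mxE; ring.
  have := is_deriveD (is_derive_cst (k%:R * pi * dotxy u) 0 (1:R)) (is_derive_scale (k%:R * pi * u 0 (rshift n j)) 0).
  by move/is_derive_eq; apply; rewrite add0r.
have := is_cderiveM (cderiv_expi dq) (smooth_cderiv (lshift n j) u sh).
rewrite -/(untilded h) => /cderiv_partial ->; rewrite /untilded /Dx.
rewrite !rmorphN !rmorphM /=; ring.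
Qed.

End Quasi.

Section Averages.
Variable R : realType.
Variables (n k : nat).
Local Notation Re := (@complex.Re R).
Local Notation Im := (@complex.Im R).
Implicit Types (h : 'rV[R]_(n + n) -> R[i]) (u : 'rV[R]_(n + n)) (l : 'rV[int]_(n + n)).

(** The integrand of [avg] as a function of all the variables at once, for
    differentiation under the integral. *)
Definition avgH (p r : R) (j : 'I_n) h (v : 'rV[R]_(n + n).+1) : R[i] :=
  (p + r * v 0 ord0)%:C * expi (- (2 * pi * (k%:R * (v 0 (lift ord0 (rshift n j)) * v 0 ord0)))) *
  h ((\row_i v 0 (lift ord0 i)) + v 0 ord0 *: edir R (lshift n j)).

Definition avgF (p r : R) (j : 'I_n) h u (a : R) : R[i] :=
  (p + r * a)%:C * expi (- (2 * pi * (k%:R * (u 0 (rshift n j) * a)))) *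
  h (u + a *: edir R (lshift n j)).

(** For (p, r) = (1, 0) this is the average of h along x^j, twisted so as to be
    quasi-periodic again; for (1, -1) it is, up to sign, a primitive of the difference
    between h and its average, see [Dx_avg_same]. *)
Definition avg (p r : R) j h u : R[i] := cint01 (avgF p r j h u).

Lemma avgHE p r j h a u : avgH p r j h (rcons0 a u) = avgF p r j h u a.
Proof.
rewrite /avgH /avgF rcons00 rcons0S; congr (_ * h (_ + _)).
by apply/rowP => i; rewrite mxE rcons0S.
Qed.

Lemma avgE p r j h u : avg p r j h u = cint01 (fun a => avgH p r j h (rcons0 a u)).
Proof. by congr cint01; apply/funext => a; rewrite avgHE. Qed.

Lemma smooth_avgH p r j h : smooth h -> smooth (avgH p r j h).
Proof.
move=> sh; refine (smooth_mul (smooth_mul (smooth_real _) (smooth_expi _)) _).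
- exact: rsmooth_add (@rsmooth_cst R _ _) (rsmooth_mul (@rsmooth_cst R _ _) (rsmooth_coord _ _)).
- apply: rsmooth_opp; apply: rsmooth_mul; first exact: rsmooth_cst.
  apply: rsmooth_mul; first exact: rsmooth_cst.
  exact: rsmooth_mul (rsmooth_coord _ _) (rsmooth_coord _ _).
apply: (smooth_map sh (L := fun v => (\row_i v 0 (lift ord0 i)) + v 0 ord0 *: edir R (lshift n j))).
  move=> v; apply: (@cvg_rV R _ (nbhs v) _ _ (fun v : 'rV[R]_(n + n).+1 =>
     (\row_i v 0 (lift ord0 i)) + v 0 ord0 *: edir R (lshift n j))) => i.
  have -> : (fun v : 'rV[R]_(n + n).+1 => ((\row_i0 v 0 (lift ord0 i0)) + v 0 ord0 *: edir R (lshift n j)) 0 i) =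
     (fun v => v 0 (lift ord0 i) + v 0 ord0 * edir R (lshift n j) 0 i).
    by apply/funext => w; rewrite !mxE.
  have -> : ((\row_i0 v 0 (lift ord0 i0)) + v 0 ord0 *: edir R (lshift n j)) 0 i =
     v 0 (lift ord0 i) + v 0 ord0 * edir R (lshift n j) 0 i by rewrite !mxE.
  apply: cvgD; first exact: cont_coord.
  apply: cvgM; [exact: cont_coord|exact: cvg_cst].
move=> i; right; case: (unliftP ord0 i) => [i' ->|->].
  exists (fun=> 1), i'; split=> [|u s]; first exact: rsmooth_cst.
  apply/rowP => a; rewrite !mxE /= !mulr1 !mulr0 addr0 (inj_eq (@lift_inj _ ord0)); ring.
exists (fun=> 1), (lshift n j); split=> [|u s]; first exact: rsmooth_cst.
by apply/rowP => a; rewrite !mxE /=; ring.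
Qed.

Lemma smooth_avg p r j h : smooth h -> smooth (avg p r j h).
Proof. by move=> sh; rewrite (funext (avgE p r j h)); apply: smooth_cint01; exact: smooth_avgH. Qed.

Lemma ccont_avgF p r j h u : smooth h -> ccont (avgF p r j h u).
Proof.
move=> sh; have -> : avgF p r j h u = fun a => avgH p r j h (rcons0 a u).
  by apply/funext => a; rewrite avgHE.
exact: ccont_rcons0 (smooth_avgH p r j sh).
Qed.

Lemma partial_avg p r j h i u : smooth h ->
  partial (lshift n i) (avg p r j h) u = avg p r j (partial (lshift n i) h) u.
Proof.
move=> sh; rewrite (funext (avgE p r j h)); apply: cderiv_partial.
have -> : avg p r j (partial (lshift n i) h) u =
  cint01 (fun a => partial (lift ord0 (lshift n i)) (avgH p r j h) (rcons0 a u)); last first.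
  exact: cderiv_cint01 (smooth_avgH p r j sh).
congr cint01; apply/funext => a; apply/esym/cderiv_partial.
have := smooth_cderiv (lshift n i) (u + a *: edir R (lshift n j)) sh => /is_cderive_line0 dh.
apply/is_cderive_line0.
have E s : avgH p r j h (rcons0 a u + s *: edir R (lift ord0 (lshift n i))) =
  (p + r * a)%:C * expi (- (2 * pi * (k%:R * (u 0 (rshift n j) * a)))) * h (u + a *: edir R (lshift n j) + s *: edir R (lshift n i)).
  rewrite -rcons0_line avgHE /avgF; congr (_ * expi (- (_ * (_ * (_ * _)))) * h _).
    by rewrite !mxE /= [rshift n j == _]eq_sym eq_lrshift mulr0 addr0.
  by rewrite addrAC.
under eq_fun do rewrite E; exact: (is_cderiveZ _ dh).
Qed.

Lemma smooth_Dx i h : smooth h -> smooth (Dx k i h).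
Proof.
move=> sh; refine (smooth_sub (smooth_partial _ sh) (smooth_mul (smooth_mul (smooth_real _) (smooth_cst _)) sh)).
apply: rsmooth_mul; first exact: rsmooth_cst.
exact: rsmooth_mul (@rsmooth_cst R _ _) (rsmooth_coord _ _).
Qed.

Lemma Dx_avg p r j h i u : smooth h -> Dx k i (avg p r j h) u = avg p r j (Dx k i h) u.
Proof.
move=> sh; rewrite /Dx partial_avg//; set c := (2 * pi * _)%:C * imag R.
have := cint01_lin (- c) (ccont_avgF p r j u sh) (ccont_avgF p r j u (smooth_partial (lshift n i) sh)).
rewrite -/(avg p r j h u) -/(avg p r j _ u) => E.
rewrite addrC -mulNr -E; congr cint01; apply/funext => a; rewrite /avgF.
have -> : (u + a *: edir R (lshift n j)) 0 (rshift n i) = u 0 (rshift n i).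
  by rewrite !mxE /= [rshift n i == _]eq_sym eq_lrshift mulr0 addr0.
rewrite -/c; ring.
Qed.

Lemma quasi_per_x h u (j : 'I_n) : quasi_periodic k h -> h (u + edir R (lshift n j)) = h u.
Proof.
move=> [_ qh]; have := qh (delta_mx 0 (lshift n j)) u.
have -> : map_mx intr (delta_mx 0 (lshift n j) : 'rV[int]_(n + n)) = edir R (lshift n j).
  by apply/rowP => i; rewrite !mxE; case: (_ && _).
move=> ->; have -> : rsubmx (delta_mx 0 (lshift n j) : 'rV[int]_(n + n)) = 0.
  by apply/rowP => i; rewrite !mxE /= [rshift n i == _]eq_sym eq_lrshift.
by rewrite map_mx0 dotC dot0l !mulr0 expi0 mul1r.
Qed.

(** The integrand of avg p r (Dx h) is, up to r times that of avg 1 0 h, the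
    derivative in a of (p + r a) e^(-2 pi i k y_j a) h(x + a e_j, y), and h has
    period 1 in x^j. *)
Lemma Dx_avg_same p r j h u : quasi_periodic k h -> Dx k j (avg p r j h) u =
  ((p + r)%:C * expi (- (2 * pi * (k%:R * u 0 (rshift n j)))) - p%:C) * h u - r%:C * avg 1 0 j h u.
Proof.
move=> qh; have sh := qh.1; rewrite Dx_avg//; apply/eqP; rewrite eq_sym subr_eq; apply/eqP.
have c0 := ccont_avgF 1 0 j u sh; have c1' := ccont_avgF p r j u (smooth_Dx j sh).
have := cint01_lin r%:C c0 c1'; rewrite -/(avg 1 0 j h u) -/(avg p r j (Dx k j h) u) addrC => <-.
rewrite (@cint01_derive R (avgF p r j h u)); last 2 first.
- exact: ccont_lin.
- move=> a; set y := u 0 (rshift n j).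
  have yE : (u + a *: edir R (lshift n j)) 0 (rshift n j) = y.
    by rewrite !mxE /= [rshift n j == _]eq_sym eq_lrshift mulr0 addr0.
  have dh : is_cderive a (1 : R) (fun s => h (u + s *: edir R (lshift n j)))
      (partial (lshift n j) h (u + a *: edir R (lshift n j))).
    by apply/is_cderive_line; exact: smooth_cderiv sh.
  have de : is_derive a (1:R) (fun s => - (2 * pi * (k%:R * (y * s)))) (- (2 * pi * (k%:R * y))).
    have -> : (fun s => - (2 * pi * (k%:R * (y * s)))) = (fun s => - (2 * pi * (k%:R * y)) * s).
      by apply/funext => s; ring.
    exact: is_derive_scale.
  have dw : is_cderive a (1 : R) (fun s => (p + r * s)%:C) r%:C.
    split=> /=; last exact: is_derive_cst.
    have := is_deriveD (is_derive_cst p a (1:R)) (is_derive_scale r a).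
    by move/is_derive_eq; apply; rewrite add0r.
  have := is_cderiveM (is_cderiveM dw (is_cderive_expi de)) dh.
  set X := (X in is_cderive _ _ _ X) => H.
  suff -> : r%:C * avgF 1 0 j h u a + avgF p r j (Dx k j h) u a = X by exact: H.
  rewrite /X /avgF /Dx yE -/y mul0r addr0 rmorphN; ring.
by rewrite /avgF !mulr1 scale1r quasi_per_x// !mulr0 oppr0 expi0 scale0r !addr0; ring.
Qed.

Lemma quasi_avg p r j h : quasi_periodic k h -> quasi_periodic k (avg p r j h).
Proof.
move=> qh; have [sh Hq] := qh; split=> [|l u]; first exact: smooth_avg.
set e := expi _; rewrite /avg -(cint01Z e (ccont_avgF p r j u sh)).
congr cint01; apply/funext => a; rewrite /avgF addrAC Hq.
have E : expi (- (2 * pi * (k%:R * ((u + map_mx intr l) 0 (rshift n j) * a)))) *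
    expi (2 * pi * (k%:R * dot (lsubmx (u + a *: edir R (lshift n j))) (map_mx intr (rsubmx l)))) =
    e * expi (- (2 * pi * (k%:R * (u 0 (rshift n j) * a)))).
  rewrite /e -!expiD; set b := rsubmx l.
  have -> : (u + map_mx intr l) 0 (rshift n j) = u 0 (rshift n j) + (b 0 j)%:~R by rewrite !mxE.
  rewrite raddfD /= edir_lshift scale_row_mx row_mxKl dotDl [dot (a *: _) _]dotC dotZr dot_edir [map_mx intr b 0 j]mxE.
  by congr expi; ring.
by rewrite -mulrA [X in _ * X]mulrA E !mulrA; congr (_ * _ * _); exact: mulrC.
Qed.

End Averages.

(** * Sections with prescribed Weil-Brezin coefficients *)

Section SmoothStep.
Variable R : realType.

(** A family closed under derivation up to linear combinations, as [rsm_comp1]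
    requires. *)
Definition flat (j : nat) (x : R) : R := if 0 < x then x^-1 ^+ j * expR (- x^-1) else 0.

Lemma flat_le0 j x : x <= 0 -> flat j x = 0.
Proof. by rewrite /flat leNgt => /negbTE ->. Qed.

Lemma flat_gt0 x : 0 < x -> 0 < flat 0 x.
Proof. by rewrite /flat => x0; rewrite x0 expr0 mul1r expR_gt0. Qed.

Lemma flat_ge0 x : 0 <= flat 0 x.
Proof. by have [/flat_gt0/ltW//|/flat_le0 ->] := ltP 0 x. Qed.

(** The exponential series dominates each of its terms; the bound by x^2 gives
    the derivative 0 at the origin. *)
Lemma flat_bound j x : `|flat j x| <= (j.+2)`!%:R * x ^+ 2.
Proof.
rewrite /flat; case: ifP => x0; last by rewrite normr0 mulr_ge0// sqr_ge0.
have v0 : 0 < x^-1 by rewrite invr_gt0.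
rewrite ger0_norm; last by rewrite mulr_ge0 ?expR_ge0// exprn_ge0// ltW.
rewrite expRN ler_pdivrMr ?expR_gt0// mulrAC -mulrA -ler_pdivrMl ?ltr0n ?fact_gt0//.
have -> : (j.+2)`!%:R^-1 * x^-1 ^+ j = x^-1 ^+ j.+2 / (j.+2)`!%:R * x ^+ 2.
  have -> : x^-1 ^+ j.+2 = x^-1 ^+ j * x^-1 ^+ 2 by rewrite -exprD addn2.
  rewrite [RHS]mulrAC -[_ * _ * x ^+ 2]mulrA -exprMn mulVf ?gt_eqF// expr1n mulr1 mulrC//.
rewrite ler_wpM2r ?sqr_ge0//; apply: le_trans (@expR_ge1Dxn R x^-1 j.+1 (ltW v0)).
by rewrite lerDr.
Qed.

Lemma is_derive_flat j x : is_derive x (1:R) (flat j) (- j%:R * flat j.+1 x + flat j.+2 x).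
Proof.
case: (ltgtP x 0) => [x0|x0|->].
- rewrite !flat_le0 ?ltW// mulr0 addr0.
  refine (@near_eq_is_derive _ _ _ (fun=> 0) _ _ _ _ _ (is_derive_cst _ _ _)).
  have : \forall y \near x, y < 0 by exact: (cvgr_lt x cvg_id).
  by apply: filterS => y /ltW y0; rewrite flat_le0.
- have dv : is_derive x (1:R) (fun y : R => y^-1) (- (x^-1 ^+ 2)).
    have := is_deriveV (lt0r_neq0 x0) (is_derive_id x (1:R)).
    by move/is_derive_eq; apply; rewrite /GRing.scale /= mulr1 exprVn.
  suff D : is_derive x (1:R) (fun y => y^-1 ^+ j * expR (- y^-1)) (- j%:R * flat j.+1 x + flat j.+2 x).
    refine (@near_eq_is_derive _ _ _ _ _ _ _ _ _ D).
    have : \forall y \near x, 0 < y by exact: (cvgr_gt x cvg_id).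
    by apply: filterS => y y0; rewrite /flat y0.
  have d1 : is_derive x (1:R) (fun y : R => y^-1 ^+ j) (- j%:R * x^-1 ^+ j.+1).
    case: j => [|j]; first by rewrite oppr0 mul0r; exact: is_derive_cst.
    by apply: (is_derive_chain (is_derive_pow j _) dv); rewrite !exprS expr0; ring.
  have d2 := is_derive_chain (is_derive_expR _) (is_deriveN dv) erefl.
  have := is_deriveM d1 d2; move/is_derive_eq; apply.
  rewrite /flat x0 /GRing.scale /= opprK; set v := x^-1; set e := expR _.
  by rewrite !exprS expr0; ring.
have f0 i : flat i 0 = 0 by exact: flat_le0.
rewrite !f0 mulr0 addr0.
have H : (fun h : R => h^-1 *: ((flat j \o shift 0) (h *: (1:R)) - flat j 0)) @ 0^' --> (0:R).
  apply/cvgrPdist_le => e e0; set C := (j.+2)`!%:R : R.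
  have C0 : 0 < C by rewrite ltr0n fact_gt0.
  near=> h; rewrite sub0r normrN /= addr0 f0 subr0 /GRing.scale /= mulr1.
  have h0 : h != 0 by near: h; exact: nbhs_dnbhs_neq.
  have he : `|h| <= e / C.
    by near: h; apply: dnbhs0_le; rewrite divr_gt0.
  rewrite normrM normfV ler_pdivrMl ?normr_gt0//; apply: le_trans (flat_bound j h) _.
  rewrite -/C -[h ^+ 2]real_normK ?num_real// expr2 mulrA [leRHS]mulrC ler_wpM2r//.
  by rewrite -ler_pdivlMl// mulrC.
apply: DeriveDef; first by apply/cvg_ex; exists 0.
exact: cvg_lim H.
Unshelve. all: by end_near.
Qed.

Lemma rsmooth_flat d (q : 'rV[R]_d -> R) : rsmooth q -> rsmooth (fun u => flat 0 (q u)).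
Proof.
move=> Hq m; apply: (rsm_comp1 (G := flat)) => // j.
exists [:: (- j%:R, j.+1); (1, j.+2)] => x.
by rewrite big_cons big_cons big_nil /= addr0 mul1r; exact: is_derive_flat.
Qed.

(** A smooth step: 0 up to a and 1 from b on. *)
Definition step (a b t : R) : R := flat 0 (t - a) / (flat 0 (t - a) + flat 0 (b - t)).

Lemma step_den a b t : a < b -> 0 < flat 0 (t - a) + flat 0 (b - t).
Proof.
move=> ab; have [ta|ta] := ltP a t.
  by rewrite ltr_pwDl ?flat_ge0// flat_gt0// subr_gt0.
by rewrite ltr_wpDl ?flat_ge0// flat_gt0// subr_gt0 (le_lt_trans ta).
Qed.

Lemma step0 a b t : t <= a -> step a b t = 0.
Proof. by move=> ta; rewrite /step flat_le0 ?subr_le0// mul0r. Qed.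

Lemma step1 a b t : a < b -> b <= t -> step a b t = 1.
Proof.
move=> ab bt; have := step_den t ab; rewrite /step (flat_le0 0 (_ : b - t <= 0)) ?subr_le0// addr0.
by move=> /lt0r_neq0 H; rewrite divff.
Qed.

Lemma step_ge0 a b t : a < b -> 0 <= step a b t.
Proof. by move=> ab; rewrite divr_ge0 ?flat_ge0// ltW// step_den. Qed.

Lemma step_le1 a b t : a < b -> step a b t <= 1.
Proof. by move=> ab; rewrite ler_pdivrMr ?step_den// mul1r lerDl flat_ge0. Qed.

Lemma rsmooth_step a b d (q : 'rV[R]_d -> R) : a < b -> rsmooth q -> rsmooth (fun u => step a b (q u)).
Proof.
move=> ab Hq.
have s1 : rsmooth (fun u => flat 0 (q u - a)).
  by apply: (rsmooth_flat (q := fun u => q u - a)); exact: rsmooth_sub Hq (@rsmooth_cst R _ _).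
have s2 : rsmooth (fun u => flat 0 (b - q u)).
  by apply: (rsmooth_flat (q := fun u => b - q u)); exact: rsmooth_sub (@rsmooth_cst R _ _) Hq.
apply: rsmooth_mul => //; apply: rsmooth_inv => [u|]; last exact: rsmooth_add.
by rewrite gt_eqF// step_den.
Qed.

End SmoothStep.

Section Bump.
Variable R : realType.
Variable n : nat.

Definition plateau (y : 'rV[R]_n) : R[i] := (\prod_(i < n) step (1 / 4) (1 / 2) (1 - y 0 i ^+ 2))%:C.

Lemma smooth_plateau : smooth plateau.
Proof.
apply: smooth_real; apply: rsmooth_prod => i; apply: (rsmooth_step (q := fun u : 'rV[R]_n => 1 - u 0 i ^+ 2)).
  lra.
exact: rsmooth_sub (@rsmooth_cst R _ _) (rsmooth_mul (rsmooth_coord _ _) (rsmooth_coord _ _)).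
Qed.

Lemma plateau_out (y : 'rV[R]_n) : 1 <= `|y| -> plateau y = 0.
Proof.
move=> y1; have [i Hi] : exists i, 1 <= `|y 0 i|.
  apply: contrapT => /forallNP H; move: y1; rewrite leNgt => /negP; apply.
  pose c := \big[Num.max/0]_(i < n) `|y 0 i|.
  have c1 : c < 1.
    rewrite /c; elim/big_ind: _ => // [a b a1 b1|i _]; first by rewrite gt_max a1.
    by have /negP := H i; rewrite -ltNge.
  apply: le_lt_trans c1; apply: mx_norm_ler => [|i]; first by rewrite bigmax_ge_id.
  exact: (le_bigmax _ (fun i : 'I_n => `|y 0 i|)).
rewrite /plateau (bigD1 i)//= step0 ?mul0r//.
have : 1 <= `|y 0 i| ^+ 2 by rewrite exprn_ege1.
rewrite real_normK ?num_real//; lra.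
Qed.

Lemma plateau_in (y : 'rV[R]_n) : `|y| <= 1 / 2 -> plateau y = 1.
Proof.
move=> y1; rewrite /plateau big1// => i _; apply: step1; first lra.
have : `|y 0 i| <= 1 / 2 by exact: le_trans (ler_mx_norm _ _) y1.
rewrite ler_norml => /andP[a b]; nra.
Qed.

Lemma cutoff_plateau : cutoff plateau.
Proof.
split; first exact: smooth_plateau; first by exists 1 => y; exact: plateau_out.
have h0 : (0 : R) < 1 / 2 by lra.
by apply: filterS (nbhs0_le h0) => y; exact: plateau_in.
Qed.

End Bump.

Section Periodization.
Variable R : realType.
Variables (n k' : nat).
Local Notation k := k'.+1.
Local Notation V := 'rV['I_k]_n.
Local Notation grid_pt := (@grid_pt R n k').
Implicit Types (u : 'rV[R]_(n + n)) (m : V) (phi : 'rV[R]_n -> R[i]).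

(** The lattice points p congruent to m contribute copies of phi centred at p/k. *)
Definition wb_section_term m phi u (p : 'rV[int]_n) : R[i] :=
  (kdvd k' (p - zvec m))%:R * chr p (lsubmx u) * phi (rsubmx u - hbar R k *: map_mx intr p).

(** The quasi-periodic function whose Weil-Brezin coefficient of index m is phi and
    whose other coefficients vanish, see [fhat_wb_section]; it inverts the
    transform on test functions. *)
Definition wb_section m phi u : R[i] := \sum_(p \in [set: 'rV[int]_n]) wb_section_term m phi u p.

Definition supp_in (r : R) phi := forall y, r <= `|y| -> phi y = 0.

Lemma fsum_zbox (F : 'rV[int]_n -> R[i]) M : (forall p, p \notin zbox M n -> F p = 0) ->
  \sum_(p \in [set: 'rV[int]_n]) F p = \sum_(p <- zbox M n) F p.
Proof.
move=> H; rewrite (fsbigE (zbox M n)) ?uniq_zbox//.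
- by apply: eq_bigl => p; rewrite in_setT.
- by move=> p _; exact: H.
Qed.

Lemma wb_section_term_out m phi r u p M : supp_in r phi -> k%:R * (`|rsubmx u| + r) <= M%:R ->
  p \notin zbox M n -> wb_section_term m phi u p = 0.
Proof.
move=> sr HM; rewrite mem_zbox negb_forall => /existsP[j].
rewrite -ltnNge => pM; rewrite /wb_section_term sr ?mulr0//.
have H1 : `|(hbar R k *: map_mx intr p) 0 j| <= `|hbar R k *: map_mx intr p| :> R by exact: ler_mx_norm.
have H2 : `|hbar R k *: map_mx intr p| <= `|rsubmx u - hbar R k *: map_mx intr p| + `|rsubmx u|.
  by rewrite -{1}[hbar R k *: _](subKr (rsubmx u)) distrC; exact: ler_normB.
have k0 : (0 : R) < k%:R by rewrite ltr0n.
have H3 : `|rsubmx u| + r <= `|(hbar R k *: map_mx intr p) 0 j|.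
  rewrite !mxE /hbar normrM ger0_norm ?invr_ge0 ?ler0n// ler_pdivlMl//.
  apply: le_trans HM _; rewrite -intr_norm pmulrn ler_int; lia.
lra.
Qed.

Lemma wb_section_zbox m phi r (B : R) M : supp_in r phi -> k%:R * (B + r) <= M%:R ->
  forall u, `|rsubmx u| <= B -> wb_section m phi u = \sum_(p <- zbox M n) wb_section_term m phi u p.
Proof.
move=> sr HM u uB; apply: fsum_zbox => p; apply: wb_section_term_out sr _.
by apply: le_trans HM; rewrite ler_wpM2l// lerD2r.
Qed.

Lemma smooth_wb_section_term m phi p : smooth phi -> smooth (fun u => wb_section_term m phi u p).
Proof.
move=> sphi; refine (smooth_mul (smooth_mul (smooth_cst _) (smooth_expi _)) _).
  apply: rsmooth_mul; first exact: rsmooth_cst.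
  apply: rsmooth_sum => i; apply: rsmooth_mul; first exact: rsmooth_cst.
  by under eq_fun do rewrite mxE; exact: rsmooth_coord.
apply: (smooth_map sphi (L := fun u => rsubmx u - hbar R k *: map_mx intr p)).
  move=> u; apply: (@cvg_rV R _ (nbhs u) _ _ (fun u : 'rV[R]_(n + n) => rsubmx u - hbar R k *: map_mx intr p)) => i.
  have -> : (fun u : 'rV[R]_(n + n) => (rsubmx u - hbar R k *: map_mx intr p) 0 i) =
     (fun u => u 0 (rshift n i) - (hbar R k *: map_mx intr p) 0 i).
    by apply/funext => w; rewrite !mxE.
  have -> : (rsubmx u - hbar R k *: map_mx intr p) 0 i = u 0 (rshift n i) - (hbar R k *: map_mx intr p) 0 i.
    by rewrite !mxE.
  by apply: cvgB; [exact: cont_coord|exact: cvg_cst].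
move=> j; case: (split_ordP j) => i ->.
  by left=> u s; rewrite raddfD /= edir_lshift scale_row_mx row_mxKr scaler0 addr0.
right; exists (fun=> 1), i; split; first exact: rsmooth_cst.
by move=> u s; rewrite raddfD /= edir_rshift scale_row_mx row_mxKr mulr1 addrAC.
Qed.

Lemma norm_rsubmx u : `|rsubmx u| <= `|u|.
Proof. by apply: mx_norm_ler => // i; rewrite mxE; exact: ler_mx_norm. Qed.

(** For compactly supported phi the sum is locally finite. *)
Lemma smooth_wb_section m phi r : smooth phi -> supp_in r phi -> smooth (wb_section m phi).
Proof.
move=> sphi sr; apply: smooth_local => u.
pose M := (Num.truncn (k%:R * (`|u| + 1 + r))).+1.
exists (fun v => \sum_(p <- zbox M n) wb_section_term m phi v p); split.
  by apply: smooth_sum => p; exact: smooth_wb_section_term.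
have /cvgrPdist_lt/(_ 1 ltr01) := @cvg_id _ (nbhs u).
apply: filterS => v uv; apply: (wb_section_zbox m (B := `|u| + 1) sr).
  exact: ltW (truncnS_gt _).
apply: le_trans (norm_rsubmx v) _; rewrite -[v](subKr u) addrC opprB.
by rewrite (le_trans (ler_normD _ _))// addrC lerD2l ltW// distrC.
Qed.

(** A shift by an integral vector b in y permutes the terms by p + k b and multiplies
    the characters by e^(2 pi i k x.b). *)
Lemma quasi_wb_section m phi r : smooth phi -> supp_in r phi -> quasi_periodic k (wb_section m phi).
Proof.
move=> sphi sr; split=> [|l u]; first exact: smooth_wb_section sr.
set b := rsubmx l; rewrite /wb_section.
rewrite (reindex_fsbigT (fun p => p + k%:Z *: b)) /=; last first.
  by exists (fun p => p - k%:Z *: b) => p; rewrite ?addrK ?subrK.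
have E p : wb_section_term m phi (u + map_mx intr l) (p + k%:Z *: b) =
   expi (2 * pi * (k%:R * dot (lsubmx u) (map_mx intr b))) * wb_section_term m phi u p.
  rewrite /wb_section_term.
  have -> : kdvd k' (p + k%:Z *: b - zvec m) = kdvd k' (p - zvec m).
    by rewrite addrAC addrC kdvdD//; apply/kdvdP; exists b.
  have -> : rsubmx (u + map_mx intr l) - hbar R k *: map_mx intr (p + k%:Z *: b) =
      rsubmx u - hbar R k *: map_mx intr p.
    apply/rowP => i; rewrite !mxE /= intrD intrM -pmulrn /hbar; field.
    by rewrite addrC natr1 pnatr_eq0.
  rewrite [RHS]mulrA; congr (_ * _); rewrite [RHS]mulrCA; congr (_ * _).
  rewrite chrD raddfD /= -map_lsubmx /chr !dotDr !dot_int.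
  have Hz (x : R) z : expi (2 * pi * (x + z%:~R)) = expi (2 * pi * x) by rewrite mulrDr expiD expi2piz mulr1.
  rewrite !Hz mulrC; congr (expi (_ * _) * _).
  by rewrite dotC /dot mulr_sumr; apply: eq_bigr => i _; rewrite !mxE /= intrM -pmulrn; ring.
pose M := (Num.truncn (k%:R * (`|rsubmx u| + r))).+1.
have HM : k%:R * (`|rsubmx u| + r) <= M%:R by exact: ltW (truncnS_gt _).
have H0 p : p \notin zbox M n -> wb_section_term m phi u p = 0 by exact: wb_section_term_out sr HM.
rewrite (@fsum_zbox _ M); last by move=> p /H0 p0; rewrite E p0 mulr0.
by rewrite (@fsum_zbox _ M)// mulr_sumr; apply: eq_bigr => p _; exact: E.
Qed.

Lemma fc_chr (p q : 'rV[int]_n) (a : R[i]) : fourier_coef (fun x => a * chr p x) q = (p == q)%:R * a.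
Proof.
have pc : periodic_smooth (fun x : 'rV[R]_n => chr p x).
  have := psm_chrN R (- p); congr periodic_smooth; apply/funext => x; rewrite /chr; congr expi.
  by rewrite -mulrN; congr (_ * _); rewrite /dot -sumrN; apply: eq_bigr => i _; rewrite !mxE /= rmorphN mulNr opprK.
have cb : cbounded (1:R) (fun x : 'rV[R]_n => chr p x * expi (- (2 * pi * dot (map_mx intr q) x))).
  rewrite -[X in cbounded X]mulr1; apply: cboundedM (cbounded_chrN R q).
  by apply: cbounded_expi; apply: rsmooth_mul; [exact: rsmooth_cst|exact: rsmooth_dot].
have -> : fourier_coef (fun x => a * chr p x) q = a * fourier_coef (fun x => chr p x) q.
  rewrite /fourier_coef -(cintZ (weight01 R) a (cboundedP cb)); congr cint.
  by apply/funext => x; rewrite mulrA.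
rewrite mulrC; congr (_ * _); have [->|pq] := eqVneq p q.
  rewrite /fourier_coef; have -> : (fun x : 'rV[R]_n => chr q x * expi (- (2 * pi * dot (map_mx intr q) x))) = fun=> 1.
    by apply/funext => x; rewrite /chr expiV.
  rewrite /cint; apply: complex_eqP => /=; elim: n => [|d IH] //=.
  - by rewrite IH weight01_mass.
  - by rewrite IH Rintegral_cst ?mul0r//=.
have [j pqj] : exists j, p 0 j != q 0 j.
  by apply/existsP; apply: contraNT pq; rewrite negb_exists => /forallP H;
    apply/eqP/rowP => j; apply/eqP; have := H j; rewrite negbK.
have := fc_partial j q pc.
have -> : partial j (fun x : 'rV[R]_n => chr p x) = fun x => ((2 * pi * (p 0 j)%:~R)%:C * imag R) * chr p x.
  apply/funext => x; apply: cderiv_partial; apply: cderiv_expi.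
  have := is_derive_scaled (2 * pi) (is_derive_dot (map_mx intr p) x j); by rewrite mxE.
have -> : fourier_coef (fun x => ((2 * pi * (p 0 j)%:~R)%:C * imag R) * chr p x) q =
   ((2 * pi * (p 0 j)%:~R)%:C * imag R) * fourier_coef (fun x => chr p x) q.
  rewrite /fourier_coef -(cintZ (weight01 R) _ (cboundedP cb)); congr cint.
  by apply/funext => x; rewrite mulrA.
move=> /eqP; rewrite -subr_eq0 -mulrBl mulf_eq0 => /orP[|/eqP //].
rewrite -mulrBl mulf_eq0 (negbTE (imag_neq0 R)) orbF -rmorphB -mulrBr => /eqP[/eqP].
by rewrite !mulf_eq0 (gt_eqF (pi_gt0 R)) pnatr_eq0 /= subr_eq0 eqr_int (negbTE pqj).
Qed.

Lemma fhat_wb_section m phi r (m' : V) y : smooth phi -> supp_in r phi ->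
  fhat (wb_section m phi) (zvec m') (y + grid_pt m') = (m == m')%:R * phi y.
Proof.
move=> sphi sr; set Y := y + grid_pt m'.
pose M0 := (Num.truncn (k%:R * (`|Y| + r))).+1.
pose M := maxn M0 k.
have HM : k%:R * (`|Y| + r) <= M%:R.
  by apply: le_trans (ltW (truncnS_gt _)) _; rewrite ler_nat leq_maxl.
have zm : zvec m' \in zbox M n.
  rewrite mem_zbox; apply/forallP => i; rewrite mxE /= (leq_trans _ (leq_maxr _ _))//.
  exact: ltnW.
have -> : fhat (wb_section m phi) (zvec m') Y =
   \sum_(p <- zbox M n) fourier_coef (fun x => ((kdvd k' (p - zvec m))%:R * phi (Y - hbar R k *: map_mx intr p)) * chr p x) (zvec m').
  rewrite /fhat /fourier_coef.
  have cb (p : 'rV[int]_n) (a : R[i]) : cbounded (cabs a * 1 * 1) (fun x => a * chr p x * expi (- (2 * pi * dot (map_mx intr (zvec m')) x))).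
    apply: cboundedM (cbounded_chrN R _); apply: cboundedM; first exact: cbounded_cst.
    by apply: cbounded_expi; apply: rsmooth_mul; [exact: rsmooth_cst|exact: rsmooth_dot].
  rewrite -(cint_sum (weight01 R)); last by move=> p; eexists; exact: cboundedP (cb _ _).
  congr cint; apply/funext => x; rewrite -mulr_suml; congr (_ * _).
  rewrite /xslice (wb_section_zbox m sr HM); last by rewrite row_mxKr.
  by apply: eq_bigr => p _; rewrite /wb_section_term row_mxKl row_mxKr mulrAC.
under eq_bigr do rewrite fc_chr.
rewrite (bigD1_seq (zvec m'))//= ?uniq_zbox// eqxx mul1r big1 ?addr0; last first.
  by move=> p /negbTE ->; rewrite mul0r.
rewrite kdvd_zred; have -> : zred k' (zvec m') = m'.
  by apply/eqP; rewrite eq_sym -kdvd_zred subrr; apply/kdvdP; exists 0; rewrite scaler0.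
by rewrite /Y /grid_pt Zk_vecE addrK.
Qed.

End Periodization.

(** * Functions near the grid of the y variables *)

Section Rounding.
Variable R : realType.
Variables (n k' : nat).
Local Notation k := k'.+1.
Local Notation Re := (@complex.Re R).
Local Notation Im := (@complex.Im R).
Implicit Types (g h : 'rV[R]_(n + n) -> R[i]) (u : 'rV[R]_(n + n)) (l : 'rV[int]_(n + n)) (j : 'I_n) (q : int).

Definition grid_angle j u : R := 2 * pi * (k%:R * u 0 (rshift n j)).

Lemma rsmooth_grid_angle j : rsmooth (grid_angle j).
Proof.
apply: rsmooth_mul; first exact: rsmooth_cst.
exact: rsmooth_mul (@rsmooth_cst R _ _) (rsmooth_coord _ _).
Qed.

Lemma grid_angle_shift j l u : expi (grid_angle j (u + map_mx intr l)) = expi (grid_angle j u) :> R[i].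
Proof.
rewrite /grid_angle; have -> : (u + map_mx intr l) 0 (rshift n j) = u 0 (rshift n j) + (l 0 (rshift n j))%:~R by rewrite !mxE.
have -> : 2 * pi * (k%:R * (u 0 (rshift n j) + (l 0 (rshift n j))%:~R)) =
  2 * pi * (k%:R * u 0 (rshift n j)) + 2 * pi * (k%:Z * l 0 (rshift n j))%:~R :> R.
  by rewrite intrM -pmulrn; ring.
by rewrite expiD expi2piz mulr1.
Qed.

Lemma psm_grid_angle j (F : R[i] -> R[i]) : smooth (fun u => F (expi (grid_angle j u))) ->
  periodic_smooth (fun u => F (expi (grid_angle j u))).
Proof. by move=> sF; split=> // l u; rewrite grid_angle_shift. Qed.

Lemma psm_expi_angle j : periodic_smooth (fun u => expi (grid_angle j u)).
Proof. by apply: (@psm_grid_angle j id); apply: smooth_expi; exact: rsmooth_grid_angle. Qed.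

Lemma psm_cos_fun j (F : R -> R) : rsmooth (fun u => F (cos (grid_angle j u))) ->
  periodic_smooth (fun u => (F (cos (grid_angle j u)))%:C).
Proof.
move=> sF; split; first exact: smooth_real.
by move=> l u; have /(congr1 Re) /= -> := grid_angle_shift j l u.
Qed.

(** A periodic cutoff equal to 1 near the hyperplanes y_j in (1/k)Z and to 0 where
    cos (2 pi k y_j) is at most 1/4, in particular halfway between them. *)
Definition grid_window j u : R := step (1 / 4) (1 / 2) (cos (grid_angle j u)).

Lemma rsmooth_cos_angle j : rsmooth (fun u => cos (grid_angle j u)).
Proof. by have [] := rsmooth_sincos (rsmooth_grid_angle j). Qed.

Lemma rsmooth_grid_window j : rsmooth (grid_window j).
Proof. by apply: rsmooth_step; [lra|exact: rsmooth_cos_angle]. Qed.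

Lemma grid_window_shift j l u : grid_window j (u + map_mx intr l) = grid_window j u.
Proof. by rewrite /grid_window; have /(congr1 Re) /= -> := grid_angle_shift j l u. Qed.

(** The integer nearest to k y. *)
Definition nearest (y : R) : int := Num.floor (k%:R * y + 1 / 2).

Lemma nearest_itv y : (nearest y)%:~R <= k%:R * y + 1 / 2 < (nearest y)%:~R + 1.
Proof.
by rewrite /nearest real_floor_le ?num_real//= -[1]/(1%:~R) -intrD real_floorD1_gt ?num_real.
Qed.

Lemma nearest_eq y (q : int) : q%:~R <= k%:R * y + 1 / 2 < q%:~R + 1 -> nearest y = q.
Proof. by move=> H; apply: floor_def; rewrite intrD. Qed.

Lemma nearest_shift y (b : int) : nearest (y + b%:~R) = nearest y + k%:Z * b.
Proof.
apply: nearest_eq; have := nearest_itv y; rewrite intrD intrM -pmulrn mulrDr; lra.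
Qed.

Lemma cos_le0 (x : R) : pi / 2 <= x <= pi -> cos x <= 0.
Proof.
move=> /andP[x1 x2]; have -> : cos x = - sin (x - pi / 2).
  have -> : cos x = cos (x - pi / 2 + pi / 2) by congr cos; lra.
  by rewrite cosD cos_pihalf sin_pihalf mulr0 mulr1 sub0r.
by rewrite oppr_le0; apply: sin_ge0_pi; have := pi_gt0 R; lra.
Qed.

Lemma grid_window_near j u : grid_window j u != 0 -> `|k%:R * u 0 (rshift n j) - (nearest (u 0 (rshift n j)))%:~R| < 1 / 4.
Proof.
move=> H; set y := u 0 (rshift n j); set t := _ - _; rewrite ltNge; apply/negP => t4.
move/eqP: H; apply; apply: step0.
have ct : cos (grid_angle j u) = cos (2 * pi * t).
  have -> : 2 * pi * t = grid_angle j u + 2 * pi * (- nearest y)%:~R.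
    by rewrite rmorphN /= /t /grid_angle -/y; ring.
  by have /(congr1 Re) /= <- : expi (grid_angle j u + 2 * pi * (- nearest y)%:~R) = expi (grid_angle j u) :> R[i]
    by rewrite expiD expi2piz mulr1.
apply: (@le_trans _ _ 0); last lra.
rewrite ct; have t2 : `|t| <= 1 / 2.
  by rewrite ler_norml; have := nearest_itv y; rewrite /t; lra.
have -> : cos (2 * pi * t) = cos (2 * pi * `|t|).
  by case: (ler0P t) => _ //; rewrite mulrN cosN.
by apply: cos_le0; have := pi_gt0 R; nra.
Qed.

(** The nearest integer jumps only where the window vanishes. *)
Lemma smooth_glue j (F : int -> 'rV[R]_(n + n) -> R[i]) : (forall q, smooth (F q)) ->
  smooth (fun u => (grid_window j u)%:C * F (nearest (u 0 (rshift n j))) u).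
Proof.
move=> sF; apply: smooth_local => u; set y := u 0 (rshift n j); set q := nearest y.
have cy : (fun v : 'rV[R]_(n + n) => k%:R * v 0 (rshift n j) + 1 / 2) @ u --> k%:R * y + 1 / 2.
  apply: (cont_add (cont_mul (@cont_cst R _ _) (@cont_coord R _ _)) (@cont_cst R _ _)).
have /andP[q1 q2] := nearest_itv y.
move: q1; rewrite le_eqVlt => /orP[/eqP q1|q1].
  exists (fun=> 0); split; first exact: smooth_cst.
  have c0 : cos (grid_angle j u) < 0.
    have -> : cos (grid_angle j u) = -1.
      have -> : grid_angle j u = - pi + 2 * pi * (nearest y)%:~R.
        by rewrite q1 /grid_angle -/y; field.
      have : expi (- pi + 2 * pi * (nearest y)%:~R) = expi (- pi) :> R[i] by rewrite expiD expi2piz mulr1.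
      by move=> /(congr1 Re) /= ->; rewrite cosN cospi.
    lra.
  have cc : (fun v => cos (grid_angle j v)) @ u --> cos (grid_angle j u) by exact: (rsmooth_cont (rsmooth_cos_angle j)).
  have H0 := @cvgr_lt _ _ _ (nbhs_filter u) _ _ cc _ c0.
  apply: (@filterS _ _ (nbhs_filter u) _ _ _ H0) => v cv.
  by rewrite /grid_window step0 ?mul0r//; lra.
exists (fun v => (grid_window j v)%:C * F q v); split.
  by refine (smooth_mul (smooth_real (rsmooth_grid_window j)) (sF q)).
have H1 := @cvgr_gt _ _ _ (nbhs_filter u) _ _ cy _ q1.
have H2 := @cvgr_lt _ _ _ (nbhs_filter u) _ _ cy _ q2.
apply: (@filterS2 _ _ (nbhs_filter u) _ _ _ _ H1 H2) => v v1 v2.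
by rewrite /= (@nearest_eq _ q)// (ltW v1) v2.
Qed.

Lemma quasi_glue j (F : int -> 'rV[R]_(n + n) -> R[i]) : (forall q, smooth (F q)) ->
  (forall q l u, F (q + k%:Z * l 0 (rshift n j)) (u + map_mx intr l) =
     expi (2 * pi * (k%:R * dot (lsubmx u) (map_mx intr (rsubmx l)))) * F q u) ->
  quasi_periodic k (fun u => (grid_window j u)%:C * F (nearest (u 0 (rshift n j))) u).
Proof.
move=> sF HF; split; first exact: smooth_glue.
move=> l u; rewrite grid_window_shift.
have -> : (u + map_mx intr l) 0 (rshift n j) = u 0 (rshift n j) + (l 0 (rshift n j))%:~R by rewrite !mxE.
by rewrite nearest_shift HF mulrCA.
Qed.

Definition sety j (v : R) u := u + (v - u 0 (rshift n j)) *: edir R (rshift n j).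

Lemma sety_shift j v l u : sety j (v + (l 0 (rshift n j))%:~R) (u + map_mx intr l) = sety j v u + map_mx intr l.
Proof.
rewrite /sety; have -> : (u + map_mx intr l) 0 (rshift n j) = u 0 (rshift n j) + (l 0 (rshift n j))%:~R by rewrite !mxE.
by rewrite addrAC; congr (_ + _ *: _ + _); ring.
Qed.

Lemma lsub_sety j v u : lsubmx (sety j v u) = lsubmx u.
Proof. by rewrite /sety raddfD /= edir_rshift scale_row_mx row_mxKl scaler0 addr0. Qed.

Lemma cont_sety_aux j (c : R) : continuous (fun w : 'rV[R]_(n + n).+1 =>
  sety j (c + w 0 ord0 * (w 0 (lift ord0 (rshift n j)) - c)) (\row_i w 0 (lift ord0 i))).
Proof.
move=> w; apply: (@cvg_rV R _ (nbhs w) _ _ (fun w : 'rV[R]_(n + n).+1 =>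
  sety j (c + w 0 ord0 * (w 0 (lift ord0 (rshift n j)) - c)) (\row_i w 0 (lift ord0 i)))) => i.
have E (v : 'rV[R]_(n + n).+1) : sety j (c + v 0 ord0 * (v 0 (lift ord0 (rshift n j)) - c)) (\row_i v 0 (lift ord0 i)) 0 i
  = v 0 (lift ord0 i) + (c + v 0 ord0 * (v 0 (lift ord0 (rshift n j)) - c) - v 0 (lift ord0 (rshift n j))) * edir R (rshift n j) 0 i.
  by rewrite /sety !mxE.
rewrite E; under eq_fun do rewrite E.
have cc x : (fun v : 'rV[R]_(n + n).+1 => v 0 x) @ w --> w 0 x by exact: cont_coord.
apply: cvgD => //; apply: cvgM; last exact: cvg_cst.
apply: cvgB => //; apply: cvgD; first exact: cvg_cst.
by apply: cvgM => //; apply: cvgB => //; exact: cvg_cst.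
Qed.

Lemma smooth_sety_aux j c g : smooth g -> smooth (fun w : 'rV[R]_(n + n).+1 =>
  g (sety j (c + w 0 ord0 * (w 0 (lift ord0 (rshift n j)) - c)) (\row_i w 0 (lift ord0 i)))).
Proof.
move=> sg; apply: (smooth_map sg (@cont_sety_aux j c)) => i.
case: (unliftP ord0 i) => [i' ->|->]; right; last first.
  exists (fun w => w 0 (lift ord0 (rshift n j)) - c), (rshift n j); split.
    exact: rsmooth_sub (rsmooth_coord _ _) (@rsmooth_cst R _ _).
  move=> u s; apply/rowP => a; rewrite /sety !mxE /=; ring.
case: (eqVneq i' (rshift n j)) => [->|ij].
  exists (fun w => w 0 ord0), (rshift n j); split; first exact: rsmooth_coord.
  move=> u s; apply/rowP => a; rewrite /sety !mxE /= !eqxx !(inj_eq (@lift_inj _ ord0)).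
  by case: (a == _) => /=; ring.
exists (fun=> 1), i'; split; first exact: rsmooth_cst.
move=> u s; apply/rowP => a; rewrite /sety !mxE /= !(inj_eq (@lift_inj _ ord0)).
by rewrite [rshift n j == i']eq_sym (negbTE ij) /=; ring.
Qed.

Lemma smooth_sety j c g : smooth g -> smooth (fun u => g (sety j c u)).
Proof.
move=> sg; apply: (smooth_map sg (L := sety j c)).
  move=> u; apply: (@cvg_rV R _ (nbhs u) _ _ (sety j c)) => i.
  have E (v : 'rV[R]_(n + n)) : sety j c v 0 i = v 0 i + (c - v 0 (rshift n j)) * edir R (rshift n j) 0 i.
    by rewrite /sety !mxE.
  rewrite E; under eq_fun do rewrite E.
  have cc x : (fun v : 'rV[R]_(n + n) => v 0 x) @ u --> u 0 x by exact: cont_coord.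
  apply: cvgD => //; apply: cvgM; last exact: cvg_cst.
  by apply: cvgB => //; exact: cvg_cst.
move=> i; case: (eqVneq i (rshift n j)) => [->|ij].
  left=> u s; apply/rowP => a; rewrite /sety !mxE !eqxx /=; by case: (a == _) => /=; ring.
right; exists (fun=> 1), i; split; first exact: rsmooth_cst.
move=> u s; apply/rowP => a; rewrite /sety !mxE eqxx [rshift n j == i]eq_sym (negbTE ij) /=; ring.
Qed.

Definition hadamard_quot j (c : R) g u : R[i] := cint01 (fun s => partial (rshift n j) g (sety j (c + s * (u 0 (rshift n j) - c)) u)).

Lemma hadamard_quotE j c g u : hadamard_quot j c g u = cint01 (fun s => (fun w : 'rV[R]_(n + n).+1 =>
  partial (rshift n j) g (sety j (c + w 0 ord0 * (w 0 (lift ord0 (rshift n j)) - c)) (\row_i w 0 (lift ord0 i)))) (rcons0 s u)).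
Proof.
congr cint01; apply/funext => s /=; rewrite rcons00 rcons0S; congr (partial _ _ (sety _ _ _)).
by apply/rowP => i; rewrite mxE rcons0S.
Qed.

Lemma smooth_hadamard_quot j c g : smooth g -> smooth (hadamard_quot j c g).
Proof.
move=> sg; rewrite (funext (hadamard_quotE j c g)).
apply: (smooth_cint01 (H := fun w : 'rV[R]_(n + n).+1 => partial (rshift n j) g
  (sety j (c + w 0 ord0 * (w 0 (lift ord0 (rshift n j)) - c)) (\row_i w 0 (lift ord0 i))))).
exact: smooth_sety_aux (smooth_partial _ sg).
Qed.

(** The difference quotient in y_j at the hyperplane y_j = c, as the integral of the
    derivative along the segment, is smooth across the hyperplane. *)
Lemma hadamard j c g u : smooth g ->
  g u - g (sety j c u) = (u 0 (rshift n j) - c)%:C * hadamard_quot j c g u.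
Proof.
move=> sg; set z := u 0 (rshift n j) - c.
have sp := smooth_partial (rshift n j) sg.
pose f s := partial (rshift n j) g (sety j (c + s * z) u).
have cf : ccont f.
  have := ccont_rcons0 u (smooth_sety_aux j c sp); congr ccont; apply/funext => s.
  rewrite rcons00 rcons0S; congr (partial _ _ (sety _ _ _)).
  by apply/rowP => i; rewrite mxE rcons0S.
rewrite -(cint01Z z%:C cf).
have cyE s : sety j (c + s * z) u = sety j c u + (s * z) *: edir R (rshift n j).
  by rewrite /sety -[RHS]addrA -scalerDl; congr (_ + _ *: _); ring.
rewrite (@cint01_derive R (fun s => g (sety j (c + s * z) u))); last 2 first.
- by apply: ccontM cf; exact: ccont_cst.
- move=> t; have dg : is_cderive (t * z) (1 : R) (fun r => g (sety j c u + r *: edir R (rshift n j))) (f t).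
    by rewrite /f cyE; apply/is_cderive_line; exact: smooth_cderiv sg.
  have dz : is_derive t (1:R) (fun s => s * z) z.
    by under eq_fun do rewrite mulrC; exact: is_derive_scale.
  have := @is_cderive_comp _ _ (fun s => s * z) t _ _ dg dz; congr is_cderive; apply/funext => s; by rewrite cyE.
rewrite !cyE mul1r mul0r scale0r addr0; congr (g _ - _).
rewrite /sety -addrA -scalerDl /z; have -> : c - u 0 (rshift n j) + (u 0 (rshift n j) - c) = 0 by ring.
by rewrite scale0r addr0.
Qed.

Lemma quasi_partialy j g l u : quasi_periodic k g -> partial (rshift n j) g (u + map_mx intr l) =
  expi (2 * pi * (k%:R * dot (lsubmx u) (map_mx intr (rsubmx l)))) * partial (rshift n j) g u.
Proof.
move=> [sg qg]; set e := expi _.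
have := smooth_cderiv (rshift n j) u sg => /is_cderive_line0 dg.
apply: cderiv_partial; apply/is_cderive_line0.
have E s : g (u + map_mx intr l + s *: edir R (rshift n j)) = e * g (u + s *: edir R (rshift n j)).
  rewrite addrAC qg; congr (expi (_ * (_ * dot _ _)) * _).
  by rewrite raddfD /= edir_rshift scale_row_mx row_mxKl scaler0 addr0.
by under eq_fun do rewrite E; exact: (is_cderiveZ _ dg).
Qed.

Definition grid_offset j q u : R := k%:R * u 0 (rshift n j) - q%:~R.
(** The function sin (2 pi t) / (2 pi t), written as an integral to be smooth at
    t = 0. *)
Definition sinc j q u : R := \int[@lebesgue_measure R]_(s in `[0, 1]) cos (2 * pi * grid_offset j q u * s).

Lemma rsmooth_grid_offset j q : rsmooth (grid_offset j q).
Proof.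
apply: rsmooth_sub (@rsmooth_cst R _ _).
exact: rsmooth_mul (@rsmooth_cst R _ _) (rsmooth_coord _ _).
Qed.

Lemma rsmooth_sinc j q : rsmooth (sinc j q).
Proof.
have -> : sinc j q = (fun u => \int[@lebesgue_measure R]_(s in `[0, 1])
   (fun w : 'rV[R]_(n + n).+1 => cos (2 * pi * (k%:R * w 0 (lift ord0 (rshift n j)) - q%:~R) * w 0 ord0)) (rcons0 s u)).
  by apply/funext => u; apply: eq_Rintegral => s _ /=; rewrite rcons00 rcons0S.
apply: (@rsmooth_int01 R _ (fun w : 'rV[R]_(n + n).+1 => cos (2 * pi * (k%:R * w 0 (lift ord0 (rshift n j)) - q%:~R) * w 0 ord0))).
have H : rsmooth (fun w : 'rV[R]_(n + n).+1 => 2 * pi * (k%:R * w 0 (lift ord0 (rshift n j)) - q%:~R) * w 0 ord0).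
  apply: rsmooth_mul (rsmooth_coord _ _); apply: rsmooth_mul; first exact: rsmooth_cst.
  apply: rsmooth_sub (@rsmooth_cst R _ _).
  exact: rsmooth_mul (@rsmooth_cst R _ _) (rsmooth_coord _ _).
by have [] := rsmooth_sincos H.
Qed.

Lemma sincE j q u : 2 * pi * grid_offset j q u * sinc j q u = sin (2 * pi * grid_offset j q u).
Proof.
set a := 2 * pi * grid_offset j q u.
have cc : continuous (fun s => cos (a * s)).
  move=> s; apply: (@continuous_comp _ _ _ (fun s => a * s) (@cos R)); last exact: continuous_cos.
  by apply: cvgM; [exact: cvg_cst|exact: cvg_id].
have c' : continuous (fun s => a * cos (a * s)) by apply: cont_mul => //; exact: cont_cst.
have d' (t : R) : is_derive t (1:R) (fun s => sin (a * s)) (a * cos (a * t)).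
  by apply: (is_derive_chain (is_derive_sin _) (is_derive_scale a t)); exact: mulrC.
have := int01_derive c' d'; rewrite mulr1 mulr0 sin0 subr0 => H; rewrite -H.
by rewrite int_bZ//; exact: bmeas_cont.
Qed.

Lemma sinc1 j q u : grid_offset j q u = 0 -> sinc j q u = 1.
Proof.
move=> t0; rewrite /sinc t0; under eq_Rintegral do rewrite mulr0 mul0r cos0.
exact: weight01_mass.
Qed.

Lemma sinc_neq0 j q u : `|grid_offset j q u| < 1 / 2 -> sinc j q u != 0.
Proof.
move=> t2; have [t0|t0] := eqVneq (grid_offset j q u) 0; first by rewrite sinc1// oner_neq0.
apply/eqP => s0; have := sincE j q u; rewrite s0 mulr0 => /esym/eqP.
have p0 := pi_gt0 R.
have a0 : 0 < `|grid_offset j q u| by rewrite normr_gt0.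
have : 0 < sin (2 * pi * `|grid_offset j q u|) by apply: sin_gt0_pi; nra.
by case: (ler0P (grid_offset j q u)) => _; rewrite ?mulrN ?sinN; lra.
Qed.

(** Equal to 1 for |t| at most 1/4 and to 0 for |t| at least 1/2, t being the grid
    offset. *)
Definition offset_window j q u : R := step 0 (1 / 16) (1 / 4 - grid_offset j q u ^+ 2).
(** A global smooth function equal to 1 / sinc near the hyperplane: the term
    1 - offset_window keeps the denominator positive where sinc has zeros. *)
Definition sin_quot j q u : R := sinc j q u / (sinc j q u ^+ 2 + (1 - offset_window j q u)).

Lemma sin_quot_den j q u : 0 < sinc j q u ^+ 2 + (1 - offset_window j q u).
Proof.
have h : (0 : R) < 1 / 16 by lra.
have [t2|t2] := ltP (`|grid_offset j q u|) (1 / 2).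
  apply: ltr_pwDl; first by rewrite exprn_even_gt0 ?sinc_neq0 ?orbT.
  by rewrite subr_ge0 step_le1.
rewrite /offset_window step0 ?subr0; first by rewrite ltr_wpDl ?sqr_ge0.
by rewrite subr_le0 -[_ ^+ 2]real_normK ?num_real//; nra.
Qed.

Lemma rsmooth_sin_quot j q : rsmooth (sin_quot j q).
Proof.
have h : (0 : R) < 1 / 16 by lra.
apply: rsmooth_mul (rsmooth_sinc j q) _; apply: rsmooth_inv => [u|]; first by rewrite gt_eqF// sin_quot_den.
apply: rsmooth_add; first exact: rsmooth_mul (rsmooth_sinc j q) (rsmooth_sinc j q).
apply: rsmooth_sub (@rsmooth_cst R _ _) _.
apply: (rsmooth_step (q := fun u => 1 / 4 - grid_offset j q u ^+ 2)) h _.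
exact: rsmooth_sub (@rsmooth_cst R _ _) (rsmooth_mul (rsmooth_grid_offset j q) (rsmooth_grid_offset j q)).
Qed.

(** Near a hyperplane of the grid, vanishing to first order is the same as being
    divisible by sin (2 pi k y_j). *)
Lemma sin_quotE j q u : `|grid_offset j q u| < 1 / 4 -> 2 * pi * grid_offset j q u = sin (grid_angle j u) * sin_quot j q u.
Proof.
move=> t4; have c0 : sinc j q u != 0 by apply: sinc_neq0; lra.
rewrite /sin_quot /offset_window step1; [|lra|]; last first.
  by have := t4; rewrite -[grid_offset j q u ^+ 2]real_normK ?num_real//; have := normr_ge0 (grid_offset j q u); nra.
have -> : sin (grid_angle j u) = sin (2 * pi * grid_offset j q u).
  have -> : 2 * pi * grid_offset j q u = grid_angle j u + 2 * pi * (- q)%:~R.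
    by rewrite rmorphN /= /grid_offset /grid_angle; ring.
  by have /(congr1 Im) /= <- : expi (grid_angle j u + 2 * pi * (- q)%:~R) = expi (grid_angle j u) :> R[i]
    by rewrite expiD expi2piz mulr1.
by rewrite -sincE subrr addr0; field.
Qed.

End Rounding.

(** * The quantum space *)

Section QuantumStates.
Variable R : realType.
Variables (n k' : nat).
Local Notation k := k'.+1.
Local Notation V := 'rV['I_k]_n.
Local Notation grid_pt := (@grid_pt R n k').
Local Notation grd j v := ((nearest k' (v 0 (rshift n j)))%:~R / k%:R).
Implicit Types (g h : 'rV[R]_(n + n) -> R[i]) (u : 'rV[R]_(n + n)) (j : 'I_n).

(** Replaces y_j by the nearest point of (1/k)Z and cuts off away from these
    points. *)
Definition snap j g u : R[i] := (grid_window k' j u)%:C * g (sety j (grd j u) u).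
Definition snaps (l : seq 'I_n) g := foldr snap g l.
Definition avgs (l : seq 'I_n) h := foldr (fun j h => avg k 1 0 j h) h l.
Definition on_grid j u := exists q : int, u 0 (rshift n j) = q%:~R / k%:R.

Lemma quasi_snap j g : quasi_periodic k g -> quasi_periodic k (snap j g).
Proof.
move=> [sg qg]; apply: (quasi_glue (F := fun q u => g (sety j (q%:~R / k%:R) u))) => [q|q l u].
  exact: smooth_sety.
have -> : (q + k%:Z * l 0 (rshift n j))%:~R / k%:R = q%:~R / k%:R + (l 0 (rshift n j))%:~R :> R.
  by rewrite intrD intrM -pmulrn mulrDl mulrAC divff ?pnatr_eq0// mul1r.
by rewrite sety_shift qg lsub_sety.
Qed.

Lemma quasi_snaps l g : quasi_periodic k g -> quasi_periodic k (snaps l g).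
Proof. by move=> qg; elim: l => //= j l; exact: quasi_snap. Qed.

Lemma quasi_avgs l h : quasi_periodic k h -> quasi_periodic k (avgs l h).
Proof. by move=> qh; elim: l => //= j l; exact: quasi_avg. Qed.

(** After snapping all coordinates, g is evaluated at points of the grid only. *)
Lemma snaps_eq0 (l D : seq 'I_n) g u :
  (forall v, (forall j, j \in l ++ D -> on_grid j v) -> g v = 0) ->
  (forall j, j \in D -> on_grid j u) -> snaps l g u = 0.
Proof.
elim: l D u => [|j l IH] D u Hg HD /=; first exact: Hg.
rewrite /snap (IH (j :: D)) ?mulr0// => [v Hv|i].
  apply: Hg => i H; apply: Hv; move: H; rewrite !mem_cat !in_cons.
  by case: (i == j); case: (i \in l).
have s_i : (sety j (grd j u) u) 0 (rshift n i) = if i == j then grd j u else u 0 (rshift n i).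
  rewrite /sety !mxE eqxx /= (inj_eq (@rshift_inj _ _)).
  by case: eqP => [->|_]; rewrite ?mulr1 ?mulr0 ?addr0// addrC subrK.
rewrite in_cons /on_grid s_i; case: eqP => [_ _|_ /= /HD//].
by exists (nearest k' (u 0 (rshift n j))).
Qed.

Section Annihilator.
Variable S : functional R n.
Hypothesis HS : quantum_space k S.
Local Notation Lam h := (S (untilded k h)).

Let S_lin := HS.1.1.

Lemma sec_lin0 : S (fun=> 0) = 0.
Proof.
have s0 : smooth_section k (fun _ : 'rV[R]_(n + n) => 0).
  by split=> [|l u]; [exact: smooth_cst|rewrite mulr0].
have := S_lin 1 s0 s0; have -> : (fun u : 'rV[R]_(n + n) => 1 * 0 + 0 : R[i]) = fun=> 0.
  by apply/funext => u; rewrite mulr0 addr0.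
by rewrite conjc1 mul1r => /eqP; rewrite -subr_eq0 opprD addrA subrr sub0r oppr_eq0 => /eqP.
Qed.

(** The constant vector fields are among those in the definition of the quantum
    space. *)
Lemma quantum_nabla j t : smooth_section k t -> S (nabla k (lshift n j) t) = 0.
Proof.
move=> st; have := HS.2 (fun i _ => (i == j)%:R).
have ts i : torus_smooth (fun _ : 'rV[R]_(n + n) => (i == j)%:R : R[i]).
  by split=> //; exact: smooth_cst.
move=> /(_ ts t st); rewrite (bigD1 j)//= eqxx big1 ?addr0; last first.
  move=> i /negbTE ij; rewrite /dmul /dnabla ij; apply/eqP; rewrite oppr_eq0; apply/eqP.
  rewrite -[RHS]sec_lin0; congr S.
  have -> : (fun u => conjc (conjc (false%:R : R[i])) * t u) = (fun=> 0).
    by apply/funext => u; rewrite !conjc0 mul0r.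
  by apply/funext => u; rewrite /nabla (cderiv_partial (is_cderive_cst _ _ _)) mulr0 subr0.
rewrite /dmul /dnabla => /eqP; rewrite oppr_eq0 => /eqP H; rewrite -[RHS]H; congr (S (nabla _ _ _)).
by apply/funext => u; rewrite !conjc1 mul1r.
Qed.

Lemma lam_lin (a : R[i]) h1 h2 : quasi_periodic k h1 -> quasi_periodic k h2 ->
  Lam (fun u => a * h1 u + h2 u) = conjc a * Lam h1 + Lam h2.
Proof.
move=> q1 q2; rewrite -(S_lin a (quasi_section q1) (quasi_section q2)); congr S.
by apply/funext => u; rewrite /untilded mulrDr mulrCA.
Qed.

Lemma lam0 : Lam (fun=> 0) = 0.
Proof. by rewrite -[RHS]sec_lin0; congr S; apply/funext => u; rewrite /untilded mulr0. Qed.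

Lemma lamB h1 h2 : quasi_periodic k h1 -> quasi_periodic k h2 -> Lam (fun u => h1 u - h2 u) = Lam h1 - Lam h2.
Proof.
move=> q1 q2; have := lam_lin (-1) q2 q1; have -> : conjc (-1 : R[i]) = -1 by apply: complex_eqP; rewrite /= ?oppr0.
rewrite mulN1r addrC => <-.
by congr S; apply/funext => u; rewrite /untilded mulN1r addrC.
Qed.

Lemma lam_sum (I : Type) (r : seq I) (a : I -> R[i]) (F : I -> 'rV[R]_(n + n) -> R[i]) :
  (forall i, quasi_periodic k (F i)) ->
  Lam (fun u => \sum_(i <- r) a i * F i u) = \sum_(i <- r) conjc (a i) * Lam (F i).
Proof.
move=> H; elim: r => [|i r IH].
  by rewrite big_nil -[RHS]lam0; congr S; apply/funext => u; rewrite /untilded big_nil.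
rewrite big_cons -IH -lam_lin//; last by apply: quasi_sum => j; exact: quasi_scale.
by congr S; apply/funext => u; rewrite /untilded big_cons.
Qed.

Lemma lam_Dx j h : quasi_periodic k h -> Lam (Dx k j h) = 0.
Proof. by move=> qh; rewrite -nabla_untilded ?quantum_nabla//; [exact: quasi_section|exact: qh.1]. Qed.

(** h and its average differ by a covariant derivative, that of avg 1 (-1). *)
Lemma lam_avg j h : quasi_periodic k h -> Lam (avg k 1 0 j h) = Lam h.
Proof.
move=> qh; have q1 := quasi_avg 1 0 j qh; have qm := quasi_avg 1 (-1) j qh.
apply/eqP; rewrite -subr_eq0 -lamB//; apply/eqP; rewrite -[RHS](lam_Dx j qm).
congr (S (untilded _ _)); apply/funext => u; rewrite Dx_avg_same// subrr mul0r sub0r rmorphN /=; ring.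
Qed.

Lemma lam_avgs l h : quasi_periodic k h -> Lam (avgs l h) = Lam h.
Proof. by move=> qh; elim: l => //= j l <-; apply: lam_avg; exact: quasi_avgs. Qed.

(** By [Dx_avg_same] the function is the covariant derivative of an average. *)
Lemma lam_exp j h : quasi_periodic k h -> Lam (fun u => (expi (- grid_angle k' j u) - 1) * h u) = 0.
Proof.
move=> qh; have q1 := quasi_avg 1 0 j qh; rewrite -[RHS](lam_Dx j q1).
congr (S (untilded _ _)); apply/funext => u; rewrite Dx_avg_same// addr0 mul0r subr0; congr (_ * _).
by rewrite mul1r.
Qed.

(** A multiple of the sine is e^(-i t) - 1 times the periodic function e^(i t) + 1. *)
Lemma lam_sin j h : quasi_periodic k h -> Lam (fun u => (sin (grid_angle k' j u))%:C * h u) = 0.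
Proof.
move=> qh; have pm := psm_mul (psm_cst _ (imag R / 2%:R)) (psm_add (psm_expi_angle R k' j) (psm_cst _ 1)).
rewrite -[RHS](lam_exp j (quasi_mul pm qh)); congr (S (untilded _ _)); apply/funext => u.
rewrite mulrA; congr (_ * _); set t := grid_angle _ _ _.
have E : (expi (- t) - 1) * (expi t + 1) = - 2%:R * imag R * (sin t)%:C.
  rewrite mulrDr mulr1 mulrBl mul1r [expi (- t) * _]mulrC expiV.
  by apply: complex_eqP; rewrite /expi /imag /= ?cosN ?sinN; ring.
rewrite mulrCA E; transitivity (- (imag R * imag R) * (sin t)%:C); first by rewrite imag_sqr opprK mul1r.
by field.
Qed.

(** 2 (1 - cos t) is e^(-i t) - 1 times e^(i t) - 1. *)
Lemma lam_cos j h : quasi_periodic k h -> Lam (fun u => (1 - cos (grid_angle k' j u))%:C * h u) = 0.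
Proof.
move=> qh; have pm := psm_mul (psm_cst _ (2%:R^-1)) (psm_sub (psm_expi_angle R k' j) (psm_cst _ 1)).
rewrite -[RHS](lam_exp j (quasi_mul pm qh)); congr (S (untilded _ _)); apply/funext => u.
rewrite mulrA; congr (_ * _); set t := grid_angle _ _ _.
have E : (expi (- t) - 1) * (expi t - 1) = 2%:R * (1 - cos t)%:C.
  rewrite mulrBr mulr1 mulrBl mul1r [expi (- t) * _]mulrC expiV.
  by apply: complex_eqP; rewrite /expi /= ?cosN ?sinN; ring.
by rewrite mulrCA E; field.
Qed.

(** 1 - grid_window vanishes near the zeros of 1 - cos (2 pi k y_j) and is
    therefore a smooth multiple of it. *)
Lemma lam_window j h : quasi_periodic k h -> Lam (fun u => (grid_window k' j u)%:C * h u) = Lam h.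
Proof.
move=> qh; have h1 : (1 / 4 : R) < 1 / 2 by lra. have h2 : (1 / 2 : R) < 3 / 4 by lra.
(* (1 - c) nu(c) = 1 - grid_window as a function of c = cos; the step in the
   denominator is supported where the numerator vanishes, and keeps it positive *)
pose nu (c : R) := (1 - step (1 / 4) (1 / 2) c) / (1 - c + step (1 / 2) (3 / 4) c).
have den u : 0 < 1 - cos (grid_angle k' j u) + step (1 / 2) (3 / 4) (cos (grid_angle k' j u)).
  set c := cos _; have c1 : c <= 1 by exact: cos_le1.
  have [c3|c3] := ltP c (3 / 4).
    by rewrite ltr_pwDl ?step_ge0//; lra.
  by rewrite step1//; lra.
have pn : periodic_smooth (fun u => (nu (cos (grid_angle k' j u)))%:C).
  apply: psm_cos_fun; have rc := rsmooth_cos_angle R k' j.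
  apply: rsmooth_mul.
    exact: rsmooth_sub (@rsmooth_cst R _ _) (rsmooth_step h1 rc).
  apply: rsmooth_inv => [u|]; first by rewrite gt_eqF.
  exact: rsmooth_add (rsmooth_sub (@rsmooth_cst R _ _) rc) (rsmooth_step h2 rc).
have pb : periodic_smooth (fun u => (grid_window k' j u)%:C) by apply: psm_cos_fun; exact: rsmooth_grid_window.
apply/eqP; rewrite eq_sym -subr_eq0 -lamB//; last exact: quasi_mul.
apply/eqP; rewrite -[RHS](lam_cos j (quasi_mul pn qh)); congr (S (untilded _ _)); apply/funext => u.
rewrite mulrA -rmorphM -[X in X - _]mul1r -mulrBl -rmorphB; congr (_%:C * _).
rewrite /nu /grid_window; set c := cos _; have c1 : c <= 1 by exact: cos_le1.
have [c2|c2] := leP (1 / 2) c; first by rewrite step1// subrr mul0r mulr0.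
by rewrite (@step0 _ (1 / 2)) ?(ltW c2)// addr0 mulrCA divff ?mulr1//; lra.
Qed.

(** Inside the window, g minus its value at the nearest hyperplane is divisible by
    k y_j - q ([hadamard]), hence by sin (2 pi k y_j) ([sin_quotE]), and S
    annihilates the multiples of this function ([lam_sin]). *)
Lemma lam_snap j g : quasi_periodic k g -> Lam (snap j g) = Lam g.
Proof.
move=> qg; have [sg _] := qg; rewrite -(lam_window j qg).
have qb : quasi_periodic k (fun u => (grid_window k' j u)%:C * g u).
  by apply: quasi_mul qg; apply: psm_cos_fun; exact: rsmooth_grid_window.
apply/eqP; rewrite eq_sym -subr_eq0 -lamB//; last exact: quasi_snap.
pose F q u := (sin_quot k' j q u / (2 * pi * k%:R))%:C * hadamard_quot j (q%:~R / k%:R) g u.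
have qF : quasi_periodic k (fun u => (grid_window k' j u)%:C * F (nearest k' (u 0 (rshift n j))) u).
  apply: quasi_glue => [q|q l u].
    refine (smooth_mul (smooth_real _) (smooth_hadamard_quot j _ sg)).
    exact: rsmooth_mul (@rsmooth_sin_quot R n k' j q) (@rsmooth_cst R _ _).
  have yE : (u + map_mx intr l) 0 (rshift n j) = u 0 (rshift n j) + (l 0 (rshift n j))%:~R by rewrite !mxE.
  have tE : grid_offset k' j (q + k%:Z * l 0 (rshift n j)) (u + map_mx intr l) = grid_offset k' j q u.
    by rewrite /grid_offset yE intrD intrM -pmulrn; ring.
  have QE : sin_quot k' j (q + k%:Z * l 0 (rshift n j)) (u + map_mx intr l) = sin_quot k' j q u.
    by rewrite /sin_quot /offset_window /sinc tE.
  rewrite /F QE mulrCA; congr (_ * _); set e := expi _.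
  have cE : (q + k%:Z * l 0 (rshift n j))%:~R / k%:R = q%:~R / k%:R + (l 0 (rshift n j))%:~R :> R.
    by rewrite intrD intrM -pmulrn mulrDl mulrAC divff ?pnatr_eq0// mul1r.
  rewrite /hadamard_quot; set c := q%:~R / k%:R in cE *.
  have sp := smooth_partial (rshift n j) sg.
  have cf : ccont (fun s => partial (rshift n j) g (sety j (c + s * (u 0 (rshift n j) - c)) u)).
    have := ccont_rcons0 u (smooth_sety_aux j c sp); congr ccont; apply/funext => s.
    rewrite rcons00 rcons0S; congr (partial _ _ (sety _ _ _)).
    by apply/rowP => i; rewrite mxE rcons0S.
  rewrite -(cint01Z e cf); congr cint01; apply/funext => s; rewrite cE yE.
  have -> : c + (l 0 (rshift n j))%:~R + s * (u 0 (rshift n j) + (l 0 (rshift n j))%:~R - (c + (l 0 (rshift n j))%:~R)) =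
    (c + s * (u 0 (rshift n j) - c)) + (l 0 (rshift n j))%:~R by ring.
  by rewrite sety_shift (quasi_partialy _ _ _ qg) lsub_sety.
apply/eqP; rewrite -[RHS](lam_sin j qF); congr (S (untilded _ _)); apply/funext => u.
rewrite /snap -mulrBr hadamard// [RHS]mulrCA; set y := u 0 (rshift n j).
have [b0|b0] := eqVneq (grid_window k' j u) 0; first by rewrite b0 !mul0r.
congr (_ * _); rewrite /F mulrA -rmorphM; congr (_%:C * _).
have /sin_quotE := grid_window_near b0; rewrite -/y /grid_offset -/y => H.
have p0 : pi != 0 :> R by rewrite gt_eqF// pi_gt0.
have k0 : k%:R != 0 :> R by rewrite pnatr_eq0.
apply: (@mulfI _ (2 * pi * k%:R)); first by rewrite !mulf_neq0// pnatr_eq0.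
rewrite [RHS]mulrC -[RHS]mulrA divfK; last by rewrite !mulf_neq0// pnatr_eq0.
by rewrite -H; field; rewrite addrC natr1 pnatr_eq0.
Qed.

Lemma lam_snaps l g : quasi_periodic k g -> Lam (snaps l g) = Lam g.
Proof. by move=> qg; elim: l => //= j l <-; apply: lam_snap; exact: quasi_snaps. Qed.

End Annihilator.

Lemma fc_lin (a : R[i]) (f g : 'rV[R]_n -> R[i]) p : periodic_smooth f -> periodic_smooth g ->
  fourier_coef (fun x => a * f x + g x) p = a * fourier_coef f p + fourier_coef g p.
Proof.
move=> pf pg; have [B1 H1] := psm_bounded pf; have [B2 H2] := psm_bounded pg.
rewrite /fourier_coef -(cint_lin (weight01 R) a (cboundedP (cboundedM H1 (cbounded_chrN R p)))
  (cboundedP (cboundedM H2 (cbounded_chrN R p)))).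
by congr cint; apply/funext => x; rewrite mulrDl mulrA.
Qed.

Lemma partialx_shift j h (l : 'rV[int]_(n + n)) u : quasi_periodic k h ->
  partial (lshift n j) h (u + map_mx intr l) =
    expi (2 * pi * (k%:R * dot (lsubmx u) (map_mx intr (rsubmx l)))) *
      (partial (lshift n j) h u + (2 * pi * (k%:R * (l 0 (rshift n j))%:~R))%:C * imag R * h u).
Proof.
move=> [sh qh]; set b : 'rV[R]_n := map_mx intr (rsubmx l).
have dq : is_derive u (edir R (lshift n j)) (fun v => 2 * pi * (k%:R * dot (lsubmx v) b)) (2 * pi * (k%:R * (l 0 (rshift n j))%:~R)).
  apply/is_derive_line0.
  have -> : (fun r : R => 2 * pi * (k%:R * dot (lsubmx (u + r *: edir R (lshift n j))) b)) =
     (fun r : R => 2 * pi * (k%:R * dot (lsubmx u) b) + (2 * pi * (k%:R * (l 0 (rshift n j))%:~R)) * r).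
    apply/funext => r; rewrite raddfD /= edir_lshift scale_row_mx row_mxKl dotDl [dot (_ *: _) _]dotC dotZr dot_edir.
    by rewrite /b !mxE; ring.
  have := is_deriveD (is_derive_cst (2 * pi * (k%:R * dot (lsubmx u) b)) 0 (1:R)) (is_derive_scale (2 * pi * (k%:R * (l 0 (rshift n j))%:~R)) 0).
  by move/is_derive_eq; apply; rewrite add0r.
have := is_cderiveM (cderiv_expi dq) (smooth_cderiv (lshift n j) u sh) => /is_cderive_line0 dh.
rewrite -/b; set e := expi (2 * pi * (k%:R * dot (lsubmx u) b)).
transitivity ((2 * pi * (k%:R * (l 0 (rshift n j))%:~R))%:C * imag R * e * h u + e * partial (lshift n j) h u); last by ring.
apply: cderiv_partial.
have E s : h (u + map_mx intr l + s *: edir R (lshift n j)) =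
  expi (2 * pi * (k%:R * dot (lsubmx (u + s *: edir R (lshift n j))) b)) * h (u + s *: edir R (lshift n j)).
  by rewrite addrAC qh.
by apply/is_cderive_line0; under eq_fun do rewrite E.
Qed.

Lemma quasi_Dx j h : quasi_periodic k h -> quasi_periodic k (Dx k j h).
Proof.
move=> qh; have [sh Hq] := qh; split=> [|l u]; first exact: smooth_Dx.
rewrite /Dx partialx_shift// Hq.
have -> : (u + map_mx intr l) 0 (rshift n j) = u 0 (rshift n j) + (l 0 (rshift n j))%:~R by rewrite !mxE.
by rewrite !rmorphM !rmorphD; ring.
Qed.

(** The symbol of the covariant derivative; it vanishes for p = k y, which singles
    out one Fourier coefficient at each point of the grid. *)
Lemma fhat_Dx j h p y : quasi_periodic k h -> fhat (Dx k j h) p y =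
  (2 * pi * ((p 0 j)%:~R - k%:R * y 0 j))%:C * imag R * fhat h p y.
Proof.
move=> qh; have pB := xpsm_xslice y (quasi_xpsm qh).
have pdB : periodic_smooth (xslice (partial (lshift n j) h) y).
  by rewrite -partial_xslice; [exact: psm_partial|case: qh].
have E : xslice (Dx k j h) y = fun x => (- ((2 * pi * (k%:R * y 0 j))%:C * imag R)) * xslice h y x + xslice (partial (lshift n j) h) y x.
  by apply/funext => x; rewrite /xslice /Dx row_mxEr; ring.
rewrite {1}/fhat E fc_lin// -/(fhat h p y) -/(fhat (partial _ h) p y) fhat_partialx; last exact: (quasi_xpsm qh).
by rewrite mulrBr rmorphB /=; ring.
Qed.

(** Only the class of (p, y) modulo the vectors (k l, l) matters; the k^n values
    at (m, m/k) therefore represent all pairs with p = k y. *)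
Lemma fhat_class h p y (l : 'rV[int]_n) : quasi_periodic k h ->
  fhat h (p + k%:Z *: l) (y + map_mx intr l) = fhat h p y.
Proof.
move=> [_ qh]; rewrite /fhat /fourier_coef /xslice; congr cint; apply/funext => x.
have -> : row_mx x (y + map_mx intr l) = row_mx x y + map_mx intr (row_mx 0 l).
  by rewrite map_row_mx map_mx0 add_row_mx addr0.
rewrite qh row_mxKl row_mxKr mulrAC -expiD mulrC; congr (_ * expi _).
rewrite map_mxD dotDl; have -> : dot (map_mx intr (k%:Z *: l)) x = k%:R * dot x (map_mx intr l).
  by rewrite dotC /dot mulr_sumr; apply: eq_bigr => i _; rewrite !mxE /= intrM -pmulrn mulrCA.
ring.
Qed.

(** Over a point y of the grid the averaged function is annihilated by all the
    operators Dx j, so its product with e^(-2 pi i k y.x) is constant in x.  The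
    constant is the Fourier coefficient of index k y, which averaging preserves. *)
Lemma zero_at_grid h : quasi_periodic k h -> (forall m : V, fhat h (zvec m) (grid_pt m) = 0) ->
  forall v, (forall j, j \in enum 'I_n -> on_grid j v) -> avgs (enum 'I_n) h v = 0.
Proof.
move=> qh h0 v gv.
have /choice[q Hq] : forall j, exists q : int, v 0 (rshift n j) = q%:~R / k%:R.
  by move=> j; apply: gv; rewrite mem_enum.
pose p : 'rV[int]_n := \row_j q j; pose y : 'rV[R]_n := rsubmx v.
have yp j : k%:R * y 0 j = (p 0 j)%:~R.
  by rewrite /y /p !mxE Hq mulrCA divff ?mulr1// pnatr_eq0.
have ep x j : expi (- grid_angle k' j (row_mx x y)) = 1 :> R[i].
  by rewrite /grid_angle row_mxEr yp -mulrN -rmorphN /= expi2piz.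
have Da l j : j \in l -> forall x, Dx k j (avgs l h) (row_mx x y) = 0.
  elim: l => //= i l IH; rewrite in_cons => /orP[/eqP -> x|/IH H x].
    rewrite Dx_avg_same; last exact: quasi_avgs.
    have := ep x i; rewrite /grid_angle => ->; rewrite addr0 mulr1 subrr mul0r sub0r; rewrite mul0r oppr0//.
  rewrite Dx_avg; last by have [] := quasi_avgs l qh.
  rewrite /avg; have -> : avgF k 1 0 i (Dx k j (avgs l h)) (row_mx x y) = fun=> 0.
    apply/funext => a; rewrite /avgF -[_ + a *: _]row_mx_linel H mulr0//.
  exact: cint01_0.
have fa l : fhat (avgs l h) p y = fhat h p y.
  elim: l => //= j l <-; set g := avgs l h.
  have qg : quasi_periodic k g by exact: quasi_avgs.
  have qB := quasi_avg 1 (-1) j qg; set B := avg k 1 (-1) j g in qB.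
  have E : xslice (avg k 1 0 j g) y = fun x => 1 * xslice g y x + xslice (Dx k j B) y x.
    apply/funext => x; rewrite /xslice Dx_avg_same// subrr mul0r sub0r rmorphN /=; ring.
  have pD := xpsm_xslice y (quasi_xpsm (quasi_Dx j qB)).
  rewrite {1}/fhat E fc_lin//; last exact: xpsm_xslice (quasi_xpsm qg).
  by rewrite mul1r -/(fhat g p y) -/(fhat (Dx k j B) p y) fhat_Dx// yp subrr mulr0 !mul0r addr0.
pose g := avgs (enum 'I_n) h.
have qg : quasi_periodic k g by exact: quasi_avgs.
have pg := xpsm_xslice y (quasi_xpsm qg).
(* w is constant: all its partial derivatives vanish, and so do its Fourier
   coefficients except that of index 0 *)
pose w x := xslice g y x * expi (- (2 * pi * dot (map_mx intr p) x)).
have pw : periodic_smooth w by exact: psm_mul (psm_chrN R p).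
have dw j : partial j w = fun=> 0.
  rewrite /w partialM; [|by case: pg|by case: (psm_chrN R p)].
  apply/funext => x; rewrite (cderiv_partial (cderiv_chrN p j x)) partial_xslice; last by case: qg.
  have := Da (enum 'I_n) j (mem_enum _ _) x; rewrite /Dx row_mxEr yp -/g => /eqP.
  rewrite subr_eq0 => /eqP E; rewrite {1}/xslice E /xslice; ring.
have fw (r : 'rV[int]_n) : r != 0 -> fourier_coef w r = 0.
  move=> r0; have [j rj] : exists j, r 0 j != 0.
    apply/existsP; apply: contraNT r0; rewrite negb_exists => /forallP H.
    by apply/eqP/rowP => j; apply/eqP; have := H j; rewrite negbK mxE.
  have := fc_partial j r pw; rewrite dw /fourier_coef.
  have -> : (fun x : 'rV[R]_n => 0 * expi (- (2 * pi * dot (map_mx intr r) x))) = (fun=> 0).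
    by apply/funext => x; rewrite mul0r.
  rewrite (cint0 (weight01 R)) => /esym/eqP; rewrite mulf_eq0 => /orP[|/eqP //].
  rewrite mulf_eq0 (negbTE (imag_neq0 R)) orbF => /eqP[/eqP].
  by rewrite !mulf_eq0 (gt_eqF (pi_gt0 R)) pnatr_eq0 /= intr_eq0 (negbTE rj).
have f0 : fourier_coef w 0 = 0.
  have -> : fourier_coef w 0 = fhat g p y.
    rewrite /fourier_coef /fhat /fourier_coef; congr cint; apply/funext => x.
    by rewrite map_mx0 dot0l mulr0 oppr0 expi0 mulr1.
  rewrite /g fa; set m := zred k' p.
  have /kdvdP[l Hl] : kdvd k' (p - zvec m) by rewrite kdvd_zred eqxx.
  have pE : p = zvec m + k%:Z *: l by rewrite -Hl addrC subrK.
  have -> : y = grid_pt m + map_mx intr l.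
    apply/rowP => j; apply: (@mulfI _ k%:R); first by rewrite pnatr_eq0.
    rewrite yp pE /grid_pt Zk_vecE !mxE /= intrD intrM -pmulrn /hbar mulrDr mulrA divff ?pnatr_eq0// mul1r//.
  by rewrite pE fhat_class.
have := fourier_inversion (lsubmx v) pw.
have -> : (fun M => fsum w M (lsubmx v)) = fun=> 0.
  apply/funext => M; rewrite /fsum big1// => r _.
  by have [->|/fw ->] := eqVneq r 0; rewrite ?f0 mul0r.
move=> /ccvg_unique/(_ (ccvg_cst 0)) /eqP; rewrite /w mulf_eq0 => /orP[/eqP|].
  by rewrite /xslice /g /y hsubmxK.
by move=> /eqP /(congr1 (@cabs R)); rewrite cabs_expi cabs0 => /eqP; rewrite oner_eq0.
Qed.

Definition state_section (m : V) := wb_section m (@plateau R n).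

Lemma quasi_state_section m : quasi_periodic k (state_section m).
Proof. exact: (quasi_wb_section m (@smooth_plateau R n) (@plateau_out R n)). Qed.

Lemma fhat_state_section m m' : fhat (state_section m) (zvec m') (grid_pt m') = (m == m')%:R.
Proof.
have := fhat_wb_section m m' 0 (@smooth_plateau R n) (@plateau_out R n).
by rewrite add0r plateau_in ?mulr1// normr0; lra.
Qed.

(** The difference of h and the combination of the sections [state_section m] with
    the same values [fhat h m (m/k)] has vanishing averages at the points of the
    grid, so S annihilates it after averaging and snapping. *)
Lemma quantum_value S h : quantum_space k S -> quasi_periodic k h ->
  S (untilded k h) = \sum_(m : V) conjc (fhat h (zvec m) (grid_pt m)) * S (untilded k (state_section m)).
Proof.
move=> HS qh; rewrite -(lam_sum HS); last exact: quasi_state_section.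
set hs := fun u => \sum_m _.
have qhs : quasi_periodic k hs by apply: quasi_sum => m; apply: quasi_scale; exact: quasi_state_section.
apply/eqP; rewrite -subr_eq0 -(lamB HS)//; apply/eqP.
have qd : quasi_periodic k (fun u => h u - hs u).
  have := quasi_lin (-1) qhs qh; congr quasi_periodic; apply/funext => u; by rewrite mulN1r addrC.
rewrite -(lam_avgs HS (enum 'I_n) qd) -(lam_snaps HS (enum 'I_n)); last exact: quasi_avgs.
rewrite -[RHS](lam0 HS); congr (S (untilded _ _)); apply/funext => u.
apply: (@snaps_eq0 _ [::]) => // v; rewrite cats0; apply: zero_at_grid => // m.
have fhs : fhat hs (zvec m) (grid_pt m) = fhat h (zvec m) (grid_pt m).
  have pst (m' : V) := psm_bounded (xpsm_xslice (grid_pt m) (quasi_xpsm (quasi_state_section m'))).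
  rewrite {1}/fhat /fourier_coef.
  have -> : (fun v : 'rV[R]_n => xslice hs (grid_pt m) v * expi (- (2 * pi * dot (map_mx intr (zvec m)) v))) =
    fun v => \sum_m' fhat h (zvec m') (grid_pt m') * state_section m' (row_mx v (grid_pt m)) *
       expi (- (2 * pi * dot (map_mx intr (zvec m)) v)).
    by apply/funext => x; rewrite /xslice /hs mulr_suml.
  rewrite (cint_sum (weight01 R)); last first.
    move=> m'; have [B HB] := pst m'; eexists.
    exact: cboundedP (cboundedM (cboundedM (cbounded_cst _ _) HB) (cbounded_chrN R _)).
  have E (m' : V) : cint `[0, 1]%classic (fun v => fhat h (zvec m') (grid_pt m') * state_section m' (row_mx v (grid_pt m)) *
       expi (- (2 * pi * dot (map_mx intr (zvec m)) v))) = fhat h (zvec m') (grid_pt m') * (m' == m)%:R.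
    have [B HB] := pst m'.
    rewrite -fhat_state_section /fhat /fourier_coef -(cintZ (weight01 R) _ (cboundedP (cboundedM HB (cbounded_chrN R _)))).
    by congr cint; apply/funext => x; rewrite -mulrA.
  under eq_bigr do rewrite E.
  rewrite (bigD1 m)//= eqxx mulr1 big1 ?addr0// => m' /negbTE ->; exact: mulr0.
have := fc_lin (-1) (zvec m) (xpsm_xslice (grid_pt m) (quasi_xpsm qhs)) (xpsm_xslice (grid_pt m) (quasi_xpsm qh)).
rewrite -/(fhat hs _ _) -/(fhat h _ _) fhs mulN1r addNr => <-.
by rewrite /fhat; congr fourier_coef; apply/funext => x; rewrite /xslice mulN1r addrC.
Qed.

End QuantumStates.

(** * Vanishing integrals and sums over the lattice *)

Section Positivity.
Variable R : realType.
Local Notation mu := (@lebesgue_measure R).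
Local Notation dc := (@decay R).

Lemma rint_ge0 (D : set R) d (h : 'rV[R]_d -> R) : (forall v, 0 <= h v) -> 0 <= rint D h.
Proof.
elim: d h => [|d IH] h h0 /=; first exact: h0.
by apply: Rintegral_ge0 => t _; apply: IH => v; exact: h0.
Qed.

(** Near a point where F is positive the integral would be positive. *)
Lemma Rintegral_eq0 (F : R -> R) : continuous F -> (forall t, 0 <= F t) ->
  mu.-integrable setT (EFin \o F) -> \int[mu]_t F t = 0 -> forall t, F t = 0.
Proof.
move=> cF F0 iF I0 t; apply/eqP; rewrite eq_le F0 andbT leNgt; apply/negP => Ft.
have F2 : 0 < F t / 2 by rewrite divr_gt0.
have /cvgrPdist_lt/(_ _ F2) := cF t.
move=> /nbhs_ballP[e /= e0 He].
have HF s : s \in `](t - e), (t + e)[ -> F t / 2 <= F s.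
  rewrite in_itv /= => /andP[s1 s2].
  have /He : ball t e s by rewrite /ball /= distrC ltr_norml; lra.
  by move=> /=; rewrite ltr_norml => /andP[h1 h2]; lra.
pose I : set R := `](t - e), (t + e)[%classic.
have mI : measurable (I : set (measurableTypeR R)) by exact: measurable_itv.
have mF : measurable_fun setT (EFin \o F).
  by apply/measurable_EFinP; exact: continuous_measurable_fun.
have : ((F t / 2)%:E * mu I <= \int[mu]_s (EFin \o F) s)%E.
  rewrite -(integral_cst mu mI).
  apply: (@le_trans _ _ (\int[mu]_(s in I) (EFin \o F) s)%E); last first.
    by apply: ge0_subset_integral => // s _; rewrite /= lee_fin.
  apply: ge0_le_integral => //.
  - by move=> s _; rewrite lee_fin ltW.
  - exact: measurable_funTS mF.
have -> : (\int[mu]_s (EFin \o F) s = 0)%E.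
  have /fineK <- := integrable_fin_num measurableT iF.
  by move: I0; rewrite /Rintegral => ->.
have -> : mu I = (2 * e)%:E.
  have := @lebesgue_measure_itv R `](t - e), (t + e)[; rewrite /= lte_fin ifT; last lra.
  by move=> ->; rewrite -EFinB; congr _%:E; ring.
by rewrite -EFinM lee_fin leNgt mulr_gt0// mulr_gt0.
Qed.

Lemma rint_slice_cont (D : set R) w d (h : 'rV[R]_d.+1 -> R) B : weight D w -> dominated w B h ->
  continuous (fun t => rint D (fun v => h (rcons0 t v))).
Proof.
move=> Hw Hh t; apply: seq_continuous_at => u cu; have [_ L _] := rint_main Hw d.
have HB s : dominated w B (fun v => h (rcons0 s v)).
  apply: (dominated_le Hw _ (dominated_slice Hw s Hh)).
  have [_ B0 _] := Hh; have [_ /(_ s)/andP[_ w1] _] := Hw.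
  by rewrite -[leRHS]mulr1 ler_wpM2l.
apply: (L _ _ B) => // v; have [ch _ _] := Hh.
apply: (@cvg_comp_cont _ _ _ _ (fun n => rcons0 (u n) v) h (rcons0 t v)); last exact: ch.
by apply: cvg_rcons0 => //; exact: cvg_cst.
Qed.

Lemma rint_eq0 d (h : 'rV[R]_d -> R) B : dominated dc B h -> (forall v, 0 <= h v) ->
  rint setT h = 0 -> forall v, h v = 0.
Proof.
elim: d h B => [|d IH] h B Hh h0 /=; first by move=> H v; rewrite -[RHS]H; congr h; apply/rowP => -[].
move=> H v.
have Hw := weightT R.
have cF := rint_slice_cont Hw Hh.
have F0 t : 0 <= rint setT (fun v => h (rcons0 t v)) by apply: rint_ge0.
have [L _ _] := rint_main Hw d.
have iF : mu.-integrable setT (EFin \o (fun t => rint setT (fun v => h (rcons0 t v)))).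
  apply: (dominated_integrable Hw (B := B * (\int[mu]_(t in setT) dc t) ^+ d)) cF _ => t _.
  by apply: le_trans (L _ _ (dominated_slice Hw t Hh)) _; rewrite mulrAC.
have E := Rintegral_eq0 cF F0 iF H.
rewrite [v]rcons0_eta; apply: (IH _ _ (dominated_slice Hw _ Hh)) (E _) _ => w.
exact: h0.
Qed.

End Positivity.

Section Csum.
Variable R : realType.
Variable n : nat.
Local Notation Re := (@complex.Re R).
Local Notation Im := (@complex.Im R).
Implicit Types (F G : 'rV[int]_n -> R[i]).

Definition psum F (M : nat) : R[i] := \sum_(p <- zbox M n) F p.
(** Sums over the lattice are limits over cubes, meaningful for [rapid] families. *)
Definition csum F : R[i] := (limn (fun M => Re (psum F M))) +i* (limn (fun M => Im (psum F M))).
Definition rapid (C : R) F := forall p, cabs (F p) <= C * pdecay R p.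

Lemma zbox_sub M M' p : (M <= M')%N -> p \in zbox M n -> p \in zbox M' n.
Proof.
by move=> MM; rewrite !mem_zbox => /forallP H; apply/forallP => i; exact: leq_trans (H i) MM.
Qed.

Lemma zbox_split (W : nmodType) M M' (F : 'rV[int]_n -> W) : (M <= M')%N ->
  \sum_(p <- zbox M' n) F p = \sum_(p <- zbox M n) F p + \sum_(p <- zbox M' n | p \notin zbox M n) F p.
Proof.
move=> MM; rewrite (bigID (fun p => p \in zbox M n)) /=; congr (_ + _).
rewrite -big_filter; apply: perm_big; apply: uniq_perm; rewrite ?filter_uniq ?uniq_zbox// => p.
by rewrite mem_filter; case: (boolP (p \in zbox M n)) => //= pM; rewrite (zbox_sub MM).
Qed.

Lemma zbox_sum_nd (f : 'rV[int]_n -> R) : (forall p, 0 <= f p) ->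
  nondecreasing_seq (fun M => \sum_(p <- zbox M n) f p).
Proof. by move=> f0 M M' MM; rewrite (zbox_split _ MM) lerDl sumr_ge0. Qed.

Lemma zbox_sum_cvg (f : 'rV[int]_n -> R) C : (forall p, `|f p| <= C * pdecay R p) ->
  cvgn (fun M => \sum_(p <- zbox M n) f p).
Proof.
move=> H; have C0 : 0 <= C * pdecay R (0 : 'rV[int]_n) by exact: le_trans (normr_ge0 _) (H 0).
have pp (p : 'rV[int]_n) : 0 <= pdecay R p by exact: pdecay_ge0.
have C00 : 0 <= C.
  have p0 := pdecay_gt0 R (0 : 'rV[int]_n).
  by move: C0; rewrite pmulr_lge0.
pose a M := \sum_(p <- zbox M n) (f p + C * pdecay R p); pose b M := \sum_(p <- zbox M n) C * pdecay R p.
have bB M : b M <= C * Zmass R ^+ n by rewrite /b -mulr_sumr ler_wpM2l// pdecay_sum.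
have cb : cvgn b.
  apply: nondecreasing_is_cvgn; first by apply: zbox_sum_nd => p; rewrite mulr_ge0.
  by exists (C * Zmass R ^+ n) => _ [M _ <-].
have ca : cvgn a.
  apply: nondecreasing_is_cvgn.
    apply: zbox_sum_nd => p; have := H p; rewrite ler_norml => /andP[h _]; lra.
  exists (2 * (C * Zmass R ^+ n)) => _ [M _ <-]; apply: (@le_trans _ _ (2 * b M)); last by rewrite ler_wpM2l.
  rewrite /a /b mulr_sumr; apply: ler_sum => p _.
  by have := H p; rewrite ler_norml => /andP[_ h]; lra.
have -> : (fun M => \sum_(p <- zbox M n) f p) = (fun M => a M - b M).
  by apply/funext => M; rewrite /a /b big_split /= addrK.
exact: is_cvgB.
Qed.

Lemma csum_cvg C F : rapid C F -> ccvg (psum F) (csum F).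
Proof.
move=> HF; split; rewrite /csum /=.
  have -> : (fun M => Re (psum F M)) = (fun M => \sum_(p <- zbox M n) Re (F p)).
    by apply/funext => M; rewrite /psum (big_morph Re (@Re_add R) (erefl _)).
  by apply: (@zbox_sum_cvg _ C) => p; apply: le_trans (HF p); exact: Re_le_cabs.
have -> : (fun M => Im (psum F M)) = (fun M => \sum_(p <- zbox M n) Im (F p)).
  by apply/funext => M; rewrite /psum (big_morph Im (@Im_add R) (erefl _)).
by apply: (@zbox_sum_cvg _ C) => p; apply: le_trans (HF p); exact: Im_le_cabs.
Qed.

Lemma rapid_ge0 C F : rapid C F -> 0 <= C.
Proof.
move=> /(_ 0) H; have p0 := pdecay_gt0 R (0 : 'rV[int]_n).
by have := le_trans (cabs_ge0 _) H; rewrite pmulr_lge0.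
Qed.

Lemma csum_bound C F : rapid C F -> cabs (csum F) <= C * Zmass R ^+ n.
Proof.
move=> HF; apply: (ccvg_le (csum_cvg HF)) => M; apply: le_trans (cabs_sum _ _ _) _.
apply: le_trans (ler_sum _ (fun p _ => HF p)) _.
by rewrite -mulr_sumr ler_wpM2l ?pdecay_sum// (rapid_ge0 HF).
Qed.

Lemma csum_lin C1 C2 a F G : rapid C1 F -> rapid C2 G -> csum (fun p => a * F p + G p) = a * csum F + csum G.
Proof.
move=> HF HG; have H : rapid (cabs a * C1 + C2) (fun p => a * F p + G p).
  move=> p; apply: le_trans (cabsD _ _) _; rewrite mulrDl lerD// cabsM -mulrA.
  by rewrite ler_wpM2l ?cabs_ge0.
apply: ccvg_unique (csum_cvg H) _.
have := ccvgD (ccvgM (ccvg_cst a) (csum_cvg HF)) (csum_cvg HG).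
by congr ccvg; apply/funext => M; rewrite /psum mulr_sumr big_split.
Qed.

Lemma csum_tail C F M : rapid C F -> cabs (csum F - psum F M) <= C * (Zmass R ^+ n - zmass R M ^+ n).
Proof.
move=> HF; have C0 := rapid_ge0 HF.
pose tl M' := psum F (M' + M)%N - psum F M.
apply: (@ccvg_le R tl) => [|M'].
  apply: ccvgB (ccvg_cst _); have [h1 h2] := csum_cvg HF.
  by split; [rewrite (cvg_shiftn M (fun m => Re (psum F m)))|rewrite (cvg_shiftn M (fun m => Im (psum F m)))].
rewrite /tl /psum (zbox_split F (leq_addl M' M)) addrAC subrr add0r.
apply: le_trans (cabs_sum _ _ _) _; apply: le_trans (ler_sum _ (fun p _ => HF p)) _.
rewrite -mulr_sumr ler_wpM2l//.
have := zbox_split (fun p => pdecay R p) (leq_addl M' M).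
rewrite !pdecay_sumE => E; rewrite -(@lerD2l _ (zmass R M ^+ n)) -E addrC subrK.
by rewrite lerXn2r ?nnegrE ?zmass_ge0 ?Zmass_ge0// zmass_leZ.
Qed.

(** Dominated convergence for sums over the lattice, from the uniform bound
    [csum_tail] on the tails. *)
Lemma csum_dominated C (Fs : nat -> 'rV[int]_n -> R[i]) F :
  (forall j, rapid C (Fs j)) -> rapid C F -> (forall p, ccvg (Fs^~ p) (F p)) ->
  ccvg (fun j => csum (Fs j)) (csum F).
Proof.
move=> HFs HF Hc; have C0 := rapid_ge0 HF; apply/ccvgP/cvgrPdist_le => e e0.
have cz : 2 * C * (Zmass R ^+ n - zmass R M ^+ n) @[M --> \oo] --> (0 : R).
  have -> : (0 : R) = 2 * C * (Zmass R ^+ n - Zmass R ^+ n) by rewrite subrr mulr0.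
  apply: cvgM; first exact: cvg_cst.
  apply: cvgB; first exact: cvg_cst.
  apply: (@cvg_comp_cont _ _ _ _ (zmass R) (fun x => x ^+ n)); last exact: exprn_continuous.
  exact: zmass_cvg.
have e2 : 0 < e / 2 by rewrite divr_gt0.
have /cvgrPdist_le/(_ _ e2)[M _ /(_ M (leqnn M)) HM] := cz.
have := ccvg_sum (zbox M n) Hc; move=> /ccvgP/cvgrPdist_le/(_ _ e2).
apply: filterS => j Hj; rewrite sub0r normrN ger0_norm ?cabs_ge0//.
move: Hj HM; rewrite !sub0r !normrN ger0_norm ?cabs_ge0// => Hj HM.
have -> : csum (Fs j) - csum F = (csum (Fs j) - psum (Fs j) M) + ((psum (Fs j) M - psum F M) - (csum F - psum F M)).
  by ring.
apply: le_trans (cabsD _ _) _; apply: le_trans (lerD (csum_tail M (HFs j)) (cabsB _ _)) _.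
have h1 := csum_tail M HF; have h2 := ler_norm (2 * C * (Zmass R ^+ n - zmass R M ^+ n)).
rewrite /psum; lra.
Qed.

End Csum.

(** * Weil-Brezin coefficients *)

Section WeilBrezin.
Variable R : realType.
Variables (n k' : nat).
Local Notation k := k'.+1.
Local Notation V := 'rV['I_k]_n.
Local Notation grid_pt := (@grid_pt R n k').
Local Notation Re := (@complex.Re R).
Local Notation Im := (@complex.Im R).
Local Notation dc := (@decay R).
Implicit Types (g h t : 'rV[R]_(n + n) -> R[i]) (m b c : V) (phi psi : 'rV[R]_n -> R[i]).

(** Shifting y by m/k in the definition of the transform is the same as evaluating
    the partial Fourier coefficient there. *)
Lemma weil_brezinE t m y : weil_brezin t m y = fhat (tilded k t) (zvec m) (y + grid_pt m).
Proof.
rewrite /weil_brezin /fhat /fourier_coef /xslice Zk_vecE; congr cint; apply/funext => x.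
by rewrite /tilde /tilded /dotxy row_mxKl row_mxKr -Zk_vecE.
Qed.

(** The normalisation of sigma times that of theta. *)
Definition kappa : R := (2 `^ (n%:R / 4) * k%:R `^ (n%:R / 2)) * (2 * k%:R) `^ (- n%:R / 2).

Lemma sigmaE m t : sigma m t = kappa%:C * conjc (fhat (tilded k t) (zvec m) (grid_pt m)).
Proof.
transitivity ((2 `^ (n%:R / 4) * k%:R `^ (n%:R / 2))%:C * \sum_(m' : V)
   ((m == m')%:R * ((2 * k%:R) `^ (- n%:R / 2))%:C * conjc (weil_brezin t m' 0))); first by [].
rewrite (bigD1 m)// eqxx big1; last first.
  by move=> m' ; rewrite eq_sym => /negbTE ->; rewrite !mul0r.
by rewrite [X in _ * X]addr0 mul1r weil_brezinE add0r mulrA -rmorphM.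
Qed.

Lemma kappa_gt0 : 0 < kappa.
Proof.
have k0 : 0 < k%:R :> R by rewrite ltr0n.
by rewrite /kappa !mulr_gt0 ?powR_gt0// mulr_gt0.
Qed.

(** The operator 1 - Dx^2: at y + m/k the symbol of Dx j on the coefficient of index m is
    -2 pi i k y_j, so it gives decay of Weil-Brezin coefficients in y as [laplD]
    gives decay of Fourier coefficients. *)
Definition herm (j : 'I_n) h := fun u => -1 * Dx k j (Dx k j h) u + h u.
Definition herms (l : seq 'I_n) h := foldr herm h l.

Lemma quasi_herms l h : quasi_periodic k h -> quasi_periodic k (herms l h).
Proof.
move=> qh; elim: l => //= j l IH; apply: quasi_lin => //.
by do 2! apply: quasi_Dx.
Qed.

Lemma fhat_herms l h m y : quasi_periodic k h -> fhat (herms l h) (zvec m) (y + grid_pt m) =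
  (\prod_(j <- l) (1 + (2 * pi * (k%:R * y 0 j)) ^+ 2))%:C * fhat h (zvec m) (y + grid_pt m).
Proof.
move=> qh; elim: l => [|j l IH] /=; first by rewrite big_nil mul1r.
rewrite big_cons [X in X * _]rmorphM -[RHS]mulrA -IH; set g := herms l h.
have qg : quasi_periodic k g by exact: quasi_herms.
have q1 := quasi_Dx j qg; have q2 := quasi_Dx j q1.
have yE : (zvec m 0 j)%:~R - k%:R * (y + grid_pt m) 0 j = - (k%:R * y 0 j) :> R.
  rewrite /grid_pt Zk_vecE !mxE /= mulrDr mulrA /hbar divff ?pnatr_eq0//; ring.
have := fc_lin (-1) (zvec m) (xpsm_xslice (y + grid_pt m) (quasi_xpsm q2)) (xpsm_xslice (y + grid_pt m) (quasi_xpsm qg)).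
rewrite -/(fhat g _ _) -/(fhat (Dx k j (Dx k j g)) _ _) !fhat_Dx// yE => H.
apply: (etrans (H : fhat (herm j g) (zvec m) (y + grid_pt m) = _)).
set X := fhat g _ _; set c := k%:R * y 0 j.
transitivity (- ((imag R * imag R) * ((2 * pi * - c) ^+ 2)%:C) * X + X).
  by rewrite rmorphXn expr2; ring.
have -> : (2 * pi * - c) ^+ 2 = (2 * pi * c) ^+ 2 by ring.
rewrite imag_sqr mulN1r opprK -{2}[X]mul1r -mulrDl; congr (_ * X).
by rewrite addrC [RHS]rmorphD.
Qed.

Lemma fhat_wb_decay h : quasi_periodic k h -> exists2 C, 0 <= C & forall m y,
  cabs (fhat h (zvec m) (y + grid_pt m)) <= C * \prod_(i < n) dc (y 0 i).
Proof.
move=> qh; have qL := quasi_herms (enum 'I_n) qh.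
have [B B0 HB] := quasi_bounded qL; exists (2 * B) => [|m y]; first by rewrite mulr_ge0.
have : cabs (fhat (herms (enum 'I_n) h) (zvec m) (y + grid_pt m)) <= 2 * B.
  by apply: fc_bound => [|x]; [exact: xpsm_xslice (quasi_xpsm qL)|exact: HB].
rewrite fhat_herms//; set X := fhat h _ _; rewrite cabsM cabs_real big_enum /=.
set P := \prod_(i < n) (1 + _) => H.
have d0 : 0 < \prod_(i < n) dc (y 0 i) by apply: prodr_gt0 => i _; exact: decay_gt0.
have P1 : (\prod_(i < n) dc (y 0 i))^-1 <= P.
  rewrite -prodfV; apply: ler_prod => i _; rewrite /decay invrK.
  rewrite addr_ge0 ?sqr_ge0//= lerD2l mulrA exprMn -[leLHS]mul1r ler_wpM2r ?sqr_ge0//.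
  have p2 := @pi_ge2 R; have k1 : 1 <= k%:R :> R by rewrite ler1n.
  have p1 : 1 <= 2 * pi :> R by lra.
  have : (1 : R) <= 2 * pi * k%:R by rewrite mulr_ege1.
  by move=> h1; rewrite exprn_ege1.
rewrite -ler_pdivrMr//; apply: le_trans H; rewrite mulrC ler_wpM2r ?cabs_ge0//.
exact: le_trans P1 (ler_norm _).
Qed.

Lemma cont_fhat h p (a : 'rV[R]_n) : quasi_periodic k h ->
  continuous (fun y : 'rV[R]_n => Re (fhat h p (y + a))) /\ continuous (fun y : 'rV[R]_n => Im (fhat h p (y + a))).
Proof.
move=> qh; have [B B0 HB] := quasi_bounded qh.
have cb y : cbounded (B * 1) (fun x => xslice h y x * expi (- (2 * pi * dot (map_mx intr p) x))).
  apply: cboundedM (cbounded_chrN R p); have sh := qh.1; split=> [||x]; last exact: HB.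
    exact: (smooth_contRe (smooth_xslice y sh)).
  exact: (smooth_contIm (smooth_xslice y sh)).
have H (us : nat -> 'rV[R]_n) (y : 'rV[R]_n) : us i @[i --> \oo] --> y -> ccvg (fun i => fhat h p (us i + a)) (fhat h p (y + a)).
  move=> cu; apply: (cint_cvg (weight01 R)) => [i||x]; [exact: cboundedP|exact: cboundedP|].
  apply: ccvgM (ccvg_cst _).
  have cus : row_mx x (us i + a) @[i --> \oo] --> row_mx x (y + a).
    apply: (@cvg_comp_cont _ _ _ _ (fun i => us i + a) (fun z => row_mx x z) (y + a)); last exact: cont_row_mxr.
    by apply: cvgD => //; exact: cvg_cst.
  split.
    apply: (@cvg_comp_cont _ _ _ _ (fun i => row_mx x (us i + a)) (fun u => Re (h u)) (row_mx x (y + a))) => //.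
    exact: (smooth_contRe qh.1).
  apply: (@cvg_comp_cont _ _ _ _ (fun i => row_mx x (us i + a)) (fun u => Im (h u)) (row_mx x (y + a))) => //.
  exact: (smooth_contIm qh.1).
by split=> y; apply: seq_continuous_at => us /H[].
Qed.

Lemma wb_cdominated t m : smooth_section k t ->
  exists B, cdominated dc B (fun y => conjc (weil_brezin t m y)).
Proof.
move=> /section_quasi qt; have [C C0 HC] := fhat_wb_decay qt; exists C.
have [c1 c2] := cont_fhat (zvec m) (grid_pt m) qt.
have E : (fun y => conjc (weil_brezin t m y)) = fun y => conjc (fhat (tilded k t) (zvec m) (y + grid_pt m)).
  by apply/funext => y; rewrite weil_brezinE.
have cr : continuous (fun y : 'rV[R]_n => Re (conjc (fhat (tilded k t) (zvec m) (y + grid_pt m)))).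
  by under eq_fun do rewrite Re_conjc.
have ci : continuous (fun y : 'rV[R]_n => Im (conjc (fhat (tilded k t) (zvec m) (y + grid_pt m)))).
  by under eq_fun do rewrite Im_conjc; exact: cont_opp.
rewrite E; split; split=> // y.
  by apply: le_trans (Re_le_cabs _) _; rewrite cabsJ.
by apply: le_trans (Im_le_cabs _) _; rewrite cabsJ.
Qed.

Lemma schwartz_cdominated phi B : schwartz phi ->
  (forall y, (1 + `|y|) ^+ (n + n) * cabs (phi y) <= B) -> cdominated dc B phi.
Proof.
move=> [sp _] HB.
have B0 : 0 <= B by apply: le_trans (HB 0); rewrite mulr_ge0 ?cabs_ge0// exprn_ge0// addr_ge0.
have H y : cabs (phi y) <= B * \prod_(i < n) dc (y 0 i).
  have d0 : 0 < \prod_(i < n) dc (y 0 i) by apply: prodr_gt0 => i _; exact: decay_gt0.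
  rewrite -ler_pdivrMr//; apply: le_trans (HB y); rewrite mulrC ler_wpM2r ?cabs_ge0//.
  rewrite -prodfV addnn -mul2n exprM -[X in _ ^+ X]card_ord -prodr_const.
  apply: ler_prod => i _; rewrite /decay invrK addr_ge0 ?sqr_ge0//=.
  have := ler_mx_norm y i; have := normr_ge0 (y 0 i); rewrite -[y 0 i ^+ 2]real_normK ?num_real//; nra.
have cr := smooth_contRe sp; have ci := smooth_contIm sp; split; split=> // y.
  exact: le_trans (Re_le_cabs _) (H y).
exact: le_trans (Im_le_cabs _) (H y).
Qed.

Lemma schwartz_bound phi : schwartz phi -> exists2 B, 0 <= B & forall y, cabs (phi y) <= B.
Proof.
move=> [_ /(_ [::] 0%N)[B HB]]; exists B => [|y].
  by apply: le_trans (HB 0); rewrite expr0 mul1r cabs_ge0.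
by have := HB y; rewrite expr0 mul1r.
Qed.

Lemma tempered_regular (a : R[i]) : tempered (regular_dist (fun _ : 'rV[R]_n => a)).
Proof.
have dom phi : schwartz phi -> exists B, cdominated dc B phi.
  move=> sp; have [_ /(_ [::] (n + n)%N)[B HB]] := sp; exists B; exact: schwartz_cdominated.
split=> [b phi psi sp ss|].
  have [B1 H1] := dom _ sp; have [B2 H2] := dom _ ss; rewrite /regular_dist.
  rewrite (cintZ (weightT R) a (cdominated_lin (weightT R) b H1 H2)) (cint_lin (weightT R) b H1 H2).
  by rewrite (cintZ (weightT R) a H1) (cintZ (weightT R) a H2); ring.
exists (cabs a * (2 * (\int[@lebesgue_measure R]_(t in setT) dc t) ^+ n)), (n + n)%N => phi B sp HB.
have H := schwartz_cdominated sp (fun y => HB [::] y isT).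
rewrite /regular_dist (cintZ (weightT R) a H) cabsM -mulrA ler_wpM2l ?cabs_ge0//.
by apply: le_trans (cint_bound (weightT R) H) _; rewrite -mulrA [B * _]mulrC.
Qed.

Section PairingData.
Variables (g : 'rV[R]_(n + n) -> R[i]) (u : V -> R[i]).
Hypothesis pg : periodic_smooth g.

Definition wbterm c m phi (p : 'rV[int]_n) : R[i] :=
  (kdvd k' (p - (zvec c - zvec m)))%:R * fhat g p (grid_pt m) * phi (- (hbar R k *: map_mx intr p)).

(** The Weil-Brezin coefficient of index c of g times the combination of the sigma^m
    with coefficients u: a combination of point masses at -p/k with weights
    [fhat g p (m/k)], for p congruent to c - m.  The weights decrease rapidly, but
    the support is not compact. *)
Definition wbdist c phi : R[i] := kappa%:C * \sum_(m : V) u m * csum (wbterm c m phi).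

Lemma rapid_wbterm : exists2 C, 0 <= C & forall c m phi B, (forall y, cabs (phi y) <= B) ->
  rapid (C * B) (wbterm c m phi).
Proof.
have [C C0 HC] := fhat_decay 1 pg; exists C => // c m phi B HB p.
have := HC p (grid_pt m); rewrite expr1 => H.
have B0 : 0 <= B by apply: le_trans (HB 0); exact: cabs_ge0.
rewrite /wbterm !cabsM cabs_bool mulrAC.
have H1 : (kdvd k' (p - (zvec c - zvec m)))%:R * cabs (fhat g p (grid_pt m)) <= C * pdecay R p.
  by apply: le_trans H; rewrite ler_piMl ?cabs_ge0//; case: kdvd.
rewrite mulrAC; apply: le_trans (ler_pM _ _ H1 (HB _)) _; rewrite ?mulr_ge0 ?cabs_ge0//.
by rewrite mulrAC.
Qed.

Lemma tempered_wbdist c : tempered (wbdist c).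
Proof.
have [C C0 HC] := rapid_wbterm; split=> [a phi psi sp ss|].
  have [B1 _ H1] := schwartz_bound sp; have [B2 _ H2] := schwartz_bound ss.
  have E m : csum (wbterm c m (fun y => a * phi y + psi y)) = a * csum (wbterm c m phi) + csum (wbterm c m psi).
    rewrite -(csum_lin a (HC c m _ _ H1) (HC c m _ _ H2)); congr csum; apply/funext => p.
    by rewrite /wbterm; ring.
  rewrite /wbdist; under eq_bigr do rewrite E mulrDr mulrCA.
  by rewrite big_split /= -mulr_sumr; ring.
exists (kappa * \sum_m cabs (u m) * (C * Zmass R ^+ n)), 0%N => phi B sp HB.
have H y : cabs (phi y) <= B by have := HB [::] y isT; rewrite expr0 mul1r.
rewrite /wbdist cabsM cabs_real gtr0_norm ?kappa_gt0// -mulrA ler_wpM2l ?(ltW kappa_gt0)//.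
rewrite mulr_suml; apply: le_trans (cabs_sum _ _ _) _; apply: ler_sum => m _.
rewrite cabsM -mulrA ler_wpM2l ?cabs_ge0//; apply: le_trans (csum_bound (HC c m _ _ H)) _.
by rewrite mulrAC.
Qed.

Lemma tilded_mul f t : tilded k (fun x => f x * t x) = fun x => f x * tilded k t x.
Proof. by apply/funext => x; rewrite /tilded mulrCA. Qed.

Lemma fhat_shift_class h m c (p l : 'rV[int]_n) : quasi_periodic k h ->
  zvec m + p - zvec c = k%:Z *: l ->
  fhat h (zvec m + p) (grid_pt m) = fhat h (zvec c) (- (hbar R k *: map_mx intr p) + grid_pt c).
Proof.
move=> qh Hl.
have -> : zvec m + p = zvec c + k%:Z *: l by rewrite -Hl [RHS]addrC subrK.
rewrite -[RHS](fhat_class _ _ l qh); congr fhat.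
rewrite /grid_pt !Zk_vecE; apply/rowP => i.
move: (zvec m) (zvec c) Hl => zm zc Hl.
have HH : ((zm 0 i + p 0 i - zc 0 i)%:~R : R) = k%:R * (l 0 i)%:~R.
  by have := congr1 (fun v : 'rV[int]_n => (v 0 i)%:~R : R) Hl; rewrite /= !mxE intrM.
have k0 : k%:R != 0 :> R by rewrite pnatr_eq0.
apply: (@mulfI _ k%:R) => //.
rewrite ![in LHS]mxE ![in RHS]mxE !mulrDr mulrN !mulrA /hbar divff// !mul1r.
move: HH; rewrite !intrD rmorphN /= => HH.
rewrite -HH; ring.
Qed.

(** The m-th value of the product is expanded by the Fourier series of g( . , m/k); the
    term of index p shifts the index of [fhat h] to m + p, and the reduction of
    m + p modulo k moves the base point m/k to -p/k + c/k. *)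
Lemma fhat_conj_mul h m : quasi_periodic k h ->
  conjc (fhat (fun x => conjc (g x) * h x) (zvec m) (grid_pt m)) =
  \sum_(c : V) csum (wbterm c m (fun y => conjc (fhat h (zvec c) (y + grid_pt c)))).
Proof.
move=> qh; have [B B0 HB] := quasi_bounded qh.
have [C C0 HC] := rapid_wbterm; have [C' C'0 HC'] := fhat_decay 1 pg.
have bh c y : cabs (conjc (fhat h (zvec c) (y + grid_pt c))) <= 2 * B.
  by rewrite cabsJ; apply: fc_bound => [|x]; [exact: xpsm_xslice (quasi_xpsm qh)|exact: HB].
have H1 := ccvg_sum (index_enum V) (fun c => csum_cvg (HC c m _ _ (bh c))).
apply: ccvg_unique H1.
pose y := grid_pt m; have ph := xpsm_xslice y (quasi_xpsm qh); have pgy := psm_xslice y pg.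
have Hf x := fourier_inversion x pgy.
have [Bh Hh] := psm_bounded ph; have [Bg Hg] := psm_bounded pgy.
pose e (p : 'rV[int]_n) (x : 'rV[R]_n) := expi (- (2 * pi * dot (map_mx intr p) x)) : R[i].
have cbc B' (F : 'rV[R]_n -> R[i]) : cbounded B' F -> cbounded B' (fun x => conjc (F x)).
  move=> [c1 c2 HF]; split=> [||x]; last by rewrite cabsJ.
    by under eq_fun do rewrite Re_conjc.
  by under eq_fun do rewrite Im_conjc; exact: cont_opp.
have cchr (p : 'rV[int]_n) : cbounded (1 : R) (fun x : 'rV[R]_n => chr p x).
  by apply: cbounded_expi; apply: rsmooth_mul; [exact: rsmooth_cst|exact: rsmooth_dot].
pose Bf : R := C' * Zmass R ^+ n.
have fB M x : cabs (fsum (xslice g y) M x) <= Bf.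
  apply: le_trans (cabs_sum _ _ _) _; apply: (@le_trans _ _ (\sum_(p <- zbox M n) C' * pdecay R p)).
    by apply: ler_sum => p _; rewrite cabsM cabs_chr mulr1 -[pdecay R p]expr1; exact: HC'.
  by rewrite -mulr_sumr ler_wpM2l// pdecay_sum.
have cfs M : cbounded Bf (fun x => fsum (xslice g y) M x).
  have sF : smooth (fun x : 'rV[R]_n => fsum (xslice g y) M x).
    apply: smooth_sum => p; refine (smooth_mul (smooth_cst _) (smooth_expi _)).
    by apply: rsmooth_mul; [exact: rsmooth_cst|exact: rsmooth_dot].
  by split=> [||x]; [exact: (smooth_contRe sF)|exact: (smooth_contIm sF)|exact: fB].
have bg x : cabs (xslice g y x) <= Bf by apply: (ccvg_le (Hf x)) => M; exact: fB.
have cgf : cbounded Bf (fun x => xslice g y x) by have [c1 c2 _] := Hg; split.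
have L : ccvg (fun M => fourier_coef (fun x => conjc (fsum (xslice g y) M x) * xslice h y x) (zvec m))
   (fhat (fun x => conjc (g x) * h x) (zvec m) y).
  apply: (cint_cvg (weight01 R) (B := Bf * Bh * 1)) => [M||x].
  - exact: cboundedP (cboundedM (cboundedM (cbc _ _ (cfs M)) Hh) (cbounded_chrN R _)).
  - exact: cboundedP (cboundedM (cboundedM (cbc _ _ cgf) Hh) (cbounded_chrN R _)).
  - by apply: ccvgM (ccvg_cst _); apply: ccvgM (ccvg_cst _); apply: ccvgJ; exact: Hf.
have := ccvgJ L; congr ccvg; apply/funext => M; rewrite /psum exchange_big.
have cM (a b : R[i]) : conjc (a * b) = conjc a * conjc b by exact: rmorphM.
have -> : fourier_coef (fun x => conjc (fsum (xslice g y) M x) * xslice h y x) (zvec m) =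
   \sum_(p <- zbox M n) conjc (fhat g p y) * fhat h (zvec m + p) y.
  have E x : conjc (fsum (xslice g y) M x) * xslice h y x * e (zvec m) x =
     \sum_(p <- zbox M n) conjc (fhat g p y) * (xslice h y x * e (zvec m + p) x).
    rewrite /fsum (big_morph conjc (@rmorphD _ _ (@conjc R)) (rmorph0 _)) !mulr_suml.
    apply: eq_bigr => p _; rewrite cM.
    have E2 : conjc (chr p x) * e (zvec m) x = e (zvec m + p) x.
      by rewrite /chr /e conj_expi -expiD; congr expi; rewrite map_mxD dotDl; ring.
    by rewrite -E2 /fhat -!mulrA; congr (_ * _); exact: mulrCA.
  transitivity (cint `[0, 1]%classic (fun x => \sum_(p <- zbox M n) conjc (fhat g p y) * (xslice h y x * e (zvec m + p) x))).
    by congr cint; apply/funext => x; exact: E.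
  have cbp (p : 'rV[int]_n) := cboundedP (cboundedM Hh (cbounded_chrN R (zvec m + p))).
  rewrite (cint_sum (weight01 R)); last first.
    move=> p; eexists; have := cdominated_lin (weight01 R) (conjc (fhat g p y)) (cbp p) (cdominated0 _ n).
    by congr cdominated; apply/funext => x; rewrite addr0.
  by apply: eq_bigr => p _; rewrite (cintZ (weight01 R) _ (cbp p)).
rewrite (big_morph conjc (@rmorphD _ _ (@conjc R)) (rmorph0 _)); apply: eq_bigr => p _.
rewrite cM conjcK /wbterm.
have E (c : V) : kdvd k' (p - (zvec c - zvec m)) = (c == zred k' (zvec m + p)).
  by rewrite -kdvd_zred; congr kdvd; rewrite opprB addrCA addrA.
under eq_bigr do rewrite E.
set c := zred k' (zvec m + p); rewrite (bigD1 c)// eqxx mul1r big1; last first.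
  by move=> c' /andP[_ /negbTE ->]; rewrite !mul0r.
rewrite [RHS]addr0; congr (_ * conjc _).
have /kdvdP[l Hl] : kdvd k' (zvec m + p - zvec c) by rewrite kdvd_zred eqxx.
exact: (fhat_shift_class qh Hl).
Qed.

Lemma wbdist_deq S : deq k S (fun t => \sum_(m : V) u m * sigma m t) ->
  deq k (dmul g S) (of_weil_brezin wbdist).
Proof.
move=> HS t st; rewrite /dmul HS; last first.
  by apply: section_mul st; exact: psm_conj.
have qt := section_quasi st.
transitivity (kappa%:C * \sum_(m : V) u m * \sum_(c : V) csum (wbterm c m (fun y => conjc (fhat (tilded k t) (zvec c) (y + grid_pt c))))).
  rewrite mulr_sumr; apply: eq_bigr => m _; rewrite sigmaE -fhat_conj_mul//.
  by rewrite (tilded_mul (fun x => conjc (g x))); ring.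
rewrite /of_weil_brezin /wbdist -mulr_sumr exchange_big; congr (_ * _).
apply: eq_bigr => m _; rewrite mulr_sumr; apply: eq_bigr => c _; congr (_ * csum (wbterm c m _)).
by apply/funext => y; rewrite weil_brezinE.
Qed.

(** On the dilated cutoffs chi(y/j) the sums converge dominatedly to their value on
    the constant a, where the weights add up to the matrix entry by
    [mat_fourier]. *)
Lemma wbdist_value c (a : R[i]) : dist_value (wbdist c) (fun=> a)
  (kappa%:C * (\sum_(m : V) toeplitz_mx g c m * u m) * a).
Proof.
move=> chi [schi [r Hr] chi1]; have [C C0 HC] := rapid_wbterm.
have [B B0 HB] : exists2 B, 0 <= B & forall y, cabs (chi y) <= B.
  have [B1 B10 H1] := bounded_on_ball r (smooth_contRe schi).
  have [B2 B20 H2] := bounded_on_ball r (smooth_contIm schi).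
  exists (B1 + B2) => [|y]; first exact: addr_ge0.
  have [yr|yr] := leP r `|y|; first by rewrite Hr// cabs0 addr_ge0.
  by apply: le_trans (cabs_le _) _; rewrite lerD ?H1 ?H2// ltW.
apply/ccvgP.
have matE m : csum (wbterm c m (fun=> a)) = toeplitz_mx g c m * a.
  apply: ccvg_unique (csum_cvg (HC c m (fun=> a) (cabs a) (fun _ => lexx _))) _.
  have := ccvgM (mat_fourier c m pg) (ccvg_cst a); congr ccvg; apply/funext => M.
  by rewrite /psum mulr_suml; apply: eq_bigr.
have cl m : ccvg (fun j => csum (wbterm c m (fun y => chi (j.+1%:R^-1 *: y) * a))) (csum (wbterm c m (fun=> a))).
  apply: (csum_dominated (C := C * ((1 + B) * cabs a))) => [j||p].
  - apply: HC => y; rewrite cabsM ler_wpM2r ?cabs_ge0//; apply: le_trans (HB _) _; lra.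
  - by apply: HC => y; rewrite ler_peMl ?cabs_ge0//; lra.
  rewrite /wbterm; apply: ccvgM; first exact: ccvg_cst.
  rewrite -[X in ccvg _ X]mul1r; apply: ccvgM (ccvg_cst _).
  set z := - _; have cz : j.+1%:R^-1 *: z @[j --> \oo] --> (0 : 'rV[R]_n).
    rewrite -[X in _ --> X](scale0r z); apply: cvgZr_tmp; exact: cvg_harmonic.
  have := cz _ chi1 => -[N _ HN].
  have c1 : ccvg (fun j => chi (j.+1%:R^-1 *: z)) 1.
    split; apply: cvg_near_cst; exists N => // j Nj; by rewrite (HN _ Nj).
  exact: c1.
have E : kappa%:C * (\sum_(m : V) toeplitz_mx g c m * u m) * a = kappa%:C * \sum_(m : V) u m * csum (wbterm c m (fun=> a)).
  rewrite -mulrA; congr (_ * _); rewrite mulr_suml; apply: eq_bigr => m _.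
  by rewrite matE; ring.
rewrite E; apply: ccvgM; first exact: ccvg_cst.
by apply: ccvg_sum => m; apply: ccvgM (ccvg_cst _) (cl m).
Qed.

End PairingData.

End WeilBrezin.

(** * The pairing *)

Section Pairing.
Variable R : realType.
Variables (n k' : nat).
Local Notation k := k'.+1.
Local Notation V := 'rV['I_k]_n.
Local Notation grid_pt := (@grid_pt R n k').
Local Notation kappa := (@kappa R n k').
Local Notation Re := (@complex.Re R).
Local Notation Im := (@complex.Im R).
Local Notation dc := (@decay R).
Implicit Types (g h t : 'rV[R]_(n + n) -> R[i]) (m b c : V) (phi psi : 'rV[R]_n -> R[i]).

Lemma smooth_dil phi (a : R) : smooth phi -> smooth (fun y => phi (a *: y)).
Proof.
move=> sp; apply: (smooth_map sp); first exact: scaler_continuous.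
move=> j; right; exists (fun=> a), j; split=> [|u s]; first exact: rsmooth_cst.
by rewrite scalerDr scalerA mulrC.
Qed.

Lemma supp_in_dil phi (r a : R) : 0 < a -> supp_in r phi -> supp_in (r / a) (fun y => phi (a *: y)).
Proof.
by move=> a0 H y Hy; apply: H; rewrite normrZ gtr0_norm// -ler_pdivrMl// mulrC.
Qed.

Lemma supp_inMl phi psi r : supp_in r phi -> supp_in r (fun y => phi y * psi y).
Proof. by move=> H y /H ->; rewrite mul0r. Qed.

Lemma supp_inMr psi phi r : supp_in r phi -> supp_in r (fun y => psi y * phi y).
Proof. by move=> H y /H ->; rewrite mulr0. Qed.

(** On the support the weight is bounded below. *)
Lemma cdominated_supp phi r : smooth phi -> supp_in r phi -> exists B, cdominated dc B phi.
Proof.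
move=> sp Hr.
have [B1 B10 H1] := bounded_on_ball r (smooth_contRe sp).
have [B2 B20 H2] := bounded_on_ball r (smooth_contIm sp).
have r1 : 0 < 1 + r ^+ 2 by rewrite ltr_pwDl// sqr_ge0.
exists ((B1 + B2) * (1 + r ^+ 2) ^+ n).
have P (y : 'rV[R]_n) : 0 <= \prod_(i < n) dc (y 0 i) by apply: prodr_ge0 => i _; exact/ltW/decay_gt0.
have H (y : 'rV[R]_n) : `|y| <= r -> 1 <= (1 + r ^+ 2) ^+ n * \prod_(i < n) dc (y 0 i).
  move=> yr; rewrite -[X in _ ^+ X]card_ord -prodr_const -big_split /=.
  apply: (big_ind (fun x : R => 1 <= x)) => // [x z|i _]; first exact: mulr_ege1.
  rewrite /decay ler_pdivlMr ?mul1r; last by rewrite ltr_pwDl// sqr_ge0.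
  rewrite lerD2l -[y 0 i ^+ 2]real_normK ?num_real// lerXn2r ?nnegrE ?normr_ge0//.
    exact: le_trans (normr_ge0 y) yr.
  exact: le_trans (ler_mx_norm y i) yr.
have B0 : 0 <= (B1 + B2) * (1 + r ^+ 2) ^+ n by rewrite mulr_ge0 ?addr_ge0// exprn_ge0// ltW.
have cr := smooth_contRe sp; have ci := smooth_contIm sp; split; split=> // y.
  have [yr|yr] := leP r `|y|; first by rewrite Hr// normr0 mulr_ge0.
  apply: le_trans (H1 _ (ltW yr)) _; rewrite -mulrA.
  by have := H _ (ltW yr); nra.
have [yr|yr] := leP r `|y|; first by rewrite Hr// normr0 mulr_ge0.
apply: le_trans (H2 _ (ltW yr)) _; rewrite -mulrA.
by have := H _ (ltW yr); nra.
Qed.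

Lemma weil_brezin_wb_section c c' phi r y : smooth phi -> supp_in r phi ->
  weil_brezin (untilded k (wb_section c phi)) c' y = (c == c')%:R * phi y.
Proof. by move=> sp sr; rewrite weil_brezinE untildedK (fhat_wb_section _ _ _ sp sr). Qed.

(** The linearity in the definition, applied to 0 = 1 * 0 + 0. *)
Lemma tempered0 (T : ('rV[R]_n -> R[i]) -> R[i]) : tempered T -> T (fun=> 0) = 0.
Proof.
have s0 : schwartz (fun _ : 'rV[R]_n => 0 : R[i]).
  split=> [|l p]; first exact: smooth_cst.
  exists 0 => y; suff -> : partials l (fun _ : 'rV[R]_n => 0) = fun=> 0 by rewrite cabs0 mulr0.
  elim: l => //= j l ->; apply/funext => u; exact: cderiv_partial (is_cderive_cst _ _ _).
move=> [H _]; have := H 1 _ _ s0 s0; under eq_fun do rewrite mulr0 addr0.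
by rewrite mul1r => /eqP; rewrite -subr_eq0 opprD addrA subrr sub0r oppr_eq0 => /eqP.
Qed.

(** The section with the single coefficient conj phi, in position c, is a smooth
    test section on which S takes the value T c phi.  Hence S determines each
    coefficient on test functions. *)
Lemma weil_brezin_test S (T : V -> ('rV[R]_n -> R[i]) -> R[i]) c phi r :
  has_weil_brezin S T -> smooth phi -> supp_in r phi ->
  T c phi = S (untilded k (wb_section c (fun y => conjc (phi y)))).
Proof.
move=> [tT HS] sp sr; have sc := smooth_conj sp.
have src : supp_in r (fun y => conjc (phi y)) by move=> y /sr ->; exact: rmorph0.
rewrite HS; last exact: quasi_section (quasi_wb_section _ sc src).
rewrite /of_weil_brezin (bigD1 c)// big1; last first.
  move=> m mc; rewrite -(tempered0 (tT m)); congr T; apply/funext => y.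
  by rewrite (weil_brezin_wb_section _ _ _ sc src) eq_sym (negbTE mc) mul0r; exact: rmorph0.
by rewrite [RHS]addr0; congr T; apply/funext => y; rewrite (weil_brezin_wb_section _ _ _ sc src) eqxx mul1r conjcK.
Qed.

(** Testing the difference d of the two functions against a cutoff times conj d
    gives the integral of a nonnegative continuous function. *)
Lemma regular_dist_inj (v1 v2 : 'rV[R]_n -> R[i]) : smooth v1 -> smooth v2 ->
  (forall phi r, smooth phi -> supp_in r phi -> regular_dist v1 phi = regular_dist v2 phi) -> v1 = v2.
Proof.
move=> s1 s2 H; apply/funext => y0.
pose a : R := (2 * (1 + `|y0|))^-1.
have y0p : 0 < 1 + `|y0| by rewrite ltr_pwDl.
have a0 : 0 < a by rewrite invr_gt0 mulr_gt0.
pose d y := v1 y - v2 y; have sd : smooth d by exact: smooth_sub.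
pose chi y := @plateau R n (a *: y).
have schi : smooth chi by apply: smooth_dil; exact: smooth_plateau.
have rchi : supp_in (1 / a) chi by apply: supp_in_dil => // y; exact: plateau_out.
pose phi y := chi y * conjc (d y).
have sphi : smooth phi by apply: smooth_mul => //; exact: smooth_conj.
have rphi : supp_in (1 / a) phi by exact: supp_inMl.
have [B1 D1] := cdominated_supp (smooth_mul s1 sphi) (@supp_inMr v1 _ _ rphi).
have [B2 D2] := cdominated_supp (smooth_mul s2 sphi) (@supp_inMr v2 _ _ rphi).
have [B D] := cdominated_supp (smooth_mul sd sphi) (@supp_inMr d _ _ rphi).
have I0 : cint setT (fun y => d y * phi y) = 0.
  have -> : (fun y => d y * phi y) = fun y => -1 * (v2 y * phi y) + v1 y * phi y.
    by apply/funext => y; rewrite /d; ring.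
  rewrite (cint_lin (weightT R) (-1) D2 D1) mulN1r.
  by apply/eqP; rewrite addrC subr_eq0; apply/eqP; exact: H rphi.
have E y : d y * phi y = ((\prod_(i < n) step (1 / 4) (1 / 2) (1 - (a *: y) 0 i ^+ 2)) * cabs (d y) ^+ 2)%:C.
  by rewrite /phi mulrCA cabs_sqrE /chi /plateau -rmorphM.
have := congr1 Re I0; rewrite /cint => I1.
have nn y : 0 <= Re (d y * phi y).
  by rewrite E mulr_ge0 ?sqr_ge0// prodr_ge0// => i _; apply: step_ge0; lra.
have := rint_eq0 D.1 nn I1 y0.
have c1 : chi y0 = 1.
  apply: plateau_in; rewrite normrZ gtr0_norm// /a.
  rewrite mulrC ler_pdivrMr ?mulr_gt0//; lra.
rewrite /phi c1 mul1r cabs_sqrE => /eqP; rewrite sqrf_eq0 => /eqP /cabs_eq0 /eqP.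
by rewrite subr_eq0 => /eqP.
Qed.

(** The cutoffs in [dist_value] are compactly supported, so its values only
    involve the coefficients on test functions, and these are determined by the
    two sections. *)
Lemma pairing_unique (S S' : functional R n) z1 z2 :
  is_pairing k S S' z1 -> is_pairing k S S' z2 -> z1 = z2.
Proof.
move=> [T1 [v1 [w1 [HT1 [sv1 Hv1] Hw1 ->]]]] [T2 [v2 [w2 [HT2 [sv2 Hv2] Hw2 ->]]]].
apply: eq_bigr => c _.
have ET phi r : smooth phi -> supp_in r phi -> T1 c phi = T2 c phi.
  by move=> sp sr; rewrite (weil_brezin_test c HT1 sp sr) (weil_brezin_test c HT2 sp sr).
have Ev : v1 c = v2 c.
  apply: regular_dist_inj => // phi r sp sr.
  have := weil_brezin_test c Hv1 sp sr; have := weil_brezin_test c Hv2 sp sr.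
  by move=> /= -> ->.
have := Hw1 c _ (@cutoff_plateau R n); have := Hw2 c _ (@cutoff_plateau R n).
move=> /ccvgP c2 /ccvgP c1; apply: ccvg_unique c1 _; move: c2; congr ccvg; apply/funext => j.
have j0 : (0 : R) < j.+1%:R^-1 by rewrite invr_gt0 ltr0n.
have sc : smooth (fun y : 'rV[R]_n => plateau (j.+1%:R^-1 *: y)).
  by apply: smooth_dil; exact: smooth_plateau.
have sr : supp_in (1 / j.+1%:R^-1) (fun y : 'rV[R]_n => plateau (j.+1%:R^-1 *: y)).
  by apply: supp_in_dil => // y; exact: plateau_out.
have sv := smooth_mul sc (smooth_conj (sv2 c)).
by rewrite Ev -(ET _ _ sv (@supp_inMl _ _ _ sr)).
Qed.

Lemma xget_uniq (T : choiceType) (x0 x : T) (P : set T) : P x -> (forall y, P y -> y = x) -> xget x0 P = x.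
Proof. by move=> Px H; apply: H; exact: xgetPex (ex_intro _ x Px). Qed.

Definition cst_check c b : R[i] :=
  (2 `^ (n%:R / 4) * k%:R `^ (n%:R / 2))%:C * ((c == b)%:R * (2 `^ (- n%:R / 2))%:C).

Lemma sigma_check_weil_brezin c :
  has_weil_brezin (sigma_check (R := R) c) (fun b => regular_dist (fun=> cst_check c b)).
Proof.
split=> [b|t st]; first exact: tempered_regular.
transitivity ((2 `^ (n%:R / 4) * k%:R `^ (n%:R / 2))%:C * \sum_(b : V)
  cint setT (fun y => ((c == b)%:R * (2 `^ (- n%:R / 2))%:C) * conjc (weil_brezin t b y))); first by [].
rewrite mulr_sumr; apply: eq_bigr => b _; have [B HB] := wb_cdominated b st.
by rewrite /regular_dist (cintZ (weightT R) _ HB) (cintZ (weightT R) _ HB) mulrA.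
Qed.

(** The normalisations of theta, of theta_check, of the two bases and of the
    half-forms cancel. *)
Lemma pairing_const :
  (2 `^ (n%:R / 2) * k%:R `^ (- n%:R / 2)) *
  (kappa * ((2 `^ (n%:R / 4) * k%:R `^ (n%:R / 2)) * 2 `^ (- n%:R / 2))) = 1.
Proof.
have k0 : (0 : R) <= k%:R by rewrite ler0n.
have kn0 : k%:R != 0 :> R by rewrite pnatr_eq0.
rewrite /kappa powRM//.
have A (x y z : R) : x != 0 -> x `^ y * x `^ z = x `^ (y + z).
  by move=> x0; rewrite powRD// x0 implybT.
set e := n%:R / 2; have -> : - n%:R / 2 = - e by rewrite /e mulNr.
have E4 : 2 `^ (n%:R / 4) * 2 `^ (n%:R / 4) = 2 `^ e :> R.
  by rewrite A ?pnatr_eq0//; congr (_ `^ _); rewrite /e; field.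
have E2 : 2 `^ e * 2 `^ (- e) = 1 :> R by rewrite A ?pnatr_eq0// subrr powRr0.
have Ek : k%:R `^ e * k%:R `^ (- e) = 1 :> R by rewrite A// subrr powRr0.
transitivity ((2 `^ e * 2 `^ (- e)) * ((2 `^ (n%:R / 4) * 2 `^ (n%:R / 4)) * 2 `^ (- e)) *
  (k%:R `^ e * k%:R `^ (- e)) * (k%:R `^ e * k%:R `^ (- e)) : R); first by ring.
by rewrite E4 E2 Ek !mulr1.
Qed.

(** The coefficients of sigma_check b are constants, supported in the class b, so the
    pairing is the value of one measure [wbdist g u b] on a constant. *)
Lemma pairingE g S (u : V -> R[i]) b : periodic_smooth g -> deq k S (fun t => \sum_(m : V) u m * sigma m t) ->
  pairing k (dmul g S) (sigma_check (R := R) b) = \sum_(m : V) toeplitz_mx g b m * u m.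
Proof.
move=> pg HS; set X := \sum_(m : V) _.
pose a : R := (2 `^ (n%:R / 4) * k%:R `^ (n%:R / 2)) * 2 `^ (- n%:R / 2).
have H : is_pairing k (dmul g S) (sigma_check (R := R) b) (kappa%:C * X * a%:C).
  exists (wbdist g u), (fun c _ => cst_check b c),
    (fun c => kappa%:C * (\sum_(m : V) toeplitz_mx g c m * u m) * conjc (cst_check b c)); split.
  - by split=> [c|]; [exact: tempered_wbdist|exact: wbdist_deq].
  - by split=> [c|]; [exact: smooth_cst|exact: sigma_check_weil_brezin].
  - by move=> c; exact: wbdist_value.
  rewrite [RHS](bigD1 b)// [X in _ = _ + X]big1; last first.
    move=> c cb; rewrite /cst_check eq_sym (negbTE cb) mul0r mulr0.
    have -> : conjc (0 : R[i]) = 0 by exact: rmorph0.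
    exact: mulr0.
  rewrite [RHS]addr0; congr (_ * _); rewrite /cst_check eqxx mul1r -rmorphM.
  exact: (esym (conjc_real _)).
rewrite /pairing (xget_uniq 0 H); last by move=> z Hz; exact: pairing_unique Hz H.
rewrite mulrAC -rmorphM mulrA -rmorphM pairing_const; exact: mul1r.
Qed.

End Pairing.

(** * Toeplitz operators and the estimate *)

Section ToeplitzMatrix.
Variable R : realType.
Variables (n k' : nat).
Local Notation k := k'.+1.
Local Notation V := 'rV['I_k]_n.
Local Notation kappa := (@kappa R n k').
Local Notation Re := (@complex.Re R).
Implicit Types (f g h t : 'rV[R]_(n + n) -> R[i]) (m b c : V) (S : functional R n).

Lemma sigma_state m m' : sigma m (untilded k (@state_section R n k' m')) = kappa%:C * (m' == m)%:R.
Proof.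
rewrite sigmaE untildedK fhat_state_section; congr (_ * _).
by case: (m' == m); [exact: rmorph1|exact: rmorph0].
Qed.

Lemma quantum_expansion S : quantum_space k S -> exists u : V -> R[i],
  deq k S (fun t => \sum_(m : V) u m * sigma m t).
Proof.
move=> QS; exists (fun m => S (untilded k (@state_section R n k' m)) * (kappa^-1)%:C) => t st.
rewrite -[in LHS](tildedK k t) (quantum_value QS (section_quasi st)).
apply: eq_bigr => m _; rewrite sigmaE.
have E : (kappa^-1)%:C * kappa%:C = 1 :> R[i] by rewrite -rmorphM mulVf ?gt_eqF ?kappa_gt0.
transitivity (((kappa^-1)%:C * kappa%:C) * (conjc (fhat (tilded k t) (zvec m) (grid_pt R m)) * S (untilded k (state_section m)))).
  by rewrite E mul1r.
ring.
Qed.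

(** The sections [state_section m] separate the basis vectors. *)
Lemma coordsE S (u : V -> R[i]) : deq k S (fun t => \sum_(m : V) u m * sigma m t) ->
  forall m, coords k S m = u m.
Proof.
move=> HS m; have kn0 : kappa%:C != 0 :> R[i].
  by rewrite -[X in _ != X](rmorph0 (real_complex R)) (inj_eq (@complexI R)) gt_eqF ?kappa_gt0.
have val (v : V -> R[i]) : deq k S (fun t => \sum_(m : V) v m * sigma m t) ->
    forall m, S (untilded k (@state_section R n k' m)) = v m * kappa%:C.
  move=> Hv m'; rewrite Hv; last by apply: quasi_section; exact: quasi_state_section.
  rewrite (bigD1 m')// big1; last by move=> c cm; rewrite sigma_state eq_sym (negbTE cm) !mulr0.
  by rewrite [LHS]addr0 sigma_state eqxx mulr1.
rewrite /coords (@xget_uniq _ _ [ffun m => u m]) ?ffunE//=.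
  by move=> t st; rewrite HS//; apply: eq_bigr => c _; rewrite ffunE.
move=> v Hv; apply/ffunP => c; rewrite ffunE; apply: (mulIf kn0).
by rewrite -(val _ Hv) -(val _ HS).
Qed.

Lemma hnormE S (u : V -> R[i]) : deq k S (fun t => \sum_(m : V) u m * sigma m t) ->
  hnorm k S = Num.sqrt (\sum_(m : V) cabs (u m) ^+ 2).
Proof.
move=> HS; rewrite /hnorm /inner; congr Num.sqrt.
under eq_bigr do rewrite !(coordsE HS) cabs_sqrE.
by rewrite -(rmorph_sum (real_complex R)).
Qed.

Lemma toeplitzE f S (u : V -> R[i]) : periodic_smooth f -> deq k S (fun t => \sum_(m : V) u m * sigma m t) ->
  toeplitz k f S = fun t => \sum_(b : V) (\sum_(m : V) toeplitz_mx f b m * u m) * sigma b t.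
Proof.
move=> pf HS; apply/funext => t; apply: eq_bigr => b _; congr (_ * _).
exact: pairingE.
Qed.

End ToeplitzMatrix.

Section Estimate.
Variable R : realType.

Lemma psm_sum d (I : Type) (r : seq I) (P : pred I) (F : I -> 'rV[R]_d -> R[i]) :
  (forall i, periodic_smooth (F i)) -> periodic_smooth (fun u => \sum_(i <- r | P i) F i u).
Proof.
move=> H; split; first by apply: smooth_sum => i; exact: (H i).1.
by move=> l u; apply: eq_bigr => i _; rewrite (H i).2.
Qed.

Lemma psm_star_trunc n k N (f g : 'rV[R]_(n + n) -> R[i]) : periodic_smooth f -> periodic_smooth g -> periodic_smooth (star_trunc k N f g).
Proof.
move=> pf pg; apply: psm_sum => j; apply: psm_mul; first exact: psm_cst.
apply: psm_mul; first exact: psm_cst.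
apply: psm_sum => I; apply: psm_mul; last exact: psm_partials.
by apply: psm_mul; [exact: psm_cst|exact: psm_partials].
Qed.

(** In coordinates the operator is the matrix whose row and column sums are bounded
    by B. *)
Lemma toeplitz_star_bound n k' N (f g : 'rV[R]_(n + n) -> R[i]) (B : R) : periodic_smooth f -> periodic_smooth g -> 0 <= B ->
  (let E (b m : 'rV['I_k'.+1]_n) := \sum_c toeplitz_mx f b c * toeplitz_mx g c m - toeplitz_mx (star_trunc k'.+1 N f g) b m in
   (forall m, \sum_b cabs (E b m) <= B) /\ (forall b, \sum_m cabs (E b m) <= B)) ->
  forall S, quantum_space k'.+1 S -> hnorm k'.+1 S <= 1 ->
  hnorm k'.+1 (fun t => toeplitz k'.+1 f (toeplitz k'.+1 g S) t - toeplitz k'.+1 (star_trunc k'.+1 N f g) S t) <= B.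
Proof.
move=> pf pg B0; move E_def : (fun b m => _) => E /= [Hc Hr] S QS nS.
have [u Hu] := quantum_expansion QS.
have H : deq k'.+1 (fun t => toeplitz k'.+1 f (toeplitz k'.+1 g S) t - toeplitz k'.+1 (star_trunc k'.+1 N f g) S t)
   (fun t => \sum_b (\sum_m E b m * u m) * sigma b t).
  move=> t st; rewrite (toeplitzE (psm_star_trunc _ _ pf pg) Hu) (toeplitzE pg Hu).
  rewrite (@toeplitzE _ _ _ f _ (fun c => \sum_m toeplitz_mx g c m * u m) pf) => [|? ?//].
  rewrite -sumrB; apply: eq_bigr => b _; rewrite -mulrBl; congr (_ * _).
  under [X in X - _]eq_bigr do rewrite mulr_sumr.
  rewrite exchange_big -sumrB; apply: eq_bigr => m _; rewrite -E_def mulrBl mulr_suml.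
  by congr (_ - _); apply: eq_bigr => c _; rewrite mulrA.
rewrite (hnormE H); move: nS; rewrite (hnormE Hu) => nS.
have s0 : 0 <= \sum_m cabs (u m) ^+ 2 by apply: sumr_ge0 => m _; exact: sqr_ge0.
have n1 : \sum_m cabs (u m) ^+ 2 <= 1.
  by rewrite -[leLHS]sqr_sqrtr// -[leRHS](expr1n _ 2) lerXn2r ?nnegrE ?sqrtr_ge0.
rewrite -[leRHS]ger0_norm// -sqrtr_sqr ler_wsqrtr//.
apply: le_trans (schur_test Hc Hr u) _.
by rewrite -[leRHS]mulr1 ler_wpM2l ?sqr_ge0.
Qed.

End Estimate.

Theorem theorem1p1 (R : realType) (n : nat) (hn : (1 <= n)%N)
    (f g : 'rV[R]_(n + n) -> R[i])
    (hf : torus_smooth f) (hg : torus_smooth g) (N : nat) :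
  exists K : R, 0 < K /\
    forall k : nat, (1 <= k)%N ->
      (op_norm k (fun (s : functional R n) t =>
         (toeplitz k f (toeplitz k g s) t
          - toeplitz k (star_trunc k N f g) s t)%R)
       <= (K * hbar R k ^+ N.+1)%:E)%E.
Proof.
have [K K0 HK] := matrix_estimate N hf hg.
exists (K + 1); split=> [|[//|k'] _]; first by rewrite ltr_wpDl.
have h0 : 0 <= hbar R k'.+1 ^+ N.+1 by rewrite exprn_ge0// invr_ge0.
apply: ub_ereal_sup => _ [S [QS nS] <-]; rewrite lee_fin.
apply: le_trans (toeplitz_star_bound hf hg _ (HK k') QS nS) _; first exact: mulr_ge0.
by rewrite ler_wpM2r// lerDl.
Qed.
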